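(* Let $\mathcal D\subset\mathbb C$ be a domain containing $0$ and let $A:\mathcal D\to\mathcal S_\infty(\mathcal H)$ be a holomorphic operator-valued function such that $A(0)$ is selfadjoint and $I-A'(0)\Pi_0$ is invertible. Let $\theta>0$ be fixed, with $\mathcal C_\theta(r,1)\subset\mathcal D$ for $0<r<1$. Then $$\mathcal N(\mathcal C_\theta(r,1))=n([r,1])\big(1+\mathcal O(\delta|\ln\delta|^2)\big)+\mathcal O(|\ln\delta|^2)\,n([r(1-\delta),r(1+\delta)])+\mathcal O_\delta(1)$$ in the following sense: there exist constants $C>0$ and $\delta_1>0$ such that for all $0<\delta<\delta_1$ there exist $r(\delta)>0$ and $C_\delta>0$ such that for all $0<r<r(\delta)$, $$\big|\mathcal N(\mathcal C_\theta(r,1))-n([r,1])\big|\le C\,\delta|\ln\delta|^2\,n([r,1])+C\,|\ln\delta|^2\,n([r(1-\delta),r(1+\delta)])+C_\delta .$$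
   Context: $\mathcal H$ is a separable complex Hilbert space and $\mathcal S_\infty(\mathcal H)$ is the space of compact operators on $\mathcal H$. $\Pi_0$ is the orthogonal projection onto $\ker A(0)$, and $A'(0)$ is the derivative of $A$ at $0$. For $\theta>0$ and $0<a<b$, $$\mathcal C_\theta(a,b):=\{x+iy\in\mathbb C:\ a\le x\le b,\ |y|\le\theta|x|\}.$$ A characteristic value of $I-A(z)/z$ is a point $w\in\mathcal D\setminus\{0\}$ such that $F(w):=I-A(w)/w$ is not invertible. Under the hypotheses the characteristic values form a discrete closed subset of $\mathcal D\setminus\{0\}$; the multiplicity of a characteristic value $w$ is the integer $\frac1{2i\pi}\operatorname{tr}\int_{|z-w|=\rho}F'(z)F(z)^{-1}\,dz$ for $\rho>0$ small enough that $w$ is the only characteristic value in $\{|z-w|\le\rho\}$ (and this disc lies in $\mathcal D\setminus\{0\}$). For $\Omega\subset\mathcal D$, $\mathcal N(\Omega)$ is the number of characteristic values in $\Omega\setminus\{0\}$, counted with multiplicities. For $\Lambda\subset\mathbb R$, $n(\Lambda):=\operatorname{tr}\mathbf 1_\Lambda(A(0))$ is the number of eigenvalues of $A(0)$ in $\Lambda$, counted with multiplicities. *)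

(* Defs.v *)
From HB Require Import structures.
From mathcomp Require Import all_boot all_order all_algebra.
From mathcomp Require Import all_classical all_reals all_analysis.
From mathcomp Require Import complex.
Import Order.TTheory GRing.Theory Num.Theory numFieldNormedType.Exports.

Set Implicit Arguments.
Unset Strict Implicit.
Unset Printing Implicit Defensive.

Local Open Scope classical_set_scope.
Local Open Scope complex_scope.
Local Open Scope ring_scope.

(* The dot product is linear in its first argument and conjugate-linear in the
   second one; norms of complex normed modules take values in R[i]. *)
HB.mixin Record isHilbert (R : realType) H & CompleteNormedModule R[i] H := {
  inner : {dot H for Num.conj};
  inner_norm : forall u : H, `|u| ^+ 2 = inner u u
}.

#[short(type="hilbertType")]
HB.structure Definition Hilbert (R : realType) :=
  {H of isHilbert R H & CompleteNormedModule R[i] H}.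

Definition separable (T : topologicalType) : Prop :=
  exists2 S : set T, countable S & dense S.

Section BoundedOperators.
Variables (R : realType) (H : normedModType R[i]).

Definition bounded_operator : {pred H -> H} :=
  fun f => `[< linear f /\ continuous f >].

Record bop := Bop { bop_fun :> H -> H; bop_funP : bop_fun \in bounded_operator }.

HB.instance Definition _ := [isSub for bop_fun].
HB.instance Definition _ := [Choice of bop by <:].

Lemma bop_linear (T : bop) : linear T.
Proof. by case: T => f /= /asboolP[]. Qed.

Lemma bop_continuous (T : bop) : continuous T.
Proof. by case: T => f /= /asboolP[]. Qed.

Lemma bounded_operator_submod : submod_closed bounded_operator.
Proof.
split.
  apply/asboolP; split; first by move=> a u v; rewrite /= scaler0 addr0.
  by move=> x; exact: cst_continuous.
move=> a f g /asboolP[fl fc] /asboolP[gl gc]; apply/asboolP; split.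
  move=> b u v /=; rewrite !fctE fl gl !scalerDr !scalerA mulrC.
  by rewrite -!addrA; congr (_ + _); rewrite addrCA.
move=> x; apply: (@continuousD _ _ _ (a \*: f) g); last exact: gc.
by apply: (@continuousZl_tmp _ _ _ f); exact: fc.
Qed.

HB.instance Definition _ := GRing.isSubmodClosed.Build _ _ bounded_operator
  bounded_operator_submod.
HB.instance Definition _ := [SubChoice_isSubLmodule of bop by <:].


Lemma bop_id_subproof : idfun \in bounded_operator.
Proof. by apply/asboolP; split=> // x; exact: cvg_id. Qed.

Definition bop_id : bop := Bop bop_id_subproof.

Lemma bop_comp_subproof (S T : bop) : S \o T \in bounded_operator.
Proof.
apply/asboolP; split; first by move=> a u v /=; rewrite !bop_linear.
by move=> x; apply: continuous_comp; exact: bop_continuous.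
Qed.

Definition bop_comp (S T : bop) : bop := Bop (bop_comp_subproof S T).

Lemma bopP (S T : bop) : (forall x, S x = T x) -> S = T.
Proof. by move=> ST; apply: val_inj; apply/funext. Qed.

Lemma bop_compA : associative bop_comp.
Proof. by move=> S T U; exact: bopP. Qed.

Lemma bop_comp1l : left_id bop_id bop_comp.
Proof. by move=> S; exact: bopP. Qed.

Lemma bop_comp1r : right_id bop_id bop_comp.
Proof. by move=> S; exact: bopP. Qed.

Lemma bop_compDl : left_distributive bop_comp +%R.
Proof. by move=> S T U; exact: bopP. Qed.

Lemma bop_compDr : right_distributive bop_comp +%R.
Proof.
move=> S T U; apply: bopP => x /=.
by have := bop_linear S 1 (T x) (U x); rewrite !scale1r.
Qed.

HB.instance Definition _ := GRing.Zmodule_isPzRing.Build bop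
  bop_compA bop_comp1l bop_comp1r bop_compDl bop_compDr.

HB.instance Definition _ (T : bop) :=
  GRing.isLinear.Build R[i] H H *:%R T (bop_linear T).

Let nrm (x : H) : R := complex.Re `|x|.

Let opn (T : bop) : R := sup [set nrm (T x) | x in [set x : H | `|x| <= 1]].

Definition opnorm (T : bop) : R[i] := (opn T)%:C.

Let nrmE x : `|x| = (nrm x)%:C.
Proof. by rewrite /nrm RRe_real// ger0_real. Qed.

Let nrm_ge0 x : 0 <= nrm x.
Proof. by rewrite -lecR -nrmE; exact: normr_ge0. Qed.

Let unit_ball0 (T : bop) :
  [set nrm (T x) | x in [set x : H | `|x| <= 1]] !=set0.
Proof. by exists (nrm (T 0)), 0; rewrite //= normr0. Qed.

Let opn_has_ubound (T : bop) :
  has_ubound [set nrm (T x) | x in [set x : H | `|x| <= 1]].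
Proof.
have /linear_bounded_continuous/linear_boundedP := @bop_continuous T.
move=> /pinfty_ex_gt0[M M0 TM]; exists (complex.Re M) => _ [x /= x1 <-].
rewrite -lecR -nrmE RRe_real ?gtr0_real//.
by rewrite (le_trans (TM x))// ler_piMr// ltW.
Qed.

Let opn_ge (T : bop) x : nrm (T x) <= opn T * nrm x.
Proof.
have [->|x0] := eqVneq x 0.
  by rewrite linear0 /nrm normr0 mulr0.
have nx0 : 0 < nrm x by rewrite -ltcR -nrmE normr_gt0.
rewrite -ler_pdivrMr// mulrC; apply: ub_le_sup; first exact: opn_has_ubound.
have nxV : `|(nrm x)^-1%:C| = (nrm x)^-1%:C :> R[i].
  by rewrite ger0_norm// (@lecR _ 0) invr_ge0.
exists ((nrm x)^-1%:C *: x) => /=.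
  by rewrite normrZ nxV nrmE -rmorphM /= mulVf ?gt_eqF.
apply: complexI.
by rewrite -nrmE linearZ/= normrZ nxV nrmE -rmorphM.
Qed.

Let opn_le (T : bop) (M : R) : (forall x, `|x| <= 1 -> nrm (T x) <= M) ->
  opn T <= M.
Proof. by move=> TM; apply: ge_sup => // _ [x x1 <-]; exact: TM. Qed.

Let opn_ge0 (T : bop) : 0 <= opn T.
Proof.
apply: (@le_trans _ _ (nrm (T 0))) => //; apply: ub_le_sup => //.
by exists 0; rewrite //= normr0.
Qed.

Lemma opnorm_triangle (S T : bop) : opnorm (S + T) <= opnorm S + opnorm T.
Proof.
rewrite -rmorphD lecR; apply: opn_le => x; rewrite nrmE lecR => x1.
have : nrm ((S + T) x) <= nrm (S x) + nrm (T x).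
  by rewrite -lecR rmorphD/= -!nrmE ler_normD.
move/le_trans; apply; apply: lerD; apply: le_trans (opn_ge _ _) _.
  by rewrite ler_piMr.
by rewrite ler_piMr.
Qed.

Let opn_scale_le (a : R[i]) (T : bop) : opnorm (a *: T) <= `|a| * opnorm T.
Proof.
rewrite normc_def -rmorphM lecR; apply: opn_le => x; rewrite nrmE lecR => x1.
rewrite -lecR -nrmE normrZ normc_def nrmE -rmorphM lecR ler_wpM2l ?sqrtr_ge0//.
by rewrite (le_trans (opn_ge _ _))// ler_piMr.
Qed.

Lemma opnormZ (a : R[i]) (T : bop) : opnorm (a *: T) = `|a| * opnorm T.
Proof.
apply/eqP; rewrite eq_le opn_scale_le/=.
have [->|a0] := eqVneq a 0; first by rewrite normr0 mul0r lecR.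
rewrite -ler_pdivlMl ?normr_gt0// -normfV.
by rewrite (le_trans _ (opn_scale_le _ _))// scalerA mulVf// scale1r.
Qed.

Lemma opnorm_eq0 (T : bop) : opnorm T = 0 -> T = 0.
Proof.
move=> [T0]; apply: bopP => x; apply/normr0_eq0; rewrite nrmE.
suff -> : nrm (T x) = 0 by [].
by apply/eqP; rewrite eq_le nrm_ge0 andbT -(mul0r (nrm x)) -T0 opn_ge.
Qed.

HB.instance Definition _ :=
  Lmodule_isNormed.Build R[i] bop opnorm_triangle opnormZ opnorm_eq0.

End BoundedOperators.

Definition op_invertible (R : realType) (H : normedModType R[i]) (T : bop H) :
  Prop := exists S : bop H, S * T = 1 /\ T * S = 1.

(* The inverse of T if T is invertible; unspecified otherwise. *)
Definition op_inv (R : realType) (H : normedModType R[i]) (T : bop H) : bop H :=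
  get [set S | S * T = 1 /\ T * S = 1].

Definition compact_op (R : realType) (H : normedModType R[i]) (T : bop H) :
  Prop := compact (closure (T @` [set x | `|x| <= 1])).

Section Hilbert.
Variables (R : realType) (H : hilbertType R).
Implicit Types (T P : bop H) (E : set H).

Definition op_selfadjoint T : Prop :=
  forall u v, inner (T u) v = inner u (T v).

Definition op_ker T : set H := [set u | T u = 0].

Definition op_eigenspace T (a : R[i]) : set H := [set u | T u = a *: u].

Definition orthogonal_projection E P : Prop :=
  forall u, E (P u) /\ (forall v, E v -> inner (u - P u) v = 0).

(* An orthonormal basis enumerated by nat and padded with zero vectors, so that
   finite-dimensional spaces are covered as well. *)
Definition orthonormal_basis (e : nat -> H) : Prop :=
  [/\ forall i j, i != j -> inner (e i) (e j) = 0,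
      forall i, e i = 0 \/ inner (e i) (e i) = 1
    & forall u, (forall i, inner u (e i) = 0) -> u = 0].

(* On a separable space, the diagonal series of T converges for every
   orthonormal basis if and only if T is of trace class, and its sum is then
   the trace of T whatever the basis. *)
Definition has_trace T (tau : R[i]^o) : Prop :=
  forall e, orthonormal_basis e ->
    series (fun i => inner (T (e i)) (e i) : R[i]^o) @ \oo --> tau.

(* Dimension of a subspace, possibly infinite. *)
Definition dimension E : \bar R :=
  ereal_sup [set k%:R%:E | k in [set k | exists v : 'I_k -> H,
    (forall i, E (v i)) /\
    (forall c : 'I_k -> R[i], \sum_i c i *: v i = 0 -> forall i, c i = 0)]].

(* Number of eigenvalues of T in Lambda, counted with multiplicities. *)
Definition eigen_count T (Lambda : set R) : \bar R :=
  \esum_(lambda in Lambda) dimension (op_eigenspace T lambda%:C).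

End Hilbert.

(* Riemann integral over [a, b] of a function with values in a complex normed
   space: s lists the subdivision points except a, and t the tags. *)
Definition is_riemann_integral (R : realType) (V : normedModType R[i])
    (a b : R) (f : R -> V) (I : V) : Prop :=
  forall eps : R, 0 < eps -> exists2 eta : R, 0 < eta &
    forall (s : seq R) (t : nat -> R), itv_partition a b s ->
      (forall i, (i < size s)%N ->
         nth b s i - nth b (a :: s) i < eta /\
         nth b (a :: s) i <= t i <= nth b s i) ->
      `|\sum_(0 <= i < size s)
          (nth b s i - nth b (a :: s) i)%:C *: f (t i) - I| < eps%:C.

Definition expi (R : realType) (t : R) : R[i] := cos t +i* sin t.

(* The integral of G along the positively oriented circle |z - w| = rho. *)
Definition is_circle_integral (R : realType) (V : normedModType R[i])
    (G : R[i]^o -> V) (w : R[i]) (rho : R) (I : V) : Prop :=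
  is_riemann_integral 0 (2 * pi)
    (fun t => ('i * rho%:C * expi t) *: G (w + rho%:C * expi t)) I.

Section CharacteristicValues.
Variables (R : realType) (H : hilbertType R) (D : set R[i]^o).
Variable A : R[i]^o -> bop H.

Definition charop (z : R[i]^o) : bop H := 1 - z^-1 *: A z.

Definition charval : set R[i]^o :=
  [set w | [/\ D w, w != 0 & ~ op_invertible (charop w)]].

Definition charval_mult (w : R[i]^o) : nat :=
  get [set m : nat | exists rho : R, exists I : bop H, exists tau : R[i],
    [/\ 0 < rho,
        forall z : R[i]^o, `|z - w| <= rho%:C ->
          [/\ D z, z != 0 & charval z -> z = w],
        is_circle_integral (fun z => derive1 charop z * op_inv (charop z)) w rho I,
        has_trace I tau
      & m%:R = (2 * 'i * pi%:C)^-1 * tau]].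

Definition charval_count (Omega : set R[i]^o) : \bar R :=
  \esum_(w in Omega `&` charval) (charval_mult w)%:R%:E.

End CharacteristicValues.

Definition sector (R : realType) (theta a b : R) : set R[i]^o :=
  [set z : R[i] | a <= complex.Re z <= b /\
                  `|complex.Im z| <= theta * `|complex.Re z|].

(* Main.v *)
Require Import Defs.
From HB Require Import structures.
From mathcomp Require Import all_boot all_order all_algebra.
From mathcomp Require Import all_classical all_reals all_analysis.
From mathcomp Require Import fingroup perm complex ring lra zify.
Import Order.TTheory GRing.Theory Num.Theory numFieldNormedType.Exports.

Local Open Scope classical_set_scope.
Local Open Scope complex_scope.
Local Open Scope ring_scope.

(** Everything is reduced to counting zeros of a finite determinant.  Let [K = A(0)] and let [P] be the
    spectral projection of [K] for eigenvalues in [[r(1-delta), tau]].  The condition on [A'(0) Pi_0]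
    makes [G(z) = z - A(z) + K P] invertible for small [z] with [Re z > r(1-delta/2)], and
    [z P G(z)^-1 P = P + O(kappa)]; the characteristic values there are, with multiplicities, the zeros
    of [det((z - lam_i) d_ij - lam_i Y_ij(z))] with [Y = O(kappa)] and [lam_i] the eigenvalues of [K P].
    Off the narrow cone [|Im z| <= eps Re z] this determinant is [prod (z - lam_i)] times factors close
    to [1] (the pivots), so its logarithm barely changes along the long sides of the trapezoid with
    vertices [r(1 -+ i k)], [s(1 -+ i k)].  On the short sides, Jensen's bound and Borel-Caratheodory
    on squares control the change by the number of eigenvalues within [O(delta r)] of [r] (or [s]).
    The argument principle on the trapezoid then compares the two counts.  Finitely many
    characteristic values remain in [Re z >= s], by analytic Fredholm theory along the sector.

    Since [F'F^-1] is only an operator-valued meromorphic function, the trace in the multiplicity is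
    computed from its principal part, which has finite rank, by Jacobi's formula. *)

(** Why the condition on [A'(0) Pi_0] suffices: with A(z) = K + z G1(z) one has G(z) = (1 - G1(z)
    Y(z)) (z - K(1-P)), where Y(z) = z (z - K(1-P))^-1. The difference Y(z) - Pi_0 is not small in
    norm, but A'(0) (Y(z) - Pi_0) is: A'(0) is a norm limit of compact operators, and Y(z)u - Pi_0 u
    is, up to a small remainder, orthogonal to ker K with a small image under K. The thresholds
    found this way depend on delta and not on r, and the constants of the count inherit this. The
    obstacle in the count is that the determinant has unbounded size n. A perturbation O(kappa) does
    not bring it close to the unperturbed product; it splits off n factors close to 1, and kappa is
    chosen so small that their total effect is O(delta n). Points close to a short side cannot be
    followed by their argument there. They are dropped on that side, each at a bounded cost, which
    produces the second error term. The estimate reached contains no logarithm of delta; it implies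
    the stated one because |ln delta| >= 1 for delta < 1/e. *)

(* The square-zero extension K + V: vector identities in V become identities
   of this commutative ring, where the tactic [ring] applies. *)
Section SquareZero.
Context {K : comNzRingType} {V : lmodType K}.

Definition sqz : Type := (K * V)%type.
HB.instance Definition _ := GRing.Zmodule.on sqz.

Definition sqz_mul (x y : sqz) : sqz := (x.1 * y.1, x.1 *: y.2 + y.1 *: x.2).
Definition sqz_one : sqz := (1, 0).

Lemma sqz_mulA : associative sqz_mul.
Proof.
move=> [a x] [b y] [c z]; rewrite /sqz_mul /= mulrA; congr pair.
by rewrite !scalerDr !scalerA addrA (mulrC c a) (mulrC c b).
Qed.
Lemma sqz_mulC : commutative sqz_mul.
Proof. by move=> [a x] [b y]; rewrite /sqz_mul /= mulrC addrC. Qed.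
Lemma sqz_mul1 : left_id sqz_one sqz_mul.
Proof. by move=> [a x]; rewrite /sqz_mul /= mul1r scale1r scaler0 addr0. Qed.
Lemma sqz_mulDl : left_distributive sqz_mul +%R.
Proof.
move=> [a x] [b y] [c z]; rewrite /sqz_mul /= mulrDl scalerDl scalerDr; congr pair.
by rewrite addrACA.
Qed.
Lemma sqz_one0 : sqz_one != 0.
Proof. by apply/eqP => -[/eqP]; rewrite oner_eq0. Qed.

HB.instance Definition _ := GRing.Zmodule_isComNzRing.Build sqz
  sqz_mulA sqz_mulC sqz_mul1 sqz_mulDl sqz_one0.

Definition sqv (x : V) : sqz := (0, x).
Definition sqs (a : K) : sqz := (a, 0).

Lemma sqs_additive : zmod_morphism sqs.
Proof. by move=> a b; congr pair; rewrite subr0. Qed.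
Lemma sqs_multiplicative : monoid_morphism sqs.
Proof. by split => // a b; congr pair; rewrite !scaler0 addr0. Qed.
HB.instance Definition _ := GRing.isZmodMorphism.Build K sqz sqs sqs_additive.
HB.instance Definition _ := GRing.isMonoidMorphism.Build K sqz sqs
  sqs_multiplicative.

Lemma sqv_inj x y : sqv x = sqv y -> x = y. Proof. by case. Qed.
Lemma sqvD x y : sqv (x + y) = sqv x + sqv y.
Proof. by congr pair; rewrite addr0. Qed.
Lemma sqvN x : sqv (- x) = - sqv x.
Proof. by congr pair; rewrite oppr0. Qed.
Lemma sqv0 : sqv 0 = 0. Proof. by []. Qed.
Lemma sqvZ a x : sqv (a *: x) = sqs a * sqv x.
Proof. by congr pair; rewrite ?mulr0// scaler0 addr0. Qed.
Definition sqvE := (sqvD, sqvN, sqv0, sqvZ).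
End SquareZero.

Ltac vec := apply: sqv_inj; rewrite ?sqvE;
  repeat match goal with |- context [@sqv ?K ?V ?t] => generalize (@sqv K V t); intro end;
  ring.

(** * Norms as real numbers, and sequential limits *)

Definition nr {R : realType} {V : normedZmodType R[i]} (x : V) : R :=
  complex.Re `|x|.

Section RealNorm.
Context {R : realType}.
Section Gen.
Context {V : normedZmodType R[i]}.
Implicit Types x y : V.

Lemma nrE x : `|x| = (nr x)%:C.
Proof. by rewrite /nr RRe_real// ger0_real. Qed.

Lemma nr_ge0 x : 0 <= nr x.
Proof. by rewrite -lecR -nrE; exact: normr_ge0. Qed.

Lemma nr0 : nr (0 : V) = 0.
Proof. by rewrite /nr normr0. Qed.

Lemma nr0_eq0 x : nr x = 0 -> x = 0.
Proof. by move=> x0; apply/normr0_eq0; rewrite nrE x0. Qed.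

Lemma nr_gt0 x : (0 < nr x) = (x != 0).
Proof. by rewrite -normr_gt0 nrE (@ltcR _ 0). Qed.

Lemma nrN x : nr (- x) = nr x.
Proof. by rewrite /nr normrN. Qed.

Lemma nrD x y : nr (x + y) <= nr x + nr y.
Proof. by rewrite -lecR rmorphD /= -!nrE ler_normD. Qed.

Lemma nrB x y : nr (x - y) <= nr x + nr y.
Proof. by rewrite -(nrN y) nrD. Qed.

Lemma nrC x y : nr (x - y) = nr (y - x).
Proof. by rewrite -nrN opprB. Qed.

Lemma nr_tri z x y : nr (x - y) <= nr (x - z) + nr (z - y).
Proof. by rewrite -{1}(subrKA z x) nrD. Qed.

Lemma nr_le x (c : R) : (nr x <= c) = (`|x| <= c%:C).
Proof. by rewrite nrE lecR. Qed.

Lemma nr_lt x (c : R) : (nr x < c) = (`|x| < c%:C).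
Proof. by rewrite nrE ltcR. Qed.

Lemma nr_geB x y : nr x - nr y <= nr (x - y).
Proof. by rewrite lerBlDr -{1}(subrK y x) nrD. Qed.

Lemma nr_small x : (forall e : R, 0 < e -> nr x <= e) -> x = 0.
Proof.
move=> xe; apply: nr0_eq0; apply/eqP; rewrite eq_le nr_ge0 andbT.
by apply/ler_addgt0Pr => e e0; rewrite add0r xe.
Qed.

Lemma nr_sum (I : Type) (s : seq I) (P : pred I) (F : I -> V) :
  nr (\sum_(i <- s | P i) F i) <= \sum_(i <- s | P i) nr (F i).
Proof.
elim/big_ind2 : _ => //; first by rewrite nr0.
by move=> x1 x2 y1 y2 h1 h2; rewrite (le_trans (nrD _ _))// lerD.
Qed.

End Gen.

Lemma nrZ (V : normedModType R[i]) (a : R[i]) (x : V) :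
  nr (a *: x) = nr a * nr x.
Proof. by apply: complexI; rewrite rmorphM /= -!nrE normrZ. Qed.

Implicit Types z w : R[i].

Lemma nrM z w : nr (z * w) = nr z * nr w.
Proof. by apply: complexI; rewrite rmorphM /= -!nrE normrM. Qed.

Lemma nr1 : nr (1 : R[i]) = 1.
Proof. by rewrite /nr normr1. Qed.

Lemma nrV z : nr z^-1 = (nr z)^-1.
Proof. by apply: complexI; rewrite fmorphV /= -!nrE normfV. Qed.

Lemma nrX z n : nr (z ^+ n) = nr z ^+ n.
Proof. by elim: n => [|n IH]; rewrite ?expr0 ?nr1// !exprS nrM IH. Qed.

Lemma nr_prod (I : Type) (s : seq I) (P : pred I) (F : I -> R[i]) :
  nr (\prod_(i <- s | P i) F i) = \prod_(i <- s | P i) nr (F i).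
Proof. exact: (big_morph _ nrM nr1). Qed.

Lemma nrR (x : R) : nr (x%:C) = `|x|.
Proof. by rewrite /nr normc_def /= expr0n addr0 sqrtr_sqr. Qed.

Lemma nrn n : nr (n%:R : R[i]) = n%:R.
Proof. by have := nrR n%:R; rewrite rmorph_nat normr_nat. Qed.

Lemma nrI : nr ('i : R[i]) = 1.
Proof. by rewrite /nr normc_def /= expr0n expr1n add0r sqrtr1. Qed.

Lemma nr_sqr z : nr z ^+ 2 = complex.Re z ^+ 2 + complex.Im z ^+ 2.
Proof.
by apply: complexI; rewrite rmorphXn /= -nrE -add_Re2_Im2.
Qed.

Lemma Re_le_nr z : `|complex.Re z| <= nr z.
Proof. by rewrite -lecR -nrE normc_ge_Re. Qed.

Lemma Im_le_nr z : `|complex.Im z| <= nr z.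
Proof.
rewrite -[leRHS](ger0_norm (nr_ge0 _)) -ler_sqr ?nnegrE// !real_normK ?num_real//.
by rewrite nr_sqr lerDr sqr_ge0.
Qed.

Lemma complexP z w : complex.Re z = complex.Re w -> complex.Im z = complex.Im w ->
  z = w.
Proof. by case: z; case: w => a b c d /= -> ->. Qed.

Lemma ReIm_ge_nr z : nr z <= `|complex.Re z| + `|complex.Im z|.
Proof.
case: z => a b /=; rewrite (_ : a +i* b = a%:C + 'i * b%:C); last first.
  by apply: complexP => /=; ring.
by rewrite (le_trans (nrD _ _))// nrM nrI mul1r !nrR.
Qed.

Lemma cReD z w : complex.Re (z + w) = complex.Re z + complex.Re w.
Proof. by case: z; case: w. Qed.
Lemma cImD z w : complex.Im (z + w) = complex.Im z + complex.Im w.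
Proof. by case: z; case: w. Qed.
Lemma cReN z : complex.Re (- z) = - complex.Re z.
Proof. by case: z. Qed.
Lemma cImN z : complex.Im (- z) = - complex.Im z.
Proof. by case: z. Qed.
Lemma cReM z w : complex.Re (z * w) =
  complex.Re z * complex.Re w - complex.Im z * complex.Im w.
Proof. by case: z; case: w. Qed.
Lemma cImM z w : complex.Im (z * w) =
  complex.Re z * complex.Im w + complex.Im z * complex.Re w.
Proof. by case: z; case: w. Qed.
Definition ReImE := (cReD, cImD, cReN, cImN, cReM, cImM).

End RealNorm.

Section Sequences.
Context {R : realType} {V : normedZmodType R[i]}.

Definition ntends (u : nat -> V) (l : V) :=
  forall e : R, 0 < e -> exists N, forall n, (N <= n)%N -> nr (u n - l) <= e.

Definition cauchyn (u : nat -> V) :=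
  forall e : R, 0 < e -> exists N, forall n m, (N <= n)%N -> (N <= m)%N ->
    nr (u n - u m) <= e.

Lemma ntends_uniq u l l' : ntends u l -> ntends u l' -> l = l'.
Proof.
move=> ul ul'; apply/subr0_eq/nr_small => e e0.
have e2 : 0 < e / 2 by lra.
have [N HN] := ul _ e2; have [M HM] := ul' _ e2.
have := nr_tri (u (maxn N M)) l l'; rewrite (nrC l (u _)).
have := HN (maxn N M) (leq_maxl _ _); have := HM (maxn N M) (leq_maxr _ _).
lra.
Qed.

Lemma ntends_eq u v l : (forall n, u n = v n) -> ntends u l -> ntends v l.
Proof. by move=> /funext ->. Qed.

Lemma ntends_cst l : ntends (fun=> l) l.
Proof. by move=> e e0; exists 0%N => n _; rewrite subrr nr0 ltW. Qed.

Lemma ntendsD u v l m : ntends u l -> ntends v m -> ntends (fun n => u n + v n) (l + m).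
Proof.
move=> ul vm e e0; have e2 : 0 < e / 2 by lra.
have [N HN] := ul _ e2; have [M HM] := vm _ e2.
exists (maxn N M) => n; rewrite geq_max => /andP[/HN + /HM].
by move=> h1 h2; rewrite opprD addrACA (le_trans (nrD _ _))//; lra.
Qed.

Lemma ntendsN u l : ntends u l -> ntends (fun n => - u n) (- l).
Proof.
by move=> ul e /ul[N HN]; exists N => n /HN; rewrite -opprD nrN.
Qed.

Lemma ntendsB u v l m : ntends u l -> ntends v m -> ntends (fun n => u n - v n) (l - m).
Proof. by move=> ul /ntendsN; exact: ntendsD. Qed.

Lemma ntends_le u l (c : R) : ntends u l -> (forall n, nr (u n) <= c) -> nr l <= c.
Proof.
move=> ul uc; apply/ler_addgt0Pr => e /ul[N /(_ _ (leqnn _))].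
rewrite nrC => h; have := nrD (l - u N) (u N); rewrite subrK.
by have := uc N; lra.
Qed.

End Sequences.

Lemma ntendsZ {R : realType} {V : normedModType R[i]} (u : nat -> V) l (c : R[i]) :
  ntends u l -> ntends (fun n => c *: u n) (c *: l).
Proof.
move=> ul e e0; have c0 : 0 < nr c + 1 by have := nr_ge0 c; lra.
have [N HN] := ul (e / (nr c + 1)) (divr_gt0 e0 c0).
exists N => n /HN h; rewrite -scalerBr nrZ.
move: h; rewrite ler_pdivlMr// mulrC; apply: le_trans.
by rewrite ler_wpM2r ?nr_ge0//; lra.
Qed.

(** Kept as a property, so that one integral calculus serves [R[i]], [H] and [bop H]; for the last
    one it is [bop_complete]. *)
Definition seq_complete {R : realType} (V : normedZmodType R[i]) :=
  forall u : nat -> V, cauchyn u -> exists l, ntends u l.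

Section SeqComplete.
Context {R : realType}.

Lemma real_seq_complete (u : nat -> R) :
  (forall e : R, 0 < e -> exists N, forall n m, (N <= n)%N -> (N <= m)%N ->
    `|u n - u m| <= e) ->
  exists l : R, forall e : R, 0 < e -> exists N, forall n, (N <= n)%N ->
    `|u n - l| <= e.
Proof.
move=> cu; have /cauchy_cvgP : cauchy (u @ \oo).
  apply/cauchy_ballP => e e0.
  have e2 : 0 < e / 2 by rewrite divr_gt0.
  have [N HN] := cu _ e2.
  exists ([set x | exists2 n, (N <= n)%N & x = u n],
          [set x | exists2 n, (N <= n)%N & x = u n]) => /=.
    by split; exists N => // n Nn /=; exists n.
  move=> [x y] [/= [n Nn ->] [m Nm ->]].
  have := HN _ _ Nn Nm; rewrite /ball /= => h.
  by apply: le_lt_trans h _; move: e0; lra.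
move=> /cvg_ex[l ul]; exists l => e e0.
have [N _ HN] : \forall n \near \oo, `|l - u n| < e by move/cvgrPdist_lt : ul; apply.
by exists N => n /HN /ltW; rewrite distrC.
Qed.

Lemma complex_seq_complete : seq_complete R[i].
Proof.
move=> u cu.
have [|a Ha] := real_seq_complete (fun n => complex.Re (u n)).
  move=> e /cu[N HN]; exists N => n m Nn Nm; apply: le_trans (HN _ _ Nn Nm).
  by rewrite -cReN -cReD Re_le_nr.
have [|b Hb] := real_seq_complete (fun n => complex.Im (u n)).
  move=> e /cu[N HN]; exists N => n m Nn Nm; apply: le_trans (HN _ _ Nn Nm).
  by rewrite -cImN -cImD Im_le_nr.
exists (a +i* b) => e e0; have e2 : 0 < e / 2 by rewrite divr_gt0.
have [N HN] := Ha _ e2; have [M HM] := Hb _ e2.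
exists (maxn N M) => n; rewrite geq_max => /andP[/HN h1 /HM h2].
by rewrite (le_trans (ReIm_ge_nr _))// !ReImE /=; lra.
Qed.

Lemma complete_seq_complete (V : completeNormedModType R[i]) : seq_complete V.
Proof.
move=> u cu; have /cauchy_cvgP : cauchy (u @ \oo).
  apply/cauchy_ballP => e; rewrite ltcE /= => /andP[/eqP e1 e0].
  have e2 : 0 < complex.Re e / 2 by rewrite divr_gt0.
  have [N HN] := cu _ e2.
  exists ([set x | exists2 n, (N <= n)%N & x = u n],
          [set x | exists2 n, (N <= n)%N & x = u n]) => /=.
    by split; exists N => // n Nn /=; exists n.
  move=> [x y] [/= [n Nn ->] [m Nm ->]].
  have := HN _ _ Nn Nm; rewrite -ball_normE /= => h.
  rewrite nrE ltcE /= e1 eqxx /=; apply: le_lt_trans h _; move: e0; lra.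
move=> /cvg_ex[l ul]; exists l => e e0.
have e0' : (0 : R[i]) < e%:C by rewrite ltcR.
have [N _ HN] : \forall n \near \oo, `|l - u n| < e%:C
  by move/cvgrPdist_lt : ul; apply.
by exists N => n /HN /ltW; rewrite distrC nr_le.
Qed.

End SeqComplete.

(** * Cousin's lemma *)

Section Cousin.
Context {R : realType}.

(** The supremum of the points reachable from [a] is itself reachable, and the local hypothesis at
    this point carries past it. Compactness of intervals enters below in this form: gluing of
    inequalities, uniform continuity, boundedness, propagation of a local property. *)
Lemma cousin (a b : R) (P : R -> R -> Prop) : a <= b ->
  (forall x y z, a <= x -> x <= y -> y <= z -> z <= b -> P x y -> P y z -> P x z) ->
  (forall t, a <= t <= b -> exists2 d : R, 0 < d & forall x y,
     a <= x -> x <= t -> t <= y -> y <= b -> t - d < x -> y < t + d -> P x y) ->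
  P a b.
Proof.
move=> ab tr loc.
pose S := [set x | a <= x <= b /\ P a x].
have aa : a <= a <= b by rewrite lexx.
have Sa : S a.
  by split => //; have [d d0 Hd] := loc a aa; apply: Hd => //; lra.
have ubS : has_ubound S by exists b => x [/andP[]].
have supS : has_sup S by split => //; exists a.
pose s := sup S.
have sab : a <= s <= b.
  apply/andP; split; first exact: ub_le_sup.
  by apply: ge_sup; [exists a|move=> x [/andP[]]].
have [d d0 Hd] := loc s sab.
have [x Sx sx] := sup_adherent d0 supS; rewrite -/s in sx.
have xs : x <= s by exact: ub_le_sup.
have [/andP[ax xb] Pax] := Sx.
have as_ := sab; move/andP : as_ => [as1 sb].
pose y := Num.min b (s + d / 2).
have sy : s <= y by rewrite /y le_min sb /=; lra.
have yb : y <= b by rewrite /y ge_min lexx.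
have yd : y < s + d by rewrite /y; apply: le_lt_trans (_ : s + d / 2 < _); [by rewrite ge_min lexx orbT|lra].
have Pay : P a y.
  by apply: (tr a x y) => //; [lra|apply: Hd; lra].
have Sy : S y by split => //; rewrite yb andbT; lra.
have : y <= s by exact: ub_le_sup.
move: Pay sy; rewrite /y /Num.min; case: ifPn => // h; lra.
Qed.

(** The radius found at [t] also measures the neighbourhood on which it is admissible. Gluing takes
    minima, hence the monotonicity of [Q]. *)
Lemma uniform_seg (a b : R) (Q : R -> R -> Prop) : a <= b ->
  (forall s d d', 0 < d' -> d' <= d -> Q s d -> Q s d') ->
  (forall t, a <= t <= b -> exists2 d : R, 0 < d & forall s, `|s - t| < d -> Q s d) ->
  exists2 d : R, 0 < d & forall s, a <= s <= b -> Q s d.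
Proof.
move=> ab mono loc.
apply: (cousin a b (fun x y => exists2 d : R, 0 < d & forall s, x <= s <= y -> Q s d) ab).
  move=> x y z ax xy yz zb [d d0 Hd] [d' d0' Hd'].
  have m0 : 0 < Num.min d d' by rewrite lt_min d0.
  exists (Num.min d d') => // s /andP[xs sz].
  have [sy|sy] := leP s y.
    by apply: (mono _ d) => //; [rewrite ge_min lexx|apply: Hd; rewrite xs].
  by apply: (mono _ d') => //; [rewrite ge_min lexx orbT|apply: Hd'; rewrite sz ltW].
move=> t /loc[d d0 Hd]; exists d => // x y ax xt ty yb h1 h2.
by exists d => // s /andP[xs sy]; apply: Hd; rewrite ltr_norml; lra.
Qed.

End Cousin.

(** * Derivatives of vector-valued functions *)

Section Derivatives.
Context {R : realType} {V : normedModType R[i]}.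

(** Derivatives are first-order expansions without division by [h], so [h = 0] is no exception and
    no punctured neighbourhood appears. *)
Definition rder (u : R -> V) (t : R) (l : V) := forall e : R, 0 < e ->
  exists2 d : R, 0 < d & forall h : R, `|h| < d ->
    nr (u (t + h) - u t - h%:C *: l) <= e * `|h|.

Definition cder (f : R[i] -> V) (z : R[i]) (l : V) := forall e : R, 0 < e ->
  exists2 d : R, 0 < d & forall h : R[i], nr h < d ->
    nr (f (z + h) - f z - h *: l) <= e * nr h.

Definition rcont (u : R -> V) (t : R) := forall e : R, 0 < e ->
  exists2 d : R, 0 < d & forall s : R, `|s - t| < d -> nr (u s - u t) <= e.

Definition ccont (f : R[i] -> V) (z : R[i]) := forall e : R, 0 < e ->
  exists2 d : R, 0 < d & forall w, nr (w - z) < d -> nr (f w - f z) <= e.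

(** Vector values admit no mean value equality. The inequality with slope [M + k] holds on small
    intervals around each point and is additive over adjacent intervals, so Cousin's lemma applies;
    [k] is such that its total contribution is at most [e]. *)
Lemma mean_value (a b M : R) (u : R -> V) : a <= b ->
  (forall t, a <= t <= b -> exists2 l, rder u t l & nr l <= M) ->
  nr (u b - u a) <= M * (b - a).
Proof.
move=> ab du; apply/ler_addgt0Pr => e e0.
have k0 : 0 < e / (b - a + 1) by rewrite divr_gt0//; lra.
set k := e / _ in k0.
suff : nr (u b - u a) <= (M + k) * (b - a).
  move/le_trans; apply; rewrite mulrDl lerD2l /k mulrAC ler_pdivrMr; last lra.
  by rewrite ler_pM2l//; lra.
pose P x y := nr (u y - u x) <= (M + k) * (y - x).
apply: (cousin a b P ab).
  move=> x y z _ xy yz _; rewrite /P => h1 h2.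
  rewrite (_ : z - x = (z - y) + (y - x)); last lra.
  by rewrite mulrDr (le_trans (nr_tri (u y) _ _))// lerD.
move=> t /du[l dl lM]; have [d d0 Hd] := dl _ k0; exists d => // x y _ xt ty _ h1 h2.
rewrite /P.
have Hy : nr (u y - u t - (y - t)%:C *: l) <= k * (y - t).
  have := Hd (y - t); rewrite (addrC t) subrK ger0_norm ?subr_ge0//; apply; lra.
have Hx : nr (u x - u t - (x - t)%:C *: l) <= k * (t - x).
  have := Hd (x - t); rewrite (addrC t) subrK ler0_norm ?subr_le0// opprB; apply; lra.
have -> : u y - u x = (u y - u t - (y - t)%:C *: l) - (u x - u t - (x - t)%:C *: l)
    + (y - x)%:C *: l by vec.
rewrite (le_trans (nrD _ _))//.
have := nrB (u y - u t - (y - t)%:C *: l) (u x - u t - (x - t)%:C *: l).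
rewrite nrZ nrR ger0_norm ?subr_ge0; last lra.
have : (y - x) * nr l <= (y - x) * M by rewrite ler_wpM2l//; lra.
lra.
Qed.

Lemma cder_cont f z l : cder f z l -> ccont f z.
Proof.
move=> fl e e0; have [d d0 Hd] := fl _ (@ltr01 R).
have k0 : 0 < 1 + nr l by have := nr_ge0 l; lra.
exists (Num.min d (e / (1 + nr l))); first by rewrite lt_min d0 divr_gt0.
move=> w; rewrite lt_min ltr_pdivlMr// => /andP[wd we].
have := Hd _ wd; rewrite (addrC _ (w - _)) subrK.
have := nrD (f w - f z - (w - z) *: l) ((w - z) *: l); rewrite subrK nrZ.
move: we; lra.
Qed.

Lemma rder_cont u t l : rder u t l -> rcont u t.
Proof.
move=> fl e e0; have [d d0 Hd] := fl _ (@ltr01 R).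
have k0 : 0 < 1 + nr l by have := nr_ge0 l; lra.
exists (Num.min d (e / (1 + nr l))); first by rewrite lt_min d0 divr_gt0.
move=> w; rewrite lt_min ltr_pdivlMr// => /andP[wd we].
have := Hd _ wd; rewrite (addrC _ (w - _)) subrK.
have := nrD (u w - u t - (w - t)%:C *: l) ((w - t)%:C *: l); rewrite subrK nrZ nrR.
move: we; lra.
Qed.

Definition seg (p q : R[i]) (t : R) : R[i] := p + t%:C * (q - p).

Lemma seg0 p q : seg p q 0 = p. Proof. by rewrite /seg mul0r addr0. Qed.
Lemma seg1 p q : seg p q 1 = q. Proof. by rewrite /seg mul1r addrC subrK. Qed.

Lemma seg_shift p q s t : seg p q s - seg p q t = (s - t)%:C * (q - p).
Proof. by rewrite /seg opprD addrACA subrr add0r -mulrBl rmorphB. Qed.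

Lemma cder_seg f p q t l : cder f (seg p q t) l ->
  rder (fun t => f (seg p q t)) t ((q - p) *: l).
Proof.
move=> fl e e0.
have k0 : 0 < nr (q - p) + 1 by have := nr_ge0 (q - p); lra.
have [d d0 Hd] := fl (e / (nr (q - p) + 1)) (divr_gt0 e0 k0).
exists (d / (nr (q - p) + 1)); first by rewrite divr_gt0.
move=> h; rewrite ltr_pdivlMr// => hd.
have H : nr (h%:C * (q - p)) <= `|h| * (nr (q - p) + 1).
  by rewrite nrM nrR ler_wpM2l//; lra.
have := Hd _ (le_lt_trans H hd).
rewrite (_ : seg p q t + _ = seg p q (t + h)); last first.
  by rewrite /seg rmorphD mulrDl addrA.
rewrite scalerA => /le_trans; apply.
apply: le_trans (ler_wpM2l _ H) _; first by rewrite ltW// divr_gt0.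
by rewrite mulrC -mulrA [X in `|h| * X]mulrC divfK ?gt_eqF// mulrC.
Qed.

Lemma ccont_seg f p q t : ccont f (seg p q t) -> rcont (fun t => f (seg p q t)) t.
Proof.
move=> fc e e0; have [d d0 Hd] := fc _ e0.
have k0 : 0 < nr (q - p) + 1 by have := nr_ge0 (q - p); lra.
exists (d / (nr (q - p) + 1)); first by rewrite divr_gt0.
move=> h; rewrite ltr_pdivlMr// => hd; apply: Hd.
rewrite seg_shift nrM nrR; apply: le_lt_trans hd.
by rewrite ler_wpM2l//; lra.
Qed.

Lemma unif_cont_seg f p q : (forall t, 0 <= t <= 1 -> ccont f (seg p q t)) ->
  forall e : R, 0 < e -> exists2 d : R, 0 < d &
    forall t k, 0 <= t <= 1 -> nr k < d -> nr (f (seg p q t + k) - f (seg p q t)) <= e.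
Proof.
move=> fc e e0.
pose Q t d := forall k, nr k < d -> nr (f (seg p q t + k) - f (seg p q t)) <= e.
have [//|||d d0 Hd] := uniform_seg 0 1 Q.
- by move=> s d d' d0 dd Hd k kd; apply: Hd; exact: lt_le_trans dd.
- move=> t /fc fct; have e2 : 0 < e / 2 by lra.
  have [d d0 Hd] := fct _ e2.
  have k0 : 0 < 2 * (nr (q - p) + 1) by have := nr_ge0 (q - p); lra.
  exists (Num.min (d / 2) (d / (2 * (nr (q - p) + 1)))).
    by rewrite lt_min !divr_gt0.
  move=> s; rewrite lt_min => /andP[_ hs0] k; rewrite lt_min => /andP[kd _].
  have hs : `|s - t| * (2 * (nr (q - p) + 1)) < d by rewrite -ltr_pdivlMr.
  have h : nr (seg p q s - seg p q t) < d / 2.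
    rewrite seg_shift nrM nrR.
    have : `|s - t| * nr (q - p) <= `|s - t| * (nr (q - p) + 1).
      by rewrite ler_wpM2l//; lra.
    lra.
  have h1 : nr (seg p q s + k - seg p q t) < d.
    by rewrite addrAC; apply: le_lt_trans (nrD _ _) _; lra.
  have hB : nr (f (seg p q t) - f (seg p q s)) <= e / 2.
    by rewrite nrC; apply: Hd; lra.
  have := nr_tri (f (seg p q t)) (f (seg p q s + k)) (f (seg p q s)).
  by have := Hd _ h1; lra.
by exists d => // t k /Hd; exact.
Qed.

End Derivatives.

(** * Trapezoidal sums, integrals and line integrals *)

Section Integral.
Context {R : realType} {V : normedModType R[i]} (Vc : seq_complete V).
Implicit Types g : R -> V.

(** The trapezoidal rule on [0, 1] with 2^n equal steps. Halving at the top makes bisection,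
    reversal and exactness on affine functions plain inductions on [n]. *)
Fixpoint trap n g : V := match n with
  | 0 => 2^-1 *: (g 0 + g 1)
  | m.+1 => 2^-1 *: (trap m (fun t => g (t / 2)) + trap m (fun t => g ((t + 1) / 2)))
  end.

Lemma scale_half (x : V) : 2^-1 *: (x + x) = x.
Proof. by rewrite -mulr2n -[x *+ 2]scaler_nat scalerA mulVf ?scale1r// pnatr_eq0. Qed.

Lemma nr_half (x : V) : nr ((2^-1 : R[i]) *: x) = nr x / 2.
Proof. by rewrite nrZ nrV nrn mulrC. Qed.

Lemma trapD n g h : trap n (fun t => g t + h t) = trap n g + trap n h.
Proof.
elim: n g h => [|n IH] g h /=; first by rewrite addrACA scalerDr.
by rewrite !IH addrACA scalerDr.
Qed.

Lemma trapZ n (c : R[i]) g : trap n (fun t => c *: g t) = c *: trap n g.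
Proof.
elim: n g => [|n IH] g /=; first by rewrite -scalerDr !scalerA mulrC.
by rewrite !IH -scalerDr !scalerA mulrC.
Qed.

Lemma trap_ext n g h : (forall t, 0 <= t <= 1 -> g t = h t) -> trap n g = trap n h.
Proof.
elim: n g h => [|n IH] g h gh /=; first by rewrite !gh//; lra.
by congr (_ *: (_ + _)); apply: IH => t t01; apply: gh; lra.
Qed.

Lemma trap_rev n g : trap n (fun t => g (1 - t)) = trap n g.
Proof.
elim: n g => [|n IH] g /=; first by rewrite subr0 subrr addrC.
rewrite addrC; congr (_ *: (_ + _)); rewrite -IH; apply: trap_ext => t _;
  congr g; lra.
Qed.

Lemma trap_affine n (a b : V) : trap n (fun t => a + t%:C *: b) = a + 2^-1 *: b.
Proof.
elim: n a b => [|n IH] a b /=.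
  by rewrite scale0r addr0 scale1r addrA scalerDr scale_half.
have E1 : trap n (fun t => a + (t / 2)%:C *: b) = a + 2^-1 *: (2^-1 *: b).
  rewrite -IH; apply: trap_ext => t _.
  by rewrite rmorphM /= fmorphV rmorph_nat scalerA.
have E2 : trap n (fun t => a + ((t + 1) / 2)%:C *: b) =
    (a + 2^-1 *: b) + 2^-1 *: (2^-1 *: b).
  rewrite -IH; apply: trap_ext => t _.
  rewrite rmorphM /= fmorphV rmorph_nat scalerA -addrA -scalerDl rmorphD rmorph1.
  by congr (_ + _ *: _); field.
rewrite E1 E2; have Eb : 2^-1 *: b = 2^-1 *: (2^-1 *: b) + 2^-1 *: (2^-1 *: b).
  by rewrite -scalerDr scale_half.
rewrite -[RHS]scale_half; congr (_ *: _).
by move: Eb; set q := 2^-1 *: (2^-1 *: b) => ->; vec.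
Qed.

Lemma trap_cst n (a : V) : trap n (fun=> a) = a.
Proof. by elim: n => [|n IH] /=; rewrite ?IH scale_half. Qed.

Lemma trap_le n g M : (forall t, 0 <= t <= 1 -> nr (g t) <= M) -> nr (trap n g) <= M.
Proof.
elim: n g => [|n IH] g gM /=; rewrite nr_half ler_pdivrMr//.
  have h0 : nr (g 0) <= M by apply: gM; lra.
  have h1 : nr (g 1) <= M by apply: gM; lra.
  by rewrite (le_trans (nrD _ _))//; lra.
have h1 : nr (trap n (fun t => g (t / 2))) <= M by apply: IH => t t01; apply: gM; lra.
have h2 : nr (trap n (fun t => g ((t + 1) / 2))) <= M.
  by apply: IH => t t01; apply: gM; lra.
by rewrite (le_trans (nrD _ _))//; lra.
Qed.

(** Refinement changes the sum by at most the oscillation over one step: at level 0 every value of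
    [g] is within [w] of both end values, and a higher level averages two halves. *)
Lemma trap_cauchy n k g (w : R) :
  (forall s t, 0 <= s <= 1 -> 0 <= t <= 1 -> `|s - t| <= 2^-1 ^+ n ->
     nr (g s - g t) <= w) ->
  nr (trap (n + k) g - trap n g) <= w.
Proof.
elim: n g => [|n IH] g gw.
  rewrite add0n /= expr0 in gw *.
  have -> : trap k g - 2^-1 *: (g 0 + g 1) =
      trap k (fun t => g t + - (2^-1 *: (g 0 + g 1))).
    by rewrite trapD trap_cst.
  apply: trap_le => t t01.
  rewrite -{1}(scale_half (g t)) -scalerBr nr_half ler_pdivrMr//.
  rewrite opprD addrACA (le_trans (nrD _ _))//.
  have h0 : nr (g t - g 0) <= w by apply: gw; rewrite ?ler_norml; lra.
  have h1 : nr (g t - g 1) <= w by apply: gw; rewrite ?ler_norml; lra.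
  lra.
rewrite addSn /= -scalerBr nr_half ler_pdivrMr// opprD addrACA.
have h1 : nr (trap (n + k) (fun t => g (t / 2)) - trap n (fun t => g (t / 2))) <= w.
  apply: IH => s t s01 t01 st; apply: gw; rewrite ?exprS; try lra.
  by rewrite -mulrBl normrM mulrC ger0_norm ?invr_ge0// ler_pM2l// invr_gt0.
have h2 : nr (trap (n + k) (fun t => g ((t + 1) / 2)) - trap n (fun t => g ((t + 1) / 2))) <= w.
  apply: IH => s t s01 t01 st; apply: gw; rewrite ?exprS; try lra.
  rewrite -mulrBl normrM mulrC ger0_norm ?invr_ge0// ler_pM2l ?invr_gt0//.
  by rewrite (_ : s + 1 - (t + 1) = s - t)//; ring.
by rewrite (le_trans (nrD _ _))//; lra.
Qed.

Definition ucont g := forall t, 0 <= t <= 1 -> rcont g t.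

Lemma ucontP g : ucont g -> forall e : R, 0 < e -> exists2 d : R, 0 < d &
  forall s t, 0 <= s <= 1 -> 0 <= t <= 1 -> `|s - t| < d -> nr (g s - g t) <= e.
Proof.
move=> gc e e0; have e2 : 0 < e / 2 by lra.
pose Q t d := forall s, `|s - t| < d -> nr (g s - g t) <= e.
have [//|||d d0 Hd] := uniform_seg 0 1 Q.
- by move=> s d d' d0 dd Hd k kd; apply: Hd; exact: lt_le_trans dd.
- move=> t /gc/(_ _ e2)[d d0 Hd]; exists (d / 2); first lra.
  move=> s st s' ss.
  have h1 := Hd s; have h2 := Hd s'.
  have h3 := ler_normD (s' - s) (s - t); rewrite subrKA in h3.
  rewrite (le_trans (nr_tri (g t) _ _))// [nr (g t - _)]nrC.
  by have := h1; have := h2; move: st ss h3; lra.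
by exists d => // s t s01 /Hd + st; apply.
Qed.

(** An unspecified value if the sums diverge; [J_cvg] covers continuous integrands. *)
Definition J g : V := get [set l : V | ntends (fun n => trap n g) l].

Lemma J_cvg g : ucont g -> ntends (fun n => trap n g) (J g).
Proof.
move=> gc; apply: (getPex (P := [set l : V | ntends (fun n => trap n g) l])).
apply: Vc => e e0; have e2 : 0 < e / 2 by lra.
have [d d0 Hd] := ucontP g gc _ e2.
have [N HN] : exists N, 2^-1 ^+ N < d.
  have [N _ HN] : \forall n \near \oo, (2^-1 : R) ^+ n < d.
    have : (2^-1 : R) ^+ n @[n --> \oo] --> (0 : R).
      by apply: cvg_expr; rewrite ger0_norm ?invr_ge0//; lra.
    move/cvgrPdist_lt => /(_ _ d0); apply: filterS => n.
    by rewrite sub0r normrN ger0_norm// exprn_ge0// invr_ge0.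
  by exists N; apply: HN => /=.
exists N => n m Nn Nm.
have H k : (N <= k)%N -> nr (trap k g - trap N g) <= e / 2.
  move=> /subnKC <-; apply: trap_cauchy => s t s01 t01 st.
  by apply: Hd => //; exact: le_lt_trans st HN.
by rewrite (le_trans (nr_tri (trap N g) _ _))// [X in _ + X]nrC; have := H _ Nn; have := H _ Nm; lra.
Qed.

Lemma J_eq g l : ucont g -> ntends (fun n => trap n g) l -> J g = l.
Proof. by move=> /J_cvg; exact: ntends_uniq. Qed.

Lemma J_ext g h : (forall t, 0 <= t <= 1 -> g t = h t) -> J g = J h.
Proof.
move=> gh; rewrite /J; congr get; apply/funext => l; congr ntends.
by apply/funext => n; apply: trap_ext.
Qed.

Lemma ucontD g h : ucont g -> ucont h -> ucont (fun t => g t + h t).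
Proof.
move=> gc hc t t01 e e0; have e2 : 0 < e / 2 by lra.
have [d d0 Hd] := gc _ t01 _ e2; have [d' d0' Hd'] := hc _ t01 _ e2.
exists (Num.min d d'); first by rewrite lt_min d0.
move=> s; rewrite lt_min => /andP[/Hd h1 /Hd' h2].
by rewrite opprD addrACA (le_trans (nrD _ _))//; lra.
Qed.

Lemma ucontZ c g : ucont g -> ucont (fun t => c *: g t).
Proof.
move=> gc t t01 e e0; have k0 : 0 < nr c + 1 by have := nr_ge0 c; lra.
have [d d0 Hd] := gc _ t01 _ (divr_gt0 e0 k0); exists d => // s /Hd.
rewrite ler_pdivlMr// -scalerBr nrZ => h; have := nr_ge0 (g s - g t).
by move: h; rewrite mulrDr mulr1 mulrC; lra.
Qed.

Lemma JD g h : ucont g -> ucont h -> J (fun t => g t + h t) = J g + J h.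
Proof.
move=> gc hc; apply: J_eq; first exact: ucontD.
apply: (ntends_eq (fun n => trap n g + trap n h)); first by move=> n; rewrite trapD.
by apply: ntendsD; exact: J_cvg.
Qed.

Lemma JZ c g : ucont g -> J (fun t => c *: g t) = c *: J g.
Proof.
move=> gc; apply: J_eq; first exact: ucontZ.
apply: (ntends_eq (fun n => c *: trap n g)); first by move=> n; rewrite trapZ.
by apply: ntendsZ; exact: J_cvg.
Qed.

Lemma J_le g M : ucont g -> (forall t, 0 <= t <= 1 -> nr (g t) <= M) -> nr (J g) <= M.
Proof. by move=> gc gM; apply: (ntends_le _ _ _ (J_cvg _ gc)) => n; exact: trap_le. Qed.

Lemma J_affine (a b : V) : J (fun t => a + t%:C *: b) = a + 2^-1 *: b.
Proof.
rewrite /J (_ : [set l : V | _] = [set l : V | l = a + 2^-1 *: b]).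
  by have := getPex (P := [set l : V | l = a + 2^-1 *: b]); apply; exists (a + 2^-1 *: b).
apply/seteqP; split => l /= h.
  apply: ntends_uniq h _; apply: (ntends_eq (fun=> a + 2^-1 *: b)); last exact: ntends_cst.
  by move=> n; rewrite trap_affine.
rewrite h; apply: (ntends_eq (fun=> a + 2^-1 *: b)); last exact: ntends_cst.
by move=> n; rewrite trap_affine.
Qed.

Lemma J_rev g : J (fun t => g (1 - t)) = J g.
Proof.
rewrite /J; congr get; apply/funext => l; congr ntends.
by apply/funext => n; exact: trap_rev.
Qed.

Lemma J_bisect g : ucont g ->
  J g = 2^-1 *: (J (fun t => g (t / 2)) + J (fun t => g ((t + 1) / 2))).
Proof.
move=> gc; have h1 : ucont (fun t => g (t / 2)).
  move=> t t01 e e0; have [|d d0 Hd] := gc (t / 2) _ _ e0; first lra.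
  exists d => // s st; apply: Hd; rewrite -mulrBl normrM (ger0_norm (_ : 0 <= 2^-1)) ?invr_ge0//.
  by have := normr_ge0 (s - t); lra.
have h2 : ucont (fun t => g ((t + 1) / 2)).
  move=> t t01 e e0; have [|d d0 Hd] := gc ((t + 1) / 2) _ _ e0; first lra.
  exists d => // s st; apply: Hd; rewrite -mulrBl normrM (ger0_norm (_ : 0 <= 2^-1)) ?invr_ge0// (_ : s + 1 - (t + 1) = s - t); last ring.
  by have := normr_ge0 (s - t); lra.
apply: J_eq => // e e0.
have := ntendsZ _ _ 2^-1 (ntendsD _ _ _ _ (J_cvg _ h1) (J_cvg _ h2)).
move=> /(_ _ e0)[N HN]; exists N.+1 => -[//|n] Nn; exact: HN.
Qed.

End Integral.

Section LineIntegral.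
Context {R : realType} {V : normedModType R[i]} (Vc : seq_complete V).
Implicit Types (f : R[i] -> V) (g u : R -> V) (p q : R[i]).

(** At level 0, with [c] the mean of the end values of [g], the function u(t) - t c has derivative
    at most [w]. The two halves are rescaled by t -> 2 u((t + c) / 2), whose derivative is g((t + c)
    / 2). *)
Lemma trap_deriv n g u (w : R) :
  (forall t, 0 <= t <= 1 -> rder u t (g t)) ->
  (forall s t, 0 <= s <= 1 -> 0 <= t <= 1 -> `|s - t| <= 2^-1 ^+ n ->
     nr (g s - g t) <= w) ->
  nr (trap n g - (u 1 - u 0)) <= w.
Proof.
elim: n g u => [|n IH] g u du gw.
  rewrite expr0 in gw; rewrite nrC /=; set c := _ *: _.
  have := mean_value 0 1 w (fun t => u t - t%:C *: c) ler01.
  rewrite scale1r scale0r !subr0 mulr1 => h.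
  rewrite (_ : _ - c = u 1 - c - u 0); last by vec.
  apply: h => t t01; exists (g t - c).
    move=> e e0; have [d d0 Hd] := du _ t01 _ e0; exists d => // h /Hd.
    congr (nr _ <= _); rewrite rmorphD; vec.
  rewrite -(scale_half (g t)) -scalerBr nr_half ler_pdivrMr//.
  rewrite opprD addrACA (le_trans (nrD _ _))//.
  have h0 : nr (g t - g 0) <= w by apply: gw; rewrite ?ler_norml; lra.
  have h1 : nr (g t - g 1) <= w by apply: gw; rewrite ?ler_norml; lra.
  lra.
have D (c : R) : (forall t, 0 <= t <= 1 -> 0 <= (t + c) / 2 <= 1) ->
    forall t, 0 <= t <= 1 ->
    rder (fun t => 2 *: u ((t + c) / 2)) t (g ((t + c) / 2)).
  move=> c01 t /c01 t01 e e0; have [d d0 Hd] := du _ t01 _ e0; exists d => // h hd.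
  have hd2 : `|h / 2| < d.
    rewrite normrM (ger0_norm (_ : 0 <= 2^-1)) ?invr_ge0//.
    by have := normr_ge0 h; lra.
  have := Hd _ hd2; rewrite (_ : (t + c) / 2 + h / 2 = (t + h + c) / 2); last by field.
  set a := u _; set b := u _; set l := g _.
  have -> : 2 *: a - 2 *: b - h%:C *: l = 2 *: (a - b - (h / 2)%:C *: l).
    rewrite !scalerBr scalerA; congr (_ - _ *: _).
    by rewrite rmorphM fmorphV rmorph_nat; field.
  rewrite nrZ nrn normrM (ger0_norm (_ : 0 <= 2^-1)) ?invr_ge0//; lra.
have h1 : nr (trap n (fun t => g (t / 2)) - (2 *: u (1 / 2) - 2 *: u (0 / 2))) <= w.
  have h : forall t : R, 0 <= t <= 1 -> 0 <= (t + 0) / 2 <= 1 by move=> t; lra.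
  have := D 0 h; under eq_fun do rewrite addr0.
  move=> h'; apply: (IH _ (fun t => 2 *: u (t / 2))) => [t /h'|s t s01 t01 st].
    by rewrite addr0.
  apply: gw; rewrite ?exprS; try lra.
  by rewrite -mulrBl normrM mulrC ger0_norm ?invr_ge0// ler_pM2l// invr_gt0.
have h2 : nr (trap n (fun t => g ((t + 1) / 2)) -
    (2 *: u ((1 + 1) / 2) - 2 *: u ((0 + 1) / 2))) <= w.
  apply: (IH _ (fun t => 2 *: u ((t + 1) / 2))) => [t|s t s01 t01 st].
    by apply: D => t'; lra.
  apply: gw; rewrite ?exprS; try lra.
  rewrite -mulrBl normrM mulrC ger0_norm ?invr_ge0// ler_pM2l ?invr_gt0//.
  by rewrite (_ : s + 1 - (t + 1) = s - t)//; ring.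
rewrite /= -[u 1 - u 0]scale_half -scalerBr nr_half.
move: h1 h2; rewrite mul0r add0r (_ : (1 + 1) / 2 = 1 :> R); last lra.
set A := trap _ _; set B := trap _ _; set b := u (1 / 2) => h1 h2.
have -> : A + B - (u 1 - u 0 + (u 1 - u 0)) =
   (A - (2 *: b - 2 *: u 0)) + (B - (2 *: u 1 - 2 *: b)) by vec.
have := nrD (A - (2 *: b - 2 *: u 0)) (B - (2 *: u 1 - 2 *: b)); lra.
Qed.

Lemma pow_half_lt (d : R) : 0 < d -> exists N, 2^-1 ^+ N < d.
Proof.
move=> d0; have [N _ HN] : \forall n \near \oo, (2^-1 : R) ^+ n < d.
  have : (2^-1 : R) ^+ n @[n --> \oo] --> (0 : R).
    by apply: cvg_expr; rewrite ger0_norm ?invr_ge0//; lra.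
  move/cvgrPdist_lt => /(_ _ d0); apply: filterS => n.
  by rewrite sub0r normrN ger0_norm// exprn_ge0// invr_ge0.
by exists N; apply: HN => /=.
Qed.

Lemma J_deriv g u : ucont g -> (forall t, 0 <= t <= 1 -> rder u t (g t)) ->
  J g = u 1 - u 0.
Proof.
move=> gc du; apply: J_eq => // e e0.
have [d d0 Hd] := ucontP g gc _ e0.
have [N HN] := pow_half_lt _ d0; exists N => n Nn.
apply: trap_deriv => // s t s01 t01 st; apply: Hd => //.
apply: le_lt_trans st (le_lt_trans _ HN).
by rewrite ler_wiXn2l// ?invr_ge0//; lra.
Qed.

Definition L f p q := (q - p) *: J (fun t => f (seg p q t)).

Definition cont_seg f p q := forall t, 0 <= t <= 1 -> ccont f (seg p q t).

Lemma cont_seg_ucont f p q : cont_seg f p q -> ucont (fun t => f (seg p q t)).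
Proof. by move=> fc t /fc; exact: ccont_seg. Qed.
Hint Resolve cont_seg_ucont : core.

Lemma L_le f p q M : cont_seg f p q ->
  (forall t, 0 <= t <= 1 -> nr (f (seg p q t)) <= M) -> nr (L f p q) <= M * nr (q - p).
Proof.
move=> fc fM; rewrite nrZ mulrC ler_wpM2r ?nr_ge0//; apply: J_le => //.
exact: cont_seg_ucont.
Qed.

Lemma seg_rev p q t : seg q p t = seg p q (1 - t).
Proof. by rewrite /seg rmorphB rmorph1; ring. Qed.

Lemma L_rev f p q : L f q p = - L f p q.
Proof.
rewrite /L -[in RHS]J_rev -scaleNr opprB; congr (_ *: _); congr J.
by apply/funext => t; rewrite seg_rev.
Qed.

Lemma L_bisect f p q m : cont_seg f p q -> 2 * m = p + q ->
  L f p q = L f p m + L f m q.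
Proof.
move=> fc em; have -> : m = seg p q 2^-1.
  apply: (@mulfI _ 2); first by rewrite pnatr_eq0.
  by rewrite em /seg fmorphV rmorph_nat; field.
rewrite /L (J_bisect Vc _ (cont_seg_ucont _ _ _ fc)).
rewrite scalerA scalerDr; congr (_ *: _ + _ *: _); rewrite /seg.
- by rewrite fmorphV rmorph_nat; field.
- congr J; apply/funext => t; congr f.
  by rewrite rmorphM fmorphV rmorph_nat; field.
- by rewrite fmorphV rmorph_nat; field.
- congr J; apply/funext => t; congr f.
  by rewrite rmorphM rmorphD rmorph1 fmorphV rmorph_nat; field.
Qed.

Lemma LD f h p q : cont_seg f p q -> cont_seg h p q ->
  L (fun z => f z + h z) p q = L f p q + L h p q.
Proof. by move=> fc hc; rewrite /L JD ?scalerDr//; exact: cont_seg_ucont. Qed.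

Lemma LZ c f p q : cont_seg f p q -> L (fun z => c *: f z) p q = c *: L f p q.
Proof.
by move=> fc; rewrite /L JZ ?scalerA; [rewrite mulrC|exact: Vc|exact: cont_seg_ucont].
Qed.

Lemma L_affine (a b : V) p q :
  L (fun z => a + z *: b) p q = (q - p) *: a + (2^-1 * (q ^+ 2 - p ^+ 2)) *: b.
Proof.
rewrite /L (_ : (fun t => _) = fun t => (a + p *: b) + t%:C *: ((q - p) *: b)).
  rewrite J_affine.
  rewrite (_ : _ * (_ - _) = (q - p) * p + (q - p) * 2^-1 * (q - p)); last by field.
  by vec.
by apply/funext => t; rewrite /seg; vec.
Qed.

Lemma L_prim f F p q : cont_seg f p q ->
  (forall t, 0 <= t <= 1 -> cder F (seg p q t) (f (seg p q t))) ->
  L f p q = F q - F p.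
Proof.
move=> fc dF; rewrite /L -JZ; [|exact: Vc|exact: cont_seg_ucont].
rewrite (J_deriv _ (fun t => F (seg p q t))) ?seg0 ?seg1//.
  by apply: ucontZ; exact: cont_seg_ucont.
by move=> t /dF; exact: cder_seg.
Qed.

Lemma L_ext f h p q : (forall t, 0 <= t <= 1 -> f (seg p q t) = h (seg p q t)) ->
  L f p q = L h p q.
Proof. by move=> fh; rewrite /L; congr (_ *: _); apply: J_ext. Qed.

End LineIntegral.

(** The right triangle with vertex (x, y) and legs [s] lies in the reference triangle. A negative
    [s] describes the inverted middle triangle of a subdivision, so all four pieces have the same
    form. *)
Definition valid_triangle {R : realType} (x y s : R) :=
  [/\ [/\ 0 <= x, 0 <= y & x + y <= 1], [/\ 0 <= x + s, 0 <= y & x + s + y <= 1]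
    & [/\ 0 <= x, 0 <= y + s & x + (y + s) <= 1]].

Lemma valid_triangle_half {R : realType} (x y s : R) : valid_triangle x y s ->
  [/\ valid_triangle x y (s / 2), valid_triangle (x + s / 2) y (s / 2),
    valid_triangle x (y + s / 2) (s / 2)
    & valid_triangle (x + s / 2) (y + s / 2) (- (s / 2))].
Proof.
move=> [[h1 h2 h3] [h4 h5 h6] [h7 h8 h9]].
by split; (split; split; lra).
Qed.

(** * Goursat's theorem *)

Section Goursat.
Context {R : realType} {V : normedModType R[i]} (Vc : seq_complete V).
Variables (f : R[i] -> V) (a u v : R[i]).

Definition triangle_integral p q r := L f p q + L f q r + L f r p.

Let pt (x y : R) := a + x%:C * u + y%:C * v.
Let ok (x y : R) := [/\ 0 <= x, 0 <= y & x + y <= 1].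
Hypothesis df : forall x y, ok x y -> exists l, cder f (pt x y) l.

Let seg_pt x y x' y' t : seg (pt x y) (pt x' y') t =
  pt (x + t * (x' - x)) (y + t * (y' - y)).
Proof. by rewrite /pt /seg !(rmorphD, rmorphM, rmorphN) /=; ring. Qed.

Let cseg x y x' y' : ok x y -> ok x' y' -> cont_seg f (pt x y) (pt x' y').
Proof.
move=> [h1 h2 h3] [h4 h5 h6] t /andP[t0 t1]; rewrite seg_pt.
have [|l] := df (x + t * (x' - x)) (y + t * (y' - y)); last exact: cder_cont.
split; nra.
Qed.

Let Tr (w : R * R * R) :=
  triangle_integral (pt w.1.1 w.1.2) (pt (w.1.1 + w.2) w.1.2) (pt w.1.1 (w.1.2 + w.2)).
Let valid (w : R * R * R) :=
  valid_triangle w.1.1 w.1.2 w.2.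

Let split_tri x y s : valid (x, y, s) -> Tr (x, y, s) =
  Tr (x, y, s / 2) + Tr (x + s / 2, y, s / 2) + Tr (x, y + s / 2, s / 2)
  + Tr (x + s / 2, y + s / 2, - (s / 2)).
Proof.
rewrite /valid /Tr /triangle_integral /= => -[oA oB oC].
rewrite !addrK.
rewrite (_ : x + s / 2 + s / 2 = x + s); last by field.
rewrite (_ : y + s / 2 + s / 2 = y + s); last by field.
have half z z' w w' : 2 * pt ((z + z') / 2) ((w + w') / 2) = pt z w + pt z' w'.
  by rewrite /pt !(rmorphM, rmorphD) /= fmorphV rmorph_nat; field.
rewrite (L_bisect Vc f (pt x y) (pt (x + s) y) (pt (x + s / 2) y)); last 2 first.
- exact: cseg.
- by rewrite -half; congr (_ * pt _ _); field.
rewrite (L_bisect Vc f (pt (x + s) y) (pt x (y + s)) (pt (x + s / 2) (y + s / 2)));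
  last 2 first.
- exact: cseg.
- by rewrite -half; congr (_ * pt _ _); field.
rewrite (L_bisect Vc f (pt x (y + s)) (pt x y) (pt x (y + s / 2))); last 2 first.
- exact: cseg.
- by rewrite -half; congr (_ * pt _ _); field.
rewrite (L_rev f (pt x (y + s / 2)) (pt (x + s / 2) y)).
rewrite (L_rev f (pt (x + s / 2) (y + s / 2)) (pt (x + s / 2) y)).
rewrite (L_rev f (pt (x + s / 2) (y + s / 2)) (pt x (y + s / 2))).
by vec.
Qed.

Let step w : valid w -> exists w', [/\ valid w', `|w'.2| = `|w.2| / 2,
   `|w'.1.1 - w.1.1| <= `|w.2| / 2, `|w'.1.2 - w.1.2| <= `|w.2| / 2
   & nr (Tr w) <= 4 * nr (Tr w')].
Proof.
case: w => -[x y] s vw; have := split_tri _ _ _ vw.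
have [v1 v2 v3 v4] := valid_triangle_half _ _ _ vw.
move: Tr => T; rewrite /= => E.
have E1 : `|s / 2| = `|s| / 2 by rewrite normrM (ger0_norm (_ : 0 <= 2^-1)) ?invr_ge0.
have s0 : 0 <= `|s| / 2 by rewrite divr_ge0.
have le4 : nr (T (x, y, s)) <= nr (T (x, y, s / 2)) + nr (T (x + s / 2, y, s / 2)) +
    nr (T (x, y + s / 2, s / 2)) + nr (T (x + s / 2, y + s / 2, - (s / 2))).
  rewrite E (le_trans (nrD _ _))// lerD2r (le_trans (nrD _ _))// lerD2r.
  exact: nrD.
have ex x' y' s' : valid_triangle x' y' s' -> `|s'| = `|s| / 2 ->
    `|x' - x| <= `|s| / 2 -> `|y' - y| <= `|s| / 2 ->
    nr (T (x, y, s)) <= 4 * nr (T (x', y', s')) -> exists w', [/\ valid w', `|w'.2| = `|s| / 2,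
   `|w'.1.1 - x| <= `|s| / 2, `|w'.1.2 - y| <= `|s| / 2
   & nr (T (x, y, s)) <= 4 * nr (T w')].
  by move=> a1 a2 b1 b2 b3; exists (x', y', s').
have n0 z : `|z - z| <= `|s| / 2 by rewrite subrr normr0.
have n1 z : `|z + s / 2 - z| <= `|s| / 2 by rewrite addrC addKr E1.
case: (leP (nr (T (x, y, s))) (4 * nr (T (x, y, s / 2)))) => hA; first exact: ex hA.
case: (leP (nr (T (x, y, s))) (4 * nr (T (x + s / 2, y, s / 2)))) => hB; first exact: ex hB.
case: (leP (nr (T (x, y, s))) (4 * nr (T (x, y + s / 2, s / 2)))) => hC; first exact: ex hC.
apply: (ex _ _ _ v4); rewrite ?normrN//.
move: le4 hA hB hC; move: (nr _) (nr _) (nr _) (nr _) (nr _) => t1 t2 t3 t4 t5.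
lra.
Qed.

Lemma goursat : triangle_integral a (a + u) (a + v) = 0.
Proof.
have v0 : valid (0, 0, 1) by rewrite /valid /=; split; split; lra.
have E0 : Tr (0, 0, 1) = triangle_integral a (a + u) (a + v).
  by rewrite /Tr /= /pt !add0r !mul0r !mul1r !addr0.
have [w|nx Hnx'] := @choice (R * R * R)%type (R * R * R)%type
   (fun w w' => valid w -> [/\ valid w', `|w'.2| = `|w.2| / 2,
   `|w'.1.1 - w.1.1| <= `|w.2| / 2, `|w'.1.2 - w.1.2| <= `|w.2| / 2
   & nr (Tr w) <= 4 * nr (Tr w')]).
  have [/step[w' Hw']|nw] := pselect (valid w); first by exists w'.
  by exists w.
have Hnx w : valid w -> [/\ valid (nx w), `|(nx w).2| = `|w.2| / 2,
    `|(nx w).1.1 - w.1.1| <= `|w.2| / 2, `|(nx w).1.2 - w.1.2| <= `|w.2| / 2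
    & nr (Tr w) <= 4 * nr (Tr (nx w))] := Hnx' w.
pose S n := iter n nx (0, 0, 1).
have vS n : valid (S n) by elim: n => //= n /Hnx[].
have sS n : `|(S n).2| = 2^-1 ^+ n.
  elim: n => [|n IH]; first by rewrite /= normr1.
  by have [_ /= -> _ _ _] := Hnx _ (vS n); rewrite IH exprS mulrC.
have TS n : nr (Tr (S 0)) <= 4 ^+ n * nr (Tr (S n)).
  elim: n => [|n IH]; first by rewrite expr0 mul1r.
  have [_ _ _ _ /= h] := Hnx _ (vS n); apply: le_trans IH _.
  by rewrite exprSr -mulrA ler_wpM2l// exprn_ge0.
(* At each step a coordinate moves by at most half of the current leg, so the telescoped differences
   form a geometric series with an explicit rate. *)
have far (F : R * R * R -> R) : (forall n, `|F (S n.+1) - F (S n)| <= `|(S n).2| / 2) ->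
    exists l : R, forall n, `|F (S n) - l| <= 2^-1 ^+ n.
  move=> hF; have hk n k : `|F (S (n + k)%N) - F (S n)| <= 2^-1 ^+ n - 2^-1 ^+ (n + k).
    elim: k => [|k IH]; first by rewrite addn0 !subrr normr0.
    rewrite addnS; have := hF (n + k)%N; rewrite sS exprS.
    have := ler_normD (F (S (n + k).+1) - F (S (n + k)%N)) (F (S (n + k)%N) - F (S n)).
    rewrite subrKA; lra.
  have hp n : 0 <= (2^-1 : R) ^+ n by rewrite exprn_ge0 ?invr_ge0.
  have hk' n k : `|F (S (n + k)%N) - F (S n)| <= 2^-1 ^+ n.
    by apply: le_trans (hk n k) _; have := hp (n + k)%N; lra.
  have [e e0|l Hl] := real_seq_complete (fun n => F (S n)).
    have [N HN] := pow_half_lt _ (divr_gt0 e0 (ltr0n R 2)).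
    exists N => n m Nn Nm.
    have := hk' N (n - N)%N; have := hk' N (m - N)%N; rewrite !subnKC//.
    have := ler_normD (F (S n) - F (S N)) (F (S N) - F (S m)); rewrite subrKA.
    rewrite (distrC (F (S N))) ; move: HN; lra.
  exists l => n; apply/ler_addgt0Pr => e /Hl[N HN].
  have := HN (n + N)%N (leq_addl _ _); have := hk' n N.
  have := ler_normD (F (S n) - F (S (n + N)%N)) (F (S (n + N)%N) - l); rewrite subrKA.
  by rewrite (distrC (F (S n)) (F (S (n + N)%N))); lra.
have [X HX] : exists l : R, forall n, `|(S n).1.1 - l| <= 2^-1 ^+ n.
  by apply: (far (fun w => w.1.1)) => n; have [] := Hnx _ (vS n).
have [Y HY] : exists l : R, forall n, `|(S n).1.2 - l| <= 2^-1 ^+ n.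
  by apply: (far (fun w => w.1.2)) => n; have [] := Hnx _ (vS n).
have oXY : ok X Y.
  have key (e : R) : 0 < e -> exists n, `|(S n).1.1 - X| < e /\ `|(S n).1.2 - Y| < e.
    by move=> /pow_half_lt[n hn]; exists n; split; apply: le_lt_trans hn.
  split.
  - apply/ler_addgt0Pr => e /key[n]; have [[h1 h2 h3] _ _] := vS n.
    by rewrite !ltr_norml; lra.
  - apply/ler_addgt0Pr => e /key[n]; have [[h1 h2 h3] _ _] := vS n.
    by rewrite !ltr_norml; lra.
  - apply/ler_addgt0Pr => e e0; have /key[n] : 0 < e / 2 by lra.
    by have [[h1 h2 h3] _ _] := vS n; rewrite !ltr_norml; lra.
rewrite -E0; apply: nr_small => e e0.
pose D := nr u + nr v + 1.
have D0 : 0 < D by rewrite /D; have := nr_ge0 u; have := nr_ge0 v; lra.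
have [l dl] := df _ _ oXY.
pose p := pt X Y.
(* At level [n] the legs have length q = 2^-n, each of the three sides contributes at most k (2 q D)
   (q D), and the subdivision costs 4^n. As 4^n q^2 = 1, the total is 6 k D^2 = e. *)
have k0 : 0 < e / (6 * D ^+ 2) by rewrite divr_gt0// mulr_gt0// exprn_gt0.
have [d d0 Hd] := dl _ k0.
set k := e / _ in k0 Hd.
have [n Hn] := pow_half_lt _ (divr_gt0 d0 (mulr_gt0 (ltr0n R 2) D0)).
have q0 : (0 : R) < 2^-1 ^+ n by rewrite exprn_gt0 ?invr_gt0.
move: Hn; rewrite ltr_pdivlMr; last by rewrite mulr_gt0.
set q := 2^-1 ^+ n in q0 *; move=> Hn.
have [oA oB oC] := vS n.
have sn := sS n; have xn := HX n; have yn := HY n; rewrite -/q in sn xn yn.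
move: oA oB oC sn xn yn (TS n); case: (S n) => -[x y] s /= oA oB oC sn xn yn Tn.
pose h z := f z - ((f p - p *: l) + z *: l).
have near' x' y' x'' y'' t : 0 <= t <= 1 -> `|x' - X| <= 2 * q -> `|y' - Y| <= 2 * q ->
    `|x'' - X| <= 2 * q -> `|y'' - Y| <= 2 * q ->
    nr (seg (pt x' y') (pt x'' y'') t - p) <= 2 * q * D.
  move=> /andP[t0 t1] a1 a2 a3 a4; rewrite seg_pt /p /pt.
  set x3 := x' + _; set y3 := y' + _.
  rewrite (_ : _ - _ = (x3 - X)%:C * u + (y3 - Y)%:C * v); last first.
    by rewrite !rmorphB; ring.
  rewrite (le_trans (nrD _ _))// !nrM !nrR.
  have b1 : `|x3 - X| <= 2 * q.
    move: a1 a3; rewrite /x3 !ler_norml => /andP[a1 a1'] /andP[a3 a3'].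
    by apply/andP; split; nra.
  have b2 : `|y3 - Y| <= 2 * q.
    move: a2 a4; rewrite /y3 !ler_norml => /andP[a1' a1''] /andP[a3' a3''].
    by apply/andP; split; nra.
  have := ler_wpM2r (nr_ge0 u) b1; have := ler_wpM2r (nr_ge0 v) b2.
  by rewrite /D; lra.
have s1 : -q <= s <= q by rewrite -ler_norml sn.
have nearA : `|x - X| <= 2 * q /\ `|y - Y| <= 2 * q by split; lra.
have nearB : `|x + s - X| <= 2 * q /\ `|y - Y| <= 2 * q.
  by split; [move: xn; rewrite !ler_norml; lra|lra].
have nearC : `|x - X| <= 2 * q /\ `|y + s - Y| <= 2 * q.
  by split; [lra|move: yn; rewrite !ler_norml; lra].
have hle x' y' x'' y'' : ok x' y' -> ok x'' y'' ->
    `|x' - X| <= 2 * q /\ `|y' - Y| <= 2 * q ->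
    `|x'' - X| <= 2 * q /\ `|y'' - Y| <= 2 * q ->
    `|x'' - x'| <= q -> `|y'' - y'| <= q ->
    exists r, [/\ L f (pt x' y') (pt x'' y'') =
       r + (L (fun z => (f p - p *: l) + z *: l) (pt x' y') (pt x'' y''))
      & nr r <= k * (2 * q * D) * (q * D)].
  move=> o1 o2 [n1 n2] [n3 n4] m1 m2; exists (L h (pt x' y') (pt x'' y'')).
  have caff z : ccont (fun z => (f p - p *: l) + z *: l) z.
    apply: (cder_cont _ _ l) => e' e0'; exists 1 => // h' _.
    rewrite (_ : _ - _ = 0); first by rewrite nr0 mulr_ge0 ?nr_ge0// ltW.
    by vec.
  have ch : cont_seg h (pt x' y') (pt x'' y'').
    move=> t t01 e' e0'; have e2 : 0 < e' / 2 by lra.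
    have [d1 d10 Hd1] := cseg _ _ _ _ o1 o2 t t01 _ e2.
    have [d2 d20 Hd2] := caff (seg (pt x' y') (pt x'' y'') t) _ e2.
    exists (Num.min d1 d2); first by rewrite lt_min d10.
    move=> w; rewrite lt_min => /andP[/Hd1 g1 /Hd2 g2].
    set w0 := seg _ _ _ in g1 g2 *.
    rewrite (_ : h w - h w0 = (f w - f w0) -
       ((f p - p *: l) + w *: l - ((f p - p *: l) + w0 *: l))); last by rewrite /h; vec.
    by apply: le_trans (nrB _ _) _; lra.
  split.
    by rewrite -LD//; apply: L_ext => t _; rewrite /h subrK.
  apply: le_trans (L_le Vc h _ _ (k * (2 * q * D)) ch _) _.
    move=> t t01; have np := near' x' y' x'' y'' t t01 n1 n2 n3 n4.
    move: np; set w0 := seg _ _ _ => np.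
    have := Hd (w0 - p); rewrite (addrC _ (w0 - p)) subrK.
    rewrite (_ : f w0 - f p - (w0 - p) *: l = h w0); last by rewrite /h; vec.
    move=> /(_ _)/le_trans; apply; last by rewrite ler_wpM2l// ltW.
    by apply: le_lt_trans np _; lra.
  have k1 := ltW k0; have q1 := ltW q0; have D1 := ltW D0.
  apply: ler_wpM2l; first by rewrite mulr_ge0// mulr_ge0// mulr_ge0.
  rewrite /pt (_ : _ - _ = (x'' - x')%:C * u + (y'' - y')%:C * v); last first.
    by rewrite !rmorphB; ring.
  rewrite (le_trans (nrD _ _))// !nrM !nrR.
  have := ler_wpM2r (nr_ge0 u) m1; have := ler_wpM2r (nr_ge0 v) m2.
  by rewrite /D; lra.
have z0 (z : R) : `|z - z| <= q by rewrite subrr normr0 ltW.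
have [|r1 [e1 b1]] := hle x y (x + s) y oA oB nearA nearB _ (z0 y).
  by rewrite (addrC x) addrK sn.
have [||r2 [e2 b2]] := hle (x + s) y x (y + s) oB oC nearB nearC.
- by rewrite opprD addNKr normrN sn.
- by rewrite (addrC y) addrK sn.
have [|r3 [e3 b3]] := hle x (y + s) x y oC oA nearC nearA (z0 x).
  by rewrite opprD addNKr normrN sn.
have E : Tr (x, y, s) = r1 + r2 + r3.
  rewrite /Tr /triangle_integral /= e1 e2 e3 !L_affine//.
  move: (pt x y) (pt (x + s) y) (pt x (y + s)) (2^-1 : R[i]) => A B E c.
  by vec.
apply: le_trans Tn _; rewrite E.
have : nr (r1 + r2 + r3) <= 3 * (k * (2 * q * D) * (q * D)).
  have := nrD (r1 + r2) r3; have := nrD r1 r2; lra.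
move/(ler_wpM2l (_ : 0 <= 4 ^+ n :> R)) => /(_ (exprn_ge0 _ (ler0n R 4)))/le_trans; apply.
rewrite (_ : 4 ^+ n * (3 * (k * (2 * q * D) * (q * D))) =
  (4 ^+ n * q ^+ 2) * (6 * D ^+ 2 * k)); last by move: (4 ^+ n) => t; ring.
have -> : 4 ^+ n * q ^+ 2 = 1.
  rewrite /q -exprM mulnC exprM -exprMn (_ : 4 * _ = 1) ?expr1n//.
  by rewrite expr2; field.
by rewrite mul1r mulrC /k divfK// gt_eqF// mulr_gt0// exprn_gt0.
Qed.

End Goursat.

(** * Primitives of holomorphic functions *)

Section Holomorphic.
Context {R : realType}.
Notation C := R[i].

Definition copen (U : set C) := forall z, U z -> exists2 d : R, 0 < d &
  forall w, nr (w - z) < d -> U w.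

Definition segment_in (U : set C) (p q : C) := forall t, 0 <= t <= 1 -> U (seg p q t).

Definition cconvex (U : set C) := forall p q, U p -> U q -> segment_in U p q.

Definition holo {V : normedModType C} (U : set C) (f : C -> V) :=
  forall z, U z -> exists l, cder f z l.

Lemma tube (U : set C) p q : copen U -> segment_in U p q ->
  exists2 d : R, 0 < d & forall t k, 0 <= t <= 1 -> nr k < d -> U (seg p q t + k).
Proof.
move=> oU sU.
pose Q t d := forall k, nr k < d -> U (seg p q t + k).
have [//|||d d0 Hd] := uniform_seg 0 1 Q.
- by move=> s d d' d0 dd Hd k kd; apply: Hd; exact: lt_le_trans dd.
- move=> t /sU/oU[d d0 Hd].
  have k0 : 0 < 2 * (nr (q - p) + 1) by have := nr_ge0 (q - p); lra.
  exists (Num.min (d / 2) (d / (2 * (nr (q - p) + 1)))).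
    by rewrite lt_min !divr_gt0.
  move=> s; rewrite lt_min => /andP[_ hs0] k; rewrite lt_min => /andP[kd _].
  have hs : `|s - t| * (2 * (nr (q - p) + 1)) < d by rewrite -ltr_pdivlMr.
  have h : nr (seg p q s - seg p q t) < d / 2.
    rewrite seg_shift nrM nrR.
    have : `|s - t| * nr (q - p) <= `|s - t| * (nr (q - p) + 1).
      by rewrite ler_wpM2l//; lra.
    lra.
  by apply: Hd; rewrite addrAC; apply: le_lt_trans (nrD _ _) _; lra.
by exists d => // t k /Hd; exact.
Qed.

Lemma seg_add (z h : C) t : seg z (z + h) t = z + t%:C * h.
Proof. by rewrite /seg (addrC z h) addrK. Qed.

Lemma addKl (z h : C) : z + h - z = h.
Proof. by rewrite addrC addKr. Qed.

Lemma copen_seg (U : set C) z : copen U -> U z ->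
  exists2 d : R, 0 < d & forall h, nr h < d -> segment_in U z (z + h).
Proof.
move=> oU /oU[d d0 Hd]; exists d => // h hd t /andP[t0 t1]; apply: Hd.
rewrite seg_add addKl nrM nrR ger0_norm//.
by apply: le_lt_trans hd; rewrite ler_piMl ?nr_ge0.
Qed.

Section V.
Context {V : normedModType C} (Vc : seq_complete V).
Implicit Types (f F : C -> V) (U : set C).

Lemma cder_uniq f z l l' : cder f z l -> cder f z l' -> l = l'.
Proof.
move=> fl fl'; apply/subr0_eq/nr_small => e e0.
have e2 : 0 < e / 2 by lra.
have [d d0 Hd] := fl _ e2; have [d' d0' Hd'] := fl' _ e2.
pose h : R := Num.min d d' / 2.
have m0 : 0 < Num.min d d' by rewrite lt_min d0.
have h0 : 0 < h by rewrite divr_gt0.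
have hm : h < Num.min d d' by rewrite /h; lra.
move: hm; rewrite lt_min => /andP[hd hd'].
have nh : nr h%:C = h by rewrite nrR gtr0_norm.
have := Hd h%:C; have := Hd' h%:C; rewrite nh => /(_ hd') a1 /(_ hd) a2.
set x := f _ - f _ in a1 a2.
have : nr (h%:C *: (l - l')) <= e * h.
  rewrite (_ : _ *: _ = (x - h%:C *: l') - (x - h%:C *: l)); last by vec.
  by apply: le_trans (nrB _ _) _; lra.
by rewrite nrZ nh mulrC ler_pM2r.
Qed.

Lemma holo_cont U f z : holo U f -> U z -> ccont f z.
Proof. by move=> hf /hf[l]; exact: cder_cont. Qed.

Lemma L_cst (c : V) p q : L (fun=> c) p q = (q - p) *: c.
Proof.
have := L_affine c 0 p q; rewrite scaler0 addr0 => <-.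
by apply: L_ext => t _; rewrite scaler0 addr0.
Qed.

(** Goursat on the triangle w, z, z'. The filled triangle is described as the union of the segments
    from [w] to the opposite side, a form that suits convex sets as well as tubes around a
    segment. *)
Lemma L_triangle U f w z z' : holo U f ->
  (forall s t, 0 <= s <= 1 -> 0 <= t <= 1 -> U (seg w (seg z z' t) s)) ->
  L f w z' - L f w z = L f z z'.
Proof.
move=> hf HU.
have := goursat Vc f w (z - w) (z' - w); rewrite /triangle_integral !(addrC w) !subrK.
rewrite (L_rev f w z') => H; apply/eqP; rewrite subr_eq addrC -subr_eq0; apply/eqP.
rewrite -oppr0 -H; last first.
  move=> x y [x0 y0 xy]; apply: hf.
  have [e|ne] := eqVneq (x + y) 0.
    have -> : x = 0 by lra.
    have -> : y = 0 by lra.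
    rewrite !mul0r !addr0; have h0 : 0 <= (0 : R) <= 1 by rewrite lexx ler01.
    by have := HU 0 0 h0 h0; rewrite /seg !mul0r !addr0.
  have p0 : 0 < x + y by rewrite lt_def ne /=; lra.
  have := HU (x + y) (y / (x + y)) _ _.
  rewrite (_ : seg _ _ _ = w + x%:C * (z - w) + y%:C * (z' - w)); last first.
    rewrite /seg rmorphM fmorphV rmorphD /=; field.
    by rewrite -rmorphD fmorph_eq0.
  by apply; rewrite ?divr_ge0//= ?ler_pdivrMr//; lra.
by vec.
Qed.

(** Only the segment from [w] to [z] has to lie in [U]: a tube around it does too, and contains the
    thin triangles w, z, z + h. This matters for domains that are not convex, as in
    [charval_multE]. *)
Lemma primitive U f w z : copen U -> holo U f -> segment_in U w z ->
  cder (fun z => L f w z) z (f z).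
Proof.
move=> oU hf sU e e0.
have Uz : U z by rewrite -(seg1 w z); apply: sU; lra.
have [d d0 Hd] := tube _ _ _ oU sU.
have [d' d0' Hd'] := holo_cont _ _ _ hf Uz _ e0.
exists (Num.min d d'); first by rewrite lt_min d0.
move=> h; rewrite lt_min => /andP[hd hd'].
have ns t : 0 <= t <= 1 -> nr (t%:C * h) <= nr h.
  by move=> /andP[t0 t1]; rewrite nrM nrR ger0_norm// ler_piMl ?nr_ge0.
rewrite (L_triangle U)//; last first.
  move=> s t /andP[s0 s1] /andP[t0 t1].
  rewrite (_ : seg _ _ _ = seg w z s + (s * t)%:C * h); last first.
    by rewrite /seg rmorphM; ring.
  apply: Hd; first lra.
  by apply: le_lt_trans hd; apply: ns; nra.
have cs : cont_seg f z (z + h).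
  move=> t t01; apply: (holo_cont U) => //.
  rewrite seg_add -{1}(seg1 w z).
  by apply: Hd; [lra|apply: le_lt_trans hd; exact: ns].
have cc (p : C) (c : V) : ccont (fun=> c) p.
  by move=> e' e0'; exists 1 => // ? _; rewrite subrr nr0 ltW.
have -> : L f z (z + h) - h *: f z = L (fun x => f x + - f z) z (z + h).
  by rewrite LD// L_cst addKl scalerN.
have -> : e * nr h = e * nr (z + h - z) by rewrite addKl.
apply: L_le => //.
  move=> t /cs ct e' /ct[d1 d10 Hd1]; exists d1 => // x /Hd1.
  by rewrite (_ : f x - _ - _ = f x - f (seg z (z + h) t))//; vec.
move=> t t01; apply: Hd'; rewrite seg_add addKl.
by apply: le_lt_trans hd'; exact: ns.
Qed.

(* The primitive in zeta of the difference quotient (F zeta - F z) / (zeta - z). *)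
Lemma quotient_primitive U F f z : copen U -> cconvex U -> U z ->
  (forall x, U x -> cder F x (f x)) -> holo U f ->
  exists P, forall x, U x -> x != z -> cder P x ((x - z)^-1 *: (F x - F z)).
Proof.
move=> oU cU Uz dF hf.
have fc x : U x -> ccont f x by exact: holo_cont.
(* The primitive at [x] is the integral over t in [0, 1] of (F(z + t(x - z)) - F z) / t, continued
   by its limit at t = 0. Differentiating in [x] under the integral leaves the mean of [f] over the
   segment, which is the difference quotient. *)
pose q x (t : R) := if t == 0 then (x - z) *: f z
                    else (t^-1)%:C *: (F (seg z x t) - F z).
have uq x : U x -> ucont (q x).
  move=> Ux t t01 e e0; rewrite /q; case: (eqVneq t 0) => [->|t0].
    have k0 : 0 < nr (x - z) + 1 by have := nr_ge0 (x - z); lra.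
    have [d d0 Hd] := dF _ Uz _ (divr_gt0 e0 k0).
    exists (d / (nr (x - z) + 1)); first by rewrite divr_gt0.
    move=> s; rewrite subr0; case: (eqVneq s 0) => [-> _|s0].
      by rewrite subrr nr0 ltW.
    rewrite ltr_pdivlMr// => sd.
    have H : nr (s%:C * (x - z)) < d.
      rewrite nrM nrR; apply: le_lt_trans sd; rewrite ler_wpM2l//; lra.
    have := Hd _ H; rewrite -/(seg z x s) -scalerA.
    have -> : (s^-1)%:C *: (F (seg z x s) - F z) - (x - z) *: f z =
       (s^-1)%:C *: (F (seg z x s) - F z - s%:C *: ((x - z) *: f z)).
      have E : x - z = (s^-1)%:C * (s%:C * (x - z)) by rewrite mulrA -rmorphM mulVf//= mul1r.
      by rewrite {1}E; vec.
    have si : 0 <= `|s|^-1 by rewrite invr_ge0.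
    rewrite nrM !nrR => /(ler_wpM2l si) h; rewrite nrZ nrR normfV.
    apply: le_trans h _; rewrite mulrCA mulKf ?normr_eq0//.
    by rewrite mulrAC ler_pdivrMr// ler_wpM2l ?(ltW e0)//; lra.
  have tp : 0 < t by rewrite lt_def t0; lra.
  have := cder_seg F z x t (f (seg z x t)) (dF _ (cU _ _ Uz Ux _ t01)).
  move=> /rder_cont Fc.
  have [d0 [d00 Hd0]] : exists d : R, 0 < d /\ forall s, `|s - t| < d ->
      nr (F (seg z x s) - F z) * `|s^-1 - t^-1| <= e / 2.
    have [d d0 Hd] := Fc 1 ltr01.
    set M := nr (F (seg z x t) - F z) + 2.
    have M0 : 0 < M by rewrite /M; have := nr_ge0 (F (seg z x t) - F z); lra.
    exists (Num.min (Num.min d (t / 2)) (e / M * t * t / 4)).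
    rewrite !lt_min d0 !divr_gt0//=; last by rewrite !mulr_gt0// invr_gt0.
    split=> // s; rewrite !lt_min => /andP[/andP[sd st] se].
    have sp : t / 2 < s by move: st; rewrite ltr_norml; lra.
    have s0 : 0 < s by lra.
    have FM : nr (F (seg z x s) - F z) <= M.
      by have := nr_tri (F (seg z x t)) (F (seg z x s)) (F z); have := Hd _ sd; rewrite /M; lra.
    have -> : s^-1 - t^-1 = (t - s) / (s * t) by field; rewrite ?gt_eqF.
    rewrite normrM normfV distrC (gtr0_norm (_ : 0 < s * t)) ?mulr_gt0//.
    have h1 : `|s - t| / (s * t) <= e / M / 2.
      rewrite ler_pdivrMr ?mulr_gt0//; apply: le_trans (ltW se) _.
      have eM : 0 < e / M by rewrite divr_gt0.
      have : t / 2 * t <= s * t by rewrite ler_pM2r//; lra.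
      move/(ler_wpM2l (ltW eM)); lra.
    apply: le_trans (ler_pM (nr_ge0 _) _ FM h1) _.
      by rewrite divr_ge0// mulr_ge0// ltW.
    by rewrite mulrA mulrCA mulfV ?gt_eqF// mulr1.
  have [d1 d10 Hd1] := Fc (e * t / 2) (divr_gt0 (mulr_gt0 e0 tp) (ltr0n R 2)).
  exists (Num.min d0 (Num.min d1 t)); first by rewrite !lt_min d00 d10.
  move=> s; rewrite !lt_min => /andP[/Hd0 h0 /andP[/Hd1 h1 st]].
  have s0 : 0 < s by move: st; rewrite ltr_norml; lra.
  rewrite (gt_eqF s0).
  set a := F (seg z x s) in h0 h1 *; set b := F (seg z x t) in h1 *.
  have -> : (s^-1)%:C *: (a - F z) - (t^-1)%:C *: (b - F z) =
     (s^-1 - t^-1)%:C *: (a - F z) + (t^-1)%:C *: (a - b).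
    by rewrite rmorphB; vec.
  apply: le_trans (nrD _ _) _; rewrite !nrZ !nrR normfV (gtr0_norm tp).
  have : t^-1 * nr (a - b) <= e / 2.
    by rewrite mulrC ler_pdivrMr//; lra.
  by move: h0; rewrite mulrC; lra.
exists (fun x => J (q x)) => x Ux xz e e0.
have fg : (x - z)^-1 *: (F x - F z) = J (fun t => f (seg z x t)).
  rewrite -(L_prim Vc f F z x) /L.
  - by rewrite scalerA mulVf ?scale1r// subr_eq0.
  - by move=> t t01; apply: fc; apply: cU.
  - by move=> t t01; apply: dF; apply: cU.
rewrite fg.
have uf : ucont (fun t => f (seg z x t)).
  by move=> t t01; apply: ccont_seg; apply: fc; apply: cU.
have [d d0 Hd] := unif_cont_seg f z x (fun t t01 => fc _ (cU _ _ Uz Ux _ t01)) _ e0.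
have [d' d0' Hd'] := tube _ _ _ oU (cU _ _ Uz Ux).
exists (Num.min d d'); first by rewrite lt_min d0.
move=> h; rewrite lt_min => /andP[hd hd'].
have Uxh : U (x + h) by rewrite -(seg1 z x); apply: Hd' => //; lra.
have -> : J (q (x + h)) - J (q x) - h *: J (fun t => f (seg z x t)) =
   J (fun t => q (x + h) t + (-1) *: (q x t + h *: f (seg z x t))).
  rewrite JD ?JZ ?JD ?JZ//; try by [exact: uq|apply: ucontZ|].
  - by vec.
  - by apply: ucontD; [exact: uq|exact: ucontZ].
  - by apply: ucontZ; apply: ucontD; [exact: uq|exact: ucontZ].
apply: (J_le Vc).
  by apply: ucontD; [exact: uq|apply: ucontZ; apply: ucontD; [exact: uq|exact: ucontZ]].
move=> t t01; rewrite /q; case: (eqVneq t 0) => [->|t0].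
  rewrite seg0 (_ : _ + _ = 0); first by rewrite nr0 mulr_ge0 ?nr_ge0// ltW.
  by vec.
have tp : 0 < t by rewrite lt_def t0; lra.
set p := seg z x t.
have E1 : seg z (x + h) t = p + t%:C * h by rewrite /p /seg; ring.
have ns s : 0 <= s <= 1 -> nr (s%:C * (t%:C * h)) <= nr h.
  move=> s01; rewrite !nrM !nrR !ger0_norm; try lra.
  by rewrite mulrA ler_piMl ?nr_ge0//; nra.
have Us s : 0 <= s <= 1 -> U (seg p (p + t%:C * h) s).
  move=> s01; rewrite seg_add.
  by apply: Hd' => //; apply: le_lt_trans hd'; exact: ns.
have E2 : F (p + t%:C * h) - F p = L f p (p + t%:C * h).
  rewrite (L_prim Vc f F)//.
  - by move=> s s01; apply: fc; exact: Us.
  - by move=> s s01; apply: dF; exact: Us.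
have -> : (t^-1)%:C *: (F (seg z (x + h) t) - F z)
     + -1 *: ((t^-1)%:C *: (F p - F z) + h *: f p)
   = (t^-1)%:C *: (L f p (p + t%:C * h) + L (fun=> - f p) p (p + t%:C * h)).
  rewrite E1 -E2 L_cst addKl.
  have hh : h = (t^-1)%:C * (t%:C * h) by rewrite mulrA -rmorphM mulVf//= mul1r.
  by move: (F (p + _)) => a; rewrite [in LHS]hh; vec.
have cf : cont_seg f p (p + t%:C * h) by move=> s s01; apply: fc; exact: Us.
have cc : cont_seg (fun=> - f p) p (p + t%:C * h).
  by move=> s _ e' e0'; exists 1 => // ? _; rewrite subrr nr0 ltW.
rewrite -LD// nrZ nrR gtr0_norm ?invr_gt0// mulrC ler_pdivrMr//.
have -> : e * nr h * t = e * nr (p + t%:C * h - p).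
  by rewrite addKl nrM nrR gtr0_norm// mulrA mulrAC.
apply: L_le => //.
  move=> s /cf cs e' /cs[d1 d10 Hd1]; exists d1 => // y /Hd1.
  by rewrite (_ : f y - _ - _ = f y - f (seg p (p + t%:C * h) s))//; vec.
move=> s s01; rewrite seg_add.
by apply: Hd => //; apply: le_lt_trans hd; exact: ns.
Qed.

End V.
End Holomorphic.

(** * Rules of differentiation *)

Section Calculus.
Context {R : realType}.
Notation C := R[i].
Notation Co := (R[i]^o).

Lemma Co_complete : seq_complete Co.
Proof. exact: complex_seq_complete. Qed.

Section Rules.
Context {V : normedModType C}.
Implicit Types (f g : C -> V) (z : C).

Lemma cder_cst (c : V) z : cder (fun=> c) z 0.
Proof.
move=> e e0; exists 1 => // h _; rewrite scaler0 subrr subr0 nr0.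
by rewrite mulr_ge0 ?nr_ge0// ltW.
Qed.

Lemma cderD f g z l m : cder f z l -> cder g z m -> cder (fun z => f z + g z) z (l + m).
Proof.
move=> fl gm e e0; have e2 : 0 < e / 2 by lra.
have [d d0 Hd] := fl _ e2; have [d' d0' Hd'] := gm _ e2.
exists (Num.min d d'); first by rewrite lt_min d0.
move=> h; rewrite lt_min => /andP[/Hd h1 /Hd' h2].
rewrite (_ : _ - _ - _ = (f (z + h) - f z - h *: l) + (g (z + h) - g z - h *: m)).
  by apply: le_trans (nrD _ _) _; lra.
by vec.
Qed.

Lemma cderN f z l : cder f z l -> cder (fun z => - f z) z (- l).
Proof.
move=> fl e /fl[d d0 Hd]; exists d => // h /Hd.
by rewrite -nrN; congr (nr _ <= _); vec.
Qed.

Lemma cderB f g z l m : cder f z l -> cder g z m -> cder (fun z => f z - g z) z (l - m).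
Proof. by move=> fl /cderN; exact: cderD. Qed.

Lemma cder_sum (I : Type) (s : seq I) (F : I -> C -> V) (F' : I -> V) z :
  (forall i, cder (F i) z (F' i)) ->
  cder (fun z => \sum_(i <- s) F i z) z (\sum_(i <- s) F' i).
Proof.
move=> dF; elim: s => [|i s IH].
  rewrite big_nil (_ : (fun _ => _) = fun=> 0); first exact: cder_cst.
  by apply/funext => x; rewrite big_nil.
rewrite big_cons (_ : (fun _ => _) = fun x => F i x + \sum_(j <- s) F j x).
  exact: cderD.
by apply/funext => x; rewrite big_cons.
Qed.

Lemma cder_near (U : set C) f g z l : copen U -> U z -> (forall w, U w -> f w = g w) ->
  cder f z l -> cder g z l.
Proof.
move=> oU Uz fg fl e /fl[d d0 Hd]; have [d' d0' Hd'] := oU _ Uz.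
exists (Num.min d d'); first by rewrite lt_min d0.
move=> h; rewrite lt_min => /andP[/Hd + hd'].
by rewrite !fg//; apply: Hd'; rewrite addKl.
Qed.

Lemma ccont_cst (c : V) z : ccont (fun=> c) z.
Proof. by move=> e e0; exists 1 => // w _; rewrite subrr nr0 ltW. Qed.

Lemma ccont_bounded f z : ccont f z -> exists2 d : R, 0 < d &
  forall w, nr (w - z) < d -> nr (f w) <= nr (f z) + 1.
Proof.
move=> /(_ _ ltr01)[d d0 Hd]; exists d => // w /Hd.
by have := nr_geB (f w) (f z); lra.
Qed.

End Rules.

Lemma cder_id z : cder (fun z : C => (z : Co)) z 1.
Proof.
move=> e e0; exists 1 => // h _.
rewrite (_ : _ - _ - _ = 0); first by rewrite nr0 mulr_ge0 ?nr_ge0// ltW.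
by rewrite addKl /GRing.scale /= mulr1 subrr.
Qed.

Section Bilinear.
Context {V1 V2 V3 : normedModType C} (B : V1 -> V2 -> V3) (M : R).
Hypothesis BDl : forall x x' y, B (x + x') y = B x y + B x' y.
Hypothesis BDr : forall x y y', B x (y + y') = B x y + B x y'.
Hypothesis BZl : forall a x y, B (a *: x) y = a *: B x y.
Hypothesis BZr : forall a x y, B x (a *: y) = a *: B x y.
Hypothesis M0 : 0 <= M.
Hypothesis BM : forall x y, nr (B x y) <= M * (nr x * nr y).
Implicit Types (f : C -> V1) (g : C -> V2).

Let BNl x y : B (- x) y = - B x y. Proof. by rewrite -scaleN1r BZl scaleN1r. Qed.
Let BNr x y : B x (- y) = - B x y. Proof. by rewrite -scaleN1r BZr scaleN1r. Qed.

(** The one product rule behind scaling ([cderZ]), composition of operators ([cder_comp_op]) and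
    evaluation at a vector ([cder_app]). *)
Lemma cder_bilinear f g z (f' : V1) (g' : V2) : cder f z f' -> cder g z g' ->
  cder (fun z => B (f z) (g z)) z (B f' (g z) + B (f z) g').
Proof.
move=> df dg e e0.
have gc := cder_cont _ _ _ dg; have [d0 d00 Hd0] := ccont_bounded _ _ gc.
pose K := M * (nr (f z) + nr f' + nr (g z) + 2) + 1.
have n1 := nr_ge0 (f z); have n2 := nr_ge0 f'; have n3 := nr_ge0 (g z).
have K0 : 0 < K by rewrite /K; have : 0 <= M * (nr (f z) + nr f' + nr (g z) + 2); [apply: mulr_ge0 => //; lra|lra].
have k0 : 0 < e / K by rewrite divr_gt0.
have [d1 d10 Hd1] := df _ k0; have [d2 d20 Hd2] := dg _ k0.
have [d3 d30 Hd3] := gc _ k0.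
exists (Num.min (Num.min d0 d3) (Num.min d1 d2)); first by rewrite !lt_min d00 d30 d10.
move=> h; rewrite !lt_min => /andP[/andP[h0 h3] /andP[/Hd1 h1 /Hd2 h2]].
have {h0}b0 : nr (g (z + h)) <= nr (g z) + 1 by apply: Hd0; rewrite addKl.
have {h3}b3 : nr (g (z + h) - g z) <= e / K by apply: Hd3; rewrite addKl.
set x := f (z + h) - f z - h *: f' in h1.
set y := g (z + h) - g z - h *: g' in h2.
have -> : B (f (z + h)) (g (z + h)) - B (f z) (g z) - h *: (B f' (g z) + B (f z) g') =
    B x (g (z + h)) + h *: B f' (g (z + h) - g z) + B (f z) y.
  rewrite /x /y !(BDl, BDr, BNl, BNr, BZl, BZr); vec.
have nh := nr_ge0 h.
have B1 := BM x (g (z + h)); have B2 := BM f' (g (z + h) - g z); have B3 := BM (f z) y.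
have s1 : nr (B x (g (z + h))) <= e / K * (M * (nr (g z) + 1)) * nr h.
  apply: le_trans B1 _; rewrite (_ : _ * nr h = M * ((e / K * nr h) * (nr (g z) + 1))).
    by rewrite ler_wpM2l// ler_pM ?nr_ge0.
  by move: (e / K) => t; ring.
have s2 : nr (h *: B f' (g (z + h) - g z)) <= e / K * (M * nr f') * nr h.
  rewrite nrZ mulrC ler_wpM2r//; apply: le_trans B2 _.
  rewrite (_ : e / K * (M * nr f') = M * (nr f' * (e / K))).
    by rewrite ler_wpM2l// ler_wpM2l.
  by move: (e / K) => t; ring.
have s3 : nr (B (f z) y) <= e / K * (M * nr (f z)) * nr h.
  apply: le_trans B3 _; rewrite (_ : _ * nr h = M * (nr (f z) * (e / K * nr h))).
    by rewrite ler_wpM2l// ler_wpM2l.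
  by move: (e / K) => t; ring.
apply: le_trans (nrD _ _) _; apply: le_trans (lerD (nrD _ _) s3) _.
apply: le_trans (lerD (lerD s1 s2) (lexx _)) _.
rewrite -!mulrDl ler_wpM2r// -!mulrDr mulrAC ler_pdivrMr// ler_wpM2l ?(ltW e0)//.
by rewrite /K !mulrDr; have := M0; lra.
Qed.

Lemma ccont_bilinear f g z : ccont f z -> ccont g z -> ccont (fun z => B (f z) (g z)) z.
Proof.
move=> fc gc e e0; have [d0 d00 Hd0] := ccont_bounded _ _ gc.
have n1 := nr_ge0 (f z); have n3 := nr_ge0 (g z).
pose K := M * (nr (f z) + nr (g z) + 1) + 1.
have K0 : 0 < K by rewrite /K; have : 0 <= M * (nr (f z) + nr (g z) + 1); [apply: mulr_ge0 => //; lra|lra].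
have k0 : 0 < e / K by rewrite divr_gt0.
have [d1 d10 Hd1] := fc _ k0; have [d2 d20 Hd2] := gc _ k0.
exists (Num.min d0 (Num.min d1 d2)); first by rewrite !lt_min d00 d10.
move=> w; rewrite !lt_min => /andP[/Hd0 h0 /andP[/Hd1 h1 /Hd2 h2]].
rewrite (_ : _ - _ = B (f w - f z) (g w) + B (f z) (g w - g z)); last first.
  by rewrite !(BDl, BDr, BNl, BNr); vec.
apply: le_trans (nrD _ _) _.
apply: le_trans (lerD (BM _ _) (BM _ _)) _.
have s1 : M * (nr (f w - f z) * nr (g w)) <= M * (e / K * (nr (g z) + 1)).
  by rewrite ler_wpM2l// ler_pM ?nr_ge0.
have s2 : M * (nr (f z) * nr (g w - g z)) <= M * (nr (f z) * (e / K)).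
  by rewrite ler_wpM2l// ler_wpM2l.
apply: le_trans (lerD s1 s2) _.
rewrite (_ : _ + _ = (e / K) * (M * (nr (g z) + 1 + nr (f z)))); last first.
  by move: (e / K) => t; ring.
rewrite mulrAC ler_pdivrMr// ler_wpM2l ?(ltW e0)//.
by rewrite /K !mulrDr; have := M0; lra.
Qed.

End Bilinear.

Section Scaling.
Context {V : normedModType C}.
Implicit Types (a : C -> Co) (f : C -> V).

Let scaleB (x : Co) (y : V) : V := (x : C) *: y.
Let scaleBM (x : Co) (y : V) : nr (scaleB x y) <= 1 * (nr x * nr y).
Proof. by rewrite mul1r nrZ. Qed.

Lemma cderZ a f z (a' : Co) (f' : V) : cder a z a' -> cder f z f' ->
  cder (fun z => (a z : C) *: f z) z ((a' : C) *: f z + (a z : C) *: f').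
Proof.
apply: (cder_bilinear scaleB 1) => //.
- by move=> *; exact: scalerDl.
- by move=> *; exact: scalerDr.
- by move=> *; rewrite /scaleB scalerA.
- by move=> c *; rewrite /scaleB !scalerA mulrC.
Qed.

Lemma ccontZ a f z : ccont a z -> ccont f z -> ccont (fun z => (a z : C) *: f z) z.
Proof.
apply: (ccont_bilinear scaleB 1) => //.
- by move=> *; exact: scalerDl.
- by move=> *; exact: scalerDr.
- by move=> *; rewrite /scaleB scalerA.
- by move=> c *; rewrite /scaleB !scalerA mulrC.
Qed.

Lemma cderZc (c : C) f z (f' : V) : cder f z f' -> cder (fun z => c *: f z) z (c *: f').
Proof.
move=> df; rewrite -[c *: f']add0r -(scale0r (f z)).
exact: (cderZ (fun=> c) f z 0 f' (cder_cst _ _) df).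
Qed.

End Scaling.

Lemma cderM (a b : C -> Co) z a' b' : cder a z a' -> cder b z b' ->
  cder (fun z => (a z * b z : Co)) z (a' * b z + a z * b').
Proof. exact: cderZ. Qed.

Let inv_expand (x y d h : C) : x != 0 -> y != 0 ->
  y^-1 - x^-1 - h * (- d / x ^+ 2) =
   - (y^-1 * x^-1) * (y - x - h * d) + h * d * x^-1 ^+ 2 * (y^-1 * (y - x)).
Proof. by move=> x0 y0; field; rewrite x0 y0. Qed.

Lemma cderV (a : C -> Co) z a' : cder a z a' -> a z != 0 ->
  cder (fun z => ((a z)^-1 : Co)) z (- a' / (a z) ^+ 2).
Proof.
move=> da az.
have az0 : 0 < nr (a z) by rewrite nr_gt0.
have ca := cder_cont _ _ _ da.
have [d0 d00 Hd0] := ca (nr (a z) / 2) (divr_gt0 az0 (ltr0n _ 2)).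
move=> e e0; pose A := 2 / nr (a z).
have A0 : 0 < A by rewrite divr_gt0.
have n1 := nr_ge0 a'.
pose K := A ^+ 2 + A ^+ 3 * nr a' + 1.
have K0 : 0 < K.
  have h1 : 0 < A ^+ 2 by rewrite exprn_gt0.
  have h2 : 0 <= A ^+ 3 * nr a' by rewrite mulr_ge0// exprn_ge0// ltW.
  by rewrite /K; lra.
have k0 : 0 < e / K by rewrite divr_gt0.
have [d1 d10 Hd1] := da _ k0; have [d2 d20 Hd2] := ca _ k0.
exists (Num.min d0 (Num.min d1 d2)); first by rewrite !lt_min d00 d10.
move=> h; rewrite !lt_min => /andP[h0 /andP[/Hd1 h1 h2]].
have {}h0 : nr (a (z + h) - a z) <= nr (a z) / 2 by apply: Hd0; rewrite addKl.
have {}h2 : nr (a (z + h) - a z) <= e / K by apply: Hd2; rewrite addKl.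
have b0 : nr (a z) / 2 <= nr (a (z + h)).
  by have := nr_geB (a z) (a z - a (z + h)); rewrite subKr (nrC (a z)); lra.
have azh : a (z + h) != 0 by rewrite -nr_gt0; lra.
have E : (a (z + h))^-1 - (a z)^-1 - h *: (- a' / a z ^+ 2) =
   - ((a (z + h))^-1 * (a z)^-1) * (a (z + h) - a z - h * a')
   + h * a' * (a z)^-1 ^+ 2 * ((a (z + h))^-1 * (a (z + h) - a z)).
  exact: inv_expand.
rewrite E.
have v1 : nr (a z)^-1 <= A.
  by rewrite nrV /A -[leLHS]mul1r ler_wpM2r ?invr_ge0 ?nr_ge0//; lra.
have v2 : nr (a (z + h))^-1 <= A.
  rewrite nrV /A -(invrK (2 / _)) lef_pV2 ?posrE ?nr_gt0// ?invr_gt0//.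
  by rewrite invfM invrK mulrC.
have w1 := nr_ge0 (a z)^-1; have w2 := nr_ge0 (a (z + h))^-1; have nh := nr_ge0 h.
have A1 := ltW A0.
apply: le_trans (nrD _ _) _.
have s1 : nr (- ((a (z + h))^-1 * (a z)^-1) * (a (z + h) - a z - h * a')) <=
    A ^+ 2 * (e / K * nr h).
  by rewrite nrM nrN nrM ler_pM ?nr_ge0 ?mulr_ge0// expr2 ler_pM.
have s2 : nr (h * a' * (a z)^-1 ^+ 2 * ((a (z + h))^-1 * (a (z + h) - a z))) <=
    (nr h * nr a' * A ^+ 2) * (A * (e / K)).
  rewrite nrM (nrM (h * a')) (nrM h) nrX (nrM (a (z + h))^-1).
  apply: ler_pM; rewrite ?mulr_ge0 ?exprn_ge0 ?nr_ge0//.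
    by rewrite ler_wpM2l ?mulr_ge0// lerXn2r ?nnegrE.
  by rewrite ler_pM ?nr_ge0.
apply: le_trans (lerD s1 s2) _.
rewrite (_ : _ + _ = (e / K) * (A ^+ 2 + A ^+ 3 * nr a') * nr h); last first.
  by move: (e / K) => t; ring.
rewrite ler_wpM2r// mulrAC ler_pdivrMr// ler_wpM2l ?(ltW e0)//.
by rewrite /K; lra.
Qed.

Lemma cderX (a : C -> Co) z a' n : cder a z a' ->
  cder (fun z => ((a z) ^+ n : Co)) z (n%:R * a z ^+ n.-1 * a').
Proof.
move=> da; elim: n => [|n IH].
  by rewrite !mul0r; exact: cder_cst.
rewrite (_ : _ * a' = a' * a z ^+ n + a z * (n%:R * a z ^+ n.-1 * a')).
  rewrite (_ : (fun z => _) = fun z => a z * a z ^+ n); first exact: cderM.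
  by apply/funext => x; rewrite exprS.
case: n {IH} => [|n] /=; first by rewrite !expr0 mul0r mul0r mulr0 addr0 mulrC mulr1.
by rewrite exprS [in LHS](_ : n.+2%:R = n.+1%:R + 1 :> C) ?natr1//; ring.
Qed.

Lemma cder_subc (c z : C) : cder (fun z : C => (z - c : Co)) z 1.
Proof.
have := cderB _ _ _ _ _ (cder_id z) (cder_cst (c : Co) z).
by rewrite subr0.
Qed.

Lemma cder_prod (s : seq C) (z : C) : exists l,
  cder (fun z : C => (\prod_(w <- s) (z - w) : Co)) z l.
Proof.
elim: s => [|w s [l IH]].
  exists 0; rewrite (_ : (fun _ => _) = fun=> 1); first exact: cder_cst.
  by apply/funext => x; rewrite big_nil.
exists (1 * \prod_(w <- s) (z - w) + (z - w) * l).
rewrite (_ : (fun _ => _) = fun x => (x - w) * \prod_(w <- s) (x - w)).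
  by apply: cderM => //; exact: cder_subc.
by apply/funext => x; rewrite big_cons.
Qed.

End Calculus.

(** * Cauchy's formula on squares *)

Section CauchySquare.
Context {R : realType}.
Notation C := R[i].
Notation Co := (R[i]^o).

(** The sup norm. Its balls are squares, with boundaries made of four segments, so Cauchy's formula
    needs no integral along a curve. *)
Definition sn (z : C) : R := Num.max `|complex.Re z| `|complex.Im z|.

Lemma sn_le_nr z : sn z <= nr z.
Proof. by rewrite /sn ge_max Re_le_nr Im_le_nr. Qed.

Lemma nr_le_sn z : nr z <= 2 * sn z.
Proof.
have h1 : `|complex.Re z| <= sn z by rewrite le_max lexx.
have h2 : `|complex.Im z| <= sn z by rewrite le_max lexx orbT.
by apply: le_trans (ReIm_ge_nr z) _; lra.
Qed.

Lemma snD z w : sn (z + w) <= sn z + sn w.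
Proof.
have hz1 : `|complex.Re z| <= sn z by rewrite le_max lexx.
have hz2 : `|complex.Im z| <= sn z by rewrite le_max lexx orbT.
have hw1 : `|complex.Re w| <= sn w by rewrite le_max lexx.
have hw2 : `|complex.Im w| <= sn w by rewrite le_max lexx orbT.
rewrite {1}/sn ge_max !ReImE; apply/andP; split.
  by apply: le_trans (ler_normD _ _) _; lra.
by apply: le_trans (ler_normD _ _) _; lra.
Qed.

Lemma snN z : sn (- z) = sn z. Proof. by rewrite /sn !ReImE !normrN. Qed.
Lemma snC z w : sn (z - w) = sn (w - z). Proof. by rewrite -snN opprB. Qed.

Lemma sn_tri x z w : sn (z - w) <= sn (z - x) + sn (x - w).
Proof. by rewrite -{1}(subrKA x z) snD. Qed.

Lemma sn_lt z (l : R) : (sn z < l) = (`|complex.Re z| < l) && (`|complex.Im z| < l).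
Proof. by rewrite /sn gt_max. Qed.

Lemma sn_le z (l : R) : (sn z <= l) = (`|complex.Re z| <= l) && (`|complex.Im z| <= l).
Proof. by rewrite /sn ge_max. Qed.

Lemma nr_ge_dist (z w c : C) (l : R) : sn (w - c) = l -> l - sn (z - c) <= nr (w - z).
Proof.
move=> wl; apply: le_trans (sn_le_nr _).
by have := sn_tri z w c; lra.
Qed.

Lemma seg_ReIm (p q : C) t : seg p q t =
  (complex.Re p + t * (complex.Re q - complex.Re p)) +i*
  (complex.Im p + t * (complex.Im q - complex.Im p)).
Proof. by apply: complexP; rewrite /seg !ReImE /=; ring. Qed.

Lemma sn_open (c : C) (l : R) : copen [set z | sn (z - c) < l].
Proof.
move=> z /= zl; exists (l - sn (z - c)); first by rewrite subr_gt0.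
by move=> w /(le_lt_trans (sn_le_nr _)); have := sn_tri z w c; lra.
Qed.

Lemma conv_lt (a b l t : R) : 0 <= t <= 1 -> a < l -> b < l -> a + t * (b - a) < l.
Proof.
move=> /andP[t0 t1] al bl; have [ab|/ltW ba] := leP a b.
  by apply: le_lt_trans bl; rewrite -lerBrDl ler_piMl// subr_ge0.
by apply: le_lt_trans al; rewrite gerDl mulr_ge0_le0// subr_le0.
Qed.

Lemma sn_convex (c : C) (l : R) : cconvex [set z | sn (z - c) < l].
Proof.
move=> p q /=; rewrite !sn_lt !ReImE !ltr_norml.
move=> /andP[/andP[a1 a2] /andP[a3 a4]] /andP[/andP[b1 b2] /andP[b3 b4]] t t01 /=.
rewrite seg_ReIm sn_lt !ReImE /= !ltr_norml.
have h x y x0 : - l < x - x0 -> x - x0 < l -> - l < y - x0 -> y - x0 < l ->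
    - l < x + t * (y - x) - x0 < l.
  move=> h1 h2 h3 h4; have := conv_lt _ _ (x0 + l) t t01 (_ : x < _) (_ : y < _).
  have := conv_lt _ _ (l - x0) t t01 (_ : - x < _) (_ : - y < _).
  by move=> /(_ _ _)/= g1 /(_ _ _)/= g2; apply/andP; split;
    [have : - x + t * (- y - - x) < l - x0 by apply: g1; lra
    |have : x + t * (y - x) < x0 + l by apply: g2; lra]; lra.
by rewrite !h.
Qed.

(** Powers of ['i] run through the corners counterclockwise from the lower left one, so that the
    four sides are treated by one argument. *)
Definition corner (c : C) (l : R) (k : nat) : C := c + l%:C * ('i ^+ k * (- 1 - 'i)).

Lemma corner_side c (l : R) k t : 0 <= l -> 0 <= t <= 1 ->
  sn (seg (corner c l k) (corner c l k.+1) t - c) = l.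
Proof.
move=> l0 /andP[t0 t1].
rewrite /seg /corner (_ : _ - c = 'i ^+ k * (l%:C * (- 1 - 'i) * (1 + t%:C * ('i - 1)))); last first.
  by rewrite exprSr; ring.
have sni z : sn ('i * z) = sn z.
  rewrite /sn (_ : complex.Re ('i * z) = - complex.Im z); last by rewrite !ReImE /=; ring.
  rewrite (_ : complex.Im ('i * z) = complex.Re z); last by rewrite !ReImE /=; ring.
  by rewrite normrN maxC.
elim: k => [|k IH]; last by rewrite exprS -mulrA sni.
rewrite expr0 mul1r (_ : _ * _ = (l * (2 * t - 1)) +i* (- l)); last first.
  by apply: complexP; rewrite !ReImE /=; ring.
rewrite /sn /= normrN (ger0_norm l0) normrM (ger0_norm l0); apply/max_idPr.
by rewrite ler_piMr// ler_norml; lra.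
Qed.

Section V.
Context {V : normedModType C} (Vc : seq_complete V).
Implicit Types (f F : C -> V).

Lemma bounded_seg f p q : cont_seg f p q ->
  exists2 M : R, 0 <= M & forall t : R, 0 <= t <= 1 -> nr (f (seg p q t)) <= M.
Proof.
move=> fc.
have [d d0 Hd] := unif_cont_seg f p q fc _ (@ltr01 R).
have : exists2 M : R, 0 <= M & forall t : R, 0 <= t <= 1 -> nr (f (seg p q t)) <= M.
  apply: (cousin 0 1 (fun x y => exists2 M : R, 0 <= M &
      forall t, x <= t <= y -> nr (f (seg p q t)) <= M)) => //.
    move=> x y z _ xy yz _ [M M0 HM] [M' M0' HM']; exists (Num.max M M').
      by rewrite le_max M0.
    move=> t /andP[xt tz]; rewrite le_max.
    have [ty|/ltW ty] := leP t y; first by rewrite HM// xt.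
    by rewrite HM' ?orbT// ty.
  move=> t /fc/ccont_seg/(_ _ (@ltr01 R))[d' d0' Hd']; exists d' => // x y _ xt ty _ h1 h2.
  exists (nr (f (seg p q t)) + 1); first by have := nr_ge0 (f (seg p q t)); lra.
  move=> s /andP[xs sy]; have := Hd' s; rewrite ltr_norml => /(_ _) h.
  by have := nr_geB (f (seg p q s)) (f (seg p q t)); have := h; lra.
by [].
Qed.

Lemma inv_sub (x y h : C) : x != 0 -> y != 0 -> x - y = h ->
  y^-1 - x^-1 = h * (x^-1 * y^-1).
Proof. by move=> x0 y0 <-; field; rewrite x0 y0. Qed.

(** For a = 1/(w - z) and b = 1/(w - z - h) the hypothesis holds. The conclusion is the second-order
    remainder of (w - z)^-k as a function of z, uniform in w, as needed for differentiation under
    the integral. *)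
Lemma inv_pow_expand (a b h : C) k : b - a = h * (a * b) ->
  exists2 E : C, b ^+ k - a ^+ k - h * (k%:R * a ^+ k.+1) = h ^+ 2 * E &
  forall A : R, nr a <= A -> nr b <= A -> nr E <= (k ^ 2)%:R * A ^+ k.+2.
Proof.
move=> ba; elim: k => [|k [E HE HA]].
  exists 0; first by rewrite !expr0 mul0r !mulr0 subrr subr0.
  by move=> A _ _; rewrite nr0 mul0r.
exists (b * E + k.+1%:R * a ^+ k.+2 * b).
  have -> : b ^+ k.+1 - a ^+ k.+1 - h * (k.+1%:R * a ^+ k.+2) =
     b * (b ^+ k - a ^+ k - h * (k%:R * a ^+ k.+1)) + a ^+ k * (b - a) + k%:R * h * a ^+ k.+1 * (b - a)
     - h * a ^+ k.+2.
    by rewrite !exprS -natr1; ring.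
  rewrite HE ba.
  rewrite [LHS](_ : _ = b * (h ^+ 2 * E) + h * a ^+ k.+1 * (b - a)
     + k%:R * h * a ^+ k.+1 * (h * (a * b))); last by rewrite !exprS; ring.
  by rewrite ba !exprS -natr1; ring.
move=> A aA bA; have A0 : 0 <= A := le_trans (nr_ge0 a) aA.
apply: le_trans (nrD _ _) _.
rewrite (nrM b) (nrM _ b) (nrM _ (a ^+ k.+2)) nrX nrn.
have h1 : nr b * nr E <= A * ((k ^ 2)%:R * A ^+ k.+2).
  by rewrite ler_pM ?nr_ge0 ?HA.
have h2 : k.+1%:R * nr a ^+ k.+2 * nr b <= k.+1%:R * A ^+ k.+2 * A.
  apply: ler_pM => //.
  - by rewrite mulr_ge0// exprn_ge0// nr_ge0.
  - exact: nr_ge0.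
  - by rewrite ler_wpM2l// lerXn2r// nnegrE ?nr_ge0.
apply: le_trans (lerD h1 h2) _.
have -> : A * ((k ^ 2)%:R * A ^+ k.+2) + k.+1%:R * A ^+ k.+2 * A =
    ((k ^ 2)%:R + k.+1%:R) * A ^+ k.+3 by rewrite (exprSr A k.+2); ring.
rewrite ler_wpM2r ?exprn_ge0// -natrD ler_nat.
by rewrite -!mulnn mulSn mulnS; lia.
Qed.

Lemma kernel_deriv (m : C -> V) (p q z : C) (dd : R) k : cont_seg m p q -> 0 < dd ->
  (forall t : R, 0 <= t <= 1 -> dd <= nr (seg p q t - z)) ->
  cder (fun z => L (fun w => (w - z)^-1 ^+ k *: m w) p q) z
       (L (fun w => (k%:R * (w - z)^-1 ^+ k.+1) *: m w) p q).
Proof.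
move=> mc d0 Hd e e0; have [M M0 HM] := bounded_seg _ _ _ mc.
pose A := 2 / dd; have A0 : 0 <= A by rewrite divr_ge0// ltW.
pose K := (k ^ 2)%:R * A ^+ k.+2 * M * nr (q - p) + 1.
have K1 : 0 <= (k ^ 2)%:R * A ^+ k.+2 * M * nr (q - p).
  by rewrite mulr_ge0 ?nr_ge0// mulr_ge0// mulr_ge0// exprn_ge0.
have K0 : 0 < K by rewrite /K; lra.
exists (Num.min (dd / 2) (e / K)); first by rewrite lt_min !divr_gt0.
move=> h; rewrite lt_min => /andP[hd he].
have far z' t : nr (z' - z) < dd / 2 -> 0 <= t <= 1 -> dd / 2 <= nr (seg p q t - z').
  by move=> zz /Hd; have := nr_tri z' (seg p q t) z; lra.
have cinv z' n : nr (z' - z) < dd / 2 -> forall t, 0 <= t <= 1 ->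
    ccont (fun w : C => ((w - z')^-1 ^+ n : Co)) (seg p q t).
  move=> zz t t01; have nz : seg p q t - z' != 0.
    by rewrite -nr_gt0; have := far _ _ zz t01; lra.
  apply: cder_cont; apply: cderX; apply: (cderV (fun w => w - z')) => //.
  exact: cder_subc.
have z0 : nr (z - z) < dd / 2 by rewrite subrr nr0; lra.
have zh : nr (z + h - z) < dd / 2 by rewrite addKl.
have c1 : cont_seg (fun w => (w - (z + h))^-1 ^+ k *: m w) p q.
  by move=> t t01; apply: (ccontZ (fun w => (w - (z + h))^-1 ^+ k)); [exact: cinv|exact: mc].
have c2 : cont_seg (fun w => (w - z)^-1 ^+ k *: m w) p q.
  by move=> t t01; apply: (ccontZ (fun w => (w - z)^-1 ^+ k)); [exact: cinv|exact: mc].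
have c3 : cont_seg (fun w => (k%:R * (w - z)^-1 ^+ k.+1) *: m w) p q.
  move=> t t01; apply: (ccontZ (fun w => k%:R * (w - z)^-1 ^+ k.+1)); last exact: mc.
  by apply: (ccontZ (fun=> k%:R)); [exact: ccont_cst|exact: cinv].
have cN g : cont_seg g p q -> cont_seg (fun w => -1 *: g w) p q.
  by move=> gc t t01; apply: (ccontZ (fun=> -1)); [exact: ccont_cst|exact: gc].
have cZ g : cont_seg g p q -> cont_seg (fun w => h *: g w) p q.
  by move=> gc t t01; apply: (ccontZ (fun=> h)); [exact: ccont_cst|exact: gc].
have cA g g' : cont_seg g p q -> cont_seg g' p q -> cont_seg (fun w => g w + g' w) p q.
  move=> gc gc' t t01 e' e0'; have e2 : 0 < e' / 2 by lra.
  have [d1 d10 Hd1] := gc t t01 _ e2; have [d2 d20 Hd2] := gc' t t01 _ e2.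
  exists (Num.min d1 d2); first by rewrite lt_min d10.
  move=> w; rewrite lt_min => /andP[/Hd1 h1 /Hd2 h2].
  by rewrite opprD addrACA (le_trans (nrD _ _))//; lra.
set f1 := (fun w => (w - (z + h))^-1 ^+ k *: m w) in c1 *.
set f2 := (fun w => (w - z)^-1 ^+ k *: m w) in c2 *.
set f3 := (fun w => (k%:R * (w - z)^-1 ^+ k.+1) *: m w) in c3 *.
have -> : L f1 p q - L f2 p q - h *: L f3 p q =
    L (fun w => f1 w + -1 *: (f2 w + h *: f3 w)) p q.
  rewrite LD//; last by apply: (cN); apply: (cA) => //; exact: cZ.
  rewrite LZ//; last by apply: (cA) => //; exact: cZ.
  rewrite LD//; last exact: cZ.
  by rewrite LZ//; vec.
apply: le_trans (L_le Vc _ _ _ ((k ^ 2)%:R * A ^+ k.+2 * M * nr h ^+ 2) _ _) _.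
- by apply: (cA) => //; apply: (cN); apply: (cA) => //; exact: cZ.
- move=> t t01; rewrite /f1 /f2 /f3; set w := seg p q t.
  have n1 := far _ _ z0 t01; have n2 := far _ _ zh t01; rewrite -/w in n1 n2.
  have w1 : w - z != 0 by rewrite -nr_gt0; lra.
  have w2 : w - (z + h) != 0 by rewrite -nr_gt0; lra.
  have [|E HE HA] := inv_pow_expand (w - z)^-1 (w - (z + h))^-1 h k.
    by apply: inv_sub => //; ring.
  rewrite (_ : _ + _ = ((w - (z + h))^-1 ^+ k - (w - z)^-1 ^+ k -
     h * (k%:R * (w - z)^-1 ^+ k.+1)) *: m w); last first.
    by move: (_^-1) (_^-1) => a b; vec.
  rewrite HE nrZ nrM nrX (mulrC (nr h ^+ 2)) mulrAC ler_wpM2r ?exprn_ge0 ?nr_ge0//.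
  apply: ler_pM; rewrite ?nr_ge0 ?HM//; apply: HA.
    by rewrite nrV /A -(invrK (2 / dd)) lef_pV2 ?posrE ?nr_gt0 ?invr_gt0 ?divr_gt0// invfM invrK mulrC.
  by rewrite nrV /A -(invrK (2 / dd)) lef_pV2 ?posrE ?nr_gt0 ?invr_gt0 ?divr_gt0// invfM invrK mulrC.
have h0 := nr_ge0 h.
move: he; rewrite ltr_pdivlMr// => he.
rewrite (_ : _ * nr (q - p) = ((k ^ 2)%:R * A ^+ k.+2 * M * nr (q - p)) * nr h * nr h); last by ring.
rewrite ler_wpM2r//; move: he; rewrite /K mulrDr mulr1.
by rewrite [X in X + _]mulrC; lra.
Qed.

Lemma L_scal (a : C -> Co) (v : V) p q : cont_seg a p q ->
  L (fun w => (a w : C) *: v) p q = (L a p q : C) *: v.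
Proof.
move=> ac; rewrite /L -scalerA; congr (_ *: _).
have uc := cont_seg_ucont _ _ _ ac.
apply: (J_eq Vc).
  by move=> t t01; apply: (ccont_seg (fun w => (a w : C) *: v)); apply: ccontZ;
    [exact: ac|exact: ccont_cst].
have E n (g : R -> Co) : trap n (fun t => (g t : C) *: v) = (trap n g : C) *: v.
  elim: n g => [|n IH] g /=.
    by rewrite -scalerDl scalerA.
  by rewrite (IH (fun t => g (t / 2))) (IH (fun t => g ((t + 1) / 2))) -scalerDl scalerA.
move=> e e0; have k0 : 0 < nr v + 1 by have := nr_ge0 v; lra.
have [N HN] := J_cvg Co_complete _ uc _ (divr_gt0 e0 k0).
exists N => n /HN; rewrite (E n (fun t => a (seg p q t))) -scalerBl nrZ ler_pdivlMr// mulrDr mulr1 => h.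
by have := nr_ge0 (trap n (fun t => a (seg p q t)) - J (fun t => a (seg p q t))); lra.
Qed.

End V.
End CauchySquare.

Lemma cder_ext {R : realType} {V : normedModType R[i]} (f g : R[i] -> V) z l l' :
  (forall x, f x = g x) -> l = l' -> cder f z l -> cder g z l'.
Proof. by move=> /funext -> ->. Qed.

Section CauchyFormula.
Context {R : realType}.
Notation C := R[i].
Notation Co := (R[i]^o).

Definition sqint {V : normedModType C} (f : C -> V) (c : C) (l : R) : V :=
  L f (corner c l 0) (corner c l 1) + L f (corner c l 1) (corner c l 2)
  + L f (corner c l 2) (corner c l 3) + L f (corner c l 3) (corner c l 4).

Definition onsq (c : C) (l : R) (w : C) := sn (w - c) = l.

Section V.
Context {V : normedModType C} (Vc : seq_complete V).
Implicit Types (f F : C -> V).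

Section Fixed.
Variables (c : C) (l : R).
Hypothesis l0 : 0 < l.

Let side k : (forall w, onsq c l w -> True) ->
  forall t : R, 0 <= t <= 1 -> onsq c l (seg (corner c l k) (corner c l k.+1) t).
Proof. by move=> _ t t01; apply: corner_side => //; exact: ltW. Qed.

Lemma onsq_side k (t : R) : 0 <= t <= 1 ->
  onsq c l (seg (corner c l k) (corner c l k.+1) t).
Proof. exact: side. Qed.

Lemma cont_onsq f k : (forall w, onsq c l w -> ccont f w) ->
  cont_seg f (corner c l k) (corner c l k.+1).
Proof. by move=> fc t t01; apply: fc; exact: onsq_side. Qed.

Lemma corner4 : corner c l 4 = corner c l 0.
Proof. by rewrite /corner (exprM _ 2 2) sqr_i sqrrN expr1n. Qed.

Lemma sqint_prim f P : (forall w, onsq c l w -> ccont f w) ->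
  (forall w, onsq c l w -> cder P w (f w)) -> sqint f c l = 0.
Proof.
move=> fc dP; rewrite /sqint !(L_prim Vc f P); try (by apply: cont_onsq);
  try (by move=> t t01; apply: dP; exact: onsq_side).
by rewrite corner4; vec.
Qed.

Lemma sqintD f g : (forall w, onsq c l w -> ccont f w) ->
  (forall w, onsq c l w -> ccont g w) ->
  sqint (fun w => f w + g w) c l = sqint f c l + sqint g c l.
Proof.
move=> fc gc; rewrite /sqint !LD; try (by []); try (by apply: cont_onsq).
by vec.
Qed.

Lemma sqint_ext f g : (forall w, onsq c l w -> f w = g w) -> sqint f c l = sqint g c l.
Proof.
by move=> fg; rewrite /sqint; congr (_ + _ + _ + _); apply: L_ext => t t01;
  apply: fg; exact: onsq_side.
Qed.

Lemma sqint_scal (a : C -> Co) (v : V) : (forall w, onsq c l w -> ccont a w) ->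
  sqint (fun w => (a w : C) *: v) c l = (sqint a c l : C) *: v.
Proof.
move=> ac; rewrite /sqint !L_scal; try (by []);
  try (by move=> t t01; apply: ac; exact: onsq_side).
by rewrite !scalerDl.
Qed.

Lemma nr_corner k : nr (corner c l k.+1 - corner c l k) = 2 * l.
Proof.
rewrite /corner (_ : _ - _ = 'i ^+ k * (2 * l)%:C); last first.
  rewrite exprSr rmorphM /= (_ : 2%:C = 2); last by rewrite rmorph_nat.
  rewrite (_ : _ - _ = 'i ^+ k * l%:C * (1 - 'i * 'i)); last by ring.
  by rewrite -expr2 sqr_i; ring.
by rewrite nrM nrX nrI expr1n mul1r nrR gtr0_norm// mulr_gt0.
Qed.

Lemma sqint_le f M : (forall w, onsq c l w -> ccont f w) ->
  (forall w, onsq c l w -> nr (f w) <= M) -> nr (sqint f c l) <= M * (8 * l).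
Proof.
move=> fc fM.
have h k : nr (L f (corner c l k) (corner c l k.+1)) <= M * (2 * l).
  rewrite -(nr_corner k); apply: (L_le Vc); first exact: cont_onsq.
  by move=> t t01; apply: fM; exact: onsq_side.
have := h 0%N; have := h 1%N; have := h 2%N; have := h 3%N; rewrite /sqint.
set a := L _ _ _; set b := L _ _ _; set d := L _ _ _; set e := L _ _ _ => h1 h2 h3 h4.
apply: le_trans (nrD _ _) _; apply: le_trans (lerD (nrD _ _) (lexx _)) _.
by apply: le_trans (lerD (lerD (nrD _ _) (lexx _)) (lexx _)) _; lra.
Qed.

Lemma onsq_neq z w : sn (z - c) < l -> onsq c l w -> w - z != 0.
Proof.
move=> zl wl; rewrite -nr_gt0; apply: lt_le_trans (nr_ge_dist z w c l wl).
by rewrite subr_gt0.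
Qed.

Lemma ccont_inv z k w : sn (z - c) < l -> onsq c l w ->
  ccont (fun w : C => ((w - z)^-1 ^+ k : Co)) w.
Proof.
move=> zl wl; apply: cder_cont; apply: cderX; apply: (cderV (fun w => w - z)).
  exact: cder_subc.
exact: onsq_neq wl.
Qed.

Lemma sqint_kernel (m : C -> V) z k : (forall w, onsq c l w -> ccont m w) ->
  sn (z - c) < l ->
  cder (fun z => sqint (fun w => (w - z)^-1 ^+ k *: m w) c l) z
    (sqint (fun w => (k%:R * (w - z)^-1 ^+ k.+1) *: m w) c l).
Proof.
move=> mc zl.
have K j : cder (fun z => L (fun w => (w - z)^-1 ^+ k *: m w) (corner c l j) (corner c l j.+1)) z
   (L (fun w => (k%:R * (w - z)^-1 ^+ k.+1) *: m w) (corner c l j) (corner c l j.+1)).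
  apply: (kernel_deriv Vc _ _ _ _ (l - sn (z - c))).
  - exact: cont_onsq.
  - by rewrite subr_gt0.
  - by move=> t t01; apply: nr_ge_dist; exact: onsq_side.
by rewrite /sqint; apply: cderD; [apply: cderD; [apply: cderD|]|]; exact: K.
Qed.

End Fixed.
End V.

(** Its value is 2 pi i, but the proof needs only that it is nonzero and does not depend on [z],
    which spares its evaluation. *)
Definition c0 (c : C) (l : R) (z : C) : C := sqint (fun w => ((w - z)^-1 : Co)) c l.

Lemma Im_J_ge (g : R -> Co) : ucont g ->
  (forall t : R, 0 <= t <= 1 -> 1 <= complex.Im (g t)) -> 1 <= complex.Im (J g).
Proof.
move=> gc g1; apply/ler_addgt0Pr => e e0.
have [N HN] := J_cvg Co_complete _ gc _ e0.
have := HN N (leqnn _).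
have T n (h : R -> Co) : (forall t : R, 0 <= t <= 1 -> 1 <= complex.Im (h t)) ->
    1 <= complex.Im (trap n h).
  have E (x : C) : complex.Im (2^-1 * x) = 2^-1 * complex.Im x.
    rewrite cImM (_ : (2^-1 : C) = (2^-1)%:C) /= ?mul0r ?addr0//.
    by rewrite fmorphV rmorph_nat.
  elim: n h => [|n IH] h h1 /=.
    rewrite [X in complex.Im X](_ : _ = 2^-1 * (h 0 + h 1) :> C)// E cImD.
    by have := h1 0; have := h1 1; rewrite !lexx !ler01 => /(_ isT) a /(_ isT) b; lra.
  rewrite [X in complex.Im X](_ : _ = 2^-1 * (trap n (fun t => h (t / 2)) +
    trap n (fun t => h ((t + 1) / 2))) :> C)// E cImD.
  have : 1 <= complex.Im (trap n (fun t => h (t / 2))) by apply: IH => t t01; apply: h1; lra.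
  have : 1 <= complex.Im (trap n (fun t => h ((t + 1) / 2))) by apply: IH => t t01; apply: h1; lra.
  lra.
have := T N g g1 => h1 h2.
have := le_trans (Im_le_nr _) h2; rewrite cImD cImN ler_norml; lra.
Qed.

(** On each side the integrand is (i - 1) / (1 + t (i - 1)), with imaginary part 1 / ((1 - t)^2 +
    t^2) >= 1, so the four sides together give an imaginary part of at least 4. *)
Lemma c0_center_neq0 c l : 0 < l -> c0 c l c != 0.
Proof.
move=> l0.
have cinv k : cont_seg (fun w => ((w - c)^-1 : Co)) (corner c l k) (corner c l k.+1).
  apply: cont_onsq => // w wl; have := ccont_inv c l c 1 w _ wl.
  by rewrite subrr /sn /= !normr0 maxxx; apply.
have K k : 1 <= complex.Im (L (fun w => ((w - c)^-1 : Co)) (corner c l k) (corner c l k.+1)).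
  have ck := cont_seg_ucont _ _ _ (cinv k).
  rewrite /L -(JZ Co_complete _ _ ck).
  apply: Im_J_ge; first exact: ucontZ.
  move=> t /andP[t0 t1].
  have i0 : ('i : C) ^+ k != 0.
    by rewrite expf_neq0// -nr_gt0 nrI.
  have l1 : l%:C != 0 :> C by rewrite fmorph_eq0 gt_eqF.
  have m0 : (- 1 - 'i : C) != 0.
    by apply/eqP => /(congr1 (@complex.Re R)); rewrite !ReImE /=; lra.
  have d0 : (1 + t%:C * ('i - 1) : C) != 0.
    apply/eqP => h; have := congr1 (@complex.Re R) h; have := congr1 (@complex.Im R) h.
    by rewrite !ReImE /=; lra.
  rewrite [X in complex.Im X](_ : _ = ('i - 1) / (1 + t%:C * ('i - 1)) :> C); last first.
    rewrite /GRing.scale /= /seg /corner.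
    rewrite (_ : _ + _ - c = 'i ^+ k * (l%:C * (- 1 - 'i)) * (1 + t%:C * ('i - 1))); last first.
      by rewrite exprSr; ring.
    rewrite (_ : _ - _ = 'i ^+ k * (l%:C * (- 1 - 'i)) * ('i - 1)); last first.
      by rewrite exprSr; ring.
    by rewrite invfM mulrACA mulfV ?mul1r// !mulf_neq0.
  rewrite (_ : 1 + _ = (1 - t) +i* t); last by apply: complexP; rewrite !ReImE /=; ring.
  have D : 0 < (1 - t) ^+ 2 + t ^+ 2 by nra.
  rewrite (_ : _ / _ = ((2 * t - 1) / ((1 - t) ^+ 2 + t ^+ 2)) +i* (((1 - t) ^+ 2 + t ^+ 2)^-1)).
    by rewrite /= invf_ge1//; nra.
  apply: (@mulIf _ ((1 - t) +i* t)).
    by apply/eqP => h; have := congr1 (@complex.Re R) h; have := congr1 (@complex.Im R) h => /= -> ; lra.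
  rewrite mulfVK; last first.
    by apply/eqP => h; have := congr1 (@complex.Re R) h; have := congr1 (@complex.Im R) h => /= -> ; lra.
  by apply: complexP; rewrite !ReImE /=; field; rewrite gt_eqF.
apply/eqP => /(congr1 (@complex.Im R)); rewrite /c0 /sqint !cImD /=.
have s4 (a b d e : R) : 1 <= a -> 1 <= b -> 1 <= d -> 1 <= e -> a + b + d + e != 0.
  by move=> *; apply/eqP; lra.
by apply/eqP; apply: s4; exact: K.
Qed.

(** The derivative in [z] is the integral of (w - z)^-2 over a closed contour, and this integrand
    has the primitive -(w - z)^-1. *)
Lemma c0_const c l z : 0 < l -> sn (z - c) < l -> c0 c l z = c0 c l c.
Proof.
move=> l0 zl.
have d0 x : sn (x - c) < l -> cder (fun z => (c0 c l z : Co)) x 0.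
  move=> xl.
  have := sqint_kernel Co_complete c l l0 (fun=> (1 : Co)) x 1 (fun _ _ => ccont_cst _ _) xl.
  have -> : sqint (fun w => (1 * (w - x)^-1 ^+ 2) *: (1 : Co)) c l = 0.
    apply: (sqint_prim Co_complete c l l0 _ (fun w => - (w - x)^-1)) => w wl.
      apply: ccontZ; last exact: ccont_cst.
      by apply: (ccontZ (fun=> 1)); [exact: ccont_cst|exact: ccont_inv wl].
    have wx := onsq_neq c l x w xl wl.
    have := cderN _ _ _ (cderV (fun w => w - x) w 1 (cder_subc x w) wx).
    rewrite (_ : - (- 1 / (w - x) ^+ 2) = (1 * (w - x)^-1 ^+ 2) *: (1 : Co))//.
    by rewrite /GRing.scale /= mulr1 mul1r exprVn mulNr opprK mul1r.
  move=> H; apply: (cder_ext _ _ _ _ _ _ erefl H) => y.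
  apply: (sqint_ext c l l0) => w _.
  by rewrite expr1 /GRing.scale /= mulr1.
have cl : sn (c - c) < l by rewrite subrr /sn /= !normr0 maxxx.
apply/subr0_eq/nr_small => e e0.
have := mean_value 0 1 0 (fun t => (c0 c l (seg c z t) : Co)) ler01.
rewrite mul0r seg0 seg1 => h; apply: le_trans (h _) (ltW e0) => t t01.
exists ((z - c) *: (0 : Co)); last by rewrite scaler0 nr0.
apply: (cder_seg (fun z => (c0 c l z : Co))); apply: d0.
exact: (sn_convex c l c z cl zl t t01).
Qed.

Section Formula.
Context {V : normedModType C} (Vc : seq_complete V).
Implicit Types (f F : C -> V) (U : set C).

(** That the derivative [f] is holomorphic is assumed at this stage because [quotient_primitive]
    requires it. [holo_derivative] then removes the assumption by applying this case to a primitive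
    of [F]. *)
Lemma cauchy_formula_prim U F f c l z : copen U -> cconvex U -> 0 < l ->
  (forall x, sn (x - c) <= l -> U x) -> sn (z - c) < l ->
  (forall x, U x -> cder F x (f x)) -> holo U f ->
  sqint (fun w => (w - z)^-1 *: F w) c l = c0 c l c *: F z.
Proof.
move=> oU cU l0 QU zl dF hf.
have UZ w : onsq c l w -> U w by move=> h; apply: QU; rewrite h.
have Uz : U z by apply: QU; exact: ltW.
have [P dP] := quotient_primitive Vc U F f z oU cU Uz dF hf.
have cF w : onsq c l w -> ccont F w by move=> /UZ/dF/cder_cont.
have ci w : onsq c l w -> ccont (fun w : C => ((w - z)^-1 : Co)) w.
  by move=> wl; have := ccont_inv c l z 1 w zl wl.
have c1 w : onsq c l w -> ccont (fun w => (w - z)^-1 *: F w) w.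
  by move=> wl; apply: (ccontZ (fun w => (w - z)^-1)); [exact: ci|exact: cF].
have c2 w : onsq c l w -> ccont (fun w => (w - z)^-1 *: - F z) w.
  by move=> wl; apply: (ccontZ (fun w => (w - z)^-1)); [exact: ci|exact: ccont_cst].
have c3 w : onsq c l w -> ccont (fun w => (w - z)^-1 *: (F w - F z)) w.
  move=> wl; apply: (ccontZ (fun w => (w - z)^-1)); first exact: ci.
  have [l' dFl] : exists l', cder F w l' by exists (f w); apply: dF; exact: UZ.
  exact: cder_cont (cderB _ _ _ _ _ dFl (cder_cst (F z) w)).
have : sqint (fun w => (w - z)^-1 *: (F w - F z)) c l = 0.
  apply: (sqint_prim Vc c l l0 _ P c3) => w wl; apply: dP; first exact: UZ.
  by have := onsq_neq c l z w zl wl; rewrite subr_eq0.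
rewrite (sqint_ext c l l0 _ (fun w => (w - z)^-1 *: F w + (w - z)^-1 *: - F z)); last first.
  by move=> w _; rewrite scalerDr.
rewrite sqintD// (sqint_scal Vc c l l0 (fun w => (w - z)^-1))//.
by rewrite -/(c0 c l z) c0_const// scalerN => /subr0_eq.
Qed.

(** A primitive [P] of [F] on a square is given by its boundary values against 1/(w - z), since its
    derivative [F] is holomorphic. Differentiating the kernel once, twice and three times gives [F],
    [f] and a derivative of [f]. *)
Lemma holo_derivative U F f : copen U -> (forall z, U z -> cder F z (f z)) -> holo U f.
Proof.
move=> oU dF c Uc; have [d d0 Hd] := oU _ Uc.
pose l := d / 4; have l0 : 0 < l by rewrite divr_gt0.
pose W := [set z | sn (z - c) < 2 * l].
have oW : copen W := sn_open c (2 * l).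
have cW : cconvex W := sn_convex c (2 * l).
have WU z : W z -> U z.
  move=> Wz; apply: Hd; apply: le_lt_trans (nr_le_sn _) _.
  by move: Wz; rewrite /W /l /=; lra.
have hF : holo W F by move=> z /WU/dF; exists (f z).
have cc : sn (c - c) < l by rewrite subrr /sn /= !normr0 maxxx.
have Wc : W c by rewrite /W /=; lra.
pose P z := L F c z.
have dP z : W z -> cder P z (F z).
  by move=> Wz; apply: (primitive Vc W) => //; exact: cW.
have QW x : sn (x - c) <= l -> W x by rewrite /W /=; lra.
have cP w : onsq c l w -> ccont P w.
  by move=> wl; apply: cder_cont (dP _ _); apply: QW; rewrite wl.
pose g0 := c0 c l c; have g00 : g0 != 0 by exact: c0_center_neq0.
pose N k z := sqint (fun w => (w - z)^-1 ^+ k *: P w) c l.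
have dN k z : sn (z - c) < l -> cder (N k) z (k%:R *: N k.+1 z).
  move=> zl; have := sqint_kernel Vc c l l0 P z k cP zl.
  move=> H; apply: (cder_ext _ _ _ _ _ (fun=> erefl) _ H); rewrite /N.
  have cm (w : C) : onsq c l w -> ccont (fun w => (w - z)^-1 ^+ k.+1 *: P w) w.
    by move=> wl; apply: (ccontZ (fun w => (w - z)^-1 ^+ k.+1)); [exact: ccont_inv wl|exact: cP].
  rewrite (sqint_ext c l l0 _ (fun w => k%:R *: ((w - z)^-1 ^+ k.+1 *: P w))); last first.
    by move=> w _; rewrite scalerA.
  by rewrite /sqint !LZ; try (by []); try (by apply: cont_onsq); rewrite !scalerDr.
pose I := [set z | sn (z - c) < l].
have oI : copen I := sn_open c l.
have E1 z : I z -> P z = g0^-1 *: N 1%N z.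
  move=> Iz; have := cauchy_formula_prim W P F c l z oW cW l0 QW Iz dP hF.
  rewrite /N -/g0 (sqint_ext c l l0 _ (fun w => (w - z)^-1 ^+ 1 *: P w)).
    by move=> ->; rewrite scalerA mulVf// scale1r.
  by move=> w _; rewrite expr1.
have IW z : I z -> W z by move=> Iz; apply: QW; exact: ltW.
have E2 z : I z -> F z = g0^-1 *: N 2 z.
  move=> Iz; apply: (cder_uniq P z); first by apply: dP; exact: IW.
  apply: (cder_near I (fun z => g0^-1 *: N 1%N z)) => //; first by move=> w /E1.
  by apply: cderZc; rewrite -[N 2 z]scale1r; exact: dN.
have E3 z : I z -> f z = g0^-1 *: (2 *: N 3 z).
  move=> Iz; apply: (cder_uniq F z); first by apply: dF; apply: WU; exact: IW.
  apply: (cder_near I (fun z => g0^-1 *: N 2 z)) => //; first by move=> w /E2.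
  by apply: cderZc; exact: dN.
exists (g0^-1 *: (2 *: (3 *: N 4 c))).
apply: (cder_near I (fun z => g0^-1 *: (2 *: N 3 z))) => //; first by move=> w /E3.
by apply: cderZc; apply: cderZc; exact: dN.
Qed.

Lemma holo_choose U F : holo U F -> exists f : C -> V, forall z, U z -> cder F z (f z).
Proof.
move=> hF; have [z|f Hf] := @choice C V (fun z l => U z -> cder F z l).
  have [/hF[l Hl]|nU] := pselect (U z); first by exists l.
  by exists 0.
by exists f.
Qed.

Lemma cauchy_formula U F c l z : copen U -> cconvex U -> 0 < l ->
  (forall x, sn (x - c) <= l -> U x) -> sn (z - c) < l -> holo U F ->
  sqint (fun w => (w - z)^-1 *: F w) c l = c0 c l c *: F z.
Proof.
move=> oU cU l0 QU zl hF; have [f df] := holo_choose U F hF.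
by apply: (cauchy_formula_prim U F f) => //; exact: holo_derivative df.
Qed.

(** The singularity at [w] is removable: the quotient takes the value F'(w) there and has derivative
    F''(w)/2, by a Taylor estimate from the mean value inequality. The identity is stated for every
    [z], in [U] or not, so that iterated factorizations carry no membership conditions. *)
Lemma divided_difference U F w : copen U -> U w -> holo U F ->
  exists2 G, holo U G & forall z, F z = F w + (z - w) *: G z.
Proof.
move=> oU Uw hF; have [f df] := holo_choose U F hF.
have [l' dl] := holo_derivative U F f oU df w Uw.
pose G z := if z == w then f w else (z - w)^-1 *: (F z - F w).
exists G; last first.
  move=> z; rewrite /G; case: eqVneq => [->|zw]; first by rewrite subrr scale0r addr0.
  by rewrite scalerA mulfV ?subr_eq0// scale1r addrC subrK.
move=> z Uz; have [->|zw] := eqVneq z w; last first.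
  have zw0 : 0 < nr (z - w) by rewrite nr_gt0 subr_eq0.
  pose U' := [set x | U x /\ x != w].
  have oU' : copen U'.
    move=> x [Ux xw]; have [d d0 Hd] := oU _ Ux.
    have xw0 : 0 < nr (x - w) by rewrite nr_gt0 subr_eq0.
    exists (Num.min d (nr (x - w))); first by rewrite lt_min d0.
    move=> y; rewrite lt_min => /andP[/Hd Uy yx]; split => //.
    by apply/eqP => yw; move: yx; rewrite yw nrC ltxx.
  exists (- 1 / (z - w) ^+ 2 *: (F z - F w) + (z - w)^-1 *: (f z - 0)).
  apply: (cder_near U' (fun z => (z - w)^-1 *: (F z - F w))) => //.
    by move=> x [_ xw]; rewrite /G (negPf xw).
  apply: (cderZ (fun z => (z - w)^-1)).
    by apply: (cderV (fun z => z - w)); [exact: cder_subc|rewrite subr_eq0].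
  by apply: cderB; [exact: df|exact: cder_cst].
exists (2^-1 *: l') => e e0.
have [d d0 Hd] := dl _ e0; have [d' d0' Hd'] := copen_seg U w oU Uw.
exists (Num.min d d'); first by rewrite lt_min d0.
move=> h; rewrite lt_min => /andP[hd hd'].
have [->|h0] := eqVneq h 0.
  by rewrite addr0 subrr scale0r subr0 nr0 mulr_ge0 ?nr_ge0// ltW.
have hw : w + h != w by rewrite -subr_eq0 addKl.
rewrite /G eqxx (negPf hw) addKl.
have nh : 0 < nr h by rewrite nr_gt0.
have -> : h^-1 *: (F (w + h) - F w) - f w - h *: (2^-1 *: l') =
   h^-1 *: (F (w + h) - F w - h *: f w - (h ^+ 2 * 2^-1) *: l').
  have Ef : f w = h^-1 *: (h *: f w) by rewrite scalerA mulVf// scale1r.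
  have El : h *: (2^-1 *: l') = h^-1 *: ((h ^+ 2 * 2^-1) *: l').
    by rewrite !scalerA expr2 -mulrA mulKf.
  by rewrite El {1}Ef; move: (h ^+ 2 * _) (h^-1) => a b; vec.
rewrite nrZ nrV [_^-1 * _]mulrC ler_pdivrMr//.
rewrite (_ : e * nr h * nr h = e * nr h ^+ 2); last by ring.
have := mean_value 0 1 (e * nr h ^+ 2)
   (fun t => F (seg w (w + h) t) - t%:C *: (h *: f w) - (t%:C ^+ 2 * (h ^+ 2 * 2^-1)) *: l') ler01.
rewrite seg1 seg0 !scale1r !scale0r expr1n expr0n mul1r mul0r scale0r !subr0 mulr1.
rewrite (_ : _ - F w = F (w + h) - F w - h *: f w - (h ^+ 2 * 2^-1) *: l'); last by vec.
apply => t t01; have Ut := Hd' h hd' t t01.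
exists (h *: (f (seg w (w + h) t) - f w - (t%:C * h) *: l')); last first.
  have [t0 t1] := andP t01.
  have th : nr (t%:C * h) <= nr h by rewrite nrM nrR ger0_norm// ler_piMl// ltW.
  have := Hd (t%:C * h) (le_lt_trans th hd); rewrite -seg_add nrZ => h1.
  rewrite expr2 mulrCA ler_wpM2l ?(ltW nh)//; apply: le_trans h1 _.
  by rewrite ler_wpM2l// (ltW e0).
have D1 := cder_seg F w (w + h) t _ (df _ Ut).
rewrite addKl in D1.
move=> e' e0'; have e2 : 0 < e' / 2 by lra.
have [d1 d10 Hd1] := D1 _ e2.
pose K := nr (h ^+ 2 * 2^-1) * nr l' + 1.
have K0 : 0 < K.
  have k1 : 0 <= nr (h ^+ 2 * 2^-1) * nr l' by rewrite mulr_ge0 ?nr_ge0.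
  by rewrite /K; lra.
exists (Num.min d1 (e' / 2 / K)); first by rewrite lt_min d10 divr_gt0.
move=> s; rewrite lt_min => /andP[/Hd1 h1]; rewrite ltr_pdivlMr// => h2.
rewrite (_ : _ - _ - _ = (F (seg w (w + h) (t + s)) - F (seg w (w + h) t) - s%:C *: (h *: f (seg w (w + h) t)))
    + (- (s%:C ^+ 2 * (h ^+ 2 * 2^-1))) *: l'); last first.
  rewrite rmorphD /=.
  move: (F _) (F _) (f (seg _ _ _)) => a b ft.
  rewrite [h *: (ft - _ - _)](_ : _ = h *: ft - h *: f w - (2 * t%:C * (h ^+ 2 * 2^-1)) *: l').
    by move: (h ^+ 2 * 2^-1) => q; vec.
  by rewrite !scalerBr scalerA; congr (_ - _ *: _); field.
apply: le_trans (nrD _ _) _; rewrite nrZ nrN nrM nrX nrR.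
have s0 := normr_ge0 s.
have : `|s| ^+ 2 * nr (h ^+ 2 * 2^-1) * nr l' <= `|s| * (`|s| * K).
  rewrite (_ : _ * nr l' = `|s| * (`|s| * (nr (h ^+ 2 * 2^-1) * nr l'))).
    by rewrite ler_wpM2l// ler_wpM2l// /K lerDl.
  by move: (nr (h ^+ 2 * 2^-1)) => q; ring.
have : `|s| * (`|s| * K) <= `|s| * (e' / 2) by rewrite ler_wpM2l// ltW.
lra.
Qed.

End Formula.
End CauchyFormula.

(** * Maximum principle, complex exponential and logarithmic derivatives *)

Section MaxPrinciple.
Context {R : realType}.
Notation C := R[i].
Notation Co := (R[i]^o).

(** By Bernoulli's inequality. It discards the constant [K]: for Cauchy's formula applied to powers
    of a function, and for the factorial in the crude bound of the determinant of a power. *)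
Lemma pow_trick (a M K : R) : 0 <= a -> 0 <= M -> (forall n, a ^+ n <= K * M ^+ n) -> a <= M.
Proof.
move=> a0 M0 aM; rewrite leNgt; apply/negP => Ma.
have K0 : 0 < K by have := aM 0%N; rewrite !expr0 mulr1; lra.
have [M0'|Mp] := eqVneq M 0.
  by have := aM 1%N; rewrite !expr1 M0' mulr0; lra.
have {Mp}Mp : 0 < M by rewrite lt_def Mp.
have bern n : M ^+ n * (1 + n%:R * ((a - M) / M)) <= a ^+ n.
  elim: n => [|n IH]; first by rewrite !expr0 mul0r addr0 mulr1.
  rewrite !exprS; apply: le_trans (ler_wpM2l a0 IH).
  rewrite [X in _ <= X]mulrCA -mulrA (mulrC M) -!mulrA ler_wpM2l ?exprn_ge0//.
  set t := (a - M) / M; have t0 : 0 <= t by rewrite divr_ge0//; lra.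
  have -> : a = M * (1 + t) by rewrite /t mulrDr mulr1 mulrC divfK ?gt_eqF//; ring.
  rewrite -natr1 mulrC -mulrA ler_wpM2l//.
  have := mulr_ge0 (ler0n R n) (mulr_ge0 t0 t0); nra.
pose t := (a - M) / M; have t0 : 0 < t by rewrite divr_gt0//; lra.
have [n Hn] : exists n : nat, K / t < n%:R.
  by exists (Num.truncn (K / t)).+1; rewrite truncnS_gt.
have := le_trans (bern n) (aM n); rewrite mulrC ler_pM2r ?exprn_gt0//.
move: Hn; rewrite ltr_pdivrMr//= -/t; lra.
Qed.

(** Cauchy's formula for F^n bounds |F z|^n by a constant times M^n, with a constant that depends on
    the distance of [z] to the boundary but not on n. *)
Lemma max_principle (F : C -> Co) c l L' M z : 0 < l -> l < L' ->
  holo [set z | sn (z - c) < L'] F -> (forall w, onsq c l w -> nr (F w) <= M) ->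
  sn (z - c) < l -> nr (F z) <= M.
Proof.
move=> l0 lL hF FM zl; set U := [set z | _] in hF.
have oU : copen U := sn_open c L'; have cU : cconvex U := sn_convex c L'.
have QU x : sn (x - c) <= l -> U x by move=> h; apply: le_lt_trans lL.
have onU w : onsq c l w -> U w by move=> h; apply: QU; rewrite h.
have M0 : 0 <= M.
  have h01 : 0 <= (0 : R) <= 1 by rewrite lexx ler01.
  exact: le_trans (nr_ge0 _) (FM _ (onsq_side c l l0 0 0 h01)).
pose d := l - sn (z - c); have d0 : 0 < d by rewrite subr_gt0.
have g0 : 0 < nr (c0 c l c) by rewrite nr_gt0 c0_center_neq0.
apply: (pow_trick _ _ (8 * l / d / nr (c0 c l c))) => [||n]; rewrite ?nr_ge0//.
have hFn : holo U (fun w => (F w ^+ n : Co)).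
  move=> w /hF[F' dF]; exists (n%:R * F w ^+ n.-1 * F'); exact: cderX.
have := cauchy_formula Co_complete U _ c l z oU cU l0 QU zl hFn.
move=> /(congr1 nr); rewrite nrZ nrX => E.
rewrite mulrAC ler_pdivlMr// mulrC -E.
have -> : 8 * l / d * M ^+ n = (d^-1 * M ^+ n) * (8 * l) by ring.
apply: (sqint_le Co_complete) => // w wl.
  apply: (ccontZ (fun w => (w - z)^-1) (fun w => (F w ^+ n : Co))).
    by have := ccont_inv c l z 1 w zl wl; exact.
  by apply: (holo_cont U) => //; exact: onU.
rewrite nrZ nrV nrX; apply: ler_pM; rewrite ?invr_ge0 ?exprn_ge0 ?nr_ge0//.
  have dw : d <= nr (w - z) by exact: nr_ge_dist.
  by rewrite lef_pV2 ?posrE//; exact: lt_le_trans dw.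
by rewrite lerXn2r ?nnegrE ?nr_ge0// FM.
Qed.

Lemma derive_eps (f : R -> R) (x df : R) : is_derive x 1 f df -> forall e : R, 0 < e ->
  exists2 d : R, 0 < d & forall h : R, `|h| < d -> `|f (x + h) - f x - h * df| <= e * `|h|.
Proof.
move=> fd e e0; have [fx fD] := fd.
have : h^-1 *: ((f \o shift x) (h *: 1) - f x) @[h --> 0^'] --> df.
  by rewrite -fD; exact: fx.
move/cvgrPdist_lt => /(_ _ e0); rewrite /dnbhs /= near_withinE.
move=> /nbhs_ballP[d /= d0 Hd]; exists d => // h hd.
have [->|h0] := eqVneq h 0; first by rewrite addr0 subrr mul0r subr0 normr0 mulr0.
have := Hd h; rewrite /ball /= sub0r normrN => /(_ hd h0) /ltW.
rewrite -(ler_pM2r (_ : 0 < `|h|)) ?normr_gt0// -normrM mulrBl.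
rewrite /GRing.scale /= mulr1 (addrC h) mulrAC mulVf// mul1r distrC mulrC.
by [].
Qed.

Definition cexp (z : C) : C := (expR (complex.Re z))%:C * (cos (complex.Im z) +i* sin (complex.Im z)).

Lemma cexp0 : cexp 0 = 1.
Proof. by rewrite /cexp /= expR0 cos0 sin0 mul1r. Qed.

Lemma cexpD z w : cexp (z + w) = cexp z * cexp w.
Proof.
rewrite /cexp cReD cImD expRD cosD sinD; apply: complexP; rewrite !ReImE /=; ring.
Qed.

Lemma nr_cexp z : nr (cexp z) = expR (complex.Re z).
Proof.
rewrite /cexp nrM nrR ger0_norm ?expR_ge0// [X in _ * X](_ : _ = 1) ?mulr1//.
apply/eqP; rewrite -(@eqrXn2 _ 2) ?nr_ge0// nr_sqr /= cos2Dsin2 expr1n//.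
Qed.

Lemma cexp_neq0 z : cexp z != 0.
Proof. by rewrite -nr_gt0 nr_cexp expR_gt0. Qed.

Lemma cexpN z : cexp (- z) = (cexp z)^-1.
Proof. by apply: (mulfI (cexp_neq0 z)); rewrite -cexpD subrr cexp0 mulfV// cexp_neq0. Qed.

Lemma cder_cexp z : cder (fun z => (cexp z : Co)) z (cexp z).
Proof.
have at0 (e : R) : 0 < e -> exists2 d : R, 0 < d &
    forall h : C, nr h < d -> nr (cexp h - 1 - h) <= e * nr h.
  move=> e0; pose k := Num.min (e / 8) 1.
  have k0 : 0 < k by rewrite lt_min divr_gt0//= ltr01.
  have ke : k <= e / 8 by rewrite ge_min lexx.
  have k1 : k <= 1 by rewrite ge_min lexx orbT.
  move: k k0 ke k1 => k k0 ke k1.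
  have [d1 d10 Hd1] := derive_eps expR 0 _ (is_derive_expR 0) _ k0.
  have [d2 d20 Hd2] := derive_eps cos 0 _ (is_derive_cos 0) _ k0.
  have [d3 d30 Hd3] := derive_eps sin 0 _ (is_derive_sin 0) _ k0.
  exists (Num.min (k / 2) (Num.min d1 (Num.min d2 d3))).
    by rewrite !lt_min d10 d20 d30 divr_gt0.
  case=> a b; rewrite !lt_min => /andP[hk /andP[h1 /andP[h2 h3]]].
  have la := Re_le_nr (a +i* b); have lb := Im_le_nr (a +i* b); rewrite /= in la lb.
  have {Hd1}E1 := Hd1 a (le_lt_trans la h1); have {Hd2}E2 := Hd2 b (le_lt_trans lb h2).
  have {Hd3}E3 := Hd3 b (le_lt_trans lb h3).
  rewrite !add0r expR0 mulr1 in E1; rewrite !add0r cos0 sin0 oppr0 mulr0 subr0 in E2.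
  rewrite !add0r cos0 sin0 subr0 mulr1 in E3.
  apply: le_trans (ReIm_ge_nr _) _; rewrite /cexp !ReImE /=.
  set N := nr _ in hk h1 h2 h3 la lb *.
  rewrite (_ : _ + _ - a = (expR a - 1 - a) + (cos b - 1) + (expR a - 1) * (cos b - 1)); last by ring.
  rewrite (_ : _ + _ - b = (sin b - b) + (expR a - 1) * sin b); last by ring.
  have ea : `|expR a - 1| <= 2 * N.
    have := ler_normD (expR a - 1 - a) a; rewrite subrK.
    by have := ler_wpM2r (normr_ge0 a) k1; lra.
  have sb : `|sin b| <= 2 * N.
    have := ler_normD (sin b - b) b; rewrite subrK.
    by have := ler_wpM2r (normr_ge0 b) k1; lra.
  have N0 : 0 <= N := nr_ge0 _.
  have t1 : `|expR a - 1 - a| <= k * N by apply: le_trans E1 _; rewrite ler_wpM2l// ltW.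
  have t2 : `|cos b - 1| <= k * N by apply: le_trans E2 _; rewrite ler_wpM2l// ltW.
  have t3 : `|sin b - b| <= k * N by apply: le_trans E3 _; rewrite ler_wpM2l// ltW.
  have t4 : `|(expR a - 1) * (cos b - 1)| <= k * N.
    have ea1 : `|expR a - 1| <= 1 by lra.
    by rewrite normrM -[leRHS]mul1r; apply: ler_pM.
  have t5 : `|(expR a - 1) * sin b| <= 2 * k * N.
    rewrite normrM; have := ler_pM (normr_ge0 _) (normr_ge0 _) ea sb.
    by have := ler_wpM2l N0 (ltW hk); lra.
  have kN : k * N <= e / 8 * N by rewrite ler_wpM2r.
  apply: le_trans (lerD (ler_normD _ _) (ler_normD _ _)) _.
  have := ler_normD (expR a - 1 - a) (cos b - 1).
  have := mulr_ge0 (ltW e0) N0; lra.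
move=> e e0; have [d d0 Hd] := at0 _ (divr_gt0 e0 (expR_gt0 (complex.Re z))).
exists d => // h /Hd h1; rewrite cexpD.
rewrite (_ : _ - _ - _ = cexp z * (cexp h - 1 - h)); last first.
  by rewrite /GRing.scale /=; ring.
rewrite nrM nr_cexp; apply: le_trans (ler_wpM2l (expR_ge0 _) h1) _.
by rewrite mulrA mulrCA divff ?mulr1// gt_eqF// expR_gt0.
Qed.

Lemma cder_comp_cexp (g : C -> Co) z g' : cder g z g' ->
  cder (fun z => (cexp (g z) : Co)) z (cexp (g z) * g').
Proof.
move=> dg e e0; have cg := cder_cont _ _ _ dg.
have n1 := nr_ge0 g'; have n2 := nr_ge0 (cexp (g z)).
pose K := nr g' + nr (cexp (g z)) + 2; have K0 : 0 < K by rewrite /K; lra.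
have k0 : 0 < Num.min (e / K) 1 by rewrite lt_min divr_gt0//= ltr01.
set k := Num.min _ _ in k0; have ke : k <= e / K by rewrite ge_min lexx.
have k1 : k <= 1 by rewrite ge_min lexx orbT.
have [d1 d10 Hd1] := cder_cexp (g z) _ k0.
have [d2 d20 Hd2] := dg _ k0.
have [d3 d30 Hd3] := cg _ (divr_gt0 d10 (ltr0n R 2)).
exists (Num.min d2 d3); first by rewrite lt_min d20.
move=> h; rewrite lt_min => /andP[/Hd2 h2 h3].
have {Hd3 h3}h3 : nr (g (z + h) - g z) <= d1 / 2 by apply: Hd3; rewrite addKl.
have {Hd1}h1 := Hd1 (g (z + h) - g z); rewrite (addrC (g z)) subrK in h1.
have {}h1 := h1 (le_lt_trans h3 (_ : d1 / 2 < d1)).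
have {}h1 := h1 ltac:(lra).
have nh := nr_ge0 h.
have G : nr (g (z + h) - g z) <= (1 + nr g') * nr h.
  have := nrD (g (z + h) - g z - h *: g') (h *: g'); rewrite subrK nrZ.
  by have := ler_wpM2r nh k1; lra.
set x := g (z + h) - g z in h1 h2 G.
rewrite (_ : _ - _ - _ = (cexp (g (z + h)) - cexp (g z) - x * cexp (g z)) + cexp (g z) * (x - h *: g')); last first.
  by rewrite /GRing.scale /=; ring.
apply: le_trans (nrD _ _) _; rewrite nrM.
have s1 : nr (cexp (g (z + h)) - cexp (g z) - x * cexp (g z)) <= k * ((1 + nr g') * nr h).
  by apply: le_trans h1 _; rewrite ler_wpM2l// ltW.
have s2 : nr (cexp (g z)) * nr (x - h *: g') <= nr (cexp (g z)) * (k * nr h) by rewrite ler_wpM2l.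
have : k * K <= e by rewrite -ler_pdivlMr.
move/(ler_wpM2r nh); rewrite /K; have := mulr_ge0 (ltW k0) nh; lra.
Qed.

Lemma cder0_const {V : normedModType C} (U : set C) (f : C -> V) p q :
  segment_in U p q -> (forall z, U z -> cder f z 0) -> f q = f p.
Proof.
move=> sU df; apply/subr0_eq/nr_small => e e0.
have := mean_value 0 1 0 (fun t => f (seg p q t)) ler01.
rewrite mul0r seg0 seg1 => h; apply: le_trans (h _) (ltW e0) => t t01.
exists ((q - p) *: 0); last by rewrite scaler0 nr0.
by apply: cder_seg; apply: df; exact: sU.
Qed.

(** No branch of the logarithm of [v] is ever chosen: the increment of log v from p to q is the line
    integral of [logd v v'], related to [v] by [exp_increment]. *)
Definition logd (v v' : C -> Co) : C -> Co := fun z => v' z / v z.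

Lemma logd_holo (U : set C) (v v' : C -> Co) : copen U ->
  (forall z, U z -> cder v z (v' z)) -> (forall z, U z -> v z != 0) -> holo U (logd v v').
Proof.
move=> oU dv v0 z Uz; have [v2 dv2] := holo_derivative Co_complete U v v' oU dv z Uz.
exists (v2 * (v z)^-1 + v' z * (- (v' z) / v z ^+ 2)).
by apply: cderM => //; apply: cderV; [exact: dv|exact: v0].
Qed.

Lemma exp_increment (U : set C) (v v' : C -> Co) p q : copen U -> cconvex U -> U p -> U q ->
  (forall z, U z -> cder v z (v' z)) -> (forall z, U z -> v z != 0) ->
  v q = v p * cexp (L (logd v v') p q).
Proof.
move=> oU cU Up Uq dv v0.
pose psi z := L (logd v v') p z.
have dpsi z : U z -> cder psi z (logd v v' z).
  move=> Uz; apply: (primitive Co_complete U) => //; last exact: cU.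
  exact: logd_holo.
have d0 z : U z -> cder (fun z => (v z * cexp (- psi z) : Co)) z 0.
  move=> Uz; have := cderM _ _ _ _ _ (dv _ Uz) (cder_comp_cexp _ _ _ (cderN _ _ _ (dpsi _ Uz))).
  apply: cder_ext => //; rewrite /logd.
  by rewrite mulrN mulrCA mulrA mulrA mulrN -mulrA (mulrC (cexp _)) -/(_ / _) mulrCA mulrA; field; rewrite v0.
have := cder0_const U _ p q (cU _ _ Up Uq) d0.
rewrite /psi (_ : L _ p p = 0); last by rewrite /L subrr scale0r.
rewrite oppr0 cexp0 mulr1 cexpN => <-.
by rewrite divfK// cexp_neq0.
Qed.

End MaxPrinciple.

Section LogIncrements.
Context {R : realType}.
Notation C := R[i].
Notation Co := (R[i]^o).

Lemma cexp_eq1 (z : C) : cexp z = 1 ->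
  [/\ complex.Re z = 0, cos (complex.Im z) = 1 & sin (complex.Im z) = 0].
Proof.
move=> z1; have := nr_cexp z; rewrite z1 nr1 => /esym/eqP.
rewrite -expR0 (inj_eq (@expR_inj R)) => /eqP Re0.
have := z1; rewrite /cexp Re0 expR0 mul1r => -[-> ->].
by [].
Qed.

Lemma sin_eq0_2pi (t : R) : sin t = 0 -> 0 < t < 2 * pi -> t = pi.
Proof.
move=> st /andP[t0 t2]; case: (ltgtP t pi) => // tpi.
  by have := sin_gt0_pi (x := t); rewrite st ltxx t0 tpi => /(_ isT).
have := sin_gt0_pi (x := t - pi); rewrite sinB cospi sinpi st mulr0 subr0 mul0r ltxx.
by move=> /(_ _)/= h; have := h ltac:(by apply/andP; split; lra).
Qed.

(** Identifies the total change of argument around a point once it is known to lie strictly between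
    0 and 4 pi. *)
Lemma cos_eq1_4pi (t : R) : cos t = 1 -> 0 < t < 4 * pi -> t = 2 * pi.
Proof.
move=> ct t4; have E : t = t / 2 + t / 2 by lra.
have s0 : sin (t / 2) = 0.
  have := cos2Dsin2 (t / 2); move: ct; rewrite {1}E cosD -!expr2 => h1 h2.
  by apply/eqP; rewrite -sqrf_eq0; apply/eqP; lra.
by have := sin_eq0_2pi _ s0; have := t4; lra.
Qed.

(** An intermediate value theorem: the side of [x] on which the imaginary part lies is locally
    constant, and Cousin's lemma transports it. *)
Lemma avoid_value (u : R -> Co) (x : R) :
  (forall t, 0 <= t <= 1 -> rcont u t) -> (forall t, 0 <= t <= 1 -> complex.Im (u t) != x) ->
  (complex.Im (u 0) < x <-> complex.Im (u 1) < x).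
Proof.
move=> uc ux.
apply: (cousin 0 1 (fun a b => complex.Im (u a) < x <-> complex.Im (u b) < x)) => //.
  by move=> a b c _ _ _ _ h1 h2; apply: iff_trans h1 h2.
move=> t t01; have := ux t t01; rewrite neq_lt => /orP[utx|utx].
  have e0 : 0 < (x - complex.Im (u t)) / 2 by rewrite divr_gt0// subr_gt0.
  have [d d0 Hd] := uc t t01 _ e0; exists d => // a b _ at_ tb _ h1 h2.
  have K s : `|s - t| < d -> complex.Im (u s) < x.
    move=> /Hd; have := Im_le_nr (u s - u t); rewrite cImD cImN ler_norml; lra.
  by rewrite !K// ltr_norml; lra.
have e0 : 0 < (complex.Im (u t) - x) / 2 by rewrite divr_gt0// subr_gt0.
have [d d0 Hd] := uc t t01 _ e0; exists d => // a b _ at_ tb _ h1 h2.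
have K s : `|s - t| < d -> (complex.Im (u s) < x) = false.
  move=> /Hd h; apply/negbTE; rewrite -leNgt.
  by move: h; have := Im_le_nr (u s - u t); rewrite cImD cImN ler_norml; lra.
by rewrite !K// ltr_norml; lra.
Qed.

Definition linv (w : C) : C -> Co := fun z => (z - w)^-1.

Lemma linv_logd w : linv w = logd (fun z => z - w) (fun=> 1).
Proof. by apply/funext => z; rewrite /logd mul1r. Qed.

Lemma linv_exp (U : set C) w p q : copen U -> cconvex U -> U p -> U q ->
  ~ U w -> q - w = (p - w) * cexp (L (linv w) p q).
Proof.
move=> oU cU Up Uq nUw; rewrite linv_logd.
apply: (exp_increment U (fun z => z - w) (fun=> 1)) => //.
  by move=> z _; exact: cder_subc.
by move=> z Uz; rewrite subr_eq0; apply/eqP => zw; apply: nUw; rewrite -zw.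
Qed.

Definition halfplane (u w : C) : set C := [set z | 0 < complex.Re (u * (z - w))].

Lemma halfplane_open u w : copen (halfplane u w).
Proof.
move=> z /= zu; have k0 : 0 < nr u + 1 by have := nr_ge0 u; lra.
exists (complex.Re (u * (z - w)) / (nr u + 1)); first by rewrite divr_gt0.
move=> x; rewrite ltr_pdivlMr// => h; rewrite /halfplane /=.
have -> : u * (x - w) = u * (z - w) + u * (x - z) by ring.
rewrite cReD; have := Re_le_nr (u * (x - z)); rewrite nrM ler_norml.
have := nr_ge0 (x - z); have := nr_ge0 u; move: h; nra.
Qed.

Lemma halfplane_convex u w : cconvex (halfplane u w).
Proof.
move=> p q; rewrite /halfplane /= => hp hq t t01 /=.
have -> : u * (seg p q t - w) = u * (p - w) + t%:C * (u * (q - w) - u * (p - w)).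
  by rewrite /seg; ring.
move: (u * (p - w)) (u * (q - w)) hp hq => a b a0 b0.
rewrite !ReImE /= mul0r subr0.
have := conv_lt (- complex.Re a) (- complex.Re b) 0 t t01.
by rewrite !oppr_lt0 => /(_ a0 b0); lra.
Qed.

Lemma halfplane_center u w : ~ halfplane u w w.
Proof. by rewrite /halfplane /= subrr mulr0 ltxx. Qed.

Lemma linv_cont (U : set C) w p q : cconvex U -> U p -> U q -> ~ U w -> cont_seg (linv w) p q.
Proof.
move=> cU Up Uq nw t t01; apply: cder_cont; apply: (cderV (fun z => z - w)).
  exact: cder_subc.
by rewrite subr_eq0; apply/eqP => h; apply: nw; rewrite -h; apply: cU.
Qed.

Lemma linv_prim (U : set C) w p z : copen U -> cconvex U -> U p -> U z -> ~ U w ->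
  cder (fun z => L (linv w) p z) z (linv w z).
Proof.
move=> oU cU Up Uz nw; apply: (primitive Co_complete U) => //; last exact: cU.
move=> x Ux; eexists; apply: (cderV (fun z => z - w)); first exact: cder_subc.
by rewrite subr_eq0; apply/eqP => h; apply: nw; rewrite -h.
Qed.

(* The argument cannot reach +-pi inside a half plane, where no two points are
   opposite with respect to w. *)
Lemma linv_arg u w p q : halfplane u w p -> halfplane u w q ->
  - pi < complex.Im (L (linv w) p q) < pi.
Proof.
move=> Up Uq; set U := halfplane u w in Up Uq.
have oU : copen U := halfplane_open u w; have cU : cconvex U := halfplane_convex u w.
have nU : ~ U w := @halfplane_center u w.
pose v t := L (linv w) p (seg p q t).
have v0 : v 0 = 0 by rewrite /v seg0 /L subrr scale0r.
have v1 : v 1 = L (linv w) p q by rewrite /v seg1.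
have vc t : 0 <= t <= 1 -> rcont v t.
  move=> t01; have Ut := cU _ _ Up Uq t t01.
  exact: rder_cont (cder_seg _ _ _ _ _ (linv_prim U w p _ oU cU Up Ut nU)).
have vs (s t : R) : (s = pi) \/ (s = - pi) -> 0 <= t <= 1 -> complex.Im (v t) != s.
  move=> hs t01; apply/eqP => E; have Ut := cU _ _ Up Uq t t01.
  have := linv_exp U w p _ oU cU Up Ut nU; rewrite -/(v t) => E2.
  have Ev : cexp (v t) = - (expR (complex.Re (v t)))%:C.
    rewrite /cexp E; case: hs => ->; apply: complexP;
      by rewrite ?cosN ?sinN cospi sinpi !ReImE /=; ring.
  move: Ut Up; rewrite /U /halfplane /= E2 Ev.
  rewrite (_ : u * _ = - (expR (complex.Re (v t)))%:C * (u * (p - w))); last by ring.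
  have := expR_gt0 (complex.Re (v t)); move: (u * (p - w)) (expR _) => x r r0.
  rewrite !ReImE /= oppr0 mul0r subr0 => h1 h2.
  by have := mulr_gt0 r0 h2; lra.
have := avoid_value v pi vc (fun t => vs pi t (or_introl erefl)).
have := avoid_value v (- pi) vc (fun t => vs (- pi) t (or_intror erefl)).
rewrite v0 v1 /= => h1 h2; have pi0 := pi_gt0 R.
apply/andP; split; last by apply/h2.
rewrite lt_def; apply/andP; split.
  by have := vs (- pi) 1 (or_intror erefl); rewrite v1; apply; rewrite ler01 lexx.
by rewrite leNgt; apply/negP => /h1; lra.
Qed.

Lemma linv_arg_pos u w p q : halfplane u w p -> halfplane u w q ->
  0 < complex.Im ((q - w) * ((p - w)^*)%C) -> 0 < complex.Im (L (linv w) p q) < pi.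
Proof.
move=> Up Uq h; have := linv_arg u w p q Up Uq => /andP[h1 h2]; rewrite h2 andbT.
have E := linv_exp _ w p q (halfplane_open u w) (@halfplane_convex u w) Up Uq (@halfplane_center u w).
rewrite ltNge; apply/negP => h3.
move: h; rewrite E /cexp; set th := complex.Im _ in h1 h2 h3 *; set r := expR _.
case: (p - w) => a b /=.
rewrite [X in 0 < X](_ : _ = r * sin th * (a ^+ 2 + b ^+ 2)); last by ring.
have s0 : sin th <= 0.
  rewrite -oppr_ge0 -sinN; apply: sin_ge0_pi.
  by apply/andP; split; lra.
have r0 : 0 < r := expR_gt0 _.
have := mulr_ge0 (ltW r0) (addr_ge0 (sqr_ge0 a) (sqr_ge0 b)).
by move=> h5 h6; have := mulr_ge0_le0 h5 s0; lra.
Qed.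

(** Let psi be the increment of log v from [c], so Re psi <= B. Then g = psi / (2B - psi) has
    modulus at most 1 and vanishes at [c]; Schwarz's lemma, in the form of a divided difference and
    the maximum principle, gives |g| <= |z - c| / l <= 1/2. From psi = 2B g - g psi follows |psi| <=
    2B. *)
Lemma borel_caratheodory (v v' : C -> Co) c (l L' B : R) z : 0 < l -> l < L' -> 0 < B ->
  (forall x, sn (x - c) < L' -> cder v x (v' x)) ->
  (forall x, sn (x - c) < L' -> v x != 0) ->
  (forall x, sn (x - c) < L' -> nr (v x) <= nr (v c) * expR B) ->
  sn (z - c) <= l / 4 -> nr (L (logd v v') c z) <= 2 * B.
Proof.
move=> l0 lL B0 dv v0 vB zl.
pose U := [set x | sn (x - c) < L'].
have oU : copen U := sn_open c L'; have cU : cconvex U := sn_convex c L'.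
have Uc : U c by rewrite /U /= subrr /sn /= !normr0 maxxx; lra.
have hl : holo U (logd v v') by apply: logd_holo.
pose psi x := L (logd v v') c x.
have dpsi x : U x -> cder psi x (logd v v' x).
  by move=> Ux; apply: (primitive Co_complete U) => //; exact: cU.
have RB x : U x -> complex.Re (psi x) <= B.
  move=> Ux; have := vB _ Ux; rewrite (exp_increment U v v' c x oU cU Uc Ux dv v0).
  by rewrite nrM nr_cexp ler_pM2l ?nr_gt0 ?v0// ler_expR.
pose D x : Co := (2 * B)%:C - psi x.
have RD x : U x -> 0 < complex.Re (D x).
  by move=> /RB; rewrite /D; move: (psi x) => y; rewrite !ReImE /=; lra.
have D0 x : U x -> D x != 0.
  by move=> /RD h; apply/eqP => e; move: h; rewrite e /= ltxx.
pose g x : Co := psi x / D x.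
have hg : holo U g.
  move=> x Ux; eexists; apply: cderM; first exact: dpsi.
  apply: (cderV D); last exact: D0.
  exact: cderB (cder_cst _ _) (dpsi _ Ux).
have g1 x : U x -> nr (g x) <= 1.
  move=> Ux; rewrite /g nrM nrV ler_pdivrMr ?nr_gt0 ?D0// mul1r.
  rewrite -ler_sqr ?nnegrE ?nr_ge0// !nr_sqr /D.
  have := RB _ Ux; move: (psi x) => y yB; rewrite !ReImE /=.
  by have := mulr_ge0 (ltW B0) (_ : 0 <= B - complex.Re y); rewrite subr_ge0 => /(_ yB); lra.
have gc : g c = 0 by rewrite /g /psi /L subrr scale0r mul0r.
have [G hG gG] := divided_difference Co_complete U g c oU Uc hg.
have Gle x : sn (x - c) < l -> nr (G x) <= l^-1.
  apply: (max_principle G c l L') => // w wl.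
  have wc : l <= nr (w - c) by rewrite -wl; exact: sn_le_nr.
  have wp : 0 < nr (w - c) by lra.
  have Uw : U w by rewrite /U /= wl.
  have := g1 w Uw; rewrite gG gc add0r nrZ => h.
  apply: (@le_trans _ _ (nr (w - c))^-1); last by rewrite lef_pV2 ?posrE.
  by rewrite -[leRHS]mul1r ler_pdivlMr// mulrC.
have zl' : sn (z - c) < l by lra.
have Uz : U z by rewrite /U /=; lra.
have gz : nr (g z) <= 1 / 2.
  rewrite gG gc add0r nrZ; have := nr_le_sn (z - c) => h1.
  apply: le_trans (ler_pM (nr_ge0 _) (nr_ge0 _) (_ : _ <= l / 2) (Gle _ zl')) _; first lra.
  by rewrite mulrAC divff ?gt_eqF// mul1r.
have E : psi z = (2 * B)%:C * g z - g z * psi z.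
  by rewrite -mulrC -mulrBr /g divfK ?D0.
rewrite -/(psi z); have := nrB ((2 * B)%:C * g z) (g z * psi z); rewrite -E (nrM (2 * B)%:C) (nrM (g z)) nrR ger0_norm; last lra.
have := ler_wpM2r (nr_ge0 (psi z)) gz; have B2 : 0 <= 2 * B by lra.
have := ler_wpM2l B2 gz; lra.
Qed.

End LogIncrements.

(** * Extraction of finitely many zeros *)

Section Factorization.
Context {R : realType}.
Notation C := R[i].
Notation Co := (R[i]^o).
Implicit Types (O : set C) (f h : C -> Co).

Lemma prod_le (ws : seq C) z (a : R) : 0 <= a -> (forall w, w \in ws -> nr (z - w) <= a) ->
  nr (\prod_(w <- ws) (z - w)) <= a ^+ size ws.
Proof.
move=> a0; elim: ws => [|w ws IH] wa; first by rewrite big_nil nr1.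
rewrite big_cons nrM exprS; apply: ler_pM; rewrite ?nr_ge0//.
  by apply: wa; rewrite mem_head.
by apply: IH => x xw; apply: wa; rewrite in_cons xw orbT.
Qed.

Lemma prod_ge (ws : seq C) z (a : R) : 0 <= a -> (forall w, w \in ws -> a <= nr (z - w)) ->
  a ^+ size ws <= nr (\prod_(w <- ws) (z - w)).
Proof.
move=> a0; elim: ws => [|w ws IH] wa; first by rewrite big_nil nr1.
rewrite big_cons nrM exprS; apply: ler_pM; rewrite ?exprn_ge0//.
  by apply: wa; rewrite mem_head.
by apply: IH => x xw; apply: wa; rewrite in_cons xw orbT.
Qed.

(** Jensen's bound without logarithms. A zero in the square of half side [l] is at distance at least
    4l from the boundary of the square of half side 5l, and at most 2l from the centre, so each zero
    gains a factor 2. *)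
Lemma zero_bound O f h c (l L' M : R) ws : copen O -> 0 < l -> 5 * l < L' ->
  (forall z, sn (z - c) < L' -> O z) -> holo O h ->
  (forall w, onsq c (5 * l) w -> nr (f w) <= M) ->
  (forall z, f z = \prod_(w <- ws) (z - w) * h z) ->
  (forall w, w \in ws -> sn (w - c) <= l) ->
  nr (f c) * 2 ^+ size ws <= M.
Proof.
move=> oO l0 lL OL hh fM E wl.
have l5 : 0 < 5 * l by rewrite mulr_gt0.
have hM : nr (h c) <= M / (4 * l) ^+ size ws.
  apply: (max_principle h c (5 * l) L') => //.
  - by move=> z /OL; exact: hh.
  - move=> w wc; rewrite ler_pdivlMr ?exprn_gt0 ?mulr_gt0//.
    apply: le_trans (fM _ wc); rewrite E nrM mulrC ler_wpM2r ?nr_ge0//.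
    apply: prod_ge; first by rewrite mulr_ge0// ltW.
    move=> x /wl xl; apply: le_trans (sn_le_nr _).
    by have := sn_tri x w c; rewrite wc; lra.
  - by rewrite subrr /sn /= !normr0 maxxx.
have fc : nr (f c) <= (2 * l) ^+ size ws * nr (h c).
  rewrite E nrM ler_wpM2r ?nr_ge0//; apply: prod_le; first by rewrite mulr_ge0// ltW.
  by move=> w /wl h1; apply: le_trans (nr_le_sn _) _; rewrite snC; lra.
move: hM; rewrite ler_pdivlMr ?exprn_gt0 ?mulr_gt0// => hM.
apply: le_trans hM; have -> : (4 : R) * l = 2 * l * 2 by ring.
rewrite (exprMn _ (2 * l)) mulrA ler_wpM2r ?exprn_ge0//.
by rewrite mulrC.
Qed.

Lemma factor_step O f w : copen O -> O w -> holo O f -> f w = 0 ->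
  exists2 h : C -> Co, holo O h & forall z, f z = (z - w) * h z.
Proof.
move=> oO Ow hf fw; have [h hh E] := divided_difference Co_complete O f w oO Ow hf.
by exists h => // z; rewrite E fw add0r.
Qed.

Lemma max_nat (P : nat -> Prop) B : P 0%N -> (forall k, P k -> (k <= B)%N) ->
  exists2 k, P k & ~ P k.+1.
Proof.
move=> P0 PB; apply: contrapT => H.
have PS k : P k by elim: k => // k Pk; apply: contrapT => nP; apply: H; exists k.
by have := PB _ (PS B.+1); rewrite ltnn.
Qed.

Lemma holo_bounded_sq O f c l : copen O -> 0 < l -> holo O f ->
  (forall w, onsq c l w -> O w) -> exists M : R, forall w, onsq c l w -> nr (f w) <= M.
Proof.
move=> oO l0 hf Ow.
have fc k : cont_seg f (corner c l k) (corner c l k.+1).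
  by apply: cont_onsq => // w /Ow; exact: holo_cont.
have [M0 M00 H0] := bounded_seg _ _ _ (fc 0%N).
have [M1 M10 H1] := bounded_seg _ _ _ (fc 1%N).
have [M2 M20 H2] := bounded_seg _ _ _ (fc 2%N).
have [M3 M30 H3] := bounded_seg _ _ _ (fc 3%N).
exists (M0 + M1 + M2 + M3) => w wl.
have cov : exists k (t : R), [/\ (k < 4)%N, 0 <= t <= 1 & w = seg (corner c l k) (corner c l k.+1) t].
  have lu : l != 0 by rewrite gt_eqF.
  pose a := complex.Re (w - c) / l; pose b := complex.Im (w - c) / l.
  have wE : w = c + l%:C * (a +i* b).
    by apply: complexP; rewrite /a /b !ReImE /=; field.
  have ab : Num.max `|a| `|b| = 1.
    rewrite /a /b !normrM (ger0_norm (_ : 0 <= l^-1)) ?invr_ge0 ?ltW//.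
    by rewrite -maxr_pMl ?invr_ge0 ?ltW// -/(sn (w - c)) wl divff.
  have la : `|a| <= 1 by rewrite -ab le_max lexx.
  have lb : `|b| <= 1 by rewrite -ab le_max lexx orbT.
  move: la lb; rewrite !ler_norml => /andP[a1 a2] /andP[b1 b2].
  have [k [t [k4 t01 E]]] : exists k (t : R), [/\ (k < 4)%N, 0 <= t <= 1 &
      a +i* b = 'i ^+ k * ((- 1 - 'i) * (1 + t%:C * ('i - 1)))].
    have cs : [\/ b = -1, a = 1, b = 1 | a = -1].
      move: ab; rewrite /Num.max; case: ifP => _ /eqP; rewrite eqr_norml => /andP[/orP[]/eqP] -> _.
      - by apply: Or43.
      - by apply: Or41.
      - by apply: Or42.
      - by apply: Or44.
    case: cs => h.
    - exists 0%N, ((a + 1) / 2); split => //; first lra.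
      by rewrite h; apply: complexP; rewrite expr0 !ReImE /=; field.
    - exists 1%N, ((b + 1) / 2); split => //; first lra.
      by rewrite h; apply: complexP; rewrite expr1 !ReImE /=; field.
    - exists 2%N, ((1 - a) / 2); split => //; first lra.
      by rewrite h; apply: complexP; rewrite sqr_i !ReImE /=; field.
    - exists 3%N, ((1 - b) / 2); split => //; first lra.
      by rewrite h; apply: complexP; rewrite exprS sqr_i !ReImE /=; field.
  by exists k, t; split => //; rewrite wE E /seg /corner exprSr; ring.
have [k [t [k4 t01 ->]]] := cov.
case: k k4 => [_|[_|[_|[_|//]]]].
- by have := H0 t t01; lra.
- by have := H1 t t01; lra.
- by have := H2 t t01; lra.
- by have := H3 t t01; lra.
Qed.

(** Zeros in the small square are split off one by one; [zero_bound] limits their number, so a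
    maximal factorization exists and its cofactor has no zero left there. *)
Lemma factorization O f c (l L' : R) : copen O -> 0 < l -> 5 * l < L' ->
  (forall z, sn (z - c) < L' -> O z) -> holo O f -> f c != 0 ->
  exists (ws : seq C) (h : C -> Co), [/\ holo O h, forall z, f z = \prod_(w <- ws) (z - w) * h z,
    forall w, w \in ws -> sn (w - c) <= l & forall z, sn (z - c) <= l -> h z != 0].
Proof.
move=> oO l0 lL OL hf fc.
have l5 : 0 < 5 * l by rewrite mulr_gt0.
have [M HM] := holo_bounded_sq O f c (5 * l) oO l5 hf (fun w wl => OL w (eq_ind_r (fun x => x < L') lL wl)).
pose P k := exists (ws : seq C) (h : C -> Co), [/\ size ws = k, holo O h, forall z, f z = \prod_(w <- ws) (z - w) * h z
  & forall w, w \in ws -> sn (w - c) <= l].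
have P0 : P 0%N by exists [::], f; split => // z; rewrite big_nil mul1r.
have fc0 : 0 < nr (f c) by rewrite nr_gt0.
have [B HB] : exists B : nat, M / nr (f c) < B%:R.
  by exists (Num.truncn (M / nr (f c))).+1; rewrite truncnS_gt.
have PB k : P k -> (k <= B)%N.
  move=> [ws [h [<- hh E wl]]].
  have := zero_bound O f h c l L' M ws oO l0 lL OL hh HM E wl.
  rewrite mulrC -ler_pdivlMr// => h1.
  have : (2 : R) ^+ size ws < B%:R by exact: le_lt_trans HB.
  rewrite -natrX ltr_nat => /ltnW; apply: leq_trans; exact: (ltnW (ltn_expl _ _)).
have [k [ws [h [sk hh E wl]]] nP] := max_nat P B P0 PB.
exists ws, h; split => // z zl; apply/eqP => hz; apply: nP.
have Oz : O z by apply: OL; lra.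
have [h' hh' E'] := factor_step O h z oO Oz hh hz.
exists (z :: ws), h'; split => //=; first by rewrite sk.
  by move=> x; rewrite big_cons E E'; ring.
by move=> w; rewrite in_cons => /orP[/eqP->//|]; exact: wl.
Qed.

(** Each square is treated with the cofactor of the previous ones. A cofactor divides the earlier
    cofactors, so later steps create no zero in squares already cleared. The factor 6 leaves room
    for the square of 5 times the size in [zero_bound]. *)
Lemma factorization_seq O f (S : seq (C * R)) : copen O -> holo O f ->
  (forall s, s \in S -> [/\ 0 < s.2, forall z, sn (z - s.1) < 6 * s.2 -> O z & f s.1 != 0]) ->
  exists (ws : seq C) (h : C -> Co), [/\ holo O h, forall z, f z = \prod_(w <- ws) (z - w) * h z,
    forall w, w \in ws -> O w &
    forall s z, s \in S -> sn (z - s.1) <= s.2 -> h z != 0].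
Proof.
move=> oO hf; elim: S => [|[c l] S IH] HS.
  by exists [::], f; split => // z; rewrite big_nil mul1r.
have [|ws [h [hh E wO h0]]] := IH; first by move=> s sS; apply: HS; rewrite in_cons sS orbT.
have [/= l0 OL fc] := HS (c, l) (mem_head _ _).
have hc : h c != 0 by move: fc; rewrite E mulf_eq0 negb_or => /andP[].
have l56 : 5 * l < 6 * l by rewrite ltr_pM2r// ltr_nat.
have [ws' [h' [hh' E' wl' h0']]] := factorization O h c l (6 * l) oO l0 l56 OL hh hc.
exists (ws ++ ws'), h'; split => //.
- by move=> z; rewrite big_cat /= E E' mulrA.
- move=> w; rewrite mem_cat => /orP[/wO//|/wl' h1]; apply: OL; lra.
- move=> s z; rewrite in_cons => /orP[/eqP->|sS] zs; first exact: h0'.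
  by have := h0 s z sS zs; rewrite E' mulf_eq0 negb_or => /andP[].
Qed.

End Factorization.

Lemma L_same {R : realType} {V : normedModType R[i]} (f : R[i] -> V) p : L f p p = 0.
Proof. by rewrite /L subrr scale0r. Qed.

Opaque L.

(** * Changes of argument along the trapezoid *)

Section Contour.
Context {R : realType}.
Notation C := R[i].
Notation Co := (R[i]^o).

Lemma cder_comp {V : normedModType C} (F : C -> V) (g : C -> Co) z (g' : Co) (F' : V) :
  cder g z g' -> cder F (g z) F' -> cder (fun z => F (g z)) z ((g' : C) *: F').
Proof.
move=> dg dF e e0; have cg := cder_cont _ _ _ dg.
have n1 := nr_ge0 g'; have n2 := nr_ge0 F'.
pose K := nr g' + nr F' + 2; have K0 : 0 < K by rewrite /K; lra.
have k0 : 0 < Num.min (e / K) 1 by rewrite lt_min divr_gt0//= ltr01.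
set k := Num.min _ _ in k0; have ke : k <= e / K by rewrite ge_min lexx.
have k1 : k <= 1 by rewrite ge_min lexx orbT.
have [d1 d10 Hd1] := dF _ k0.
have [d2 d20 Hd2] := dg _ k0.
have [d3 d30 Hd3] := cg _ (divr_gt0 d10 (ltr0n R 2)).
exists (Num.min d2 d3); first by rewrite lt_min d20.
move=> h; rewrite lt_min => /andP[/Hd2 h2 h3].
have {Hd3 h3}h3 : nr (g (z + h) - g z) <= d1 / 2 by apply: Hd3; rewrite addKl.
have {Hd1}h1 := Hd1 (g (z + h) - g z); rewrite (addrC (g z)) subrK in h1.
have {}h1 := h1 (le_lt_trans h3 (_ : d1 / 2 < d1)).
have {}h1 := h1 ltac:(lra).
have nh := nr_ge0 h.
have G : nr (g (z + h) - g z) <= (1 + nr g') * nr h.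
  have := nrD (g (z + h) - g z - h *: g') (h *: g'); rewrite subrK nrZ.
  by have := ler_wpM2r nh k1; lra.
set x : C := g (z + h) - g z in h1 h2 G.
rewrite (_ : _ - _ - _ = (F (g (z + h)) - F (g z) - x *: F') + (x - h * g') *: F'); last by vec.
apply: le_trans (nrD _ _) _; rewrite nrZ.
have s1 : nr (F (g (z + h)) - F (g z) - x *: F') <= k * ((1 + nr g') * nr h).
  by apply: le_trans h1 _; rewrite ler_wpM2l// ltW.
have s2 : nr (x - h * g') * nr F' <= k * nr h * nr F' by rewrite ler_wpM2r.
have : k * K <= e by rewrite -ler_pdivlMr.
move/(ler_wpM2r nh); rewrite /K; have := mulr_ge0 (ltW k0) nh; lra.
Qed.

(* For v = 1 + y with y small, the logarithm of v is given by the primitive of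
   1/z in the right half plane, so its increments do not see the length of the path. *)
Lemma log_near1 (U : set C) (v v' : C -> Co) (eta : R) p q : copen U -> cconvex U ->
  U p -> U q -> 0 <= eta -> eta <= 1 / 2 -> (forall z, U z -> cder v z (v' z)) ->
  (forall z, U z -> nr (v z - 1) <= eta) -> nr (L (logd v v') p q) <= 4 * eta.
Proof.
move=> oU cU Up Uq e0 e1 dv v1.
pose H := halfplane 1 0 : set C.
have oH : copen H := halfplane_open 1 0; have cH : cconvex H := halfplane_convex 1 0.
have nH : ~ H 0 := @halfplane_center R 1 0.
have Hv (z : C) : nr (z - 1) <= eta -> H z.
  rewrite /H /halfplane /= subr0 mul1r => h.
  by have := Re_le_nr (z - 1); rewrite !ReImE /= ler_norml; lra.
have H1 : H 1 by apply: Hv; rewrite subrr nr0.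
pose Lam (z : C) : Co := L (linv 0) 1 z.
have dLam z : H z -> cder Lam z (linv 0 z) by move=> Hz; exact: (linv_prim H).
have v0 z : U z -> v z != 0.
  by move=> /v1/Hv Hz; apply/eqP => E; apply: nH; rewrite -E.
have dP z : U z -> cder (fun z => Lam (v z)) z (logd v v' z).
  move=> Uz; have := cder_comp Lam v z _ _ (dv _ Uz) (dLam _ (Hv _ (v1 _ Uz))).
  by apply: cder_ext => //; rewrite /linv subr0.
have lc : cont_seg (logd v v') p q.
  move=> t t01; apply: (holo_cont U); last exact: cU.
  exact: logd_holo.
rewrite (L_prim Co_complete _ (fun z => Lam (v z)))//; last first.
  by move=> t t01; apply: dP; exact: cU.
have bL z : nr (z - 1) <= eta -> nr (Lam z) <= 2 * eta.
  move=> hz; have := L_le Co_complete (linv 0) 1 z 2.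
  have c1 : cont_seg (linv 0) 1 z by apply: (linv_cont H) => //; exact: Hv.
  move=> /(_ c1) h; apply: le_trans (h _) _; last by rewrite ler_wpM2l.
  move=> t /andP[t0 t1]; rewrite /linv subr0 nrV -[leRHS]invrK lef_pV2 ?posrE ?invr_gt0//.
    have := nr_geB (1 : C) (1 - seg 1 z t); rewrite subKr nr1 -nrN opprB.
    rewrite (_ : seg 1 z t - 1 = t%:C * (z - 1)); last by rewrite /seg; ring.
    rewrite nrM nrR ger0_norm//.
    have := ler_pM t0 (nr_ge0 _) t1 hz; lra.
  rewrite nr_gt0; apply/eqP => E; apply: nH; rewrite -E.
  by apply: cH => //; [exact: Hv|apply/andP].
apply: le_trans (nrB _ _) _.
have := lerD (bL _ (v1 _ Uq)) (bL _ (v1 _ Up)).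
by rewrite -mulrDl (_ : (2 + 2 : R) = 4); last ring.
Qed.

Variables (r s k eps : R).
Hypotheses (r0 : 0 < r) (rs : r < s) (eps0 : 0 < eps) (epsk : eps < k).

Definition ray (sg x : R) : C := x +i* (sg * k * x).

Let a := ray (-1) r.
Let b := ray (-1) s.
Let c := ray 1 s.
Let d := ray 1 r.

Definition cone (p : C) : Prop := 0 < complex.Re p /\ `|complex.Im p| <= eps * complex.Re p.

(** The change of arg(z - p) along the trapezoid, counterclockwise from its lower left vertex [a].
    The flags switch the short sides at [r] and [s] on: a point close to such a side is discounted
    there. *)
Definition im4 (p : C) (f1 f2 : bool) : R :=
  complex.Im (L (linv p) a b) + complex.Im (L (linv p) c d) +
  (if f1 then complex.Im (L (linv p) d a) else 0) +
  (if f2 then complex.Im (L (linv p) b c) else 0).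

Let s0 : 0 < s. Proof. exact: lt_trans rs. Qed.
Let k0 : 0 < k. Proof. exact: lt_trans epsk. Qed.

Lemma below_ray p x : cone p -> 0 < x -> halfplane (- eps +i* 1) p (ray (-1) x).
Proof.
case: p => X Y [/= X0]; rewrite ler_norml => /andP[Y1 Y2] x0.
rewrite /halfplane /= !mulN1r.
by have := mulr_gt0 x0 (_ : 0 < k - eps); rewrite subr_gt0 => /(_ epsk); lra.
Qed.

Lemma above_ray p x : cone p -> 0 < x -> halfplane (- eps -i* 1) p (ray 1 x).
Proof.
case: p => X Y [/= X0]; rewrite ler_norml => /andP[Y1 Y2] x0.
rewrite /halfplane /= !mul1r.
by have := mulr_gt0 x0 (_ : 0 < k - eps); rewrite subr_gt0 => /(_ epsk); lra.
Qed.

Lemma right_of p sg x : complex.Re p < x -> halfplane 1 p (ray sg x).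
Proof. by case: p => X Y /= h; rewrite /halfplane /=; lra. Qed.

Lemma left_of p sg x : x < complex.Re p -> halfplane (- 1) p (ray sg x).
Proof. by case: p => X Y /= h; rewrite /halfplane /= ; lra. Qed.

Lemma vertical_halfplane p x : complex.Re p != x ->
  exists u, halfplane u p (ray 1 x) /\ halfplane u p (ray (-1) x).
Proof.
rewrite neq_lt => /orP[h|h]; first by exists 1; split; exact: right_of.
by exists (- 1); split; exact: left_of.
Qed.

Lemma im4_bound p (f1 f2 : bool) : cone p -> (f1 -> complex.Re p != r) -> (f2 -> complex.Re p != s) ->
  `|im4 p f1 f2| <= 4 * pi.
Proof.
move=> cp h1 h2; have pi0 := pi_gt0 R.
have /andP[A1 A2] := linv_arg _ _ _ _ (below_ray p r cp r0) (below_ray p s cp s0).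
have /andP[B1 B2] := linv_arg _ _ _ _ (above_ray p s cp s0) (above_ray p r cp r0).
have H3 : - pi <= (if f1 then complex.Im (L (linv p) d a) else 0) <= pi.
  case: f1 h1 => [/(_ isT)/vertical_halfplane[u [u1 u2]]|_]; last lra.
  by have /andP[C1 C2] := linv_arg _ _ _ _ u1 u2; apply/andP; split; exact: ltW.
have H4 : - pi <= (if f2 then complex.Im (L (linv p) b c) else 0) <= pi.
  case: f2 h2 => [/(_ isT)/vertical_halfplane[u [u1 u2]]|_]; last lra.
  by have /andP[C1 C2] := linv_arg _ _ _ _ u2 u1; apply/andP; split; exact: ltW.
rewrite /im4 ler_norml; move: A1 A2 B1 B2 H3 H4; rewrite -/a -/b -/c -/d.
move: (complex.Im _) (complex.Im _) (if _ then _ else _) (if _ then _ else _) => x y z w.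
move=> A1 A2 B1 B2 /andP[C1 C2] /andP[D1 D2]; apply/andP; split; lra.
Qed.

Lemma im4_outside p : cone p -> complex.Re p < r \/ s < complex.Re p -> im4 p true true = 0.
Proof.
move=> cp h; have [u [ua ub uc ud]] : exists u, [/\ halfplane u p a, halfplane u p b,
    halfplane u p c & halfplane u p d].
  case: h => h; [exists 1|exists (- 1)].
    by split; apply: right_of => //; exact: lt_trans rs.
  by split; apply: left_of => //; exact: lt_trans h.
pose U := halfplane u p.
have oU : copen U := halfplane_open u p; have cU : cconvex U := halfplane_convex u p.
have nU : ~ U p := @halfplane_center R u p.
have E x y : U x -> U y -> L (linv p) x y = L (linv p) a y - L (linv p) a x.
  move=> Ux Uy; apply: (L_prim Co_complete (linv p) (fun z => L (linv p) a z)).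
    exact: (linv_cont U).
  by move=> t t01; apply: (linv_prim U) => //; exact: cU.
rewrite /im4 (E c d)// (E d a)// (E b c)// (_ : L _ a a = 0); last exact: L_same.
rewrite !cImD !cImN sub0r.
by move: (complex.Im _) (complex.Im _) (complex.Im _) => x y z; ring.
Qed.

(** On each side the argument increases by strictly between 0 and pi, by the sign of a cross
    product. The product of the four exponentials is 1, so the total, strictly between 0 and 4 pi,
    is 2 pi. *)
Lemma im4_inside p : cone p -> r < complex.Re p < s -> im4 p true true = 2 * pi.
Proof.
move=> cp /andP[rp ps].
have [X0 Yc] := cp; move: Yc; rewrite ler_norml => /andP[Y1 Y2].
set X := complex.Re p in X0 Y1 Y2 rp ps; set Y := complex.Im p in Y1 Y2.
have pE : p = X +i* Y by apply: complexP.
have kX : eps * X < k * X by rewrite ltr_pM2r.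
have A : 0 < complex.Im (L (linv p) a b) < pi.
  apply: (linv_arg_pos (- eps +i* 1)); [exact: below_ray|exact: below_ray|].
  rewrite pE /a /b /ray /= (_ : _ + _ = (k * X + Y) * (s - r)); last by ring.
  by rewrite mulr_gt0//; lra.
have B : 0 < complex.Im (L (linv p) c d) < pi.
  apply: (linv_arg_pos (- eps -i* 1)); [exact: above_ray|exact: above_ray|].
  rewrite pE /c /d /ray /= (_ : _ + _ = (k * X - Y) * (s - r)); last by ring.
  by rewrite mulr_gt0//; lra.
have D : 0 < complex.Im (L (linv p) d a) < pi.
  apply: (linv_arg_pos (- 1)); [exact: left_of|exact: left_of|].
  rewrite pE /d /a /ray /= (_ : _ + _ = 2 * (k * r) * (X - r)); last by ring.
  by rewrite !mulr_gt0//; lra.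
have E : 0 < complex.Im (L (linv p) b c) < pi.
  apply: (linv_arg_pos 1); [exact: right_of|exact: right_of|].
  rewrite pE /b /c /ray /= (_ : _ + _ = 2 * (k * s) * (s - X)); last by ring.
  by rewrite !mulr_gt0//; lra.
have ex u x y : halfplane u p x -> halfplane u p y ->
    y - p = (x - p) * cexp (L (linv p) x y).
  move=> ux uy; apply: (linv_exp (halfplane u p)) => //.
  - exact: halfplane_open.
  - exact: halfplane_convex.
  - exact: halfplane_center.
have E1 := ex _ _ _ (below_ray p r cp r0) (below_ray p s cp s0).
have E2 := ex _ _ _ (right_of p (-1) s ps) (right_of p 1 s ps).
have E3 := ex _ _ _ (above_ray p s cp s0) (above_ray p r cp r0).
have E4 := ex _ _ _ (left_of p 1 r rp) (left_of p (-1) r rp).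
rewrite -/a -/b -/c -/d in E1 E2 E3 E4.
have ap : a - p != 0.
  apply/eqP => h; have := left_of p (-1) r rp; rewrite -/a /halfplane /= h mulr0 /= ltxx//.
have : cexp (L (linv p) a b + L (linv p) b c + L (linv p) c d + L (linv p) d a) = 1.
  apply: (mulfI ap); rewrite !cexpD mulr1 [in RHS]E4 [in RHS]E3 [in RHS]E2 [in RHS]E1.
  by rewrite !mulrA.
move=> /cexp_eq1[_ h _]; have := cos_eq1_4pi _ h; rewrite !cImD.
move: A B D E; rewrite /im4 /=.
move: (complex.Im _) (complex.Im _) (complex.Im _) (complex.Im _) => x y z w.
move=> /andP[x1 x2] /andP[y1 y2] /andP[z1 z2] /andP[w1 w2] H.
by rewrite -H; [ring|apply/andP; split; lra].
Qed.

End Contour.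

Section LogDerivatives.
Context {R : realType}.
Notation C := R[i].
Notation Co := (R[i]^o).

Lemma ccont_sum (I : eqType) (ws : seq I) (F : I -> C -> Co) z :
  (forall i, i \in ws -> ccont (F i) z) -> ccont (fun z => \sum_(i <- ws) F i z : Co) z.
Proof.
elim: ws => [|i ws IH] Fc.
  rewrite (_ : (fun _ => _) = fun=> 0); first exact: ccont_cst.
  by apply/funext => x; rewrite big_nil.
have {IH}IH : ccont (fun z => \sum_(i <- ws) F i z : Co) z.
  by apply: IH => j jws; apply: Fc; rewrite in_cons jws orbT.
have {}Fc : ccont (F i) z by apply: Fc; rewrite mem_head.
move=> e e0; have e2 : 0 < e / 2 by lra.
have [d d0 Hd] := Fc _ e2; have [d' d0' Hd'] := IH _ e2.
exists (Num.min d d'); first by rewrite lt_min d0.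
move=> x; rewrite lt_min => /andP[/Hd h1 /Hd' h2].
by rewrite !big_cons opprD addrACA (le_trans (nrD _ _))// {IH Fc}; lra.
Qed.

Lemma L_sum (I : eqType) (ws : seq I) (F : I -> C -> Co) p q :
  (forall i, i \in ws -> cont_seg (F i) p q) ->
  L (fun z => \sum_(i <- ws) F i z : Co) p q = \sum_(i <- ws) L (F i) p q.
Proof.
elim: ws => [|i ws IH] Fc.
  rewrite big_nil (L_ext _ (fun=> 0)); first by rewrite L_cst scaler0.
  by move=> t _; rewrite big_nil.
have Fi : cont_seg (F i) p q by apply: Fc; rewrite mem_head.
have Fws j : j \in ws -> cont_seg (F j) p q by move=> jws; apply: Fc; rewrite in_cons jws orbT.
rewrite big_cons -(IH Fws) -(LD Co_complete _ _ _ _ Fi).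
  by apply: L_ext => t _; rewrite big_cons.
by move=> t t01; apply: ccont_sum => j /Fws; apply.
Qed.

Lemma cder_prod_linv (ws : seq C) z : (forall w, w \in ws -> z != w) ->
  cder (fun z => \prod_(w <- ws) (z - w) : Co) z
    (\prod_(w <- ws) (z - w) * \sum_(w <- ws) linv w z).
Proof.
elim: ws => [|w ws IH] zw.
  rewrite !big_nil mulr0 (_ : (fun _ => _) = fun=> 1); first exact: cder_cst.
  by apply/funext => x; rewrite big_nil.
have zw0 : z - w != 0 by rewrite subr_eq0 zw// mem_head.
have zws x : x \in ws -> z != x by move=> xw; apply: zw; rewrite in_cons xw orbT.
have := cderM _ _ _ _ _ (cder_subc w z) (IH zws).
apply: cder_ext; first by move=> x; rewrite big_cons.
by rewrite !big_cons /linv; field.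
Qed.

Lemma cder_prod1 (n : nat) (y y' : nat -> C -> Co) z :
  (forall i, (i < n)%N -> cder (y i) z (y' i z)) -> (forall i, (i < n)%N -> 1 + y i z != 0) ->
  cder (fun z => \prod_(i < n) (1 + y i z) : Co) z
    (\prod_(i < n) (1 + y i z) * \sum_(i < n) logd (fun z => 1 + y i z) (y' i) z).
Proof.
elim: n => [|n IH] dy y0.
  rewrite !big_ord0 mulr0 (_ : (fun _ => _) = fun=> 1); first exact: cder_cst.
  by apply/funext => x; rewrite big_ord0.
have yn : 1 + y n z != 0 by apply: y0.
have := cderM _ _ _ _ _ (IH (fun i h => dy i (ltnW h)) (fun i h => y0 i (ltnW h)))
  (cderD _ _ _ _ _ (cder_cst (1 : Co) z) (dy n (ltnSn n))).
apply: cder_ext; first by move=> x; rewrite big_ord_recr.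
by rewrite !big_ord_recr /= /logd; move: (\prod_(i < n) _) (\sum_(i < n) _) => A B; field.
Qed.

Lemma prod_neq0 (ws : seq C) z : (forall w, w \in ws -> z != w) ->
  \prod_(w <- ws) (z - w) != 0.
Proof. by move=> zw; rewrite prodf_seq_neq0; apply/allP => w /zw; rewrite subr_eq0. Qed.

Lemma linv_seg_cont (w p q : C) : (forall t, 0 <= t <= 1 -> seg p q t != w) ->
  cont_seg (linv w : C -> Co) p q.
Proof.
move=> nw t t01; apply: cder_cont; apply: (cderV (fun z => z - w)).
  exact: cder_subc.
by rewrite subr_eq0 nw.
Qed.

End LogDerivatives.

Section CountSums.
Context {R : realType}.
Notation C := R[i].

Lemma Im_sum (I : Type) (l : seq I) (F : I -> C) :
  complex.Im (\sum_(i <- l) F i) = \sum_(i <- l) complex.Im (F i).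
Proof.
elim: l => [|i l IH]; first by rewrite !big_nil.
by rewrite !big_cons cImD IH.
Qed.

(** A point with both short sides switched on contributes exactly 2 pi or 0; any other one costs at
    most 4 pi, as each side turns by less than pi. *)
Lemma sum_im4 (r s k eps : R) (ps : seq C) (f1 f2 : pred C) : 0 < r -> r < s -> 0 < eps -> eps < k ->
  (forall p, p \in ps -> [/\ cone eps p, f1 p -> complex.Re p != r & f2 p -> complex.Re p != s]) ->
  `| \sum_(p <- ps) im4 r s k p (f1 p) (f2 p) -
     2 * pi * (count (fun p => [&& f1 p, f2 p & r < complex.Re p < s]) ps)%:R |
  <= 4 * pi * (count (fun p => ~~ f1 p || ~~ f2 p) ps)%:R.
Proof.
move=> r0 rs e0 ek; elim: ps => [|p ps IH] H.
  by rewrite big_nil /= !mulr0 subrr normr0.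
have pi0 := pi_gt0 R.
have {IH}IH := IH (fun p h => H p (mem_behead (s := _ :: _) h)).
have [cp h1 h2] := H p (mem_head _ _).
rewrite big_cons /= !natrD (mulrDr (2 * pi)) (mulrDr (4 * pi)).
rewrite opprD addrACA; apply: le_trans (ler_normD _ _) _; apply: lerD => //.
have H0 := im4_bound r s k eps r0 rs ek p _ _ cp h1 h2.
case: (f1 p) h1 H0 => /= h1 H0; last by rewrite mulr0n mulr1n mulr0 subr0 mulr1.
case: (f2 p) h2 H0 => /= h2 H0; last by rewrite mulr0n mulr1n mulr0 subr0 mulr1.
rewrite mulr0n mulr0 normr_le0 subr_eq0; apply/eqP.
have := h1 isT; rewrite neq_lt => /orP[pr|rp].
  rewrite (im4_outside r s k eps rs p cp)//; last by left.
  by rewrite [r < _]ltNge (ltW pr) mulr0n mulr0.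
have := h2 isT; rewrite neq_lt => /orP[ps'|sp].
  by rewrite (im4_inside r s k eps r0 rs e0 ek p cp) ?rp ?ps'//= mulr1n mulr1.
rewrite (im4_outside r s k eps rs p cp)//; last by right.
by rewrite rp [_ < s]ltNge (ltW sp) mulr0n mulr0.
Qed.

Lemma count_diff (T : Type) (l : seq T) (P Q N : pred T) :
  (forall x, P x -> Q x || N x) -> (count P l <= count Q l + count N l)%N.
Proof.
move=> H; rewrite -count_predUI; apply: leq_trans (leq_addr _ _).
by apply: sub_count => x /H.
Qed.

End CountSums.

(** * The function near a short side of the trapezoid *)

Section Window.
Context {R : realType}.
Notation C := R[i].
Notation Co := (R[i]^o).

Lemma sn_ray (k x : R) : 0 <= k -> 0 <= x -> sn (ray k (-1) x - ray k 1 x) = 2 * (k * x).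
Proof.
move=> k0 x0; have kx : 0 <= k * x by rewrite mulr_ge0.
rewrite /sn /ray /= subrr normr0 mulN1r mul1r.
have -> : - k * x - k * x = - (2 * (k * x)) by lra.
by rewrite normrN ger0_norm; [apply/max_idPr|]; lra.
Qed.

(** Compares the upper bound of the perturbed product with its lower bound at the centre: (1 + 3
    eta)(1 - eta) >= 1 + eta for eta <= 1/4. *)
Lemma ratio_exp (eta : R) (n : nat) : 0 <= eta -> eta <= 1 / 4 ->
  (1 + eta) ^+ n <= expR (3 * eta * n%:R) * (1 - eta) ^+ n.
Proof.
move=> e0 e1; rewrite expRM_natr -exprMn.
apply: lerXn2r; rewrite ?nnegrE; [lra | by rewrite mulr_ge0 ?expR_ge0//; lra |].
have h : 1 + 3 * eta <= expR (3 * eta) by exact: expR_ge1Dx.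
apply: (@le_trans _ _ ((1 + 3 * eta) * (1 - eta))); last by rewrite ler_wpM2r//; lra.
have : 0 <= eta * (1 - 3 * eta) by rewrite mulr_ge0//; lra.
by lra.
Qed.

Lemma pow2_exp (m : nat) (B : R) : 2 ^+ m <= expR B -> m%:R <= 2 * B.
Proof.
have h2 : expR (2^-1 : R) <= 2.
  have h : 1 + - (2^-1 : R) <= expR (- 2^-1) by exact: expR_ge1Dx.
  rewrite -[expR _]invrK -expRN -[leRHS]invrK lef_pV2 ?posrE ?expR_gt0//; first by lra.
move=> h; have : expR (m%:R * 2^-1) <= expR B.
  apply: le_trans h; rewrite expRM_natl; apply: lerXn2r; rewrite ?nnegrE ?expR_ge0//.
by rewrite ler_expR; lra.
Qed.

Lemma logd_quot (g g' p q a b : C) : g != 0 -> p != 0 -> q != 0 ->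
  ((g' * p + g * (p * a)) * q^-1 + g * p * (- (q * b) / q ^+ 2)) / (g * p * q^-1) =
  g' / g + a - b.
Proof. by move=> g0 p0 q0; field; rewrite g0 p0 q0. Qed.

Variables (O : set C) (f h h' : C -> Co) (x k eta K B : R) (ls ws : seq C).
Let c := ray k 1 x.
Let far (p : C) := 200 * (k * x) < `|complex.Re p - x|.
Let wfar (p : C) := 9 * (k * x) < sn (p - c).
Let n := size ls.
Let m := count (predC far) ls.
Hypotheses (x0 : 0 < x) (k0 : 0 < k) (K1 : 1 <= K) (eta0 : 0 <= eta) (eta1 : eta <= 1 / 4).
Hypothesis OV : forall z, sn (z - c) < 54 * (k * x) -> O z.
Hypothesis Oo : copen O.
Hypothesis dh : forall z, O z -> cder h z (h' z).
Hypothesis fE : forall z, f z = \prod_(w <- ws) (z - w) * h z.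
Hypothesis h0 : forall z, sn (z - c) <= 9 * (k * x) -> h z != 0.
Hypothesis H2 : forall z, sn (z - c) < 54 * (k * x) ->
  nr (f z) <= (1 + eta) ^+ n * (K * (k * x)) ^+ m * \prod_(l <- ls | far l) nr (z - l).
Hypothesis Hc : \prod_(l <- ls) nr (c - l) * (1 - eta) ^+ n <= nr (f c).
Hypothesis ls_real : forall l, l \in ls -> complex.Im l = 0.
Hypothesis BE : 3 * eta * n%:R + m%:R * ln K <= B.
Hypothesis B0 : 0 < B.

Let kx : 0 < k * x. Proof. exact: mulr_gt0. Qed.

Let lf := [seq l <- ls | far l].
Let wf := [seq w <- ws | wfar w].
Let wn := [seq w <- ws | ~~ wfar w].
Let P (z : C) := \prod_(w <- wf) (z - w).
Let N (z : C) := \prod_(w <- wn) (z - w).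
Let Q (z : C) := \prod_(l <- lf) (z - l).
(** What remains of f = N Q v after removing the zeros close to the centre ([N]) and the factors of
    the far eigenvalues ([Q]). It has no zero in the square of half side 9kx, and its growth there
    is governed by [n], [m] and [K] only. *)
Let v (z : C) : Co := h z * P z * (Q z)^-1.

Let Q0 z : sn (z - c) < 54 * (k * x) -> forall l, l \in lf -> z != l.
Proof.
move=> zc l; rewrite mem_filter => /andP[lfar _]; apply/eqP => zl.
move: lfar zc; rewrite -zl /far sn_lt => h1 /andP[h2 _].
move: h2; rewrite /c /ray cReD cReN /= => h2; clear zl; move: kx; lra.
Qed.

Let Qn0 z : sn (z - c) < 54 * (k * x) -> Q z != 0.
Proof. by move=> zc; apply: prod_neq0; apply: Q0. Qed.

Let fv z : sn (z - c) < 54 * (k * x) -> f z = N z * Q z * v z.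
Proof.
move=> zc; rewrite fE /v (bigID wfar) /=.
have -> : \prod_(i <- ws | wfar i) (z - i) = P z by rewrite /P big_filter.
have -> : \prod_(i <- ws | ~~ wfar i) (z - i) = N z by rewrite /N big_filter.
by have := Qn0 z zc; move: (P z) (N z) (Q z) (h z) => p n' q hz q0; field.
Qed.

Let fN z : sn (z - c) < 54 * (k * x) -> nr (f z) = nr (N z) * nr (Q z) * nr (v z).
Proof. by move=> zc; rewrite (fv z zc); move: (v z) (N z) (Q z) => a b d; rewrite 2!nrM. Qed.

Let Qnr z : nr (Q z) = \prod_(l <- ls | far l) nr (z - l).
Proof. by rewrite /Q big_filter nr_prod. Qed.

Let sc0 : sn (c - c : C) = 0. Proof. by rewrite /sn subrr /= !normr0 maxxx. Qed.
Let sc54 : sn (c - c) < 54 * (k * x). Proof. by rewrite sc0; move: kx; lra. Qed.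

Let Qc_gt0 : 0 < nr (Q c). Proof. by rewrite nr_gt0 Qn0. Qed.

(** At the centre c = x + ikx a near eigenvalue, being real, is at distance at least kx, and a near
    zero at distance at most 18kx. *)
Let low : (k * x) ^+ m * (1 - eta) ^+ n <= (18 * (k * x)) ^+ size wn * nr (v c).
Proof.
have e1 : 0 <= (1 - eta) ^+ n by apply: exprn_ge0; move: eta0 eta1; lra.
have hN : nr (N c) <= (18 * (k * x)) ^+ size wn.
  apply: prod_le; first by move: kx; lra.
  move=> w; rewrite mem_filter /wfar -leNgt => /andP[wc _].
  by apply: le_trans (nr_le_sn _) _; rewrite snC; move: kx; lra.
have hL : (k * x) ^+ m * nr (Q c) <= \prod_(l <- ls) nr (c - l).
  rewrite (bigID far) /= -Qnr mulrC; apply: ler_wpM2l; first exact: nr_ge0.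
  rewrite -big_filter /m -size_filter.
  rewrite (eq_filter (a2 := fun l => ~~ far l))//.
  have : forall l, l \in [seq l <- ls | ~~ far l] -> l \in ls.
    by move=> l; rewrite mem_filter => /andP[].
  elim: [seq _ <- _ | _] => [|l t IH] tls; first by rewrite big_nil.
  rewrite big_cons /= exprS; apply: ler_pM; [exact: ltW | by apply: exprn_ge0; exact: ltW | |].
    apply: le_trans (Im_le_nr _); rewrite cImD cImN (ls_real l) ?tls ?mem_head//.
    by rewrite /c /ray /= subr0 mul1r ger0_norm// ltW.
  by apply: IH => l' h1; apply: tls; rewrite in_cons h1 orbT.
have := Hc; rewrite (fN c sc54) => H.
have step : (k * x) ^+ m * (1 - eta) ^+ n * nr (Q c) <=
   (18 * (k * x)) ^+ size wn * nr (v c) * nr (Q c).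
  apply: (@le_trans _ _ ((k * x) ^+ m * nr (Q c) * (1 - eta) ^+ n)); first by rewrite mulrAC.
  apply: (@le_trans _ _ (\prod_(l <- ls) nr (c - l) * (1 - eta) ^+ n)).
    by rewrite ler_wpM2r.
  apply: le_trans H _; rewrite mulrAC; apply: ler_wpM2r; first exact: nr_ge0.
  by apply: ler_wpM2r; first exact: nr_ge0.
by rewrite -(ler_pM2r Qc_gt0).
Qed.

Let vholo : holo [set z | sn (z - c) < 54 * (k * x)] v.
Proof.
move=> z /= zc; have [p' dP] := cder_prod wf z; have [q' dQ] := cder_prod lf z.
eexists; apply: cderM (cderM _ _ _ _ _ (dh z (OV z zc)) dP) (cderV _ _ _ dQ (Qn0 z zc)).
Qed.

(** On the boundary of the square of half side 45kx the near zeros are at distance at least 36kx;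
    the maximum principle carries the bound inside. *)
Let up z : sn (z - c) < 45 * (k * x) ->
  nr (v z) * (36 * (k * x)) ^+ size wn <= (1 + eta) ^+ n * (K * (k * x)) ^+ m.
Proof.
move=> zc; have p36 : 0 < (36 * (k * x)) ^+ size wn by apply: exprn_gt0; move: kx; lra.
rewrite -ler_pdivlMr//.
apply: (max_principle v c (45 * (k * x)) (54 * (k * x)) _ z) => //; [move: kx; lra|move: kx; lra|].
move=> w; rewrite /onsq => wc; rewrite ler_pdivlMr//.
have wc54 : sn (w - c) < 54 * (k * x) by rewrite wc; move: kx; lra.
have Q0' : 0 < nr (Q w) by rewrite nr_gt0 Qn0.
rewrite -(ler_pM2r Q0') [in leRHS]Qnr.
apply: le_trans (H2 w wc54); rewrite (fN w wc54).
have E (a b d : R) : a * b * d = b * (d * a) by ring.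
rewrite [leLHS]E -[leRHS]mulrA; apply: ler_wpM2r; first by rewrite mulr_ge0 ?nr_ge0.
apply: prod_ge; first by move: kx; lra.
move=> w'; rewrite mem_filter /wfar -leNgt => /andP[w'c _].
apply: le_trans (sn_le_nr _); have := sn_tri w' w c; rewrite wc; move: kx; lra.
Qed.

Let expB (A : R) : 0 <= A -> (1 + eta) ^+ n * (K * (k * x)) ^+ m * A <=
   expR B * ((k * x) ^+ m * (1 - eta) ^+ n) * A.
Proof.
move=> A0; apply: ler_wpM2r => //.
rewrite exprMn [in leLHS]mulrA [in leRHS]mulrA [leRHS]mulrAC; apply: ler_wpM2r.
  by apply: exprn_ge0; exact: ltW.
apply: (@le_trans _ _ (expR (3 * eta * n%:R) * (1 - eta) ^+ n * K ^+ m)).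
  rewrite ler_wpM2r ?ratio_exp//; apply: exprn_ge0; move: eta0 eta1 K1; lra.
rewrite mulrAC; apply: ler_wpM2r; first by apply: exprn_ge0; move: eta0 eta1 K1; lra.
apply: (@le_trans _ _ (expR (3 * eta * n%:R + m%:R * ln K))); last by rewrite ler_expR.
by rewrite expRD expRM_natl lnK// posrE; move: K1; lra.
Qed.

Let vc0 : 0 < nr (v c).
Proof.
have : 0 < (k * x) ^+ m * (1 - eta) ^+ n by apply: mulr_gt0; apply: exprn_gt0 => //; move: eta1; lra.
move=> /lt_le_trans /(_ low); rewrite pmulr_rgt0//; apply: exprn_gt0; move: kx; lra.
Qed.

(** The ratio 36/18 yields a factor 2 per near zero. At z = c this is Jensen's count of the near
    zeros; elsewhere it is the growth hypothesis of Borel-Caratheodory. *)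
Let growth z : sn (z - c) < 45 * (k * x) -> nr (v z) * 2 ^+ size wn <= nr (v c) * expR B.
Proof.
move=> zc; have p18 : 0 < (18 * (k * x)) ^+ size wn by apply: exprn_gt0; move: kx; lra.
rewrite -(ler_pM2r p18) -mulrA -exprMn.
have -> : 2 * (18 * (k * x)) = 36 * (k * x) by lra.
apply: le_trans (up z zc) _.
rewrite -[X in X <= _]mulr1; apply: le_trans (expB 1 ler01) _; rewrite mulr1.
rewrite [leRHS]mulrAC mulrC; apply: ler_wpM2r; first exact: expR_ge0.
by rewrite [leRHS]mulrC; exact: low.
Qed.

Lemma window_count : (count (predC wfar) ws)%:R <= 2 * B.
Proof.
rewrite -size_filter; apply: pow2_exp.
have := growth c; rewrite sc0 mulrC ler_pM2l//; apply; move: kx; lra.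
Qed.

Lemma window_bound (z := ray k (-1) x) :
  `|complex.Im (L (logd h h') c z) -
    (\sum_(l <- ls | far l) complex.Im (L (linv l) c z) -
     \sum_(w <- ws | wfar w) complex.Im (L (linv w) c z))| <= 2 * B.
Proof.
pose U := [set z | sn (z - c) < 9 * (k * x)].
have lt54 y : U y -> sn (y - c) < 54 * (k * x) by rewrite /U /=; move: kx; lra.
have P0 y : U y -> forall w, w \in wf -> y != w.
  move=> yU w; rewrite mem_filter /wfar => /andP[wfr _]; apply/eqP => yw.
  by move: yU wfr; rewrite /U /= yw; clear yw; move: kx; lra.
pose v' y := (h' y * P y + h y * (P y * \sum_(w <- wf) linv w y)) * (Q y)^-1 +
  h y * P y * (- (Q y * \sum_(l <- lf) linv l y) / (Q y) ^+ 2) : Co.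
have dv y : U y -> cder v y (v' y).
  move=> yU; apply: cderM; first apply: cderM.
  - by apply: dh; apply: OV; exact: lt54.
  - by apply: cder_prod_linv; exact: P0.
  by apply: cderV; [apply: cder_prod_linv; apply: Q0; exact: lt54|apply: Qn0; exact: lt54].
have v0 y : U y -> v y != 0.
  move=> yU; rewrite /v mulf_neq0 ?invr_eq0 ?Qn0 ?lt54// mulf_neq0 ?prod_neq0//; last exact: P0.
  by apply: h0; exact: ltW.
have zc : sn (z - c) = 2 * (k * x) by rewrite /z /c sn_ray// ltW.
have Uz : U z by rewrite /U /= zc; move: kx; lra.
have Uc : U c by rewrite /U /= sc0; move: kx; lra.
have UC : cconvex U by exact: sn_convex.
have sg t : 0 <= t <= 1 -> U (seg c z t) by exact: UC.
(* The two ends of the short side are at sup distance 2kx, a quarter of 8kx, and [v] has no zero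
   within 9kx. *)
have := borel_caratheodory v v' c (8 * (k * x)) (9 * (k * x)) B z.
have LE : L (logd v v') c z = L (logd h h') c z + \sum_(w <- wf) L (linv w) c z
    - \sum_(l <- lf) L (linv l) c z.
  have cP w : w \in wf -> cont_seg (linv w : C -> Co) c z.
    by move=> wwf; apply: linv_seg_cont => t t01; apply: P0 => //; exact: sg.
  have cQ w : w \in lf -> cont_seg (linv w : C -> Co) c z.
    by move=> wwf; apply: linv_seg_cont => t t01; apply: Q0 => //; apply: lt54; exact: sg.
  have ch : cont_seg (logd h h') c z.
    move=> t t01; apply: (holo_cont U); last exact: sg.
    apply: logd_holo; [exact: sn_open| |].
      by move=> y yU; apply: dh; apply: OV; exact: lt54.
    by move=> y yU; apply: h0; exact: ltW.
  rewrite -(L_sum _ _ _ _ _ cP) -(L_sum _ _ _ _ _ cQ).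
  have cP' : cont_seg (fun z => \sum_(w <- wf) linv w z : Co) c z.
    by move=> t t01; apply: ccont_sum => w /cP; apply.
  have cQ' : cont_seg (fun z => (-1) *: (\sum_(w <- lf) linv w z : Co)) c z.
    move=> t t01; apply: (ccontZ (fun=> -1)); first exact: ccont_cst.
    by apply: ccont_sum => w /cQ; apply.
  have cQ'' : cont_seg (fun z => \sum_(w <- lf) linv w z : Co) c z.
    by move=> t t01; apply: ccont_sum => w /cQ; apply.
  have chP : cont_seg (fun z => logd h h' z + \sum_(w <- wf) linv w z : Co) c z.
    move=> t t01; move: (ch t t01) (cP' t t01) => a1 a2 e e0.
    have e2 : 0 < e / 2 by lra.
    have [d d0 Hd] := a1 _ e2; have [d' d0' Hd'] := a2 _ e2.
    exists (Num.min d d'); first by rewrite lt_min d0.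
    move=> y; rewrite lt_min => /andP[/Hd b1 /Hd' b2].
    by rewrite opprD addrACA (le_trans (nrD _ _))// {a1 a2}; lra.
  rewrite -(LD Co_complete _ _ _ _ ch cP') -[X in _ = _ + X]scaleN1r.
  rewrite -(LZ Co_complete _ _ _ _ cQ'') -(LD Co_complete _ _ _ _ chP cQ').
  apply: L_ext => t t01; have Ut := sg t t01.
  have hn0 : h (seg c z t) != 0 by apply: h0; exact: ltW.
  by rewrite /logd /v' /v scaleN1r; apply: logd_quot => //; [exact: prod_neq0 (P0 _ Ut)|exact: Qn0 (lt54 _ Ut)].
move=> /(_ _ _ B0 dv v0); rewrite zc LE.
move=> /(_ ltac:(move: kx; lra) ltac:(move: kx; lra) _ ltac:(move: kx; lra)) bc.
rewrite -[\sum_(l <- ls | _) _]big_filter -[\sum_(w <- ws | _) _]big_filter -/lf -/wf.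
have -> : forall a, complex.Im a - (\sum_(l <- lf) complex.Im (L (linv l) c z) -
     \sum_(w <- wf) complex.Im (L (linv w) c z)) =
   complex.Im (a + \sum_(w <- wf) L (linv w) c z - \sum_(l <- lf) L (linv l) c z).
  move=> a; rewrite cImD cImN cImD !Im_sum; move: (\sum_(_ <- _) _) (\sum_(_ <- _) _) => q q'; lra.
apply: le_trans (Im_le_nr _) _; apply: bc => y yU.
have : sn (y - c) < 45 * (k * x) by move: yU kx; rewrite /U /=; lra.
move=> /growth; apply: le_trans; rewrite -[leLHS]mulr1 ler_wpM2l ?nr_ge0//.
by apply: exprn_ege1; rewrite ler1n.
Qed.

End Window.

(** * The argument principle and the comparison of the two counts *)

Section Count.
Context {R : realType}.
Notation C := R[i].
Notation Co := (R[i]^o).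
Lemma sub_shuffle (V : zmodType) (a b c d : V) : a + b = c + d -> b - (c - a) = d.
Proof. by move=> e; rewrite opprB addrA [b + a]addrC e addrC addKr. Qed.

Lemma contour_arith (I1 I2 I3 I4 a1 a2 a3 a4 a5 a6 a7 a8 b b1 b2 : R) :
  `|I1 - (a1 - a2)| <= 4 * b -> `|I2 - (a3 - a4)| <= 4 * b ->
  `|I3 - (a5 - a6)| <= 2 * b1 -> `|I4 - (a7 - a8)| <= 2 * b2 -> I1 + I2 + I3 - I4 = 0 ->
  `|a1 + a3 + a5 - a7 - (a2 + a4 + a6 - a8)| <= 8 * b + 2 * b1 + 2 * b2.
Proof.
rewrite !ler_norml => /andP[p1 p2] /andP[p3 p4] /andP[p5 p6] /andP[p7 p8] p9.
by apply/andP; split; lra.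
Qed.

(** Passing from the open strip, counted only where both flags hold, to r <= Re < s changes the
    count by at most the number of discounted points; 6 pi is 4 pi from [sum_im4] plus 2 pi. *)
Lemma count_window (r s k eps : R) (ps : seq C) (f1 f2 : pred C) :
  0 < r -> r < s -> 0 < eps -> eps < k ->
  (forall p, p \in ps -> [/\ cone eps p, f1 p -> complex.Re p != r & f2 p -> complex.Re p != s]) ->
  `|\sum_(p <- ps) im4 r s k p (f1 p) (f2 p) -
    2 * pi * (count (fun p => r <= complex.Re p < s) ps)%:R|
  <= 6 * pi * (count (predC f1) ps + count (predC f2) ps)%:R.
Proof.
move=> r0 rs e0 ek H; have pi0 := pi_gt0 R.
have := sum_im4 r s k eps ps f1 f2 r0 rs e0 ek H.
set Q := fun p => [&& f1 p, f2 p & r < complex.Re p < s].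
set N := fun p => ~~ f1 p || ~~ f2 p; set P := fun p => r <= complex.Re p < s.
have NN : (count N ps <= count (predC f1) ps + count (predC f2) ps)%N by exact: count_diff.
have PQ : (count P ps <= count Q ps + count N ps)%N.
  elim: ps H {NN} => [|p ps IH] //= H.
  have [_ h1 _] := H p (mem_head _ _).
  have {}IH := IH (fun p h => H p (mem_behead (s := _ :: _) h)).
  suff PN : (P p <= Q p + N p)%N by rewrite addnACA leq_add.
  rewrite /P /Q /N; case: (f1 p) h1 => //=; last by case: (_ <= _); case: (_ < s).
  move=> /(_ isT) pr; case: (f2 p) => //=; last by case: (_ <= _); case: (_ < s).
  by rewrite [r < _]lt_neqAle eq_sym pr /= addn0.
have QP : (count Q ps <= count P ps)%N.
  by apply: sub_count => p; rewrite /P /Q => /and4P[_ _ /ltW -> ->].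
move: (\sum_(p <- ps) _) => S; move: NN PQ QP.
move: (count Q ps) (count N ps) (count P ps) (count (predC f1) ps) (count (predC f2) ps) => q n p a b NN PQ QP.
have {}NN : n%:R <= (a + b)%:R :> R by rewrite ler_nat.
have {}PQ : p%:R <= q%:R + n%:R :> R by rewrite -natrD ler_nat.
have {}QP : q%:R <= p%:R :> R by rewrite ler_nat.
move: (pi) pi0 ((a + b)%:R : R) (n%:R : R) (p%:R : R) (q%:R : R) NN PQ QP => w w0 c n' p' q' h1 h2 h3.
have g1 : 0 <= w * (c - n') by rewrite mulr_ge0 ?subr_ge0// ltW.
have g2 : 0 <= w * (q' + n' - p') by rewrite mulr_ge0 ?subr_ge0// ltW.
have g3 : 0 <= w * (p' - q') by rewrite mulr_ge0 ?subr_ge0// ltW.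
by rewrite !ler_norml => /andP[i1 i2]; apply/andP; split; lra.
Qed.

(** Division by 2 pi, using only pi >= 2. *)
Lemma count_arith (Sl Sw nl nw : R) (a b a' b' : nat) (T : R) :
  `|Sl - 2 * pi * nl| <= 6 * pi * (a + b)%:R -> `|Sw - 2 * pi * nw| <= 6 * pi * (a' + b')%:R ->
  `|Sl - Sw| <= T -> `|nw - nl| <= T / 4 + 3 * (a + b)%:R + 3 * (a' + b')%:R.
Proof.
move=> h1 h2 h3; have p2 := pi_ge2 R; have T0 : 0 <= T := le_trans (normr_ge0 _) h3.
move: ((a + b)%:R : R) ((a' + b')%:R : R) (pi) h1 h2 h3 p2 => c d w.
rewrite !ler_norml => /andP[p1 p3] /andP[p4 p5] /andP[p6 p7] w2.
have wT : 0 <= (w - 2) * T by rewrite mulr_ge0// subr_ge0.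
have w0 : 0 < w by lra.
apply/andP; split; rewrite leNgt; apply/negP => h.
  have := mulr_gt0 w0 (_ : 0 < - (nw - nl) - (T / 4 + 3 * c + 3 * d)); rewrite subr_gt0 ltrNr.
  by move=> /(_ ltac:(lra)); lra.
have := mulr_gt0 w0 (_ : 0 < (nw - nl) - (T / 4 + 3 * c + 3 * d)); rewrite subr_gt0.
by move=> /(_ h); lra.
Qed.

Lemma logd_id (a' d' b' c' a b c d : C) : a' * d' = b' * c' -> a' != 0 -> d' != 0 ->
  a' * a * d' + a' * d = b' * b * c' + b' * (c' * c) -> a + d / d' = b + c.
Proof.
move=> e a0 d0 e'; have e3 : a' * d' * (a + d / d') = a' * d' * (b + c).
  transitivity (a' * a * d' + a' * d); first by field.
  by rewrite e' e; ring.
by apply: (mulfI _ e3); rewrite mulf_neq0.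
Qed.

Variables (r s k eps eta K : R) (O : set C) (f : C -> Co) (ls : seq C).
Let n := size ls.

Definition sided (sg : R) : set C := [set z | O z /\ eps * complex.Re z < sg * complex.Im z].
Definition away (x : R) (p : C) := 200 * (k * x) < `|complex.Re p - x|.
Definition near_count (x : R) := count (predC (away x)) ls.

Hypotheses (r0 : 0 < r) (rs : r < s) (eps0 : 0 < eps) (epsk : eps < k) (k1 : k <= 1).
Hypotheses (eta0 : 0 <= eta) (eta1 : eta <= 1 / 4) (K1 : 1 <= K).
Hypotheses (Oo : copen O) (OC : cconvex O) (Opos : forall z, O z -> 0 < complex.Re z).
Hypothesis fholo : holo O f.
Hypothesis lsP : forall l, l \in ls -> 0 < complex.Re l /\ complex.Im l = 0.
Hypothesis OV : forall x z, r <= x <= s -> sn (z - ray k 1 x) < 54 * (k * x) -> O z.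
(** The factors 1 + y_i are kept apart because their product need not be close to 1 for large [n],
    whereas each of them has a small logarithm. *)
Hypothesis H1 : forall sg : R, sg = 1 \/ sg = -1 -> exists y : nat -> C -> Co,
  [/\ forall i, (i < n)%N -> holo (sided sg) (y i),
      forall i z, (i < n)%N -> sided sg z -> nr (y i z) <= eta &
      forall z, sided sg z -> f z = \prod_(l <- ls) (z - l) * \prod_(i < n) (1 + y i z)].
(** Far eigenvalues stay as factors, since they also occur in the lower bound at the centre; a near
    one is replaced by the scale of the window. *)
Hypothesis H2 : forall x z, x = r \/ x = s -> sn (z - ray k 1 x) < 54 * (k * x) ->
  nr (f z) <= (1 + eta) ^+ n * (K * (k * x)) ^+ near_count x *
    \prod_(l <- ls | away x l) nr (z - l).

Let k0 : 0 < k. Proof. exact: lt_trans epsk. Qed.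
Let s0 : 0 < s. Proof. exact: lt_trans rs. Qed.

Let sg_abs (sg : R) : sg = 1 \/ sg = -1 -> `|sg| = 1.
Proof. by case=> ->; rewrite ?normrN normr1. Qed.

Lemma sided_open sg : sg = 1 \/ sg = -1 -> copen (sided sg).
Proof.
move=> /sg_abs sg1 z [Oz lz]; have [d d0 Hd] := Oo z Oz.
have e1 : 0 < eps + 1 by move: eps0; lra.
exists (Num.min d ((sg * complex.Im z - eps * complex.Re z) / (eps + 1))).
  by rewrite lt_min d0 divr_gt0// subr_gt0.
move=> w; rewrite lt_min => /andP[/Hd Ow]; rewrite ltr_pdivlMr// => wz; split => //.
have hR := Re_le_nr (w - z); have hI := Im_le_nr (w - z).
move: hR hI; rewrite cReD cReN cImD cImN => hR hI.
have h1 : eps * (complex.Re w - complex.Re z) <= eps * nr (w - z).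
  by rewrite ler_pM2l// (le_trans (ler_norm _)).
have h2 : - (sg * (complex.Im w - complex.Im z)) <= nr (w - z).
  by apply: le_trans (ler_norm _) _; rewrite normrN normrM sg1 mul1r.
move: wz h1 h2; move: (nr (w - z)) => a0; lra.
Qed.

Lemma sided_convex sg : cconvex (sided sg).
Proof.
move=> p q [Op lp] [Oq lq] t t01; split; first exact: OC.
rewrite seg_ReIm /= -subr_lt0.
have -> : eps * (complex.Re p + t * (complex.Re q - complex.Re p)) -
    sg * (complex.Im p + t * (complex.Im q - complex.Im p)) =
  (eps * complex.Re p - sg * complex.Im p) + t * ((eps * complex.Re q - sg * complex.Im q)
    - (eps * complex.Re p - sg * complex.Im p)) by ring.
by apply: conv_lt; rewrite ?subr_lt0.
Qed.

Let Osided sg z : sided sg z -> O z. Proof. by case. Qed.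

Let sided_ls sg : sg = 1 \/ sg = -1 -> forall z, sided sg z -> forall l, l \in ls -> z != l.
Proof.
move=> sgP z [Oz lz] l /lsP[l0 li]; apply/eqP => zl.
move: lz; rewrite zl li mulr0 => h; have := mulr_gt0 eps0 l0; lra.
Qed.

Let onep (y : C) : nr y <= eta -> 1 + y != 0.
Proof.
move=> h; rewrite -nr_gt0; have := nr_geB 1 (- y); rewrite nr1 nrN opprK.
move: h eta1; lra.
Qed.

Let f_neq0 sg z : sg = 1 \/ sg = -1 -> sided sg z -> f z != 0.
Proof.
move=> sgP zU; have [y [_ yb fE]] := H1 sg sgP; rewrite fE// mulf_neq0//.
  by apply: prod_neq0; apply: sided_ls zU.
by apply/prodf_neq0 => i _; apply: onep; apply: yb.
Qed.

Let ray_sided x sg : r <= x <= s -> sg = 1 \/ sg = -1 -> sided sg (ray k sg x).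
Proof.
move=> xs sgP; have x0 : 0 < x by move: xs r0; lra.
have kx : 0 < k * x by exact: mulr_gt0.
split.
  apply: (OV x) => //; case: sgP => ->; first by rewrite subrr /sn /= !normr0 maxxx; lra.
  by rewrite sn_ray ?(ltW k0) ?(ltW x0)//; lra.
rewrite /ray /= !mulrA -expr2.
have -> : sg ^+ 2 = 1 by case: sgP => ->; rewrite ?expr1n ?sqrrN ?expr1n.
by rewrite mul1r ltr_pM2r.
Qed.

(** Centres of the squares in which zeros are extracted. Both ends [r] and [s] belong to the net
    because the windows there need a cofactor without zeros. *)
Let cover : exists S : seq R, [/\ forall t, t \in S -> r <= t <= s, r \in S, s \in S &
  forall u, r <= u <= s -> exists2 t, t \in S & `|u - t| <= k * r].
Proof.
pose P x y := exists S : seq R, (forall t, t \in S -> r <= t <= s) /\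
  forall u, x <= u <= y -> exists2 t, t \in S & `|u - t| <= k * r.
have kr : 0 < k * r by exact: mulr_gt0.
have [S [S1 S2]] : P r s.
  apply: cousin; first exact: ltW.
    move=> x y z _ _ _ _ [S [S1 S2]] [S' [S1' S2']]; exists (S ++ S'); split.
      by move=> t; rewrite mem_cat => /orP[/S1|/S1'].
    move=> u /andP[xu uz]; have [uy|yu] := leP u y.
      by have [|t tS tu] := S2 u; [rewrite xu|exists t; rewrite // mem_cat tS].
    by have [|t tS tu] := S2' u; [rewrite (ltW yu)|exists t; rewrite // mem_cat tS orbT].
  move=> t ts; exists (k * r) => // x y _ xt ty _ xd yd; exists [:: t]; split.
    by move=> t'; rewrite inE => /eqP ->.
  move=> u /andP[xu uy]; exists t; rewrite ?mem_head// ler_distl; apply/andP; split; lra.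
exists [:: r, s & S]; rewrite !inE !eqxx orbT; split => //.
  by move=> t; rewrite !inE => /or3P[/eqP ->|/eqP ->|/S1//]; rewrite lexx (ltW rs).
by move=> u /S2[t tS tu]; exists t; rewrite // !inE tS !orbT.
Qed.

Section Zeros.
Variables (ws : seq C) (h h' : C -> Co).
Hypothesis dh : forall z, O z -> cder h z (h' z).
Hypothesis fE : forall z, f z = \prod_(w <- ws) (z - w) * h z.
Hypothesis wsO : forall w, w \in ws -> O w.
Hypothesis h0 : forall z, O z -> r - k * r <= complex.Re z <= s + k * s -> h z != 0.
Hypothesis h0r : forall z, sn (z - ray k 1 r) <= 9 * (k * r) -> h z != 0.
Hypothesis h0s : forall z, sn (z - ray k 1 s) <= 9 * (k * s) -> h z != 0.

Lemma ws_cone w : w \in ws -> cone eps w.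
Proof.
move=> wws; have Ow := wsO w wws; split; first exact: Opos.
have fw : f w = 0 by rewrite fE (big_rem w)//= subrr !mul0r.
rewrite leNgt; apply/negP; rewrite ltr_normr => /orP[hw|hw].
  have : f w != 0 by apply: (f_neq0 1); [left|split => //; rewrite mul1r].
  by rewrite fw eqxx.
have : f w != 0 by apply: (f_neq0 (-1)); [right|split => //; rewrite mulN1r].
by rewrite fw eqxx.
Qed.

Let sided_ws sg z : sg = 1 \/ sg = -1 -> sided sg z -> forall w, w \in ws -> z != w.
Proof.
move=> sgP zU w wws; apply/eqP => zw; have := f_neq0 sg z sgP zU.
by rewrite fE zw (big_rem w)//= subrr !mul0r eqxx.
Qed.

Let sided_h sg z : sg = 1 \/ sg = -1 -> sided sg z -> h z != 0.
Proof.
by move=> sgP zU; have := f_neq0 sg z sgP zU; apply: contraNneq => hz; rewrite fE hz mulr0.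
Qed.

(** On a long side log f differs from the sum of the log(z - l) by n increments of log(1 + y_i),
    each at most 4 eta by [log_near1], however long the side is. *)
Let side sg p q : sg = 1 \/ sg = -1 -> sided sg p -> sided sg q ->
  `|complex.Im (L (logd h h') p q) -
    (\sum_(l <- ls) complex.Im (L (linv l) p q) -
     \sum_(w <- ws) complex.Im (L (linv w) p q))| <= 4 * eta * n%:R.
Proof.
move=> sgP pU qU; have [y [yh yb fy]] := H1 sg sgP.
have UC := sided_convex sg; have Uo := sided_open sg sgP.
have /choice[y' dy] : forall i, exists g : C -> Co,
    (i < n)%N -> forall z, sided sg z -> cder (y i) z (g z).
  move=> i; have [i_n|_] := boolP (i < n)%N; last by exists (fun=> 0).
  by have [g Hg] := holo_choose _ _ (yh i i_n); exists g.
pose ly (i : 'I_n) := logd (fun z => 1 + y i z) (y' i) : C -> Co.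
have dy1 (i : 'I_n) z : sided sg z -> cder (fun z => 1 + y i z : Co) z (y' i z).
  move=> zU; have := cderD _ _ _ _ _ (cder_cst (1 : Co) z) (dy i (ltn_ord i) z zU).
  by rewrite add0r.
have y1 (i : 'I_n) z : sided sg z -> 1 + y i z != 0.
  by move=> zU; apply: onep; apply: yb.
have cly i : cont_seg (ly i) p q.
  move=> t t01; apply: (holo_cont (sided sg)); last exact: UC.
  by apply: logd_holo => //; [exact: dy1|exact: y1].
have cl l : l \in ls -> cont_seg (linv l : C -> Co) p q.
  by move=> lls; apply: linv_seg_cont => t t01; apply: (sided_ls sg sgP); rewrite //; exact: UC.
have cw w : w \in ws -> cont_seg (linv w : C -> Co) p q.
  by move=> wws; apply: linv_seg_cont => t t01; apply: (sided_ws sg _ sgP); rewrite //; exact: UC.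
have ch : cont_seg (logd h h') p q.
  move=> t t01; apply: (holo_cont (sided sg)); last exact: UC.
  by apply: logd_holo => // z zU; [exact: dh (Osided _ _ zU)|exact: sided_h zU].
have scont (I : eqType) (ss : seq I) (F : I -> C -> Co) :
    (forall i, i \in ss -> cont_seg (F i) p q) ->
    cont_seg (fun z => \sum_(i <- ss) F i z : Co) p q.
  by move=> Fc t t01; apply: ccont_sum => i /Fc; apply.
have id z : sided sg z -> \sum_(w <- ws) linv w z + logd h h' z =
    \sum_(l <- ls) linv l z + \sum_(i <- index_enum 'I_n) ly i z.
  move=> zU; have Oz := Osided _ _ zU.
  have d1 := cderM _ _ _ _ _ (cder_prod_linv ws z (sided_ws sg z sgP zU)) (dh z Oz).
  have d2 := cderM _ _ _ _ _ (cder_prod_linv ls z (sided_ls sg sgP z zU))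
    (cder_prod1 n y y' z (fun i i_n => dy i i_n z zU) (fun i i_n => onep _ (yb i z i_n zU))).
  have {}d1 : cder f z _ := cder_near _ _ _ _ _ Uo zU (fun w _ => esym (fE w)) d1.
  have {}d2 : cder f z _ := cder_near _ _ _ _ _ Uo zU (fun w wU => esym (fy w wU)) d2.
  have := cder_uniq _ _ _ _ d1 d2.
  have fz := f_neq0 sg z sgP zU.
  have := fz; rewrite {1}fE mulf_eq0 negb_or => /andP[]; have := fy z zU; rewrite fE.
  by move=> e a0 d0 e'; exact: (logd_id _ _ _ _ _ _ _ _ e a0 d0 e').
have LE : \sum_(w <- ws) L (linv w) p q + L (logd h h') p q =
    \sum_(l <- ls) L (linv l) p q + \sum_(i <- index_enum 'I_n) L (ly i) p q.
  have e1 := LD Co_complete _ _ _ _ (scont _ _ _ cw) ch.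
  have e2 := LD Co_complete _ _ _ _ (scont _ _ _ cl) (scont _ (index_enum 'I_n) _ (fun i _ => cly i)).
  rewrite (L_sum _ _ _ _ _ cw) in e1.
  rewrite (L_sum _ _ _ _ _ cl) (L_sum _ (index_enum 'I_n) _ _ _ (fun i _ => cly i)) in e2.
  apply: (etrans (esym e1)); apply: etrans e2.
  by apply: L_ext => t t01; apply: id; exact: UC.
have {}LE : L (logd h h') p q - (\sum_(l <- ls) L (linv l) p q - \sum_(w <- ws) L (linv w) p q)
    = \sum_(i <- index_enum 'I_n) L (ly i) p q.
  exact: sub_shuffle LE.
rewrite (_ : _ - _ = complex.Im (L (logd h h') p q -
    (\sum_(l <- ls) L (linv l) p q - \sum_(w <- ws) L (linv w) p q))); last first.
  by rewrite [RHS]cImD cImN cImD cImN !Im_sum.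
rewrite LE.
apply: le_trans (Im_le_nr _) _; apply: le_trans (nr_sum _ _ _ _) _.
apply: (@le_trans _ _ (\sum_(i < n) (4 * eta))); last first.
  by rewrite sumr_const card_ord mulr_natr.
apply: ler_sum => i _; apply: (log_near1 (sided sg)) => //; [move: eta1; lra| exact: dy1 |].
by move=> z zU; rewrite addrC addKr; apply: yb.
Qed.

Let Om : set C := [set z | O z /\ r - k * r < complex.Re z < s + k * s].

Let Omo : copen Om.
Proof.
move=> z [Oz /andP[z1 z2]]; have [d d0 Hd] := Oo z Oz.
exists (Num.min d (Num.min (complex.Re z - (r - k * r)) (s + k * s - complex.Re z))).
  by rewrite !lt_min d0 !subr_gt0 z1.
move=> w; rewrite !lt_min => /and3P[/Hd Ow w1 w2]; split => //.
have := Re_le_nr (w - z); rewrite cReD cReN ler_norml => /andP[h1 h2].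
by apply/andP; split; lra.
Qed.

Let OmC : cconvex Om.
Proof.
move=> p q [Op /andP[p1 p2]] [Oq /andP[q1 q2]] t t01; split; first exact: OC.
rewrite seg_ReIm /=; apply/andP; split; last exact: conv_lt.
rewrite -ltrN2; have -> : - (complex.Re p + t * (complex.Re q - complex.Re p)) =
  - complex.Re p + t * (- complex.Re q - - complex.Re p) by ring.
by apply: conv_lt; rewrite ?ltrN2.
Qed.

Let contour p q u v : Om p -> Om q -> Om u -> Om v ->
  L (logd h h') p q + L (logd h h') q u + L (logd h h') u v = L (logd h h') p v.
Proof.
move=> pO qO uO vO.
have hol : holo Om (logd h h').
  by apply: logd_holo => // z [Oz /andP[z1 z2]]; [exact: dh|apply: h0; rewrite // !ltW].
have tr q' u' : Om q' -> Om u' ->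
    L (logd h h') p u' - L (logd h h') p q' = L (logd h h') q' u'.
  move=> q'O u'O; apply: (L_triangle Co_complete Om) => // s' t' s01 t01.
  by apply: OmC => //; apply: OmC.
by rewrite -(tr q u qO uO) -(tr u v uO vO); move: (L _ _ _) (L _ _ _) (L _ _ _) => a b c; ring.
Qed.

Let wfar (x : R) (p : C) := 9 * (k * x) < sn (p - ray k 1 x).

(** The exponent in the window estimate; the summand 1 only makes it positive. *)
Let B (x : R) := 3 * eta * n%:R + (near_count x)%:R * ln K + 1.

Let lnK : 0 <= ln K. Proof. exact: ln_ge0. Qed.

Let Bpos x : 0 < B x.
Proof.
rewrite /B; have h1 : 0 <= 3 * eta * n%:R by rewrite !mulr_ge0.
have h2 : 0 <= (near_count x)%:R * ln K by rewrite mulr_ge0.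
lra.
Qed.

Let Hc x : r <= x <= s -> \prod_(l <- ls) nr (ray k 1 x - l) * (1 - eta) ^+ n <= nr (f (ray k 1 x)).
Proof.
move=> xs; have sgP : (1 : R) = 1 \/ (1 : R) = -1 by left.
have U1 := ray_sided x 1 xs sgP; have [y [_ yb fy]] := H1 1 sgP; rewrite (fy _ U1).
move: (\prod_(l <- ls) (ray k 1 x - l)) (nr_prod _ ls xpredT (fun l => ray k 1 x - l)) => P <-.
have := nr_prod _ (index_enum 'I_n) xpredT (fun i => 1 + y i (ray k 1 x)).
move: (\prod_(i < n) (1 + y i (ray k 1 x))) => Q hQ; rewrite nrM ler_wpM2l ?nr_ge0// hQ.
have -> : (1 - eta) ^+ n = \prod_(i < n) (1 - eta) by rewrite prodr_const card_ord.
apply: ler_prod => i _; apply/andP; split; first by move: eta1; lra.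
have := nr_geB 1 (- y i (ray k 1 x)); rewrite nr1 nrN opprK.
have := yb i _ (ltn_ord i) U1; lra.
Qed.

Let win_count x : x = r \/ x = s -> (count (predC (wfar x)) ws)%:R <= 2 * B x.
Proof.
move=> xP; have xs : r <= x <= s by case: xP => ->; rewrite lexx (ltW rs).
have x0 : 0 < x by move: xs r0; lra.
apply: (window_count O f h h' x k eta K (B x) ls ws) => //.
- by move=> z; apply: OV.
- by move=> z; apply: H2.
- exact: Hc.
- by move=> l /lsP[].
- rewrite /B; lra.
Qed.

Let win_bound x : x = r \/ x = s ->
  `|complex.Im (L (logd h h') (ray k 1 x) (ray k (-1) x)) -
    (\sum_(l <- ls | away x l) complex.Im (L (linv l) (ray k 1 x) (ray k (-1) x)) -
     \sum_(w <- ws | wfar x w) complex.Im (L (linv w) (ray k 1 x) (ray k (-1) x)))| <= 2 * B x.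
Proof.
move=> xP; have xs : r <= x <= s by case: xP => ->; rewrite lexx (ltW rs).
have x0 : 0 < x by move: xs r0; lra.
apply: (window_bound O f h h' x k eta K (B x) ls ws) => //.
- by move=> z; apply: OV.
- by case: xP => ->.
- by move=> z; apply: H2.
- exact: Hc.
- by move=> l /lsP[].
- rewrite /B; lra.
Qed.

Let total : `|\sum_(l <- ls) im4 r s k l (away r l) (away s l) -
   \sum_(w <- ws) im4 r s k w (wfar r w) (wfar s w)| <= 8 * eta * n%:R + 2 * B r + 2 * B s.
Proof.
have rS : r <= r <= s by rewrite lexx (ltW rs).
have sS : r <= s <= s by rewrite lexx (ltW rs).
have pP : (1 : R) = 1 \/ (1 : R) = -1 by left.
have mP : (-1 : R) = 1 \/ (-1 : R) = -1 by right.
pose a := ray k (-1) r; pose b := ray k (-1) s; pose c := ray k 1 s; pose d := ray k 1 r.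
have kr : 0 < k * r by exact: mulr_gt0.
have ks : 0 < k * s by exact: mulr_gt0.
have om x sg : x = r \/ x = s -> sg = 1 \/ sg = -1 -> Om (ray k sg x).
  move=> xP sgP; split; last first.
    have -> : complex.Re (ray k sg x) = x by [].
    by case: xP => ->; apply/andP; split; move: kr ks rs; lra.
  by apply: (Osided sg); apply: ray_sided => //; case: xP => ->.
have ab := side (-1) a b mP (ray_sided _ _ rS mP) (ray_sided _ _ sS mP).
have cd := side 1 c d pP (ray_sided _ _ sS pP) (ray_sided _ _ rS pP).
have da := win_bound r (or_introl erefl).
have := win_bound s (or_intror erefl).
rewrite -!/a -!/b -!/c -!/d in da *.
have := contour a b c d (om r (-1) (or_introl erefl) mP) (om s (-1) (or_intror erefl) mP)
  (om s 1 (or_intror erefl) pP) (om r 1 (or_introl erefl) pP).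
rewrite (L_rev _ d a) (L_rev _ c b) => hL cb.
have {hL} : complex.Im (L (logd h h') a b) + complex.Im (L (logd h h') c d)
   + complex.Im (L (logd h h') d a) - complex.Im (L (logd h h') c b) = 0.
  rewrite -cImN -!cImD; move: hL.
  move: (L _ a b) (L _ c b) (L _ c d) (L _ d a) => x1 x2 x3 x4 e.
  have -> : x1 + x3 + x4 - x2 = (x1 - x2 + x3) + x4 by ring.
  by rewrite e addNr.
have sumE (ps : seq C) (f1 f2 : pred C) : \sum_(p <- ps) im4 r s k p (f1 p) (f2 p) =
    \sum_(p <- ps) complex.Im (L (linv p) a b) + \sum_(p <- ps) complex.Im (L (linv p) c d) +
    \sum_(p <- ps | f1 p) complex.Im (L (linv p) d a) -
    \sum_(p <- ps | f2 p) complex.Im (L (linv p) c b).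
  rewrite [X in _ - X]big_mkcond [X in _ + X - _]big_mkcond -sumrN -!big_split /=.
  apply: eq_bigr => p _; rewrite /im4 -/a -/b -/c -/d (L_rev _ c b) cImN.
  by case: (f2 p); rewrite ?oppr0.
rewrite -[4 * eta * n%:R]mulrA in ab; rewrite -[4 * eta * n%:R]mulrA in cd.
move=> I0; rewrite !sumE -[8 * eta * n%:R]mulrA.
exact: (contour_arith _ _ _ _ _ _ _ _ _ _ _ _ _ _ _ ab cd da cb I0).
Qed.

(** Near eigenvalues are counted by [near_count] and near zeros by Jensen's bound 2B. The sum of all
    contributions has coefficients 41, 6.5 and 13, rounded up to 44, 7 and 14. *)
Lemma zeros_count : `|(count (fun w => r <= complex.Re w < s) ws)%:R -
   (count (fun w => r <= complex.Re w < s) ls)%:R| <=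
   44 * eta * n%:R + (7 * ln K + 3) * (near_count r + near_count s)%:R + 14.
Proof.
have lcone l : l \in ls -> cone eps l.
  by move=> /lsP[l0 li]; split => //; rewrite li normr0 mulr_ge0 ?ltW.
have awN x l : 0 < x -> away x l -> complex.Re l != x.
  move=> x0; apply: contraTneq => lx; rewrite /away lx subrr normr0 -leNgt.
  by rewrite !mulr_ge0 ?ltW.
have wfN x w : w \in ws -> 0 < x -> wfar x w -> complex.Re w != x.
  move=> /ws_cone[w0 wi] x0; apply: contraTneq => wx; rewrite /wfar -leNgt.
  rewrite sn_le; move: wi; rewrite cReD cReN cImD cImN /ray /= wx subrr normr0 mul1r => wi.
  have kx : 0 < k * x by exact: mulr_gt0.
  apply/andP; split; first by move: kx; lra.
  have ex : eps * x <= k * x by rewrite ler_pM2r// ltW.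
  by apply: le_trans (ler_normB _ _) _; rewrite (ger0_norm (ltW kx)); move: wi ex kx; lra.
have Hl := count_window r s k eps ls (away r) (away s) r0 rs eps0 epsk
  (fun l lls => And3 (lcone l lls) (awN r l r0) (awN s l s0)).
have Hw := count_window r s k eps ws (wfar r) (wfar s) r0 rs eps0 epsk
  (fun w wws => And3 (ws_cone w wws) (wfN r w wws r0) (wfN s w wws s0)).
have hr := win_count r (or_introl erefl); have hs := win_count s (or_intror erefl).
apply: le_trans (count_arith _ _ _ _ _ _ _ _ _ Hl Hw total) _.
rewrite !natrD -[8 * eta * n%:R]mulrA -[44 * eta * n%:R]mulrA; move: hr hs; rewrite /B -!mulrA.
rewrite /near_count; move: (count _ ls) (count _ ls) (count _ ws) (count _ ws) => a b a' b'.
have e0 : 0 <= eta * n%:R by rewrite mulr_ge0.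
move: (eta * n%:R) (ln K) lnK e0 => e x x0 e0 hr hs.
have h1 : 0 <= a%:R * x by rewrite mulr_ge0.
have h2 : 0 <= b%:R * x by rewrite mulr_ge0.
by move: h1 h2 hr hs e0; lra.
Qed.

End Zeros.

Theorem zeros_near_reals : exists (ws : seq C) (h : C -> Co), [/\ holo O h,
  forall z, f z = \prod_(w <- ws) (z - w) * h z, forall w, w \in ws -> O w /\ cone eps w,
  forall z, O z -> r - k * r <= complex.Re z <= s + k * s -> h z != 0 &
  `|(count (fun w => r <= complex.Re w < s) ws)%:R -
    (count (fun w => r <= complex.Re w < s) ls)%:R| <=
  44 * eta * n%:R + (7 * ln K + 3) * (near_count r + near_count s)%:R + 14].
Proof.
have [S [S1 rS sS S2]] := cover.
have pP : (1 : R) = 1 \/ (1 : R) = -1 by left.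
have mP : (-1 : R) = 1 \/ (-1 : R) = -1 by right.
have [|ws [h [hh fE wsO h0]]] := factorization_seq O f [seq (ray k 1 t, 9 * (k * t)) | t <- S] Oo fholo.
  move=> _ /mapP[t /S1 ts ->] /=; have t0 : 0 < t by move: ts r0; lra.
  split; first by rewrite !mulr_gt0.
    by move=> z zt; apply: (OV t) => //; apply: lt_le_trans zt _; rewrite mulrA -natrM.
  by apply: (f_neq0 1) => //; apply: ray_sided.
have [h' dh] := holo_choose _ _ hh.
have h0t t z : t \in S -> sn (z - ray k 1 t) <= 9 * (k * t) -> h z != 0.
  by move=> tS; apply: (h0 (ray k 1 t, 9 * (k * t))); apply/mapP; exists t.
have h0z z : O z -> r - k * r <= complex.Re z <= s + k * s -> h z != 0.
  move=> Oz /andP[z1 z2].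
  have sd sg : sg = 1 \/ sg = -1 -> eps * complex.Re z < sg * complex.Im z -> h z != 0.
    move=> sgP sz; have /(_ (conj Oz sz)) := f_neq0 sg z sgP.
    by apply: contraNneq => hz; rewrite fE hz mulr0.
  have [|zc] := ltP (eps * complex.Re z) `|complex.Im z|.
    rewrite ltr_normr => /orP[h1|h1]; first by apply: (sd 1); rewrite ?mul1r.
    by apply: (sd (-1)); rewrite ?mulN1r.
  (* Only points of the cone remain, as [f] has no zero elsewhere in [O]. Such a point is close to a
     centre of the net: its real part is within 3kt of [t], its imaginary part is at most 4kt, hence
     within 5kt of that of the centre, well below 9kt. *)
  have [u us uz] : exists2 u, r <= u <= s & `|complex.Re z - u| <= k * u.
    have [zr|rz] := ltP (complex.Re z) r.
      exists r; first by rewrite lexx ltW.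
      by rewrite ltr0_norm ?subr_lt0//; move: z1; lra.
    have [zs|sz] := leP (complex.Re z) s.
      by exists (complex.Re z); rewrite ?rz// subrr normr0 mulr_ge0// ltW// (lt_le_trans r0).
    exists s; first by rewrite lexx ltW.
    by rewrite gtr0_norm ?subr_gt0//; move: z2; lra.
  have [t tS ut] := S2 u us; apply: (h0t t) => //.
  have ts := S1 t tS; have Rz := Opos z Oz.
  have t0 : 0 < t by move: ts r0; lra.
  have kt : 0 < k * t by exact: mulr_gt0.
  have krt : k * r <= k * t by rewrite ler_pM2l//; case/andP: ts.
  have kkt : k * (k * t) <= k * t by rewrite ler_piMl// ltW.
  have ku : k * u <= k * t + k * t.
    apply: (@le_trans _ _ (k * (t + k * t))); last by rewrite mulrDr lerD2l.
    by rewrite ler_pM2l//; move: ut krt; rewrite ler_distl => /andP[_ h1] h2; lra.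
  have kz : complex.Re z <= t + 3 * (k * t) /\ - (3 * (k * t)) <= complex.Re z - t.
    move: uz ut krt ku; rewrite !ler_distl => /andP[a1 a2] /andP[b1 b2] c1 c2.
    split; lra.
  have ez : eps * complex.Re z <= 4 * (k * t).
    apply: (@le_trans _ _ (k * complex.Re z)); first by rewrite ler_pM2r// ltW.
    apply: (@le_trans _ _ (k * (t + 3 * (k * t)))); first by rewrite ler_pM2l; first case: kz.
    by rewrite mulrDr mulrCA; move: kkt; lra.
  move: kz => [kz1 kz2].
  rewrite sn_le cReD cReN cImD cImN /ray /= mul1r; apply/andP; split.
    by rewrite ler_norml; apply/andP; split; move: kz1 kz2 kt; lra.
  apply: le_trans (ler_normB _ _) _; rewrite (ger0_norm (ltW kt)); move: zc ez kt; lra.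
exists ws, h; split => //.
  by move=> w wws; split; [exact: wsO|exact: (ws_cone ws h fE wsO w wws)].
apply: (zeros_count ws h h') => //.
  by move=> z; apply: h0t.
by move=> z; apply: h0t.
Qed.

End Count.

(** * Determinants of matrices with small Euclidean operator norm *)

Section MatrixBounds.
Context {R : realType}.
Notation C := R[i].
Notation Co := (R[i]^o).

Definition sqn {n} (v : 'cV[C]_n) : R := \sum_i nr (v i ord0) ^+ 2.

Definition mx_bound {n} (X : 'M[C]_n) (a : R) := forall v, sqn (X *m v) <= a ^+ 2 * sqn v.

Lemma sqn_ge0 n (v : 'cV[C]_n) : 0 <= sqn v.
Proof. by apply: sumr_ge0 => i _; rewrite exprn_ge0// nr_ge0. Qed.

Lemma sqn_coord n (v : 'cV[C]_n) i : nr (v i ord0) ^+ 2 <= sqn v.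
Proof.
rewrite /sqn (bigD1 i)//= lerDl; apply: sumr_ge0 => j _.
by rewrite exprn_ge0// nr_ge0.
Qed.

Lemma sqn_eq0 n (v : 'cV[C]_n) : sqn v = 0 -> v = 0.
Proof.
move=> v0; apply/matrixP => i j; rewrite ord1 mxE; apply: nr0_eq0; apply/eqP.
rewrite -(sqrf_eq0 (nr (v i 0))) eq_le (exprn_ge0 _ (nr_ge0 _)) andbT -v0; exact: sqn_coord.
Qed.

(** The weighted form replaces the triangle inequality, so that square roots are avoided; the weight
    t is chosen at each use. *)
Lemma sqn_add n (u v : 'cV[C]_n) (t : R) : 0 < t ->
  sqn (u + v) <= (1 + t) * sqn u + (1 + t^-1) * sqn v.
Proof.
move=> t0; rewrite /sqn !mulr_sumr -big_split /=; apply: ler_sum => i _; rewrite mxE.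
have := nrD (u i ord0) (v i ord0).
move: (nr (u i ord0)) (nr (v i ord0)) (nr_ge0 (u i ord0)) (nr_ge0 (v i ord0)) => a b a0 b0 h.
apply: (@le_trans _ _ ((a + b) ^+ 2)); first by rewrite lerXn2r ?nnegrE ?nr_ge0// addr_ge0.
rewrite -subr_ge0; have -> : (1 + t) * a ^+ 2 + (1 + t^-1) * b ^+ 2 - (a + b) ^+ 2 =
  t^-1 * (t * a - b) ^+ 2 by field; rewrite gt_eqF.
by rewrite mulr_ge0 ?invr_ge0 ?sqr_ge0// ltW.
Qed.

Lemma sqnN n (v : 'cV[C]_n) : sqn (- v) = sqn v.
Proof. by apply: eq_bigr => i _; rewrite mxE nrN. Qed.

Lemma sqn_col n m (u : 'cV[C]_n) (v : 'cV[C]_m) : sqn (col_mx u v) = sqn u + sqn v.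
Proof.
rewrite /sqn big_split_ord /=; congr (_ + _).
  by apply: eq_bigr => i _; rewrite col_mxEu.
by apply: eq_bigr => i _; rewrite col_mxEd.
Qed.

Lemma sqn_delta n (j : 'I_n) : sqn (delta_mx j ord0 : 'cV[C]_n) = 1.
Proof.
rewrite /sqn (bigD1 j)//= mxE !eqxx /= nr1 expr1n big1 ?addr0// => i ij.
by rewrite mxE (negbTE ij) /= nr0 expr0n.
Qed.

Lemma sqn_cst (a : 'cV[C]_1) : sqn a = nr (a ord0 ord0) ^+ 2.
Proof. by rewrite /sqn big_ord_recl big_ord0 addr0. Qed.

Lemma mx_entry n (X : 'M[C]_n) (a : R) i j : 0 <= a -> mx_bound X a -> nr (X i j) <= a.
Proof.
move=> a0 Xa; have := Xa (delta_mx j ord0); rewrite sqn_delta mulr1 -colE.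
move/(le_trans (sqn_coord _ _ i)); rewrite mxE => h.
by rewrite -(ler_pXn2r (n := 2)) ?nnegrE ?nr_ge0.
Qed.

Lemma det_le n (X : 'M[C]_n) (a : R) : (forall i j, nr (X i j) <= a) ->
  nr (\det X) <= (n`!)%:R * a ^+ n.
Proof.
move=> Xa; apply: le_trans (nr_sum _ _ _ _) _.
apply: (@le_trans _ _ (\sum_(s : 'S_n) a ^+ n)).
  apply: ler_sum => s _; rewrite nrM nrX nrN nr1 expr1n mul1r nr_prod.
  have -> : a ^+ n = \prod_(i < n) a by rewrite prodr_const card_ord.
  by apply: ler_prod => i _; rewrite nr_ge0 Xa.
by rewrite sumr_const card_Sn mulr_natl.
Qed.

(** The entries of X^j are at most a^j, so |det X|^j is at most n! (a^n)^j for every j, and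
    [pow_trick] removes the factorial. *)
Lemma det_bound n (X : 'M[C]_n) (a : R) : 0 <= a -> mx_bound X a -> nr (\det X) <= a ^+ n.
Proof.
case: n X => [|n] X a0 Xa; first by rewrite det_mx00 nr1 expr0.
apply: (@pow_trick _ _ _ ((n.+1)`!)%:R); [exact: nr_ge0 | exact: exprn_ge0 | move=> j].
have Xj : mx_bound (X ^+ j) (a ^+ j).
  elim: j => [|j IH] v; first by rewrite expr0 mul1mx expr1n mul1r.
  rewrite [X ^+ _]exprS -mulmxA [a ^+ j.+1]exprS exprMn -mulrA; apply: le_trans (Xa _) _.
  by rewrite ler_wpM2l ?exprn_ge0.
rewrite -nrX -exprM mulnC exprM.
have -> : (\det X) ^+ j = \det (X ^+ j).
  by elim: j {Xj} => [|j IH]; rewrite ?expr0 ?det1// exprS IH -det_mulmx exprS.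
by apply: det_le => i i'; apply: mx_entry Xj; exact: exprn_ge0.
Qed.

Lemma cder_bigprod (I : Type) (ss : seq I) (F : I -> C -> Co) z :
  (forall i, exists l, cder (F i) z l) -> exists l, cder (fun z => \prod_(i <- ss) F i z : Co) z l.
Proof.
move=> dF; elim: ss => [|i ss [l dl]].
  exists 0; apply: cder_ext (cder_cst (1 : Co) z) => // x; by rewrite big_nil.
have [l' dl'] := dF i; eexists; apply: cder_ext (cderM _ _ _ _ _ dl' dl) => // x.
by rewrite big_cons.
Qed.

Lemma holo_det (U : set C) n (X : C -> 'M[C]_n) :
  (forall i j, holo U (fun z => X z i j : Co)) -> holo U (fun z => \det (X z) : Co).
Proof.
move=> dX z zU.
have /choice[F' dF] : forall s : 'S_n, exists l, cder (fun z => (-1) ^+ s * \prod_i X z i (s i) : Co) z l.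
  move=> s; have [|l dl] := cder_bigprod _ (index_enum 'I_n) (fun i z => X z i (s i) : Co) z.
    by move=> i; exact: dX.
  by eexists; apply: cderM (cder_cst (_ : Co) z) dl.
exists (\sum_s F' s); exact: (cder_sum _ (index_enum 'S_n) _ _ _ dF).
Qed.

Lemma det_schur n (a : C) (b : 'rV[C]_n) (c : 'cV[C]_n) (D : 'M[C]_n) : D \in unitmx ->
  \det (block_mx a%:M b c D) = (a - (b *m invmx D *m c) ord0 ord0) * \det D.
Proof.
move=> Du; have E : block_mx a%:M b c D =
    block_mx 1%:M (b *m invmx D) 0 1%:M *m block_mx (a%:M - b *m invmx D *m c) 0 c D.
  by rewrite mulmx_block !mul1mx !mul0mx !add0r subrK mulmxKV.
by rewrite E det_mulmx det_ublock !det1 !mul1r det_lblock det_mx11 !mxE eqxx mulr1n.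
Qed.

Lemma near_id n (X : 'M[C]_n) (a : R) : 0 <= a -> a <= 1 / 2 -> mx_bound X a ->
  1%:M + X \in unitmx /\ forall v, sqn (invmx (1%:M + X) *m v) <= 4 * sqn v.
Proof.
move=> a0 a1 Xa; set D := 1%:M + X.
have low v : sqn v <= 4 * sqn (D *m v).
  have : v = D *m v + - (X *m v) by rewrite mulmxDl mul1mx addrK.
  move=> /(congr1 (@sqn n)) e; have := sqn_add n (D *m v) (- (X *m v)) 1 ltr01.
  rewrite -e sqnN invr1; have := Xa v.
  have h : a ^+ 2 <= 1 / 4.
    apply: (@le_trans _ _ ((1 / 2) ^+ 2)); first by rewrite lerXn2r ?nnegrE//; lra.
    by rewrite expr2; lra.
  have := ler_wpM2r (sqn_ge0 _ v) h; have := sqn_ge0 _ (D *m v).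
  by move: (sqn (D *m v)) (sqn (X *m v)) (sqn v) (a ^+ 2 * _) => *; lra.
have Du : D \in unitmx.
  rewrite -unitmx_tr -row_free_unit -kermx_eq0; apply/eqP/row_matrixP => i.
  set w := row i _; have /sub_kermxP wD : (w <= kermx D^T)%MS by exact: row_sub.
  have : D *m w^T = 0 by rewrite -[D]trmxK -trmx_mul wD trmx0.
  move=> Dw; have := low w^T; rewrite Dw.
  have -> : sqn (0 : 'cV[C]_n) = 0 by rewrite /sqn big1// => j _; rewrite mxE nr0 expr0n.
  rewrite mulr0 => h; have /sqn_eq0 w0 : sqn w^T = 0 by apply/eqP; rewrite eq_le h sqn_ge0.
  by rewrite row0 -[w]trmxK w0 trmx0.
by split => // v; apply: le_trans (low _) _; rewrite mulKVmx.
Qed.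

(** Gaussian elimination. The pivot of the first row is the Schur complement, 1 + x - b (1 + D)^-1
    c, where |x| <= a and the last term is at most 2 a^2 <= a. The bound on each pivot does not
    depend on the size, whereas det(1 + X) alone can be far from 1. *)
Lemma pivots (U : set C) n (X : C -> 'M[C]_n) (a : R) : 0 <= a -> a <= 1 / 2 ->
  (forall i j, holo U (fun z => X z i j : Co)) -> (forall z, U z -> mx_bound (X z) a) ->
  exists y : nat -> C -> Co, [/\ forall i, (i < n)%N -> holo U (y i),
    forall i z, (i < n)%N -> U z -> nr (y i z) <= 2 * a &
    forall z, U z -> \det (1%:M + X z) = \prod_(i < n) (1 + y i z)].
Proof.
move=> a0 a1; elim: n X => [|n IH] X hX bX.
  by exists (fun _ _ => 0); split=> // z _; rewrite big_ord0 det_mx00.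
pose D z : 'M[C]_n := @drsubmx _ 1 n 1 n (X z).
have DE z i j : D z i j = X z (rshift 1 i) (rshift 1 j) by rewrite !mxE.
have hD i j : holo U (fun z => D z i j : Co).
  by move=> z /(hX (rshift 1 i) (rshift 1 j))[l dl]; exists l; apply: cder_ext dl => // x; rewrite DE.
pose UL z : 'M[C]_(1, 1) := @ulsubmx _ 1 n 1 n (X z).
pose b z : 'M[C]_(1, n) := @ursubmx _ 1 n 1 n (X z).
pose c z : 'M[C]_(n, 1) := @dlsubmx _ 1 n 1 n (X z).
have blk z (v1 : 'cV[C]_1) (v2 : 'cV[C]_n) : @mulmx _ (1 + n) (1 + n) 1 (X z) (col_mx v1 v2) =
    col_mx (UL z *m v1 + b z *m v2) (c z *m v1 + D z *m v2) by rewrite -mul_block_col submxK.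
have sqn0 m : sqn (0 : 'cV[C]_m) = 0 by rewrite /sqn big1// => j _; rewrite mxE nr0 expr0n.
have bnd z v : U z -> nr ((b z *m v) ord0 ord0) ^+ 2 + sqn (D z *m v) <= a ^+ 2 * sqn v.
  move=> zU; have := bX z zU (@col_mx _ 1 n 1 0 v); rewrite blk !mulmx0 !add0r.
  by rewrite !(sqn_col 1 n) sqn0 add0r sqn_cst.
have bD z : U z -> mx_bound (D z) a.
  move=> zU v; apply: le_trans (bnd z v zU); rewrite lerDr exprn_ge0//; exact: nr_ge0.
have [y [hy by_ Ey]] := IH D hD bD.
pose y0 z : Co := \det (1%:M + X z) / \det (1%:M + D z) - 1.
have hdet m (Z : C -> 'M[C]_m) : (forall i j, holo U (fun z => Z z i j : Co)) ->
    holo U (fun z => \det (1%:M + Z z) : Co).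
  move=> hZ; apply: holo_det => i j z zU; have [l dl] := hZ i j z zU.
  eexists; apply: cder_ext (cderD _ _ _ _ _ (cder_cst (1%:M i j : Co) z) dl) => // x.
  by rewrite [RHS]mxE.
have D0 z : U z -> \det (1%:M + D z) != 0.
  by move=> zU; have [] := near_id _ _ _ a0 a1 (bD z zU); rewrite unitmxE unitfE.
exists (fun i => if i == n then y0 else y i); split.
- move=> i; rewrite ltnS leq_eqVlt; case: eqP => [_ _|_ /= /hy//] z zU.
  have [l dl] := hdet _ X hX z zU; have [l' dl'] := hdet _ D hD z zU.
  by eexists; apply: cderB (cder_cst (1 : Co) z); apply: cderM dl (cderV _ _ _ dl' (D0 z zU)).
- move=> i z; rewrite ltnS leq_eqVlt; case: eqP => [_ _|_ /= i_n zU]; last exact: by_.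
  move=> zU; have [Du Dinv] := near_id _ _ _ a0 a1 (bD z zU).
  set x := X z ord0 ord0.
  have -> : y0 z = x - (b z *m (invmx (1%:M + D z) *m c z)) ord0 ord0.
    rewrite /y0; have -> : 1%:M + X z = @block_mx _ 1 n 1 n (1 + x)%:M (b z) (c z) (1%:M + D z).
      transitivity (@block_mx _ 1 n 1 n 1%:M 0 0 1%:M + @block_mx _ 1 n 1 n (UL z) (b z) (c z) (D z)).
        by rewrite -scalar_mx_block submxK.
      rewrite add_block_mx !add0r (_ : 1%:M + UL z = (1 + x)%:M)//.
      apply/matrixP => i1 j1; rewrite !ord1 !mxE eqxx mulr1n; congr (1 + X z _ _); exact/val_inj.
    rewrite det_schur// mulfK ?D0// mulmxA; ring.
  have cb : sqn (c z) <= a ^+ 2.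
    have := bX z zU (@col_mx _ 1 n 1 (1%:M) 0); rewrite blk !mulmx0 !addr0 !mulmx1.
    rewrite !(sqn_col 1 n) sqn0 [sqn 1%:M]sqn_cst mxE eqxx nr1 expr1n addr0 mulr1; apply: le_trans.
    by rewrite lerDr sqn_ge0.
  set w := invmx _ *m c z; have wb : sqn w <= 4 * a ^+ 2.
    by apply: le_trans (Dinv (c z)) _; rewrite ler_pM2l.
  have bw : nr ((b z *m w) ord0 ord0) ^+ 2 <= (2 * a ^+ 2) ^+ 2.
    have h := bnd z w zU.
    apply: (@le_trans _ _ (a ^+ 2 * sqn w)); first by apply: le_trans h; rewrite lerDl sqn_ge0.
    have -> : (2 * a ^+ 2) ^+ 2 = a ^+ 2 * (4 * a ^+ 2) by ring.
    by rewrite ler_wpM2l ?exprn_ge0.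
  have {}bw : nr ((b z *m w) ord0 ord0) <= 2 * a ^+ 2.
    by rewrite -(ler_pXn2r (n := 2)) ?nnegrE ?nr_ge0// mulr_ge0// exprn_ge0.
  have xb : nr x <= a by apply: mx_entry (bX z zU).
  apply: le_trans (nrB _ _) _; have : 0 <= a * (1 / 2 - a) by rewrite mulr_ge0// subr_ge0.
  by move: bw xb; rewrite expr2; lra.
- move=> z zU; rewrite big_ord_recr /= eqxx.
  under eq_bigr => i _ do rewrite (ltn_eqF (ltn_ord i)).
  by rewrite -Ey// /y0 (_ : forall a : C, 1 + (a - 1) = a); [rewrite mulrC divfK ?D0|move=> a'; ring].
Qed.

Lemma mx_bound_diag n (d : 'rV[C]_n) (X : 'M[C]_n) (a t : R) : 0 <= t ->
  (forall i, nr (d ord0 i) <= t) -> mx_bound X a -> mx_bound (diag_mx d *m X) (t * a).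
Proof.
move=> t0 dt Xa v; rewrite exprMn -mulrA; apply: le_trans (_ : t ^+ 2 * sqn (X *m v) <= _); last first.
  by rewrite ler_wpM2l ?exprn_ge0.
rewrite -mulmxA mul_diag_mx /sqn mulr_sumr; apply: ler_sum => i _; rewrite mxE nrM exprMn.
by rewrite ler_wpM2r ?exprn_ge0 ?nr_ge0// lerXn2r ?nnegrE ?nr_ge0.
Qed.

Lemma mx_bound_add n (d : 'rV[C]_n) (X : 'M[C]_n) (a : R) : 0 < a ->
  (forall i, nr (d ord0 i) <= 1) -> mx_bound X a -> mx_bound (diag_mx d + X) (1 + a).
Proof.
move=> a0 d1 Xa v; rewrite mulmxDl.
have bd : sqn (diag_mx d *m v) <= sqn v.
  rewrite mul_diag_mx /sqn; apply: ler_sum => i _; rewrite mxE nrM exprMn.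
  by rewrite ler_piMl ?exprn_ge0 ?nr_ge0// exprn_ile1 ?nr_ge0.
apply: le_trans (sqn_add _ _ _ _ a0) _.
apply: (@le_trans _ _ ((1 + a) * sqn v + (1 + a^-1) * (a ^+ 2 * sqn v))).
  apply: lerD; first by rewrite ler_pM2l ?addr_gt0.
  by rewrite ler_pM2l ?addr_gt0 ?invr_gt0.
rewrite le_eqVlt; apply/orP; left; apply/eqP; field; exact: lt0r_neq0.
Qed.

End MatrixBounds.

(** * Zeros of the perturbed characteristic determinant *)

Section MatrixCount.
Context {R : realType}.
Notation C := R[i].
Notation Co := (R[i]^o).
Variables (n : nat) (r s k eps kappa K : R) (O : set C) (lam : 'I_n -> R) (Y : C -> 'M[C]_n).
Hypotheses (r0 : 0 < r) (rs : r < s) (eps0 : 0 < eps) (epsk : eps < k) (k1 : k <= 1).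
Hypotheses (kappa0 : 0 < kappa) (kappa1 : 16 * kappa <= eps) (K620 : 620 <= K).
Hypotheses (Oo : copen O) (OC : cconvex O) (Opos : forall z, O z -> 0 < complex.Re z).
Hypothesis OV : forall x z, r <= x <= s -> sn (z - ray k 1 x) < 54 * (k * x) -> O z.
Hypothesis lam0 : forall i, 0 < lam i.
Hypothesis hY : forall i j, holo O (fun z => Y z i j : Co).
Hypothesis bY : forall z, O z -> mx_bound (Y z) kappa.

(** It is z - Lam (1 + Y) with Lam the diagonal matrix of the eigenvalues: the perturbation is
    relative, so a row with a small eigenvalue has a small error. *)
Definition char_mx (z : C) : 'M[C]_n :=
  diag_mx (\row_i (z - (lam i)%:C)) + diag_mx (\row_i (- (lam i)%:C)) *m Y z.

Let ls := [seq (lam i)%:C | i <- enum 'I_n].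

Let k0 : 0 < k. Proof. exact: lt_trans epsk. Qed.

Let size_ls : size ls = n. Proof. by rewrite size_map size_enum_ord. Qed.

Let char_mxE z (d e g : 'rV[C]_n) :
  (forall i, d ord0 i * e ord0 i = z - (lam i)%:C) ->
  (forall i, d ord0 i * g ord0 i = - (lam i)%:C) ->
  char_mx z = diag_mx d *m (diag_mx e + diag_mx g *m Y z).
Proof.
move=> de dg; rewrite mulmxDr mulmxA !mulmx_diag; congr (diag_mx _ + diag_mx _ *m _).
  by apply/rowP => i; rewrite !mxE de.
by apply/rowP => i; rewrite !mxE dg.
Qed.

Let ratio (l z : C) : l = (complex.Re l)%:C -> 0 < complex.Re l -> z - l != 0 ->
  complex.Re l * eps <= 2 * nr (z - l) -> nr (- l / (z - l)) <= 2 / eps.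
Proof.
move=> lE lr z0 h; rewrite nrM nrN nrV {1}lE nrR gtr0_norm//.
by rewrite ler_pdivrMr ?nr_gt0// mulrAC ler_pdivlMr.
Qed.

Let a := 2 * kappa / eps.
Let a0 : 0 < a. Proof. by rewrite divr_gt0// mulr_gt0. Qed.
Let a1 : a <= 1 / 8. Proof. by rewrite ler_pdivrMr//; move: kappa1; lra. Qed.
Let aE : 2 / eps * kappa = a. Proof. by rewrite /a mulrAC. Qed.

(** Off the cone |z - lam_i| is at least eps lam_i / 2, so dividing row i by z - lam_i leaves 1 + X
    with norm of X at most a = 2 kappa / eps, and [pivots] gives the factors of [H1]. In a window
    the rows are scaled differently and [det_bound] gives [H2]. *)
Theorem matrix_zeros_near_reals : exists (ws : seq C) (h : C -> Co), [/\ holo O h,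
  forall z, \det (char_mx z) = \prod_(w <- ws) (z - w) * h z, forall w, w \in ws -> O w /\ cone eps w,
  forall z, O z -> r - k * r <= complex.Re z <= s + k * s -> h z != 0 &
  `|(count (fun w => r <= complex.Re w < s) ws)%:R -
    (count (fun w => r <= complex.Re w < s) ls)%:R| <=
  44 * (2 * a) * n%:R + (7 * ln K + 3) * (near_count k ls r + near_count k ls s)%:R + 14].
Proof.
rewrite (_ : (n%:R : R) = (size ls)%:R); last by rewrite size_ls.
apply: (zeros_near_reals r s k eps (2 * a) K O (fun z => \det (char_mx z)) ls) => //.
- by rewrite mulr_ge0// ltW.
- by move: a1; lra.
- by move: K620; lra.
- apply: holo_det => i j z Oz; have [l dl] := hY i j z Oz.
  eexists; apply: cder_ext (cderD _ _ _ _ _ (cderZc ((i == j)%:R) _ _ _ (cder_subc (lam i)%:C z))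
    (cderZc (- (lam i)%:C) _ _ _ dl)) => // x.
  by rewrite /char_mx mul_diag_mx !mxE; congr (_ + _); apply: mulr_natl.
- by move=> _ /mapP[i _ ->] /=.
- move=> sg sgP; rewrite size_ls.
  have zlam z : sided eps O sg z -> forall i, z - (lam i)%:C != 0.
    move=> [Oz hz] i; rewrite subr_eq0; apply/eqP => zl; move: hz; rewrite zl /= mulr0.
    by rewrite ltNge mulr_ge0 ?ltW.
  pose g z := \row_i (- (lam i)%:C / (z - (lam i)%:C)) : 'rV[C]_n.
  have [||i j z zU|z zU|y [hy by_ Ey]] := pivots (sided eps O sg) n (fun z => diag_mx (g z) *m Y z) a.
  + exact: ltW.
  + by move: a1; lra.
  + have [l dl] := hY i j z (proj1 zU).
    eexists; apply: cder_ext (cderM _ _ _ _ _ (cderM _ _ _ _ _ (cder_cst (- (lam i)%:C : Co) z)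
      (cderV _ _ _ (cder_subc (lam i)%:C z) (zlam z zU i))) dl) => // x.
    by rewrite mul_diag_mx !mxE.
  + rewrite -aE; apply: mx_bound_diag; [by rewrite divr_ge0// ltW | | exact: bY (proj1 zU)].
    move=> i; rewrite mxE; apply: ratio; [by []|exact: lam0|exact: zlam|].
    have [Oz hz] := zU; have hR := Re_le_nr (z - (lam i)%:C); have hI := Im_le_nr (z - (lam i)%:C).
    move: hR hI; rewrite cReD cReN cImD cImN /= subr0 => hR hI.
    have h1 : eps * complex.Re z < `|complex.Im z|.
      by apply: lt_le_trans hz _; case: sgP => ->; rewrite ?mul1r ?mulN1r ?ler_norm// -normrN ler_norm.
    have h2 : eps * (lam i - complex.Re z) <= 1 * nr (z - (lam i)%:C).
      apply: (@le_trans _ _ (eps * nr (z - (lam i)%:C))).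
        by rewrite ler_pM2l// (le_trans _ hR)// distrC ler_norm.
      by rewrite ler_wpM2r ?nr_ge0//; move: epsk k1; lra.
    move: h1 h2 hI; move: (nr _) `|complex.Im z| => b c; lra.
  exists y; split => //.
  move=> z zU; rewrite (char_mxE z (\row_i (z - (lam i)%:C)) (const_mx 1) (g z)).
  + rewrite det_mulmx diag_const_mx Ey// det_diag /ls big_map big_enum /=; congr (_ * _).
    by apply: eq_bigr => i _; rewrite mxE.
  + by move=> i; rewrite !mxE mulr1.
  + by move=> i; rewrite !mxE mulrC divfK// zlam.
- move=> x z xP zx; rewrite size_ls.
  have x0 : 0 < x by case: xP => ->; rewrite // (lt_trans r0).
  have kx : 0 < k * x by rewrite mulr_gt0.
  have Kkx : 620 * (k * x) <= K * (k * x) by rewrite ler_pM2r.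
  pose aw i := away k x (lam i)%:C.
  have Kx : 0 < K * (k * x) by rewrite mulr_gt0//; move: K620; lra.
  have kxC : (K * (k * x))%:C != 0 :> C by apply/eqP => -[] e; move: Kx; rewrite e ltxx.
  move: zx; rewrite sn_lt cReD cReN cImD cImN /ray /= mul1r => /andP[zR zI].
  have awP i : aw i -> 0 < nr (z - (lam i)%:C) /\ lam i * eps <= 2 * nr (z - (lam i)%:C).
    rewrite /aw /away /= => h; have hR := Re_le_nr (z - (lam i)%:C).
    rewrite cReD cReN /= in hR.
    have h1 : `|lam i - x| <= `|complex.Re z - lam i| + `|complex.Re z - x|.
      by rewrite [X in _ <= X + _]distrC ler_distD.
    have h2 : lam i * eps <= lam i * k by rewrite ler_pM2l// ltW.
    have h3 : lam i * k <= (x + `|lam i - x|) * k.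
      by rewrite ler_pM2r// -lerBlDl ler_norm.
    have h4 : `|lam i - x| * k <= `|lam i - x| by rewrite ler_piMr.
    by split; move: h hR h1 h2 h3 h4 zR kx; move: (nr _) `|lam i - x| `|_ - lam i| `|_ - x| => *; lra.
  have nwP i : ~~ aw i -> nr (z - (lam i)%:C) <= K * (k * x) /\ lam i * eps <= 2 * (K * (k * x)).
    rewrite /aw /away /= -leNgt => h; have hz := ReIm_ge_nr (z - (lam i)%:C).
    rewrite cReD cReN cImD cImN /= subr0 in hz.
    have h1 : `|complex.Re z - lam i| <= `|complex.Re z - x| + `|lam i - x|.
      by rewrite [X in _ <= _ + X]distrC ler_distD.
    have h0 : `|complex.Im z| <= `|complex.Im z - k * x| + k * x.
      by rewrite -{1}(subrK (k * x) (complex.Im z)) (le_trans (ler_normD _ _))// lerD2l ger0_norm// ltW.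
    have h2 : lam i * eps <= lam i * k by rewrite ler_pM2l// ltW.
    have h3 : lam i * k <= (x + 200 * (k * x)) * k.
      by rewrite ler_pM2r// -lerBlDl (le_trans (ler_norm _)).
    have h4 : k * x * k <= k * x by rewrite ler_piMr// ltW.
    by split; move: Kkx hz h1 h2 h3 h4 h0 zR zI h kx; move: (nr _) `|lam i - x| `|_ - lam i| `|_ - x| `|complex.Im z| `|_ - k * x| => *; lra.
  (* Far rows are divided by z - lam_i, near rows by K k x. What remains is a diagonal part with
     entries at most 1 plus a perturbation of norm at most [a]. For a near row |z - lam_i| is at
     most 309 k x: 54 + 200 for the real part and 55 for the imaginary part. *)
  pose d := \row_i (if aw i then z - (lam i)%:C else (K * (k * x))%:C) : 'rV[C]_n.
  pose e := \row_i (if aw i then 1 else (z - (lam i)%:C) / (K * (k * x))%:C) : 'rV[C]_n.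
  pose g := \row_i (if aw i then - (lam i)%:C / (z - (lam i)%:C)
    else - (lam i)%:C / (K * (k * x))%:C) : 'rV[C]_n.
  have aw0 i : aw i -> z - (lam i)%:C != 0 by move=> /awP[h _]; rewrite -nr_gt0.
  have kxn : nr ((K * (k * x))%:C : C) = K * (k * x) by rewrite nrR gtr0_norm.
  rewrite (char_mxE z d e g); first last.
  + by move=> i; rewrite !mxE; case: ifP => [/aw0 h|_]; rewrite mulrC divfK.
  + by move=> i; rewrite !mxE; case: ifP => [_|_]; rewrite ?mulr1// mulrC divfK.
  rewrite det_mulmx det_diag nrM nr_prod.
  have -> : \prod_i nr (d ord0 i) = (K * (k * x)) ^+ near_count k ls x *
      \prod_(l <- ls | away k x l) nr (z - l).
    have -> : near_count k ls x = #|[pred i | ~~ aw i]|.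
      by rewrite /near_count /ls count_map -sum1_count -sum1_card big_enum_cond; apply: eq_bigl.
    rewrite (bigID aw) /= mulrC -(prodr_const [pred i | ~~ aw i]); congr (_ * _).
      by apply: eq_bigr => i; rewrite /d mxE => /negbTE ->; rewrite kxn.
    by rewrite /ls big_map big_enum_cond /=; apply: eq_big => i //; rewrite /d mxE => ->.
  rewrite mulrC -mulrA; apply: ler_wpM2r.
    by rewrite mulr_ge0 ?exprn_ge0 ?(ltW Kx)//; apply: prodr_ge0 => *; exact: nr_ge0.
  apply: (@le_trans _ _ ((1 + a) ^+ n)); last first.
    by rewrite lerXn2r ?nnegrE ?addr_ge0//; move: a0; lra.
  apply: det_bound; first by rewrite addr_ge0// ltW.
  apply: mx_bound_add => //.
    move=> i; rewrite mxE; case: ifP => [_|/negbT/nwP[h _]]; first by rewrite nr1.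
    by rewrite nrM nrV kxn ler_pdivrMr // mul1r.
  rewrite -aE; apply: mx_bound_diag; first by rewrite divr_ge0// ltW.
    move=> i; rewrite mxE; case: ifP => [iaw|/negbT/nwP[_ h]].
      by have [h1 h2] := awP i iaw; apply: ratio; [|exact: lam0|exact: aw0|].
    rewrite nrM nrN nrV kxn nrR gtr0_norm// ler_pdivrMr//.
    by rewrite mulrAC ler_pdivlMr.
  apply: bY; apply: (OV x); first by case: xP => ->; rewrite lexx (ltW rs).
  by rewrite sn_lt cReD cReN cImD cImN /ray /= mul1r zR.
Qed.

End MatrixCount.

(** * Inner products and bounded operators *)

Section InnerProduct.
Context {R : realType} {H : hilbertType R}.
Notation C := R[i].
Notation Co := (R[i]^o).
Implicit Types u v w x : H.

Lemma ipDl u v w : inner (u + v) w = inner u w + inner v w.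
Proof. exact: linearDl. Qed.

Lemma ipDr u v w : inner u (v + w) = inner u v + inner u w.
Proof. exact: linearDr. Qed.

Lemma ipZl a u v : inner (a *: u) v = a * inner u v.
Proof. exact: linearZl_LR. Qed.

Lemma ipZr a u v : inner u (a *: v) = (a^*)%C * inner u v.
Proof. exact: linearZr_LR. Qed.

Lemma ipNl u v : inner (- u) v = - inner u v. Proof. exact: linearNl. Qed.
Lemma ipNr u v : inner u (- v) = - inner u v. Proof. exact: linearNr. Qed.
Lemma ip0l u : inner 0 u = 0. Proof. exact: linear0l. Qed.
Lemma ip0r u : inner u 0 = 0. Proof. exact: linear0r. Qed.
Lemma ipBl u v w : inner (u - v) w = inner u w - inner v w.
Proof. by rewrite ipDl ipNl. Qed.
Lemma ipBr u v w : inner u (v - w) = inner u v - inner u w.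
Proof. by rewrite ipDr ipNr. Qed.

Lemma ipC u v : inner u v = ((inner v u)^*)%C.
Proof. by rewrite hermC /= expr0 mul1r. Qed.

Lemma ip_suml (I : Type) (s : seq I) (F : I -> H) v :
  inner (\sum_(i <- s) F i) v = \sum_(i <- s) inner (F i) v.
Proof. exact: linear_sumlz. Qed.

Lemma ip_nr u : inner u u = (nr u ^+ 2)%:C.
Proof. by rewrite -inner_norm nrE rmorphXn. Qed.

Lemma ip_eq0C u v : inner u v = 0 -> inner v u = 0.
Proof. by move=> h; rewrite ipC h conjc0. Qed.

Lemma pythagoras u v : inner u v = 0 -> nr (u + v) ^+ 2 = nr u ^+ 2 + nr v ^+ 2.
Proof.
move=> uv; apply: (@complexI R); rewrite -ip_nr ipDl !ipDr uv (ip_eq0C _ _ uv).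
by rewrite add0r addr0 !ip_nr rmorphD.
Qed.

Lemma cauchy_schwarz u v : nr (inner u v) <= nr u * nr v.
Proof.
have [->|v0] := eqVneq v 0; first by rewrite ip0r !nr0 mulr0.
have nv : 0 < nr v by rewrite nr_gt0.
have nvC : (nr v ^+ 2)%:C != 0 :> C by rewrite -ip_nr ip_nr; apply/eqP => -[] /eqP; rewrite sqrf_eq0 gt_eqF.
pose a : C := inner u v / (nr v ^+ 2)%:C.
have p : inner (u - a *: v) (a *: v) = 0.
  by rewrite ipZr ipBl ipZl ip_nr divfK// subrr mulr0.
have := pythagoras _ _ p; rewrite subrK => h.
have : nr (a *: v) ^+ 2 <= nr u ^+ 2 by rewrite h lerDr exprn_ge0// nr_ge0.
rewrite (ler_pXn2r (n := 2)) ?nnegrE ?nr_ge0// nrZ nrM nrV nrR ger0_norm ?exprn_ge0 ?nr_ge0//.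
by rewrite expr2 invfM mulrA divfK ?gt_eqF// ler_pdivrMr.
Qed.

Lemma ip_nr_eq u v : (forall w, inner u w = inner v w) -> u = v.
Proof.
move=> h; apply/eqP; rewrite -subr_eq0; apply/eqP; apply: nr0_eq0; apply/eqP.
have : inner (u - v) (u - v) = 0 by rewrite ipBl h subrr.
by rewrite ip_nr => -[] /eqP; rewrite sqrf_eq0.
Qed.

End InnerProduct.

Section Operators.
Context {R : realType} {H : hilbertType R}.
Notation C := R[i].
Notation Co := (R[i]^o).
Implicit Types (S T X : bop H) (u v : H).

Lemma bounded_opP (f : H -> H) (M : R) : linear f -> (forall u, nr (f u) <= M * nr u) ->
  f \in @bounded_operator R H.
Proof.
move=> fl fM; apply/asboolP; split=> // x; apply/cvgrPdist_le => e e0.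
have M1 : 0 < `|M| + 1 by rewrite ltr_pwDr.
have er : e = (complex.Re e)%:C by rewrite RRe_real// gtr0_real.
have e0' : 0 < complex.Re e by move: e0; rewrite {1}er ltcR.
near=> y; rewrite er -nr_le.
have -> : f x - f y = f (x - y) by rewrite -{1}(subrK y x) -{1}[x - y]scale1r fl scale1r addrK.
apply: le_trans (fM _) _; apply: (@le_trans _ _ ((`|M| + 1) * nr (x - y))).
  by rewrite ler_wpM2r ?nr_ge0// (le_trans (ler_norm _))// lerDl.
rewrite mulrC -ler_pdivlMr// nr_le.
near: y; apply: (@cvgr_dist_le _ _ _ (nbhs x)); first exact: cvg_id.
by rewrite ltcR divr_gt0.
Unshelve. all: by end_near.
Qed.

Lemma bopD S T u : (S + T) u = S u + T u. Proof. by []. Qed.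
Lemma bopN S u : (- S) u = - S u. Proof. by []. Qed.
Lemma bopB S T u : (S - T) u = S u - T u. Proof. by []. Qed.
Lemma bopZ (a : C) T u : (a *: T) u = a *: T u. Proof. by []. Qed.
Lemma bopM S T u : (S * T) u = S (T u). Proof. by []. Qed.
Lemma bop1 u : (1 : bop H) u = u. Proof. by []. Qed.
Lemma bop_sum (I : Type) (s : seq I) (F : I -> bop H) u : (\sum_(i <- s) F i) u = \sum_(i <- s) F i u.
Proof. by elim: s => [|i s IH]; rewrite ?big_nil// !big_cons bopD IH. Qed.

Lemma nr_opnorm T : nr T = sup [set nr (T x) | x in [set x : H | `|x| <= 1]].
Proof. by []. Qed.

Lemma nr_app T u : nr (T u) <= nr T * nr u.
Proof.
have [->|u0] := eqVneq u 0; first by rewrite linear0 !nr0 mulr0.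
have nu : 0 < nr u by rewrite nr_gt0.
rewrite -ler_pdivrMr// nr_opnorm; apply: ub_le_sup.
  have /linear_bounded_continuous/linear_boundedP := @bop_continuous R H T.
  move=> /pinfty_ex_gt0[M M0 TM]; exists (complex.Re M) => _ [x /= x1 <-].
  rewrite nr_le RRe_real ?gtr0_real//.
  by rewrite (le_trans (TM x))// ler_piMr// ltW.
exists ((nr u)^-1%:C *: u) => /=.
  by rewrite -[1]/(1%:C) -nr_le nrZ nrR ger0_norm ?invr_ge0 ?nr_ge0// mulVf// gt_eqF.
by rewrite linearZ nrZ nrR ger0_norm ?invr_ge0 ?nr_ge0// mulrC.
Qed.

Lemma nr_app_le T u (M : R) : nr T <= M -> nr (T u) <= M * nr u.
Proof. by move=> h; apply: le_trans (nr_app T u) _; rewrite ler_wpM2r ?nr_ge0. Qed.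

Lemma nr_bop_le T (M : R) : 0 <= M -> (forall u, nr (T u) <= M * nr u) -> nr T <= M.
Proof.
move=> M0 h; rewrite nr_opnorm; apply: ge_sup.
  by exists (nr (T 0)), 0; rewrite //= normr0.
move=> y [x xB <-]; have x1 : nr x <= 1 by rewrite nr_le.
by apply: le_trans (h x) _; rewrite ler_piMr.
Qed.

Lemma nr_comp S T : nr (S * T) <= nr S * nr T.
Proof.
apply: nr_bop_le => [|u]; first by rewrite mulr_ge0 ?nr_ge0.
by rewrite bopM -mulrA (le_trans (nr_app _ _))// ler_wpM2l ?nr_ge0// nr_app.
Qed.

Lemma nr_bop1 : nr (1 : bop H) <= 1.
Proof. by apply: nr_bop_le => // u; rewrite mul1r. Qed.

Lemma bop_complete : seq_complete (bop H).
Proof.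
move=> T Tc; have Hc : seq_complete H by exact: complete_seq_complete.
have /choice[f fP] : forall u, exists l, ntends (fun n => T n u) l.
  move=> u; apply: Hc => e e0; have nu : 0 < nr u + 1 by rewrite ltr_wpDl ?nr_ge0.
  have [N HN] := Tc (e / (nr u + 1)) (divr_gt0 e0 nu); exists N => n m Nn Nm.
  rewrite -bopB; apply: le_trans (nr_app_le _ _ _ (HN n m Nn Nm)) _.
  by rewrite -mulrA ler_piMr ?(ltW e0)// mulrC ler_pdivrMr// mul1r lerDl.
have fl : linear f.
  move=> a u v; apply: ntends_uniq (fP _) _.
  apply: ntends_eq (ntendsD _ _ _ _ (ntendsZ _ _ a (fP u)) (fP v)) => n.
  by rewrite linearP.
have Tf e : 0 < e -> exists N, forall n, (N <= n)%N -> forall u, nr (T n u - f u) <= e * nr u.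
  move=> e0; have [N HN] := Tc e e0; exists N => n Nn u; rewrite nrC.
  apply: (@ntends_le _ _ (fun k => T (k + N)%N u - T n u)).
    apply: ntendsB (ntends_cst _); move=> e' e0'; have [N' HN'] := fP u e' e0'.
    by exists N' => k N'k; apply: HN'; rewrite (leq_trans N'k)// leq_addr.
  by move=> k; rewrite -bopB; apply: nr_app_le; apply: HN => //; rewrite leq_addl.
have [N HN] := Tf 1 ltr01.
have fb : f \in @bounded_operator R H.
  apply: (bounded_opP f (nr (T N) + 1)) => // u.
  have -> : f u = T N u - (T N u - f u) by rewrite subKr.
  by rewrite mulrDl (le_trans (nrB _ _))// lerD ?nr_app// HN.
exists (Bop fb) => e e0; have [M HM] := Tf e e0; exists M => n Mn.
by apply: nr_bop_le; [exact: ltW|move=> u; rewrite bopB; exact: HM].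
Qed.

Lemma rk_subproof (x e : H) : (fun u => inner u e *: x) \in @bounded_operator R H.
Proof.
apply: (bounded_opP _ (nr e * nr x)).
  by move=> a u v; rewrite ipDl ipZl scalerDl scalerA.
by move=> u; rewrite nrZ mulrAC ler_wpM2r ?nr_ge0// mulrC cauchy_schwarz.
Qed.

Definition rk (x e : H) : bop H := Bop (rk_subproof x e).

Lemma rkE x e u : rk x e u = inner u e *: x. Proof. by []. Qed.

Lemma nr_rk x e : nr (rk x e) <= nr x * nr e.
Proof.
apply: nr_bop_le => [|u]; first by rewrite mulr_ge0 ?nr_ge0.
by rewrite rkE nrZ mulrC -mulrA ler_wpM2l ?nr_ge0// mulrC cauchy_schwarz.
Qed.

Lemma expr_bop_le X (n : nat) : nr (X ^+ n) <= nr X ^+ n.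
Proof.
elim: n => [|n IH]; first by rewrite !expr0 nr_bop1.
by rewrite !exprS (le_trans (nr_comp _ _))// ler_wpM2l ?nr_ge0.
Qed.

Lemma ntends_compl S (T : nat -> bop H) (L : bop H) : ntends T L -> ntends (fun n => S * T n) (S * L).
Proof.
move=> TL e e0; have nS : 0 < nr S + 1 by rewrite ltr_wpDl ?nr_ge0.
have [N HN] := TL (e / (nr S + 1)) (divr_gt0 e0 nS); exists N => n Nn.
rewrite -mulrBr (le_trans (nr_comp _ _))//.
apply: (@le_trans _ _ ((nr S + 1) * (e / (nr S + 1)))); last by rewrite mulrC divfK ?gt_eqF.
by apply: ler_pM; rewrite ?nr_ge0 ?lerDl// HN.
Qed.

Lemma ntends_compr S (T : nat -> bop H) (L : bop H) : ntends T L -> ntends (fun n => T n * S) (L * S).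
Proof.
move=> TL e e0; have nS : 0 < nr S + 1 by rewrite ltr_wpDl ?nr_ge0.
have [N HN] := TL (e / (nr S + 1)) (divr_gt0 e0 nS); exists N => n Nn.
rewrite -mulrBl (le_trans (nr_comp _ _))//.
apply: (@le_trans _ _ ((e / (nr S + 1)) * (nr S + 1))); last by rewrite divfK ?gt_eqF.
by apply: ler_pM; rewrite ?nr_ge0 ?lerDl// HN.
Qed.

Lemma neumann X : nr X <= 1 / 2 -> exists S, [/\ S * (1 - X) = 1, (1 - X) * S = 1 & nr S <= 2].
Proof.
move=> X2; pose s n : bop H := \sum_(k < n) X ^+ k.
have Xn n : nr (X ^+ n) <= 2^-1 ^+ n.
  apply: le_trans (expr_bop_le _ _) _; rewrite lerXn2r ?nnegrE ?nr_ge0//; lra.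
have sS n : s n.+1 = s n + X ^+ n by rewrite /s big_ord_recr.
have sd n k : nr (s (n + k)%N - s n) <= 2 * 2^-1 ^+ n - 2 * 2^-1 ^+ (n + k).
  elim: k => [|k IH]; first by rewrite addn0 subrr nr0 subrr.
  rewrite addnS sS addrAC (le_trans (nrD _ _))//.
  apply: le_trans (lerD IH (Xn _)) _; rewrite exprS; move: (2^-1 ^+ (n + k)) (2^-1 ^+ n) => a b; lra.
have p2 n : 0 < 2^-1 ^+ n :> R by apply: exprn_gt0; lra.
have sc : cauchyn s.
  move=> e e0; have [N HN] := pow_half_lt (e / 2) ltac:(lra).
  have key n k : (N <= n)%N -> nr (s (n + k)%N - s n) <= e.
    move=> Nn; apply: le_trans (sd n k) _; have h1 := p2 (n + k)%N.
    have h2 : 2^-1 ^+ n <= 2^-1 ^+ N :> R by rewrite ler_wiXn2l//; lra.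
    lra.
  exists N => n m Nn Nm; have [nm|/ltnW mn] := leqP n m.
    by rewrite nrC -(subnKC nm); apply: key.
  by rewrite -(subnKC mn); apply: key.
have [S sSl] := bop_complete s sc; exists S.
have X0 : ntends (fun n => 1 - X ^+ n) (1 : bop H).
  move=> e e0; have [N HN] := pow_half_lt e e0; exists N => n Nn.
  rewrite addrC addKr nrN; apply: le_trans (Xn n) _; apply: le_trans (ltW HN).
  by rewrite ler_wiXn2l//; lra.
have e1 n : s n * (1 - X) = 1 - X ^+ n.
  elim: n => [|n IH]; first by rewrite /s big_ord0 mul0r expr0 subrr.
  by rewrite sS mulrDl IH mulrBr mulr1 -exprSr addrA subrK.
have e2 n : (1 - X) * s n = 1 - X ^+ n.
  elim: n => [|n IH]; first by rewrite /s big_ord0 mulr0 expr0 subrr.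
  by rewrite sS mulrDr IH mulrBl mul1r -exprS addrA subrK.
split.
- by apply: ntends_uniq (ntends_eq _ _ _ e1 (ntends_compr _ _ _ sSl)) X0.
- by apply: ntends_uniq (ntends_eq _ _ _ e2 (ntends_compl _ _ _ sSl)) X0.
- apply: ntends_le sSl _ => n; have := sd 0%N n; rewrite add0n /s big_ord0 subr0 expr0 mulr1.
  by have := p2 n; rewrite -/(s n); lra.
Qed.

Definition is_inv S T := S * T = 1 /\ T * S = 1.

Lemma is_inv_uniq T S S' : is_inv S T -> is_inv S' T -> S = S'.
Proof. by move=> [h1 _] [_ h2]; rewrite -[S]mulr1 -h2 mulrA h1 mul1r. Qed.

Lemma op_invP T : op_invertible T -> is_inv (op_inv T) T.
Proof. by move=> [S HS]; rewrite /op_inv; case: xgetP => [S' _ //|/(_ S)]. Qed.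

Lemma op_inv_eq T S : is_inv S T -> op_inv T = S.
Proof. by move=> h; apply: (is_inv_uniq T) => //; apply: op_invP; exists S. Qed.

Lemma sub_opp (V : zmodType) (a b z : V) : a + z = b -> a - b = - z.
Proof. by move=> <-; rewrite opprD addrA subrr add0r. Qed.

Lemma inv_perturb T S (E : bop H) : is_inv S T -> nr S * nr E <= 1 / 2 ->
  exists S', [/\ is_inv S' (T + E), nr S' <= 2 * nr S & nr (S' - S) <= 2 * nr S ^+ 2 * nr E].
Proof.
move=> [ST TS] h; have [|Y [Y1 Y2 Yn]] := neumann (- (S * E)).
  by rewrite nrN (le_trans (nr_comp _ _)).
rewrite opprK in Y1 Y2.
have TE : T + E = T * (1 + S * E) by rewrite mulrDr mulr1 mulrA TS mul1r.
have SI : is_inv (Y * S) (T + E).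
  by rewrite TE; split; [rewrite mulrA -[Y * S * T]mulrA ST mulr1|rewrite -mulrA [_ * (Y * S)]mulrA Y2 mul1r].
have Yb : nr (Y * S) <= 2 * nr S by rewrite (le_trans (nr_comp _ _))// ler_wpM2r ?nr_ge0.
exists (Y * S); split => //.
have -> : Y * S - S = - (Y * S * E * S).
  apply: sub_opp; rewrite -[RHS]mul1r -(proj1 SI) mulrDr mulrDl.
  by rewrite -[Y * S * T * S]mulrA TS mulr1.
rewrite nrN (le_trans (nr_comp _ _))//.
apply: (@le_trans _ _ (2 * nr S * nr E * nr S)).
  by rewrite ler_wpM2r ?nr_ge0// (le_trans (nr_comp _ _))// ler_wpM2r ?nr_ge0.
by rewrite expr2 !mulrA mulrAC.
Qed.

End Operators.

Section OperatorCalculus.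
Context {R : realType} {H : hilbertType R}.
Notation C := R[i].
Notation Co := (R[i]^o).

Lemma cder_linear (V W : normedModType C) (F : V -> W) (M : R) (f : C -> V) (z : C) (l : V) :
  (forall x y, F (x + y) = F x + F y) -> (forall a x, F (a *: x) = a *: F x) ->
  (forall x, nr (F x) <= M * nr x) -> cder f z l -> cder (fun z => F (f z)) z (F l).
Proof.
move=> FD FZ FM fl e e0; have M1 : 0 < `|M| + 1 by rewrite ltr_pwDr.
have [d d0 Hd] := fl (e / (`|M| + 1)) (divr_gt0 e0 M1); exists d => // h hd.
have FN x : F (- x) = - F x by rewrite -scaleN1r FZ scaleN1r.
rewrite -FZ -!FN -!FD; apply: le_trans (FM _) _.
apply: (@le_trans _ _ ((`|M| + 1) * (e / (`|M| + 1) * nr h))).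
  apply: (@le_trans _ _ ((`|M| + 1) * nr (f (z + h) - f z - h *: l))).
    by rewrite ler_wpM2r ?nr_ge0// (le_trans (ler_norm _))// lerDl.
  by rewrite ler_pM2l// Hd.
by rewrite mulrA mulrCA divff ?mulr1// gt_eqF.
Qed.

Lemma cder_comp_op (S T : C -> bop H) z (S' T' : bop H) : cder S z S' -> cder T z T' ->
  cder (fun z => S z * T z) z (S' * T z + S z * T').
Proof.
apply: (cder_bilinear (fun S T : bop H => S * T) 1) => //.
- by move=> x x' y; rewrite mulrDl.
- by move=> x x' y; rewrite mulrDr.
- by move=> a x y; apply: bopP => u; rewrite ?bopM ?bopZ ?bopM ?linearZ.
- by move=> a x y; apply: bopP => u; rewrite ?bopM ?bopZ ?bopM ?linearZ.
- by move=> x y; rewrite mul1r nr_comp.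
Qed.

Lemma cder_app (T : C -> bop H) (f : C -> H) z (T' : bop H) (f' : H) : cder T z T' -> cder f z f' ->
  cder (fun z => T z (f z)) z (T' (f z) + T z f').
Proof.
apply: (cder_bilinear (fun (T : bop H) (u : H) => T u) 1) => //.
- by move=> x y y'; rewrite linearD.
- by move=> a x y; rewrite linearZ.
- by move=> x y; rewrite mul1r nr_app.
Qed.

Lemma cder_ip (f : C -> H) (e : H) z (f' : H) : cder f z f' ->
  cder (fun z => inner (f z) e : Co) z (inner f' e).
Proof.
apply: (cder_linear H Co (fun u => inner u e) (nr e)).
- by move=> x y; rewrite ipDl.
- by move=> a x; rewrite ipZl.
- by move=> x; rewrite mulrC cauchy_schwarz.
Qed.

Lemma cder_rk (f : C -> H) (e : H) z (f' : H) : cder f z f' ->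
  cder (fun z => rk (f z) e) z (rk f' e).
Proof.
apply: (cder_linear H (bop H) (fun x => rk x e) (nr e)).
- by move=> x y; apply: bopP => u; rewrite bopD !rkE scalerDr.
- by move=> a x; apply: bopP => u; rewrite bopZ !rkE !scalerA mulrC.
- by move=> x; rewrite mulrC nr_rk.
Qed.

Lemma inv_open (T : C -> bop H) z (S : bop H) : ccont T z -> is_inv S (T z) ->
  exists2 d : R, 0 < d & forall w, nr (w - z) < d -> exists S', is_inv S' (T w) /\
    nr S' <= 2 * nr S.
Proof.
move=> Tc SI; have S1 : 0 < nr S + 1 by rewrite ltr_wpDl ?nr_ge0.
have [|d d0 Hd] := Tc (1 / 2 / (nr S + 1)); first by rewrite divr_gt0//; lra.
exists d => // w wd; have := inv_perturb (T z) S (T w - T z) SI.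
rewrite [T z + _]addrC subrK => -[|S' [S'I Sn _]]; last by exists S'.
apply: (@le_trans _ _ ((nr S + 1) * (1 / 2 / (nr S + 1)))).
  by apply: ler_pM; rewrite ?nr_ge0 ?lerDl// Hd.
by rewrite mulrC divfK// gt_eqF.
Qed.

Lemma cder_inv (U : set C) (T S : C -> bop H) z (T' : bop H) : copen U -> U z ->
  (forall w, U w -> is_inv (S w) (T w)) -> cder T z T' -> cder S z (- (S z * T' * S z)).
Proof.
move=> Uo Uz SI dT e e0; have Tc := cder_cont _ _ _ dT.
have [d1 d10 H1] := inv_open T z (S z) Tc (SI z Uz).
have [d2 d20 H2] := Uo z Uz.
pose a := nr (S z) + 1; have a0 : 0 < a by rewrite ltr_wpDl ?nr_ge0.
pose b := nr T' + 1; have b0 : 0 < b by rewrite ltr_wpDl ?nr_ge0.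
have ec : 0 < e / (4 * a ^+ 2) by rewrite divr_gt0// mulr_gt0// exprn_gt0.
have [d3 d30 H3] := dT _ ec.
have ed : 0 < e / (4 * a ^+ 3 * b) by rewrite divr_gt0// !mulr_gt0// exprn_gt0.
have [d4 d40 H4] := Tc _ ed.
exists (Num.min (Num.min d1 d2) (Num.min d3 d4)); first by rewrite !lt_min d10 d20 d30.
move=> h; rewrite !lt_min => /andP[/andP[h1 h2] /andP[h3 h4]].
have zh : z + h - z = h by rewrite addKl.
have Uh : U (z + h) by apply: H2; rewrite zh.
have Sh : nr (S (z + h)) <= 2 * a.
  have [|S' [S'I Sn]] := H1 (z + h); first by rewrite zh.
  rewrite (is_inv_uniq _ _ _ (SI _ Uh) S'I) (le_trans Sn)// ler_pM2l// lerDl//.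
have Sz : nr (S z) <= a by rewrite lerDl.
have D : S (z + h) - S z = - (S (z + h) * (T (z + h) - T z) * S z).
  rewrite mulrBr mulrBl (proj1 (SI _ Uh)) mul1r -mulrA (proj2 (SI _ Uz)) mulr1 opprB.
  by [].
have {}D : S (z + h) - S z - h *: - (S z * T' * S z) =
    - (S (z + h) * (T (z + h) - T z - h *: T') * S z) -
    h *: ((S (z + h) - S z) * T' * S z).
  have ZAl (c : C) (x y : bop H) : (c *: x) * y = c *: (x * y) by exact: bopP.
  have ZAr (c : C) (x y : bop H) : x * (c *: y) = c *: (x * y).
    by apply: bopP => u; rewrite bopM bopZ linearZ.
  have E1 : (S (z + h) - S z) * T' * S z = S (z + h) * T' * S z - S z * T' * S z by rewrite !mulrBl.
  rewrite E1 D; move: (T (z + h) - T z) => E.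
  rewrite mulrBr mulrBl ZAr ZAl scalerBr scalerN opprK.
  move: (S (z + h) * E * S z) (h *: (S (z + h) * T' * S z)) (h *: (S z * T' * S z)) => x y w.
  by vec.
rewrite D (le_trans (nrB _ _))// nrZ.
have -> : e * nr h = e / 2 * nr h + e / 2 * nr h by rewrite -mulrDl; congr (_ * _); lra.
apply: lerD.
  rewrite nrN (le_trans (nr_comp _ _))//.
  apply: (@le_trans _ _ (2 * a * (e / (4 * a ^+ 2) * nr h) * a)).
    apply: ler_pM; rewrite ?nr_ge0//; apply: le_trans (nr_comp _ _) _.
    by apply: ler_pM; rewrite ?nr_ge0// H3.
  by rewrite le_eqVlt; apply/orP; left; apply/eqP; field; exact: lt0r_neq0.
rewrite mulrC ler_wpM2r ?nr_ge0//.
have hh : nr (S (z + h) - S z) <= 2 * a * (e / (4 * a ^+ 3 * b)) * a.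
  have -> : S (z + h) - S z = - (S (z + h) * (T (z + h) - T z) * S z).
    by rewrite mulrBr mulrBl (proj1 (SI _ Uh)) mul1r -mulrA (proj2 (SI _ Uz)) mulr1 opprB.
  rewrite nrN (le_trans (nr_comp _ _))//; apply: ler_pM; rewrite ?nr_ge0//.
  apply: le_trans (nr_comp _ _) _; apply: ler_pM; rewrite ?nr_ge0//.
  by apply: H4; rewrite zh.
rewrite (le_trans (nr_comp _ _))//.
apply: (@le_trans _ _ (2 * a * (e / (4 * a ^+ 3 * b)) * a * b * a)).
  apply: ler_pM; rewrite ?nr_ge0//; apply: le_trans (nr_comp _ _) _.
  by apply: ler_pM; rewrite ?nr_ge0// lerDl.
by rewrite le_eqVlt; apply/orP; left; apply/eqP; field; rewrite !lt0r_neq0.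
Qed.

Lemma derivable_cder (V : normedModType C) (f : Co -> V) (z : Co) : derivable f z 1 ->
  cder f z (derive1 f z).
Proof.
rewrite derive1E => df; have /cvgrPdist_le Hf : (fun h : Co => h^-1 *: ((f \o shift z) (h *: 1) - f z)) @ 0^'
  --> 'D_1 f z by exact: df.
move=> e e0; have /Hf : 0 < (e%:C : C) by rewrite ltcR.
rewrite near_withinE => /nbhs_normP[d /= d0 Hd].
have dr : d = (complex.Re d)%:C by rewrite RRe_real// gtr0_real.
exists (complex.Re d); first by move: d0; rewrite {1}dr ltcR.
move=> h hd; have [->|h0] := eqVneq h 0; first by rewrite addr0 subrr scale0r subr0 !nr0 mulr0.
have /= := Hd h; rewrite sub0r normrN {1}dr -nr_lt => /(_ hd h0).
rewrite -nr_le /= => Hh.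
have -> : f (z + h) - f z - h *: 'D_1 f z =
    - (h *: ('D_1 f z - h^-1 *: (f (h *: 1 + z) - f z))).
  rewrite scalerBr scalerA divff// scale1r opprB; congr (f _ - _ - _).
  by rewrite addrC; congr (_ + _); rewrite -[h *: 1]/(h * 1) mulr1.
by rewrite nrN nrZ mulrC ler_wpM2r ?nr_ge0.
Qed.

Lemma cder_derive1 (V : normedModType C) (f : Co -> V) (z : Co) l : cder f z l ->
  derivable f z 1 /\ derive1 f z = l.
Proof.
move=> df; have H1 : (fun h : Co => h^-1 *: ((f \o shift z) (h *: 1) - f z)) @ 0^' --> l.
  apply/cvgrPdist_le => e e0; have er : e = (complex.Re e)%:C by rewrite RRe_real// gtr0_real.
  have e0' : 0 < complex.Re e by move: e0; rewrite {1}er ltcR.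
  have [d d0 Hd] := df _ e0'; rewrite near_withinE; apply/nbhs_normP; exists d%:C => /=.
    by rewrite ltcR.
  move=> h /=; rewrite sub0r normrN -nr_lt => hd h0; rewrite er -nr_le /=.
  have -> : l - h^-1 *: (f (h *: 1 + z) - f z) = - (h^-1 *: (f (z + h) - f z - h *: l)).
    rewrite [h^-1 *: (_ - h *: l)]scalerBr scalerA mulVf// scale1r opprB; congr (_ - _ *: (f _ - _)).
    by rewrite addrC; congr (_ + _); rewrite -[h *: 1]/(h * 1) mulr1.
  rewrite nrN nrZ nrV mulrC ler_pdivrMr ?nr_gt0//; exact: Hd.
split; first by apply/cvg_ex; exists l.
by rewrite derive1E; apply: cvg_lim H1; exact: norm_hausdorff.
Qed.

End OperatorCalculus.

(** * Compact operators and their spectral theorem *)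

Section Orthonormal.
Context {R : realType} {H : hilbertType R}.
Notation C := R[i].
Implicit Types (e : nat -> H) (u v : H) (T K : bop H).

Definition orthon (n : nat) e := forall i j, (i < n)%N -> (j < n)%N ->
  inner (e i) (e j) = (i == j)%:R.

Lemma ortho_nr n e i : orthon n e -> (i < n)%N -> nr (e i) = 1.
Proof.
move=> eo i_n; have := eo i i i_n i_n; rewrite ip_nr eqxx => -[] /eqP.
by rewrite sqrf_eq1 => /orP[/eqP//|/eqP h]; have := nr_ge0 (e i); rewrite h; lra.
Qed.

Lemma ortho_le m n e : (m <= n)%N -> orthon n e -> orthon m e.
Proof. by move=> mn eo i j im jm; apply: eo; rewrite (leq_trans _ mn). Qed.

Lemma ortho_sum n e (c : nat -> C) : orthon n e ->
  nr (\sum_(i < n) c i *: e i) ^+ 2 = \sum_(i < n) nr (c i) ^+ 2.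
Proof.
elim: n => [|n IH] eo; first by rewrite !big_ord0 nr0 expr0n.
rewrite !big_ord_recr /= pythagoras; last first.
  rewrite ip_suml big1// => i _; rewrite ipZl ipZr eo ?ltnS ?(ltnW (ltn_ord i))//.
  by rewrite (ltn_eqF (ltn_ord i)) !mulr0.
by rewrite IH; [rewrite nrZ (ortho_nr n.+1) ?mulr1|apply: ortho_le eo].
Qed.

Definition oproj n e : bop H := \sum_(i < n) rk (e i) (e i).

Lemma projE n e u : oproj n e u = \sum_(i < n) inner u (e i) *: e i.
Proof. by rewrite /oproj bop_sum. Qed.

Lemma ip_proj n e u j : orthon n e -> (j < n)%N -> inner (oproj n e u) (e j) = inner u (e j).
Proof.
move=> eo jn; rewrite projE ip_suml (bigD1 (Ordinal jn))//= ipZl eo// eqxx mulr1.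
rewrite big1 ?addr0// => i ij; rewrite ipZl eo// (_ : (i == j :> nat) = false) ?mulr0//.
by apply/negbTE.
Qed.

Lemma ip_proj_off n e u j : orthon n e -> (j < n)%N -> inner (u - oproj n e u) (e j) = 0.
Proof. by move=> eo jn; rewrite ipBl ip_proj// subrr. Qed.

Lemma ip_perp_proj n e u v : (forall i, (i < n)%N -> inner u (e i) = 0) -> inner u (oproj n e v) = 0.
Proof.
move=> h; rewrite ipC projE ip_suml big1 ?conjc0// => i _.
by rewrite ipZl (ip_eq0C _ _ (h i (ltn_ord i))) mulr0.
Qed.

Lemma proj_split n e u : orthon n e -> nr u ^+ 2 = nr (u - oproj n e u) ^+ 2 + nr (oproj n e u) ^+ 2.
Proof.
move=> eo; rewrite -pythagoras ?subrK//; apply: ip_perp_proj => i; exact: ip_proj_off.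
Qed.

Lemma proj_le n e u : orthon n e -> nr (oproj n e u) <= nr u.
Proof.
move=> eo; rewrite -(ler_pXn2r (n := 2)) ?nnegrE ?nr_ge0// (proj_split n e u eo).
by rewrite lerDr exprn_ge0// nr_ge0.
Qed.

Lemma proj_off_le n e u : orthon n e -> nr (u - oproj n e u) <= nr u.
Proof.
move=> eo; rewrite -(ler_pXn2r (n := 2)) ?nnegrE ?nr_ge0// [leRHS](proj_split n e u eo).
by rewrite lerDl exprn_ge0// nr_ge0.
Qed.

Lemma proj_perp n e u : (forall i, (i < n)%N -> inner u (e i) = 0) -> oproj n e u = 0.
Proof. by move=> h; rewrite projE big1// => i _; rewrite h ?scale0r. Qed.

Lemma proj_sa n e u v : inner (oproj n e u) v = inner u (oproj n e v).
Proof.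
rewrite [RHS]ipC !projE !ip_suml rmorph_sum; apply: eq_bigr => i _.
by rewrite !ipZl rmorphM /= (ipC u (e i)) (ipC (e i) v) mulrC.
Qed.

Lemma bessel n e u : orthon n e -> \sum_(i < n) nr (inner u (e i)) ^+ 2 <= nr u ^+ 2.
Proof.
move=> eo; rewrite -(ortho_sum n e (fun i => inner u (e i)) eo) -projE.
by rewrite (ler_pXn2r (n := 2)) ?nnegrE ?nr_ge0// proj_le.
Qed.

Definition ext e n v : nat -> H := fun i => if i == n then v else e i.

Lemma ortho_ext n e v : orthon n e -> nr v = 1 -> (forall i, (i < n)%N -> inner v (e i) = 0) ->
  orthon n.+1 (ext e n v).
Proof.
move=> eo v1 ve i j i_n j_n.
have cs k : (k < n.+1)%N -> (k == n) || (k < n)%N by rewrite ltnS leq_eqVlt.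
rewrite /ext; case: (eqVneq i n) (cs i i_n) => [->|ni] /= hi; case: (eqVneq j n) (cs j j_n) => [->|nj] /= hj.
- by rewrite ?eqxx ip_nr v1 expr1n.
- by rewrite ve// 1?eq_sym (negbTE nj).
- by rewrite (ip_eq0C _ _ (ve i hi)) (negbTE ni).
- exact: eo.
Qed.

Lemma unit_vector v : v != 0 -> nr ((nr v)^-1%:C *: v) = 1.
Proof.
by move=> v0; rewrite nrZ nrR ger0_norm ?invr_ge0 ?nr_ge0// mulVf// gt_eqF// nr_gt0.
Qed.

Lemma compact_net T (eta : R) : compact_op T -> 0 < eta ->
  exists ys : seq H, forall u, nr u <= 1 -> exists2 y, y \in ys & nr (T u - y) <= eta.
Proof.
move=> Tc eta0; move: Tc; rewrite /compact_op compact_cover.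
move=> /(_ H setT (fun y => (ball y eta%:C)^°)%classic) [].
- by move=> i _; exact: open_interior.
- by move=> x _; exists x => //; apply: nbhsx_ballx; rewrite ltcR.
move=> D' _ D'c; exists (finmap.enum_fset D') => u u1.
have [|y yD] := D'c (T u).
  by apply: subset_closure; exists u => //=; rewrite -[1]/(1%:C) -nr_le.
move=> /interior_subset; rewrite -ball_normE /= -nr_lt => h.
by exists y => //; rewrite nrC ltW.
Qed.

Lemma compact_cluster T (u : nat -> H) : compact_op T -> (forall n, nr (u n) <= 1) ->
  exists y, forall (eps : R) N, 0 < eps -> exists2 n, (N <= n)%N & nr (T (u n) - y) <= eps.
Proof.
move=> Tc u1; have [|y [_ yc]] := Tc ((T \o u) @ \oo) _.
  by exists 0%N => // n _ /=; apply: subset_closure; exists (u n) => //=; rewrite -[1]/(1%:C) -nr_le.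
exists y => eps N eps0.
have [||x [[n Nn <-]]] := yc [set T (u n) | n in [set n | (N <= n)%N]] (ball y eps%:C).
- by exists N => // n /= Nn; exists n.
- by apply: nbhsx_ballx; rewrite ltcR.
by rewrite -ball_normE /= -nr_lt => h; exists n => //; rewrite nrC ltW.
Qed.

(* Compactness is used through this property only: it is stable under sums
   and norm limits, and yields finite-rank approximations. *)
Definition ortho_small T := forall eta : R, 0 < eta -> exists N, forall n e, orthon n e ->
  (forall i, (i < n)%N -> eta < nr (T (e i))) -> (n <= N)%N.

(** Cover the image of the unit ball by finitely many balls of radius eta/4. If m of the orthonormal
    vectors have images close to the same y, their sum x has norm sqrt m while T x is close to m y,
    so m eta / 2 <= |T| sqrt m and m <= 4 |T|^2 / eta^2. *)
Lemma compact_ortho_small T : compact_op T -> ortho_small T.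
Proof.
move=> Tc eta eta0; have [|ys Hys] := compact_net T (eta / 4) Tc; first by lra.
pose M := nr T; have M0 : 0 <= M := nr_ge0 T.
have [B HB] : exists B : nat, 4 * M ^+ 2 / eta ^+ 2 <= B%:R.
  exists (Num.bound (4 * M ^+ 2 / eta ^+ 2)); apply: ltW; apply: archi_boundP.
  by rewrite divr_ge0 ?mulr_ge0 ?exprn_ge0// ltW.
exists (size ys * B)%N => n e eo big.
pose J y (i : nat) := nr (T (e i) - y) <= eta / 4.
have Jb y : (\sum_(i < n) J y i <= B)%N.
  set m := (\sum_(i < n) _)%N; have [m0|m0] := posnP m; first by rewrite m0.
  rewrite -(ler_nat R); apply: le_trans HB; rewrite ler_pdivlMr ?exprn_gt0//.
  have [i Ji] : exists i : 'I_n, J y i.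
    apply/existsP; apply: contraLR m0; rewrite negb_exists => /forallP h.
    by rewrite /m big1// => i _; rewrite (negbTE (h i)).
  have yb : 3 * eta / 4 < nr y.
    have := nr_geB (T (e i)) (T (e i) - y); rewrite subKr; have := big i (ltn_ord i).
    by move: Ji; rewrite /J; lra.
  pose x := \sum_(i < n) (J y i)%:R *: e i.
  have xn : nr x ^+ 2 = m%:R.
    rewrite (ortho_sum n e (fun i => (J y i)%:R) eo) /m natr_sum; apply: eq_bigr => i1 _.
    by case: (J y i1); rewrite ?nr1 ?nr0 ?expr1n ?expr0n.
  have Txe : T x = m%:R *: y + \sum_(i < n) (J y i)%:R *: (T (e i) - y).
    rewrite /x linear_sum /m natr_sum scaler_suml -big_split /=; apply: eq_bigr => i1 _.
    by rewrite linearZ scalerBr addrC subrK.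
  have l1 : m%:R * (eta / 2) <= nr (T x).
    have h1 : nr (\sum_(i < n) (J y i)%:R *: (T (e i) - y)) <= m%:R * (eta / 4).
      rewrite /m natr_sum mulr_suml; apply: le_trans (nr_sum _ _ _ _) _; apply: ler_sum => i1 _.
      rewrite nrZ; case Ji1: (J y i1); last by rewrite nr0 !mul0r.
      by rewrite nr1 !mul1r.
    have := nr_geB (m%:R *: y) (- \sum_(i < n) (J y i)%:R *: (T (e i) - y)).
    rewrite opprK -Txe nrN nrZ nrn.
    have : m%:R * (3 * eta / 4) <= m%:R * nr y by rewrite ler_wpM2l// ltW.
    move: h1; move: (nr (T x)) (m%:R * nr y) (nr _) (m%:R : R) => a b c d; lra.
  have {}l1 : (m%:R * (eta / 2)) ^+ 2 <= M ^+ 2 * m%:R.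
    rewrite -[in leRHS]xn -exprMn; apply: lerXn2r; rewrite ?nnegrE ?mulr_ge0 ?nr_ge0//; first by lra.
    by apply: le_trans l1 _; exact: nr_app.
  have m0R : 0 < m%:R :> R by rewrite ltr0n.
  rewrite -(ler_pM2r m0R); move: l1; rewrite exprMn (exprMn _ eta) !expr2.
  by move: (m%:R : R) => d; lra.
apply: (@leq_trans (\sum_(y <- ys) \sum_(i < n) J y i)); last first.
  by rewrite (leq_trans (leq_sum _ (fun y _ => Jb y)))// big_const_seq count_predT iter_addn addn0 mulnC.
rewrite exchange_big /= -{1}[n]card_ord -sum1_card; apply: leq_sum => i _.
have [|y yys h] := Hys (e i); first by rewrite (ortho_nr n).
by rewrite (big_rem y)//= /J h.
Qed.

Lemma ortho_smallZ (a : C) T : ortho_small T -> ortho_small (a *: T).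
Proof.
move=> Ts eta eta0; have a1 : 0 < nr a + 1 by rewrite ltr_wpDl ?nr_ge0.
have [N HN] := Ts (eta / (nr a + 1)) (divr_gt0 eta0 a1); exists N => n e eo big.
apply: (HN n e eo) => i i_n; rewrite ltr_pdivrMr//; apply: lt_le_trans (big i i_n) _.
by rewrite bopZ nrZ mulrC ler_wpM2l ?nr_ge0// lerDl.
Qed.

(** Each vector has an image above eta/2 under [S] or under [T]; the family splits into two
    subfamilies, each of bounded size. *)
Lemma ortho_smallD S T : ortho_small S -> ortho_small T -> ortho_small (S + T).
Proof.
move=> Ss Ts eta eta0; have e2 : 0 < eta / 2 by lra.
have [N HN] := Ss _ e2; have [N' HN'] := Ts _ e2; exists (N + N')%N => n e eo big.
pose P i := eta / 2 < nr (S (e i)).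
have sub (X : bop H) (Q : pred nat) M : (forall n e, orthon n e ->
    (forall i, (i < n)%N -> eta / 2 < nr (X (e i))) -> (n <= M)%N) ->
    (forall i, (i < n)%N -> Q i -> eta / 2 < nr (X (e i))) -> (count Q (iota 0 n) <= M)%N.
  move=> HM HQ; rewrite -size_filter; set l := [seq i <- iota 0 n | Q i].
  have lP i : (i < size l)%N -> (nth 0%N l i < n)%N /\ Q (nth 0%N l i).
    by move=> il; have := mem_nth 0%N il; rewrite mem_filter mem_iota add0n => /andP[-> /andP[_ ->]].
  have lu : uniq l by rewrite filter_uniq// iota_uniq.
  apply: (HM _ (fun i => e (nth 0%N l i))).
    by move=> i j il jl; rewrite eo ?nth_uniq//; [case: (lP i il)|case: (lP j jl)].
  by move=> i il; have [h1 h2] := lP i il; apply: HQ.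
have c1 := sub S P N HN (fun i _ h => h).
have c2 : (count (predC P) (iota 0 n) <= N')%N.
  apply: (sub T _ _ HN') => i i_n; rewrite /P /= -leNgt => h.
  by have := big i i_n; rewrite bopD; have := nrD (S (e i)) (T (e i)); lra.
by have := count_predC P (iota 0 n); rewrite size_iota; lia.
Qed.

Lemma ortho_small_lim T : (forall eta : R, 0 < eta -> exists2 S, ortho_small S & nr (T - S) <= eta) ->
  ortho_small T.
Proof.
move=> TS eta eta0; have [|S Ss TSe] := TS (eta / 2); first by lra.
have [|N HN] := Ss (eta / 2); first by lra.
exists N => n e eo big; apply: (HN n e eo) => i i_n.
have := nr_app_le _ (e i) _ TSe; rewrite (ortho_nr n)// mulr1 bopB.
by have := nr_geB (T (e i)) (S (e i)); have := big i i_n; lra.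
Qed.

(** Take a maximal orthonormal family with images larger than eta: a vector orthogonal to it with a
    large image would, after normalization, enlarge it. This is the finite-rank approximation used
    for A'(0) and in the Fredholm argument. *)
Lemma small_off T (eta : R) : ortho_small T -> 0 < eta -> exists n e, orthon n e /\
  forall u, (forall i, (i < n)%N -> inner u (e i) = 0) -> nr (T u) <= eta * nr u.
Proof.
move=> Ts eta0; have [N HN] := Ts eta eta0.
have [||n [e [eo big]] nmax] := max_nat (fun n => exists e, orthon n e /\
    forall i, (i < n)%N -> eta < nr (T (e i))) N.
- by exists (fun=> 0).
- by move=> k [e [eo big]]; exact: HN eo big.
exists n, e; split => // u ue; rewrite leNgt; apply/negP => Tu; apply: nmax.
have u0 : u != 0 by apply: contraTneq Tu => ->; rewrite linear0 !nr0 mulr0 ltxx.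
have nu : 0 < nr u by rewrite nr_gt0.
exists (ext e n ((nr u)^-1%:C *: u)); split.
  by apply: ortho_ext => //; [exact: unit_vector|move=> i i_n; rewrite ipZl ue// mulr0].
move=> i; rewrite ltnS leq_eqVlt /ext; case: eqP => [_ _|_ /= /big//].
rewrite linearZ nrZ nrR ger0_norm ?invr_ge0 ?nr_ge0//.
by rewrite mulrC ltr_pdivlMr.
Qed.

End Orthonormal.

Section Spectral.
Context {R : realType} {H : hilbertType R}.
Notation C := R[i].
Implicit Types (e : nat -> H) (u v : H) (T K : bop H).

Definition eigenfamily K n e (lam : nat -> R) :=
  orthon n e /\ forall i, (i < n)%N -> K (e i) = (lam i)%:C *: e i.

Lemma eigen_ip K n e lam u i : op_selfadjoint K -> eigenfamily K n e lam -> (i < n)%N ->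
  inner (K u) (e i) = (lam i)%:C * inner u (e i).
Proof.
by move=> Ksa [_ Ke] i_n; rewrite Ksa Ke// ipZr; congr (_ * _); rewrite conjc_real.
Qed.

Lemma eigen_proj K n e lam u : op_selfadjoint K -> eigenfamily K n e lam ->
  K (oproj n e u) = oproj n e (K u).
Proof.
move=> Ksa Ke; rewrite !projE linear_sum; apply: eq_bigr => i _.
by rewrite linearZ (eigen_ip _ _ _ _ _ _ Ksa Ke)//= (proj2 Ke)// scalerA mulrC.
Qed.

Lemma nr_subR u v (c : R) : nr (u - c%:C *: v) ^+ 2 =
  nr u ^+ 2 - 2 * c * complex.Re (inner u v) + c ^+ 2 * nr v ^+ 2.
Proof.
have : inner (u - c%:C *: v) (u - c%:C *: v) =
    inner u u - c%:C * (inner u v + (inner u v)^*%C) + (c%:C) ^+ 2 * inner v v.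
  by rewrite ipBl !ipBr ipZl !ipZr !ipZl conjc_real -(ipC v u); ring.
rewrite !ip_nr => /(congr1 (@complex.Re R)); rewrite /= => ->.
by case: (inner u v) => a b; rewrite /= expr2; ring.
Qed.

(** Let M be the norm of K restricted to the complement of the family. For almost maximizing unit
    vectors u, K^2 u is close to M^2 u; compactness gives a cluster point y of the K u with K^2 y =
    M^2 y and y nonzero. Then K y + M y is an eigenvector for M, or it vanishes and y is one for
    -M. *)
Lemma spectral_maximal K (eta : R) n e lam : op_selfadjoint K -> compact_op K -> 0 < eta ->
  eigenfamily K n e lam -> (exists u, (forall i, (i < n)%N -> inner u (e i) = 0) /\ eta * nr u < nr (K u)) ->
  exists v (l : R), [/\ forall i, (i < n)%N -> inner v (e i) = 0, nr v = 1, K v = l%:C *: v & eta < `|l|].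
Proof.
move=> Ksa Kc eta0 Ke [u0 [u0e Ku0]]; have eo := proj1 Ke.
pose Q : bop H := 1 - oproj n e; pose K' := K * Q; pose M := nr K'.
have QE u : Q u = u - oproj n e u by [].
have Qn u : nr (Q u) <= nr u by rewrite QE proj_off_le.
have Qsa u v : inner (Q u) v = inner u (Q v) by rewrite !QE ipBl ipBr proj_sa.
have KQ u : K (Q u) = Q (K u) by rewrite !QE linearB /= (eigen_proj _ _ _ _ _ Ksa Ke).
have K'sa u v : inner (K' u) v = inner u (K' v) by rewrite /K' !bopM Ksa Qsa KQ.
have Mbig : eta < M.
  have u00 : 0 < nr u0.
    rewrite nr_gt0; apply: contraTneq Ku0 => ->; by rewrite linear0 !nr0 mulr0 ltxx.
  rewrite -(ltr_pM2r u00); apply: lt_le_trans Ku0 _.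
  have -> : K u0 = K' u0 by rewrite /K' bopM QE proj_perp// subr0.
  exact: nr_app.
have M0 : 0 < M by exact: lt_trans Mbig.
have near_max (d : R) : 0 < d -> d < M -> exists u, nr u = 1 /\ M - d < nr (K' u).
  move=> d0 dM; have [u Hu] : exists u, (M - d) * nr u < nr (K' u).
    apply: contrapT => /forallNP h.
    have : nr K' <= M - d by apply: nr_bop_le => [|u]; [lra|rewrite leNgt; apply/negP/h].
    by rewrite -/M; lra.
  have u00 : u != 0 by apply: contraTneq Hu => ->; rewrite linear0 !nr0 mulr0 ltxx.
  exists ((nr u)^-1%:C *: u); rewrite unit_vector//; split => //.
  rewrite linearZ nrZ nrR ger0_norm ?invr_ge0 ?nr_ge0//.
  by rewrite mulrC ltr_pdivlMr// nr_gt0.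
have almost u (d : R) : nr u = 1 -> 0 < d -> d < M -> M - d < nr (K' u) ->
    nr (K' (K' u) - (M ^+ 2)%:C *: u) ^+ 2 <= 2 * M ^+ 3 * d.
  move=> u1 d0 dM Hu; rewrite nr_subR K'sa ip_nr /= u1.
  have h1 : nr (K' (K' u)) ^+ 2 <= M ^+ 2 * nr (K' u) ^+ 2.
    by rewrite -exprMn lerXn2r ?nnegrE ?mulr_ge0 ?nr_ge0// ?(ltW M0)// nr_app.
  have h2 : M ^+ 2 * (M - d) ^+ 2 <= M ^+ 2 * nr (K' u) ^+ 2.
    rewrite ler_pM2l ?exprn_gt0//; apply: lerXn2r; rewrite ?nnegrE ?nr_ge0 ?(ltW Hu)//.
    by rewrite subr_ge0 ltW.
  have h3 : 0 <= M ^+ 2 * d ^+ 2 by rewrite mulr_ge0 ?exprn_ge0// ltW.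
  move: h1 h2 h3; rewrite expr1n mulr1.
  by move: (nr (K' (K' u)) ^+ 2) (nr (K' u) ^+ 2) => a b; rewrite !exprS !expr0; nra.
have /choice[us Hus] : forall k : nat, exists u, nr u = 1 /\ M - M / 2 / k.+1%:R < nr (K' u).
  move=> k; have k1 : 1 <= k.+1%:R :> R by rewrite ler1n.
  apply: near_max; first by rewrite divr_gt0// divr_gt0.
  by rewrite ltr_pdivrMr ?(lt_le_trans ltr01)//; nra.
have [|y Hy] := compact_cluster K (fun k => Q (us k)) Kc.
  by move=> k; rewrite (le_trans (Qn _))// (proj1 (Hus k)).
have yE (eps : R) : 0 < eps -> exists u, [/\ nr u = 1, nr (K' u - y) <= eps, M / 2 <= nr (K' u) &
    nr (K' (K' u) - (M ^+ 2)%:C *: u) <= eps].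
  move=> eps0; pose N := Num.bound (M ^+ 4 / eps ^+ 2).
  have e2 : 0 < eps ^+ 2 by rewrite exprn_gt0.
  have HN : M ^+ 4 / eps ^+ 2 < N%:R by apply: archi_boundP; rewrite divr_ge0// exprn_ge0// ltW.
  have [k Nk Hk] := Hy eps N eps0; exists (us k); have [uk1 ukM] := Hus k.
  have k1 : 1 <= k.+1%:R :> R by rewrite ler1n.
  have k0 : 0 < k.+1%:R :> R by rewrite ltr0n.
  have M2 : M / 2 / k.+1%:R <= M / 2 by rewrite ler_pdivrMr//; nra.
  split; [exact: uk1|exact: Hk|by apply: le_trans (ltW ukM); move: M2; move: (M / 2 / _) => q; lra|].
  rewrite -(ler_pXn2r (n := 2)) ?nnegrE ?nr_ge0// ?(ltW eps0)//.
  apply: le_trans (almost (us k) (M / 2 / k.+1%:R) uk1 _ _ ukM) _.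
    by rewrite divr_gt0// divr_gt0.
    by apply: le_lt_trans M2 _; rewrite ltr_pdivrMr//; move: M0; lra.
  have -> : 2 * M ^+ 3 * (M / 2 / k.+1%:R) = M ^+ 4 / k.+1%:R by field; rewrite gt_eqF.
  rewrite ler_pdivrMr// mulrC -ler_pdivrMr//; apply: le_trans (ltW HN) _.
  by rewrite ler_nat (leq_trans Nk).
have yM : K' (K' y) = (M ^+ 2)%:C *: y.
  apply/eqP; rewrite -subr_eq0; apply/eqP; apply: nr_small => eps eps0.
  pose B := 2 * M ^+ 2 + M; have B0 : 0 < B by rewrite addr_gt0// mulr_gt0// exprn_gt0.
  have [u [_ h1 _ h2]] := yE (eps / B) (divr_gt0 eps0 B0).
  have -> : K' (K' y) - (M ^+ 2)%:C *: y = K' (K' (K' u) - (M ^+ 2)%:C *: u)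
      + (M ^+ 2)%:C *: (K' u - y) - K' (K' (K' u - y)).
    by rewrite !linearB !linearZ /=; move: (K' (K' y)) (K' (K' (K' u))) (K' u) => a b c; vec.
  apply: le_trans (nrB _ _) _; apply: le_trans (lerD (nrD _ _) (lexx _)) _.
  have a1 := nr_app_le K' _ _ (lexx M).
  have a2 : nr (K' (K' (K' u) - (M ^+ 2)%:C *: u)) <= M * (eps / B).
    by apply: le_trans (a1 _) _; rewrite ler_pM2l.
  have a3 : nr ((M ^+ 2)%:C *: (K' u - y)) <= M ^+ 2 * (eps / B).
    by rewrite nrZ nrR ger0_norm ?exprn_ge0 ?(ltW M0)// ler_pM2l ?exprn_gt0.
  have a4 : nr (K' (K' (K' u - y))) <= M ^+ 2 * (eps / B).
    by apply: le_trans (a1 _) _; rewrite expr2 -mulrA ler_pM2l// (le_trans (a1 _))// ler_pM2l.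
  have -> : eps = M * (eps / B) + M ^+ 2 * (eps / B) + M ^+ 2 * (eps / B).
    have -> : M * (eps / B) + M ^+ 2 * (eps / B) + M ^+ 2 * (eps / B) = eps / B * B.
      by rewrite /B; move: (eps / _) => q; ring.
    by rewrite divfK// gt_eqF.
  by rewrite !lerD.
have y0 : y != 0.
  have [|u [_ h1 h2 _]] := yE (M / 4); first by lra.
  rewrite -nr_gt0; have := nr_geB (K' u) (K' u - y); rewrite subKr; move: h1 h2 M0; lra.
have [v [l [v0 vl lM]]] : exists v (l : R), [/\ v != 0, K' v = l%:C *: v & `|l| = M].
  have [v0|v0] := eqVneq (K' y + M%:C *: y) 0.
    exists y, (- M); split => //; last by rewrite normrN gtr0_norm.
    by apply/eqP; rewrite rmorphN scaleNr -addr_eq0 v0.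
  exists (K' y + M%:C *: y), M; split => //; last by rewrite gtr0_norm.
  have -> : K' (K' y + M%:C *: y) = K' (K' y) + M%:C *: K' y by rewrite linearD linearZ.
  by rewrite yM scalerDr scalerA -rmorphM -expr2 addrC.
have l0 : (l%:C : C) != 0 by apply/eqP => -[] l0; move: lM; rewrite l0 normr0; move: M0; lra.
have ve i : (i < n)%N -> inner v (e i) = 0.
  move=> i_n; have : inner (K' v) (e i) = 0.
    by rewrite /K' bopM (eigen_ip _ _ _ _ _ _ Ksa Ke)// QE ip_proj_off// mulr0.
  by rewrite vl ipZl => /eqP; rewrite mulf_eq0 (negbTE l0) /= => /eqP.
have Kv : K v = l%:C *: v by rewrite -vl /K' bopM QE proj_perp// subr0.
exists ((nr v)^-1%:C *: v), l; split.
- by move=> i i_n; rewrite ipZl ve// mulr0.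
- exact: unit_vector.
- by rewrite linearZ /= Kv !scalerA mulrC.
- by rewrite lM.
Qed.

Lemma spectral K (eta : R) : op_selfadjoint K -> compact_op K -> 0 < eta ->
  exists n e lam, [/\ eigenfamily K n e lam, forall i, (i < n)%N -> eta < `|lam i| &
    forall u, (forall i, (i < n)%N -> inner u (e i) = 0) -> nr (K u) <= eta * nr u].
Proof.
move=> Ksa Kc eta0; have [N HN] := compact_ortho_small K Kc eta eta0.
have [||n [e [lam [Ke big]]] nmax] := max_nat (fun n => exists e lam, eigenfamily K n e lam /\
    forall i, (i < n)%N -> eta < `|lam i|) N.
- by exists (fun=> 0), (fun=> 0).
- move=> k [e [lam [Ke big]]]; apply: (HN k e (proj1 Ke)) => i ik.
  by rewrite (proj2 Ke)// nrZ nrR (ortho_nr k _ i (proj1 Ke))// mulr1; apply: big.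
exists n, e, lam; split => // u ue; rewrite leNgt; apply/negP => Ku; apply: nmax.
have [|v [l [ve v1 Kv lb]]] := spectral_maximal K eta n e lam Ksa Kc eta0 Ke.
  by exists u.
exists (ext e n v), (fun i => if i == n then l else lam i); split; [split|].
- by apply: ortho_ext => //; exact: (proj1 Ke).
- move=> i; rewrite ltnS leq_eqVlt /ext; case: eqP => // _ /= i_n; exact: (proj2 Ke).
- by move=> i; rewrite ltnS leq_eqVlt; case: eqP => // _ /= i_n; exact: big.
Qed.

Lemma min_arith (x y w d i j e : R) : x < d + i -> y < d + j -> i <= e / 4 -> j <= e / 4 ->
  d <= w -> 2 * x + 2 * y - 4 * w <= e.
Proof. lra. Qed.

(** The complement of ker K is the closure of ran K. A minimizing sequence of residues f - K g is
    Cauchy by the parallelogram law; its limit h is orthogonal to ran K, hence lies in ker K, yet it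
    is a limit of vectors orthogonal to ker K, so h = 0. *)
Lemma range_dense K f (eps : R) : op_selfadjoint K -> (forall v, K v = 0 -> inner f v = 0) ->
  0 < eps -> exists g, nr (f - K g) <= eps.
Proof.
move=> Ksa fk eps0; have Hc : seq_complete H by exact: complete_seq_complete.
pose E := [set nr (f - K g) ^+ 2 | g in [set: H]]%classic; pose d := inf E.
have Ei : has_inf E.
  split; first by exists (nr (f - K 0) ^+ 2), 0.
  by exists 0 => _ [g _ <-]; rewrite exprn_ge0// nr_ge0.
have dle g : d <= nr (f - K g) ^+ 2 by apply: ge_inf; [exact: (proj2 Ei)|exists g].
have /choice[gs Hg] : forall k : nat, exists g, nr (f - K g) ^+ 2 < d + k.+1%:R^-1.
  move=> k; have k0 : 0 < k.+1%:R^-1 :> R by rewrite invr_gt0 ltr0n.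
  by have [_ [g _ <-] h] := inf_adherent k0 Ei; exists g.
pose a k := f - K (gs k).
have inv_small (e : R) : 0 < e -> exists N, forall k, (N <= k)%N -> (k.+1%:R^-1 : R) <= e.
  move=> e0; exists (Num.bound e^-1) => k Nk; rewrite -[leRHS]invrK lef_pV2 ?posrE ?invr_gt0 ?ltr0n//.
  have := archi_boundP (ltW (_ : 0 < e^-1)); rewrite invr_gt0 => /(_ e0) /ltW/le_trans; apply.
  by rewrite ler_nat (leq_trans Nk).
have par (x y : H) : nr (x - y) ^+ 2 = 2 * nr x ^+ 2 + 2 * nr y ^+ 2 - 4 * nr (2^-1 *: (x + y)) ^+ 2.
  have rE (v : H) : nr v ^+ 2 = complex.Re (inner v v) by rewrite ip_nr.
  rewrite nrZ exprMn nrV nrn !rE !(ipDl, ipDr, ipNl, ipNr).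
  move: (inner x x) (inner x y) (inner y x) (inner y y) => [a1 b1] [a2 b2] [a3 b3] [a4 b4] /=.
  by field.
have ac : cauchyn a.
  move=> e e0; have e2 : 0 < e ^+ 2 / 4 by rewrite divr_gt0// exprn_gt0.
  have [N HN] := inv_small _ e2; exists N => n m Nn Nm.
  rewrite -(ler_pXn2r (n := 2)) ?nnegrE ?nr_ge0// ?(ltW e0)// par.
  have h1 : nr (a n) ^+ 2 < _ := Hg n; have h2 : nr (a m) ^+ 2 < _ := Hg m; have h3 := HN n Nn; have h4 := HN m Nm.
  have -> : 2^-1 *: (a n + a m) = f - K (2^-1 *: (gs n + gs m)).
    have half (f' x y : H) : 2^-1 *: (f' - x + (f' - y)) = f' - 2^-1 *: (x + y).
      by rewrite addrACA -opprD scalerBr scale_half.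
    have KE : K (2^-1 *: (gs n + gs m)) = 2^-1 *: (K (gs n) + K (gs m)) by rewrite linearZ linearD.
    by rewrite KE; exact: half.
  have h5 := dle (2^-1 *: (gs n + gs m)).
  exact: (min_arith _ _ _ _ _ _ _ h1 h2 h3 h4 h5).
have [h ha] := Hc a ac.
(* Moving a_k along K(g) cannot decrease its norm below d, so a_k is almost orthogonal to ran K. *)
have orth g k : nr (inner (a k) (K g)) ^+ 2 <= k.+1%:R^-1 * nr (K g) ^+ 2.
  have [K0|K0] := eqVneq (K g) 0; first by rewrite K0 ip0r !nr0 !expr0n /= mulr0.
  have n0 : 0 < nr (K g) by rewrite nr_gt0.
  have n2 : 0 < nr (K g) ^+ 2 by rewrite exprn_gt0.
  pose c : C := inner (a k) (K g) / (nr (K g) ^+ 2)%:C.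
  have cE : c * (nr (K g) ^+ 2)%:C = inner (a k) (K g).
    by rewrite divfK//; apply/eqP => -[] h0; move: n2; rewrite h0 ltxx.
  have p : inner (a k - c *: K g) (c *: K g) = 0 by rewrite ipZr ipBl ipZl ip_nr cE subrr mulr0.
  have := pythagoras _ _ p; rewrite subrK => pe.
  have h1 : d <= nr (a k - c *: K g) ^+ 2.
    by rewrite /a -addrA -opprD -linearZ -linearD; exact: dle.
  have h0 : nr (a k) ^+ 2 < d + k.+1%:R^-1 := Hg k; rewrite pe in h0.
  have h2 : nr (c *: K g) ^+ 2 <= k.+1%:R^-1.
    by apply: ltW; rewrite -(ltrD2l d); apply: le_lt_trans h0; rewrite lerD2r.
  rewrite -cE nrM nrR ger0_norm ?exprn_ge0 ?nr_ge0// exprMn [X in _ * X]expr2 mulrA -exprMn -nrZ.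
  by rewrite ler_wpM2r// ltW.
have hK g : inner h (K g) = 0.
  apply: nr_small => e e0; pose B := nr (K g) + 1; have B0 : 0 < B by rewrite ltr_wpDl ?nr_ge0.
  have e2 : 0 < e / 2 by lra.
  have [N HN] := ha (e / 2 / B) (divr_gt0 e2 B0).
  have [N' HN'] := inv_small ((e / 2 / B) ^+ 2) ltac:(by rewrite exprn_gt0// divr_gt0).
  pose k := maxn N N'.
  have -> : inner h (K g) = inner (a k) (K g) - inner (a k - h) (K g) by rewrite (ipBl (a k) h) subKr.
  rewrite (le_trans (nrB _ _))// [e]splitr; apply: lerD.
    rewrite -(ler_pXn2r (n := 2)) ?nnegrE ?nr_ge0// ?(ltW e2)//; apply: le_trans (orth g k) _.
    apply: (@le_trans _ _ ((e / 2 / B) ^+ 2 * B ^+ 2)); last by rewrite -exprMn divfK// gt_eqF.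
    apply: ler_pM; rewrite ?invr_ge0 ?exprn_ge0 ?nr_ge0//; first by apply: HN'; rewrite leq_maxr.
    by rewrite lerXn2r ?nnegrE ?nr_ge0 ?(ltW B0)// lerDl.
  apply: le_trans (cauchy_schwarz _ _) _; apply: (@le_trans _ _ (e / 2 / B * B)); last by rewrite divfK// gt_eqF.
  by apply: ler_pM; rewrite ?nr_ge0 ?lerDl// HN// leq_maxl.
have Kh : K h = 0 by apply: ip_nr_eq => w; rewrite Ksa hK ip0l.
have h0 : h = 0.
  have : inner h h = 0.
    apply: nr_small => e e0; pose B := nr h + 1; have B0 : 0 < B by rewrite ltr_wpDl ?nr_ge0.
    have [N HN] := ha (e / B) (divr_gt0 e0 B0).
    have -> : inner h h = - inner (a N - h) h.
      have aN : inner (a N) h = 0 by rewrite /a ipBl (fk h Kh) Ksa Kh ip0r subr0.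
      by rewrite (ipBl (a N) h) aN sub0r opprK.
    rewrite nrN (le_trans (cauchy_schwarz _ _))//.
    apply: (@le_trans _ _ (e / B * B)); last by rewrite divfK// gt_eqF.
    by apply: ler_pM; rewrite ?nr_ge0 ?lerDl// HN.
  by rewrite ip_nr => -[] /eqP; rewrite sqrf_eq0 => /eqP/nr0_eq0.
have [N HN] := ha eps eps0; exists (gs N); have := HN N (leqnn N).
by rewrite h0 subr0.
Qed.

End Spectral.

(** * Riemann integrals, traces and Laurent coefficients *)

Section Riemann.
Context {R : realType} {V : normedModType R[i]}.

Lemma riemann_sum_deriv (u g : R -> V) (eps eta b : R) (s : seq R) : forall (a : R) (t : nat -> R),
  path <%R a s -> last a s = b ->
  (forall x, a <= x <= b -> rder u x (g x)) ->
  (forall x y, a <= x <= b -> a <= y <= b -> `|x - y| < eta -> nr (g x - g y) <= eps) ->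
  (forall i, (i < size s)%N -> nth b s i - nth b (a :: s) i < eta /\
     nth b (a :: s) i <= t i <= nth b s i) ->
  nr (\sum_(0 <= i < size s) (nth b s i - nth b (a :: s) i)%:C *: g (t i) - (u b - u a)) <= eps * (b - a).
Proof.
elim: s => [|x s IH] a t /=.
  by move=> _ -> _ _ _; rewrite big_nil !subrr nr0 mulr0.
move=> /andP[ax xs] lb du gc Ht; have xb : x <= b.
  rewrite -lb; elim: (s) (x) xs {IH Ht lb} => [|y l IH] z //= /andP[zy yl].
  by rewrite (le_trans (ltW zy))// IH.
rewrite big_nat_recl//=; have [h1 /andP[h2 h3]] := Ht 0%N isT; rewrite /= in h1 h2 h3.
have xa y : x <= y <= b -> a <= y <= b by move=> /andP[h ->]; rewrite (le_trans (ltW ax)).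
have -> : (x - a)%:C *: g (t 0) + \sum_(0 <= i < size s) (nth b s i - nth b (x :: s) i)%:C *: g (t i.+1) -
   (u b - u a) = - ((u x - u a) - (x - a)%:C *: g (t 0)) +
   (\sum_(0 <= i < size s) (nth b s i - nth b (x :: s) i)%:C *: g (t i.+1) - (u b - u x)).
  by move: (\sum_(_ <= _ < _) _) (_ *: _) (u b) (u x) (u a) => p q a1 a2 a3; vec.
rewrite (_ : eps * (b - a) = eps * (x - a) + eps * (b - x)); last by ring.
apply: le_trans (nrD _ _) _; apply: lerD; last first.
  apply: (IH x (fun i => t i.+1)) => // [y /xa/du//|y z /xa hy /xa hz|i ilt]; first exact: gc.
  exact: (Ht i.+1).
rewrite nrN; pose w y := u y - y%:C *: g (t 0%N).
have -> : u x - u a - (x - a)%:C *: g (t 0%N) = w x - w a.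
  have -> : ((x - a)%:C : R[i]) = x%:C - a%:C by rewrite rmorphB.
  by rewrite /w; move: (x%:C : R[i]) (a%:C : R[i]) (g _) (u x) (u a) => c c' p q q'; vec.
apply: mean_value => [|y /andP[ay yx]]; first exact: ltW.
have yb : a <= y <= b by rewrite ay (le_trans yx).
exists (g y - g (t 0%N)); last first.
  apply: gc => //; first by rewrite h2 (le_trans h3).
  by rewrite ltr_norml; apply/andP; split; lra.
move=> e e0; have [d d0 Hd] := du y yb e e0; exists d => // h /Hd.
have -> // : w (y + h) - w y - h%:C *: (g y - g (t 0%N)) = u (y + h) - u y - h%:C *: g y.
rewrite /w (_ : ((y + h)%:C : R[i]) = y%:C + h%:C); last by rewrite rmorphD.
by move: (y%:C : R[i]) (h%:C : R[i]) (g (t 0%N)) (g y) (u (y + h)) (u y) => c c' p q q' q''; vec.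
Qed.

(** The circle integrals of the problem are evaluated by exhibiting a primitive, so this is the only
    existence statement for the Riemann integral that is required. *)
Lemma riemann_deriv (u g : R -> V) (a b : R) : a < b ->
  (forall x, a <= x <= b -> rder u x (g x)) -> (forall x, a <= x <= b -> rcont g x) ->
  is_riemann_integral a b g (u b - u a).
Proof.
move=> ab du cg eps eps0; have e1 : 0 < eps / (2 * (b - a)).
  by rewrite divr_gt0// mulr_gt0// subr_gt0.
have e2 : 0 < eps / (2 * (b - a)) / 2 by rewrite divr_gt0.
have [||eta eta0 Heta] := uniform_seg a b (fun x d => forall y, a <= y <= b -> `|x - y| < d ->
    nr (g x - g y) <= eps / (2 * (b - a))) (ltW ab).
- by move=> x d d' d0 dd h y yab xy; apply: h => //; exact: lt_le_trans dd.
- move=> t tab; have [d d0 Hd] := cg t tab _ e2; exists (d / 2); first by rewrite divr_gt0.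
  move=> x xt y yab xy; apply: le_trans (nr_tri (g t) _ _) _.
  rewrite [eps / (2 * (b - a))]splitr; apply: lerD; first by apply: Hd; lra.
  rewrite nrC; apply: Hd; have := ler_distD x y t; rewrite [`|y - x|]distrC; lra.
exists eta => // s t [sp /eqP sl] Hs; rewrite -nr_lt.
apply: (@le_lt_trans _ _ (eps / (2 * (b - a)) * (b - a))).
  by apply: (riemann_sum_deriv u g _ eta) => // x y xab yab xy; apply: Heta.
have ba : 0 < b - a by rewrite subr_gt0.
by rewrite (_ : eps / (2 * (b - a)) * (b - a) = eps / 2); [lra|field; rewrite gt_eqF].
Qed.

Lemma riemann_uniq (f : R -> V) (a b : R) (I I' : V) : a < b ->
  is_riemann_integral a b f I -> is_riemann_integral a b f I' -> I = I'.
Proof.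
move=> ab HI HI'; apply/eqP; rewrite -subr_eq0; apply/eqP; apply: nr_small => eps eps0.
have e2 : 0 < eps / 2 by lra.
have [eta eta0 H1] := HI _ e2; have [eta' eta0' H2] := HI' _ e2.
have ba : 0 < b - a by rewrite subr_gt0.
have m0 : 0 < Num.min eta eta' by rewrite lt_min eta0.
pose N := (Num.bound ((b - a) / Num.min eta eta')).+1.
have N0 : 0 < N%:R :> R by rewrite ltr0n.
have step : (b - a) / N%:R < Num.min eta eta'.
  rewrite ltr_pdivrMr// mulrC -ltr_pdivrMr//.
  apply: lt_trans (archi_boundP (divr_ge0 (ltW ba) (ltW m0))) _; by rewrite ltr_nat.
pose p (i : nat) : R := a + (b - a) / N%:R * i%:R.
pose s := [seq p i | i <- iota 1 N].
have p0 : a = p 0%N by rewrite /p mulr0 addr0.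
have pN : b = p N by rewrite /p divfK ?gt_eqF// addrC subrK.
have asE : a :: s = [seq p i | i <- iota 0 N.+1] by rewrite [RHS]/= -p0.
have ssz : size s = N by rewrite size_map size_iota.
have n1 i : (i < N)%N -> nth b (a :: s) i = p i.
  by move=> iN; rewrite asE (nth_map 0%N) ?size_iota ?ltnS ?(ltnW iN)// nth_iota ?ltnS ?(ltnW iN).
have n2 i : (i < N)%N -> nth b s i = p i.+1.
  by move=> iN; rewrite (nth_map 0%N) ?size_iota// nth_iota// add1n.
have pS i : p i.+1 - p i = (b - a) / N%:R by rewrite /p -natr1; ring.
have st0 : 0 < (b - a) / N%:R by rewrite divr_gt0.
have part : itv_partition a b s.
  split; last by rewrite (last_nth b) ssz asE (nth_map 0%N) ?size_iota// nth_iota// -pN.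
  apply/(pathP b) => i; rewrite ssz => iN; rewrite n1// n2//.
  by rewrite -subr_gt0 pS.
have tags i : (i < size s)%N -> nth b s i - nth b (a :: s) i < Num.min eta eta' /\
    nth b (a :: s) i <= p i <= nth b s i.
  by rewrite ssz => iN; rewrite n1// n2// pS step lexx/= -subr_ge0 pS ltW.
have m1 : Num.min eta eta' <= eta by rewrite ge_min lexx.
have m2 : Num.min eta eta' <= eta' by rewrite ge_min lexx orbT.
have {}H1 := H1 s p part (fun i h => conj (lt_le_trans (proj1 (tags i h)) m1) (proj2 (tags i h))).
have {}H2 := H2 s p part (fun i h => conj (lt_le_trans (proj1 (tags i h)) m2) (proj2 (tags i h))).
move: H1 H2; rewrite -!nr_lt; move: (\sum_(_ <= _ < _) _) => S h1 h2.
apply: le_trans (nr_tri S _ _) _; rewrite [nr (I - S)]nrC; lra.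
Qed.

End Riemann.

Section Traces.
Context {R : realType} {H : hilbertType R}.
Notation C := R[i].
Notation Co := (R[i]^o).
Implicit Types (e d : nat -> H) (u v x : H) (S T : bop H).

Lemma ntends_cvg (V : normedModType C) (u : nat -> V) (l : V) : ntends u l <-> u @ \oo --> l.
Proof.
split=> [ul|/cvgrPdist_le ul].
  apply/cvgrPdist_le => eps eps0; have er : eps = (complex.Re eps)%:C by rewrite RRe_real// gtr0_real.
  have e0 : 0 < complex.Re eps by move: eps0; rewrite {1}er ltcR.
  have [N HN] := ul _ e0; exists N => // n /= Nn.
  by rewrite er -nr_le nrC HN.
move=> eps eps0; have [|N _ HN] := ul eps%:C; first by rewrite ltcR.
by exists N => n Nn; rewrite nrC nr_le; apply: HN.
Qed.

(** If the new vector depends on the previous ones, the inverse of the norm 0 is 0 and the entry is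
    0; this is the padding by zero vectors in [orthonormal_basis]. *)
Fixpoint gram_schmidt d (n : nat) : seq H := if n is m.+1 then
  let v := d m - \sum_(x <- gram_schmidt d m) inner (d m) x *: x in
  rcons (gram_schmidt d m) ((nr v)^-1%:C *: v) else [::].

Lemma orthonormal_basis_exists : separable H -> exists e, orthonormal_basis e.
Proof.
move=> [S Sc Sd]; have /countable_injP[f fi] := Sc.
pose d n := xget 0 [set x | S x /\ f x = n]; pose l := gram_schmidt d.
have dS x : S x -> d (f x) = x.
  by move=> Sx; rewrite /d; case: xgetP => [y _ [Sy fxy]|/(_ x)[]//]; apply: fi; [exact/mem_set|exact/mem_set|exact: fxy].
pose e n := nth 0 (l n.+1) n.
have sl n : size (l n) = n by elim: n => [//|n IH]; rewrite /l /= size_rcons IH.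
have le_ n : l n = [seq e i | i <- iota 0 n].
  elim: n => [//|n IH]; rewrite -addn1 iotaD map_cat -IH add0n /= cats1 {1}/l addn1 /=.
  by congr rcons; rewrite /e /l /= nth_rcons -/l sl ltnn eqxx.
pose v n := d n - \sum_(i < n) inner (d n) (e i) *: e i.
have eE n : e n = (nr (v n))^-1%:C *: v n.
  rewrite /e /l /= nth_rcons -/l sl ltnn eqxx le_ big_map.
  by rewrite (_ : \sum_(j <- _) _ = \sum_(i < n) inner (d n) (e i) *: e i)// -(big_mkord xpredT
    (fun i => inner (d n) (e i) *: e i)) /index_iota subn0.
have e01 n : e n = 0 \/ inner (e n) (e n) = 1.
  rewrite eE; have [->|v0] := eqVneq (v n) 0; first by left; rewrite scaler0.
  by right; rewrite ip_nr unit_vector// expr1n.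
have eo n : forall j, (j < n)%N -> inner (e n) (e j) = 0.
  elim/ltn_ind: n => n IH j jn; rewrite eE ipZl (_ : inner (v n) (e j) = 0) ?mulr0//.
  rewrite /v ipBl ip_suml (bigD1 (Ordinal jn))//= big1 ?addr0 => [|i ij].
    by rewrite ipZl; case: (e01 j) => ->; rewrite ?ip0r ?mulr1 ?mulr0 subrr.
  rewrite ipZl; have /orP[h|h] : (i < j)%N || (j < i)%N by rewrite -neq_ltn.
    by rewrite (ip_eq0C _ _ (IH j jn i h)) mulr0.
  by rewrite (IH i (ltn_ord i) j h) mulr0.
exists e; split => //.
  move=> i j; rewrite neq_ltn => /orP[h|h]; last exact: eo.
  by apply: ip_eq0C; exact: eo.
move=> u ue; have ud n : inner (d n) u = 0.
  have -> : d n = v n + \sum_(i < n) inner (d n) (e i) *: e i by rewrite subrK.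
  rewrite ipDl ip_suml big1 ?addr0 => [|i _]; last by rewrite ipZl (ip_eq0C _ _ (ue i)) mulr0.
  have [->|v0] := eqVneq (v n) 0; first by rewrite ip0l.
  have nv : (nr (v n))%:C != 0 :> C by apply/eqP => -[] /nr0_eq0/eqP; rewrite (negbTE v0).
  have -> : v n = (nr (v n))%:C *: e n by rewrite eE scalerA -rmorphM divff ?scale1r// gt_eqF// nr_gt0.
  by rewrite ipZl (ip_eq0C _ _ (ue n)) mulr0.
apply: nr0_eq0; apply/eqP; rewrite eq_le nr_ge0 andbT leNgt; apply/negP => u0.
have [|x [xu /dS xd]] := Sd (ball u (nr u)%:C) _ (ball_open u _).
  by exists u; apply: ballxx; rewrite ltcR.
move: xu; rewrite -ball_normE /= -nr_lt -(ltr_pXn2r (n := 2)) ?nnegrE ?nr_ge0//.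
rewrite pythagoras; last by rewrite ipNr -xd (ip_eq0C _ _ (ud _)) oppr0.
by rewrite ltNge lerDl exprn_ge0// nr_ge0.
Qed.

(** The distances of x to the partial sums decrease, so by Pythagoras the partial sums are Cauchy;
    the difference of x and their limit is orthogonal to every e_j. *)
Lemma basis_expansion e x : orthonormal_basis e ->
  ntends (fun n => \sum_(i < n) inner x (e i) *: e i) x.
Proof.
move=> [eo e01 et]; pose s n := \sum_(i < n) inner x (e i) *: e i.
have sE n j : (j < n)%N -> inner (x - s n) (e j) = 0.
  move=> jn; rewrite ipBl ip_suml (bigD1 (Ordinal jn))//= big1 ?addr0 => [|i ij].
    by rewrite ipZl; case: (e01 j) => ->; rewrite ?ip0r ?mulr1 ?mulr0 subrr.
  by rewrite ipZl eo ?mulr0.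
have sp n m u : (m <= n)%N -> (forall j, (j < n)%N -> inner u (e j) = 0) -> inner u (s m) = 0.
  move=> mn h; apply: ip_eq0C; rewrite ip_suml big1// => i _.
  by rewrite ipZl (ip_eq0C _ _ (h i _)) ?mulr0// (leq_trans _ mn).
have an n m : (n <= m)%N -> nr (x - s n) ^+ 2 = nr (x - s m) ^+ 2 + nr (s m - s n) ^+ 2.
  move=> nm; rewrite -pythagoras ?subrKA// ipBr (sp m m)// ?(sp m n) ?subrr// => j; exact: sE.
pose E := [set nr (x - s n) ^+ 2 | n in [set: nat]]%classic.
have Ei : has_inf E.
  split; first by exists (nr (x - s 0%N) ^+ 2), 0%N.
  by exists 0 => _ [n _ <-]; rewrite exprn_ge0// nr_ge0.
have dle n : inf E <= nr (x - s n) ^+ 2 by apply: ge_inf; [exact: (proj2 Ei)|exists n].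
have sc : cauchyn s.
  move=> eps eps0; have e2 : 0 < eps ^+ 2 by rewrite exprn_gt0.
  have [_ [N _ <-] HN] := inf_adherent e2 Ei; exists N.
  have key n m : (N <= n)%N -> (n <= m)%N -> nr (s m - s n) <= eps.
    move=> Nn nm; rewrite -(ler_pXn2r (n := 2)) ?nnegrE ?nr_ge0// ?(ltW eps0)//.
    have h1 := an n m nm; have h2 := an N n Nn; have h3 := dle m.
    have h4 : 0 <= nr (s n - s N) ^+ 2 by rewrite exprn_ge0// nr_ge0.
    rewrite -(lerD2l (inf E)); apply: le_trans (ltW HN); rewrite h2 h1.
    by rewrite -addrA lerD// lerDl.
  move=> n m Nn Nm; have [nm|/ltnW mn] := leqP n m; last exact: key.
  by rewrite nrC; apply: key.
have [y sy] : exists y, ntends s y by exact: complete_seq_complete.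
suff xy : x = y by move: sy; rewrite -xy.
apply/eqP; rewrite -subr_eq0; apply/eqP; apply: et => j.
apply: nr_small => eps eps0; pose B := nr (e j) + 1; have B0 : 0 < B by rewrite ltr_wpDl ?nr_ge0.
have [N HN] := sy (eps / B) (divr_gt0 eps0 B0).
pose k := maxn N j.+1; have -> : inner (x - y) (e j) = inner (s k - y) (e j).
  have -> : x - y = (x - s k) + (s k - y) by rewrite subrKA.
  by rewrite ipDl sE ?add0r// leq_maxr.
apply: le_trans (cauchy_schwarz _ _) _; apply: (@le_trans _ _ (eps / B * B)); last by rewrite divfK// gt_eqF.
by apply: ler_pM; rewrite ?nr_ge0 ?lerDl// HN// leq_maxl.
Qed.

Lemma trace_uniq T (t t' : C) : separable H -> has_trace T t -> has_trace T t' -> t = t'.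
Proof.
move=> /orthonormal_basis_exists[e eb] h h'.
exact: (ntends_uniq _ _ _ (proj2 (ntends_cvg _ _ _) (h e eb)) (proj2 (ntends_cvg _ _ _) (h' e eb))).
Qed.

Lemma traceD S T (s t : C) : has_trace S s -> has_trace T t -> has_trace (S + T) (s + t).
Proof.
move=> hs ht e eb; have /ntends_cvg h1 := hs e eb; have /ntends_cvg h2 := ht e eb.
apply/ntends_cvg; apply: ntends_eq (ntendsD _ _ _ _ h1 h2) => n.
by rewrite /series /= -big_split; apply: eq_bigr => i _; exact: esym (ipDl _ _ _).
Qed.

Lemma traceZ T (a t : C) : has_trace T t -> has_trace (a *: T) (a * t).
Proof.
move=> ht e eb; have /ntends_cvg h := ht e eb.
apply/ntends_cvg; apply: ntends_eq (ntendsZ _ _ a h) => n.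
by rewrite /series /= scaler_sumr; apply: eq_bigr => i _; exact: esym (ipZl _ _ _).
Qed.

Lemma trace_rank1 x u S : has_trace (rk x u * S) (inner (S x) u).
Proof.
move=> e eb; apply/ntends_cvg => eps eps0; pose B := nr S * nr u + 1.
have B0 : 0 < B by rewrite ltr_wpDl// mulr_ge0 ?nr_ge0.
have [N HN] := basis_expansion e x eb (eps / B) (divr_gt0 eps0 B0); exists N => n Nn.
have -> : series (fun i => inner ((rk x u * S) (e i)) (e i) : Co) n =
    inner (S (\sum_(i < n) inner x (e i) *: e i)) u.
  rewrite linear_sum ip_suml /series /= big_mkord; apply: eq_bigr => i _.
  by rewrite ipZl linearZ ipZl mulrC.
rewrite -ipBl -linearB; apply: le_trans (cauchy_schwarz _ _) _.
apply: (@le_trans _ _ (nr S * (eps / B) * nr u)).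
  by rewrite ler_wpM2r ?nr_ge0// (le_trans (nr_app _ _))// ler_wpM2l ?nr_ge0// HN.
rewrite mulrAC -[leRHS](divfK (lt0r_neq0 B0)) mulrC; apply: ler_wpM2l.
  by rewrite divr_ge0// ltW.
by rewrite lerDl.
Qed.

End Traces.

Lemma ccont_agree {R : realType} {V : normedModType R[i]} (O : set R[i]) (f g : R[i] -> V) w : copen O -> O w ->
  ccont f w -> ccont g w -> (forall z, O z -> z != w -> f z = g z) -> f w = g w.
Proof.
move=> Oo Ow fc gc fg; apply/eqP; rewrite -subr_eq0; apply/eqP; apply: nr_small => e e0.
have e2 : 0 < e / 2 by lra.
have [d d0 Hd] := Oo w Ow; have [d1 d10 H1] := fc _ e2; have [d2 d20 H2] := gc _ e2.
pose d3 := Num.min d (Num.min d1 d2) / 2.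
have m0 : 0 < Num.min d (Num.min d1 d2) by rewrite !lt_min d0 d10.
have d30 : 0 < d3 by rewrite divr_gt0.
have d3m : d3 < Num.min d (Num.min d1 d2) by rewrite /d3; move: (Num.min _ _) m0 => x x0; lra.
move: d3m; rewrite !lt_min => /and3P[a1 a2 a3].
have zw : nr (w + d3%:C - w) = d3 by rewrite addrC addKr nrR gtr0_norm.
have E : f (w + d3%:C) = g (w + d3%:C).
  apply: fg; first by apply: Hd; rewrite zw.
  by rewrite -subr_eq0 -nr_gt0 zw.
apply: le_trans (nr_tri (f (w + d3%:C)) _ _) _; rewrite [e]splitr; apply: lerD.
  by rewrite nrC; apply: H1; rewrite zw.
by rewrite E; apply: H2; rewrite zw.
Qed.

Section TraceFamilies.
Context {R : realType} {H : hilbertType R}.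
Notation C := R[i].
Notation Co := (R[i]^o).
Implicit Types (O : set C) (N : C -> bop H) (nu : C -> Co).

(** Finite-rank holomorphic families, built together with their traces. The trace is not continuous
    for the operator norm, so that of a Laurent coefficient is not obtained by a limit; it is
    followed through constructions that stay in this class. *)
Inductive trace_family O : (C -> bop H) -> (C -> Co) -> Prop :=
| trace_family0 : trace_family O (fun=> 0) (fun=> 0)
| trace_familyS N nu (x : C -> H) (e : H) (S : C -> bop H) : holo O x -> holo O S ->
    trace_family O N nu ->
    trace_family O (fun z => rk (x z) e * S z + N z) (fun z => inner (S z (x z)) e + nu z).

Lemma trace_family_trace O N nu z : trace_family O N nu -> has_trace (N z) (nu z).
Proof.
elim=> [|N' nu' x e S _ _ _ IH]; last by apply: traceD; [exact: trace_rank1|exact: IH].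
by have := traceZ _ 0 _ (trace_rank1 (0 : H) 0 (0 : bop H)); rewrite scale0r mul0r.
Qed.

Lemma trace_family_holo O N nu : trace_family O N nu -> holo O N /\ holo O nu.
Proof.
elim=> [|N' nu' x e S hx hS _ [IH1 IH2]].
  by split=> z _; exists 0; exact: cder_cst.
split=> z Oz; have [lx dx] := hx z Oz; have [lS dS] := hS z Oz.
  have [l dl] := IH1 z Oz; eexists; apply: cderD dl.
  by apply: cder_comp_op dS; apply: cder_rk dx.
have [l dl] := IH2 z Oz; eexists; apply: cderD dl.
by apply: cder_ip; apply: cder_app dS dx.
Qed.

(** The product rule for difference quotients: the quotient of rk (x z) e S(z) is a sum of two terms
    of the same form. *)
Lemma trace_family_divided O N nu w : copen O -> O w -> trace_family O N nu ->
  exists N' nu', [/\ trace_family O N' nu', forall z, N z = N w + (z - w) *: N' z &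
    forall z, nu z = nu w + (z - w) * nu' z].
Proof.
move=> Oo Ow; elim=> [|N0 nu0 x e S hx hS _ [N' [nu' [t' HN Hnu]]]].
  exists (fun=> 0), (fun=> 0); split; first exact: trace_family0.
    by move=> z; rewrite scaler0 addr0.
  by move=> z; rewrite mulr0 addr0.
have Hc : seq_complete H by exact: complete_seq_complete.
have [x1 hx1 xE] := divided_difference Hc O x w Oo Ow hx.
have [S1 hS1 SE] := divided_difference bop_complete O S w Oo Ow hS.
have hxw : holo O (fun=> x w) by move=> z _; exists 0; exact: cder_cst.
eexists; eexists; split.
- exact: trace_familyS hxw hS1 (trace_familyS O N' nu' x1 e S hx1 hS t').
- move=> z; have ZAl (a : C) (X Y : bop H) : a *: (X * Y) = (a *: X) * Y by exact: bopP.
  have ZAr (a : C) (X Y : bop H) : a *: (X * Y) = X * (a *: Y).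
    by apply: bopP => u; rewrite bopM bopZ linearZ.
  have E1 : rk (x z) e = rk (x w) e + (z - w) *: rk (x1 z) e.
    by apply: bopP => u; rewrite bopD bopZ !rkE xE scalerDr !scalerA mulrC.
  have -> : rk (x z) e * S z = rk (x w) e * S w + (z - w) *: (rk (x w) e * S1 z + rk (x1 z) e * S z).
    by rewrite scalerDr ZAr ZAl addrA -mulrDr -SE -mulrDl -E1.
  rewrite HN; move: (rk (x w) e * S w) (rk (x w) e * S1 z) (rk (x1 z) e * S z) (N0 w) (N' z) (z - w).
  by move=> p q1 q2 p' q' c; vec.
- move=> z; rewrite Hnu.
  have -> : inner (S z (x z)) e = inner (S w (x w)) e +
      (z - w) * (inner (S1 z (x w)) e + inner (S z (x1 z)) e).
    rewrite mulrDr -!ipZl addrA -!ipDl; congr (inner _ e).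
    have -> : S w (x w) + (z - w) *: S1 z (x w) = S z (x w) by rewrite (SE z).
    by rewrite {1}xE linearD linearZ.
  by ring.
Qed.

(** Divided differences of [N] and of its trace [nu] are taken together. While m > 0 the trace
    vanishes at [w], so its order drops by one at each step; after m steps the value of the trace at
    [w] is [c]. *)
Lemma laurent O w m (c : C) : copen O -> O w -> forall N nu (q : C -> Co), trace_family O N nu ->
  ccont q w -> (forall z, O z -> nu z = c * (z - w) ^+ m + (z - w) ^+ m.+1 * q z) ->
  exists (Ck : nat -> bop H) (N1 : C -> bop H), [/\ holo O N1, has_trace (Ck m) c &
    forall z, N z = \sum_(k < m.+1) (z - w) ^+ k *: Ck k + (z - w) ^+ m.+1 *: N1 z].
Proof.
move=> Oo Ow; elim: m => [|m IH] N nu q tN qc nuE.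
  have [N' [nu' [t' HN Hnu]]] := trace_family_divided O N nu w Oo Ow tN.
  exists (fun=> N w), N'; split; first by case: (trace_family_holo _ _ _ t').
    have := trace_family_trace O N nu w tN; rewrite (nuE w Ow) subrr expr0 mulr1 expr1 mul0r addr0.
    by [].
  by move=> z; rewrite big_ord1 expr0 scale1r expr1.
have [N' [nu' [t' HN Hnu]]] := trace_family_divided O N nu w Oo Ow tN.
have nuw : nu w = 0 by rewrite (nuE w Ow) subrr !exprS !mul0r mulr0 addr0.
have czw k z : exists l, cder (fun z => (z - w) ^+ k : Co) z l.
  by eexists; exact: cderX (cder_subc w z).
have rhsc : ccont (fun z => c * (z - w) ^+ m + (z - w) ^+ m.+1 * q z : Co) w.
  have [l1 d1] := czw m w; have [l2 d2] := czw m.+1 w.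
  have k1 := ccontZ _ _ _ (cder_cont _ _ _ (cder_cst (c : Co) w)) (cder_cont _ _ _ d1).
  have k2 := ccontZ _ _ _ (cder_cont _ _ _ d2) qc.
  move=> e e0; have e2 : 0 < e / 2 by lra.
  have [d d0 Hd] := k1 _ e2; have [d' d0' Hd'] := k2 _ e2.
  exists (Num.min d d'); first by rewrite lt_min d0.
  move=> y; rewrite lt_min => /andP[/Hd b1 /Hd' b2].
  by rewrite opprD addrACA [e]splitr (le_trans (nrD _ _))// lerD.
have nu'c : ccont nu' w by apply: (holo_cont O) => //; case: (trace_family_holo _ _ _ t').
have nu'E z : O z -> z != w -> nu' z = c * (z - w) ^+ m + (z - w) ^+ m.+1 * q z.
  move=> Oz zw; have zw0 : z - w != 0 by rewrite subr_eq0.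
  apply: (mulfI zw0); have := Hnu z; rewrite nuw add0r => <-; rewrite (nuE z Oz).
  by rewrite mulrDr !exprS; ring.
have [|Ck [N1 [hN1 tC NE]]] := IH N' nu' q t' qc.
  move=> z Oz; have [->|zw] := eqVneq z w; last exact: nu'E.
  exact: (ccont_agree O nu' (fun z => c * (z - w) ^+ m + (z - w) ^+ m.+1 * q z : Co) w Oo Ow nu'c rhsc nu'E).
exists (fun k => if k is k'.+1 then Ck k' else N w), N1; split => // z.
rewrite HN NE [in RHS]big_ord_recl expr0 scale1r -[RHS]addrA; congr (_ + _).
rewrite scalerDr scaler_sumr scalerA -exprS; congr (_ + _); apply: eq_bigr => k _.
by rewrite scalerA -exprS.
Qed.

End TraceFamilies.

Section Jacobi.
Context {R : realType}.
Notation C := R[i].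
Notation Co := (R[i]^o).

Lemma cder_prod_seq (I : eqType) (r : seq I) (F : I -> C -> Co) (F' : I -> C) z : uniq r ->
  (forall i, cder (F i) z (F' i : Co)) ->
  cder (fun z => \prod_(i <- r) F i z : Co) z (\sum_(k <- r) F' k * \prod_(i <- r | i != k) F i z : C).
Proof.
elim: r => [|j r IH] /= ur dF.
  rewrite big_nil; apply: cder_ext (cder_cst (1 : Co) z) => // x; by rewrite big_nil.
move: ur => /andP[jr ur]; have := cderM _ _ _ _ _ (dF j) (IH ur dF).
apply: cder_ext; first by move=> x; rewrite big_cons.
rewrite !big_cons eqxx /=; congr (_ + _).
  congr (_ * _); rewrite big_seq [RHS]big_seq_cond; apply: eq_bigl => i.
  by case ir: (i \in r) => //=; apply/esym; apply: contraNneq jr => <-.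
rewrite big_distrr /= big_seq [RHS]big_seq; apply: eq_bigr => k kr.
rewrite big_cons ifT; first by rewrite mulrCA.
by apply: contraNneq jr => ->.
Qed.

Lemma jacobi n (M : C -> 'M[C]_n) (M' : 'M[C]_n) z :
  (forall i j, cder (fun z => M z i j : Co) z (M' i j : Co)) ->
  cder (fun z => \det (M z) : Co) z (\sum_i \sum_j M' i j * cofactor (M z) i j : C).
Proof.
move=> dM; pose Rk k : 'M[C]_n := \matrix_(i, j) (if i == k then M' i j else M z i j).
have -> : \sum_i \sum_j M' i j * cofactor (M z) i j = \sum_(s : 'S_n) (-1) ^+ s *
    \sum_(k <- index_enum 'I_n) M' k (s k) * \prod_(i <- index_enum 'I_n | i != k) M z i (s i).
  transitivity (\sum_k \det (Rk k)).
    apply: eq_bigr => k _; rewrite (expand_det_row _ k); apply: eq_bigr => j _.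
    rewrite mxE eqxx; congr (_ * _); rewrite /cofactor; congr (_ * \det _).
    by apply/matrixP => a b; rewrite !mxE eq_sym (negbTE (neq_lift _ _)).
  rewrite /determinant exchange_big /=; apply: eq_bigr => s _; rewrite mulr_sumr; apply: eq_bigr => k _.
  congr (_ * _); rewrite (bigD1 k)//= mxE eqxx; congr (_ * _).
  by apply: eq_bigr => i ik; rewrite mxE (negbTE ik).
apply: (cder_sum _ (index_enum 'S_n) (fun s z => (-1) ^+ s * \prod_(i <- index_enum 'I_n) M z i (s i) : Co)
  (fun s => _ : Co)) => s.
apply: cder_ext (cderM _ _ _ _ _ (cder_cst ((-1) ^+ s : Co) z)
  (cder_prod_seq _ (index_enum 'I_n) (fun i z => M z i (s i)) (fun i => M' i (s i)) z
  (index_enum_uniq _) (fun i => dM i (s i)))) => //.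
by rewrite mul0r add0r.
Qed.

End Jacobi.

Section CircleIntegral.
Context {R : realType} {V : normedModType R[i]}.
Notation C := R[i].
Notation Co := (R[i]^o).

Lemma expi_cexp (t : R) : expi t = cexp ('i * t%:C).
Proof.
rewrite /cexp /expi; have -> : 'i * t%:C = 0 +i* t :> C by apply: complexP; rewrite ?cReM ?cImM /=; ring.
by rewrite /= expR0 mul1r.
Qed.

Lemma nr_expi (t : R) : nr (expi t) = 1.
Proof.
rewrite expi_cexp nr_cexp; have -> : complex.Re ('i * t%:C : C) = 0 by rewrite cReM /=; ring.
exact: expR0.
Qed.

Lemma rder_restrict (F : C -> V) (t : R) l : cder F t%:C l -> rder (fun t => F t%:C) t l.
Proof.
move=> dF e e0; have [d d0 Hd] := dF e e0; exists d => // h hd.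
by rewrite rmorphD -[`|h|]nrR; apply: Hd; rewrite nrR.
Qed.

Lemma rcont_restrict (F : C -> V) (t : R) : ccont F t%:C -> rcont (fun t => F t%:C) t.
Proof.
move=> cF e e0; have [d d0 Hd] := cF e e0; exists d => // h hd.
by apply: Hd; rewrite -rmorphB nrR.
Qed.

Lemma cder_expi (rho : R) (w z : C) :
  cder (fun z => w + rho%:C * cexp ('i * z) : Co) z ('i * rho%:C * cexp ('i * z)).
Proof.
have d1 := cder_comp_cexp _ _ _ (cderZc 'i _ _ _ (cder_id z)).
have := cderD _ _ _ _ _ (cder_cst (w : Co) z) (cderZc rho%:C _ _ _ d1).
apply: cder_ext => //; rewrite add0r.
have E (a b c d : C) : d * (b * (a * c)) = a * d * b * c by ring.
by rewrite -[LHS]/(rho%:C * (cexp ('i * z) * ('i * 1))) E mulr1.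
Qed.

(** Along the circle, it Cm + Th is a primitive of the integrand. [Th] returns to its initial value,
    and the first term contributes 2 pi i Cm. *)
Lemma circle_integral (T Th : C -> V) (Cm : V) (w : C) (rho : R) : 0 < rho ->
  (forall z, nr (z - w) = rho -> cder Th z (T z - (z - w)^-1 *: Cm)) ->
  (forall z, nr (z - w) = rho -> exists l, cder T z l) ->
  is_circle_integral T w rho ((2 * 'i * pi%:C) *: Cm).
Proof.
move=> r0 dTh dT; pose c z := w + rho%:C * cexp ('i * z).
pose u z := ('i * z) *: Cm + Th (c z).
have cE (t : R) : c t%:C = w + rho%:C * expi t by rewrite expi_cexp.
have cw z : c z - w = rho%:C * cexp ('i * z) by rewrite /c addrC addKr.
have cn (t : R) : nr (c t%:C - w) = rho.
  by rewrite cE addrC addKr nrM nrR gtr0_norm// nr_expi mulr1.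
have rC : (rho%:C : C) != 0 by apply/eqP => -[] h; move: r0; rewrite h ltxx.
pose g (t : R) := ('i * rho%:C * expi t) *: T (w + rho%:C * expi t).
have du (t : R) : rder (fun t => u t%:C) t (g t).
  apply: rder_restrict.
  have d1 := cderZ _ _ _ _ _ (cderZc 'i _ _ _ (cder_id t%:C)) (cder_cst Cm t%:C).
  have d2 := cder_comp _ _ _ _ _ (cder_expi rho w t%:C) (dTh _ (cn t)).
  have := cderD _ _ _ _ _ d1 d2; apply: cder_ext => //.
  rewrite /g -cE scaler0 addr0 expi_cexp cw scalerBr scalerA addrCA [X in _ + X](_ : _ = 0) ?addr0//.
  rewrite -[X in X *: Cm - _]/('i * 1) mulr1 -scalerBl.
  have e0 := cexp_neq0 ('i * t%:C : C).
  by rewrite (_ : 'i - _ = 0) ?scale0r//; move: (cexp _) e0 => E E0; field; rewrite rC E0.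
have cg (t : R) : rcont g t.
  have [l dl] := dT _ (cn t).
  have cz : ccont (fun z => ('i * (z - w)) *: T z) (c t%:C).
    apply: (ccontZ (fun z => 'i * (z - w) : Co)); last exact: cder_cont dl.
    exact: cder_cont (cderZc 'i _ _ _ (cder_subc w (c t%:C))).
  have cc := cder_cont _ _ _ (cder_expi rho w t%:C).
  have : rcont (fun t => (fun z => ('i * (z - w)) *: T z) (c t%:C)) t.
    apply: (rcont_restrict (fun z => ('i * (c z - w)) *: T (c z))) => e e0.
    have [d d0 Hd] := cz e e0; have d2 : 0 < d / 2 by lra.
    have [d' d'0 Hd'] := cc _ d2; exists d' => // y /Hd' h; apply: Hd; apply: le_lt_trans h _; lra.
  by move=> h e e0; have [d d0 Hd] := h e e0; exists d => // y /Hd; rewrite /g -!cE !cw -!expi_cexp !mulrA.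
have pi0 : 0 < 2 * pi :> R by rewrite mulr_gt0// pi_gt0.
have := riemann_deriv (fun t => u t%:C) g 0 (2 * pi) pi0 (fun t _ => du t) (fun t _ => cg t).
rewrite /is_circle_integral -/g (_ : u _ - u _ = (2 * 'i * pi%:C) *: Cm)//.
rewrite /u !cE /expi cos0 sin0 [2 * pi]mulr_natl cos2pi sin2pi mulr0 scale0r add0r addrK.
by congr (_ *: _); rewrite rmorphMn /= -mulr_natl; ring.
Qed.

End CircleIntegral.

(** * Reduction to a finite determinant and computation of multiplicities *)

Section Reduction.
Context {R : realType} {H : hilbertType R}.
Notation C := R[i].
Notation Co := (R[i]^o).
Variables (p : nat) (x e : nat -> H).

(** The Weinstein-Aronszajn matrix: for invertible [G], with inverse [Gi], the operator [G - frank]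
    is invertible exactly if this p by p matrix is. *)
Definition redmx (Gi : bop H) : 'M[C]_p := 1%:M - \matrix_(i, j) inner (Gi (x j)) (e i).
Definition frank : bop H := \sum_(k < p) rk (x k) (e k).

Lemma frankE u : frank u = \sum_(k < p) inner u (e k) *: x k.
Proof. by rewrite /frank bop_sum. Qed.

Lemma redmxE Gi (c : 'cV[C]_p) i : (redmx Gi *m c) i ord0 =
  c i ord0 - \sum_(k < p) c k ord0 * inner (Gi (x k)) (e i).
Proof.
rewrite /redmx mulmxBl mul1mx !mxE; congr (_ - _); apply: eq_bigr => k _.
by rewrite mxE mulrC.
Qed.

Variables (G Gi F : bop H).
Hypotheses (GI : is_inv Gi G) (FE : F = G - frank).

Let GiG u : Gi (G u) = u. Proof. by rewrite -bopM (proj1 GI). Qed.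
Let GGi u : G (Gi u) = u. Proof. by rewrite -bopM (proj2 GI). Qed.

Lemma reduction_inj u : \det (redmx Gi) != 0 -> F u = 0 -> u = 0.
Proof.
move=> d0; rewrite FE bopB => /eqP; rewrite subr_eq0 => /eqP Gu.
have uE : u = \sum_(k < p) inner u (e k) *: Gi (x k).
  by rewrite -[LHS]GiG Gu frankE linear_sum; apply: eq_bigr => k _; rewrite linearZ.
pose c : 'cV[C]_p := \col_k inner u (e k).
have c0 : redmx Gi *m c = 0.
  apply/colP => i; rewrite redmxE !mxE {1}uE ip_suml -sumrB big1// => k _.
  by rewrite mxE ipZl subrr.
have Mu : redmx Gi \in unitmx by rewrite unitmxE unitfE.
have cz : c = 0 by rewrite -(mulKmx Mu c) c0 mulmx0.
rewrite uE big1// => k _; have := congr1 (fun v : 'cV[C]_p => v k ord0) cz.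
by rewrite !mxE => ->; rewrite scale0r.
Qed.

(** Woodbury's formula. Solving F u = v reduces to a linear system for the numbers [inner u (e i)];
    this gives a right inverse, which is also a left inverse because F is injective. *)
Lemma reduction_inv : \det (redmx Gi) != 0 ->
  is_inv (Gi + \sum_(k : 'I_p * 'I_p) invmx (redmx Gi) k.1 k.2 *: (rk (Gi (x k.1)) (e k.2) * Gi)) F.
Proof.
move=> d0; have Mu : redmx Gi \in unitmx by rewrite unitmxE unitfE.
set S := _ + _.
have SE v : S v = Gi v + \sum_i (invmx (redmx Gi) *m \col_k inner (Gi v) (e k)) i ord0 *: Gi (x i).
  rewrite /S bopD bop_sum; congr (_ + _); rewrite -(pair_big xpredT xpredT (fun i j =>
    (invmx (redmx Gi) i j *: (rk (Gi (x i)) (e j) * Gi)) v)) /=.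
  apply: eq_bigr => i _; rewrite mxE scaler_suml; apply: eq_bigr => j _.
  by rewrite -[LHS]/(invmx (redmx Gi) i j *: (inner (Gi v) (e j) *: Gi (x i))) scalerA mxE.
have FS v : F (S v) = v.
  rewrite SE; set c := invmx _ *m _; set u := _ + _.
  have uE (i : 'I_p) : inner u (e i) = c i ord0.
    have : (redmx Gi *m c) i ord0 = inner (Gi v) (e i) by rewrite mulKVmx// mxE.
    rewrite redmxE => h; rewrite ipDl ip_suml -h.
    under [X in _ + X]eq_bigr => k _ do rewrite ipZl.
    by rewrite subrK.
  have Gu : G u = v + \sum_(i < p) c i ord0 *: x i.
    rewrite /u linearD linear_sum /= GGi; congr (_ + _); apply: eq_bigr => i _.
    by rewrite linearZ /= GGi.
  rewrite FE bopB frankE Gu [X in _ - X](_ : _ = \sum_(i < p) c i ord0 *: x i) ?addrK//.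
  by apply: eq_bigr => i _; rewrite uE.
split; apply: bopP => v; rewrite bopM bop1; last exact: FS.
apply/eqP; rewrite -subr_eq0; apply/eqP; apply: reduction_inj => //.
by rewrite linearB /= FS subrr.
Qed.

Lemma reduction_invertible : op_invertible F <-> \det (redmx Gi) != 0.
Proof.
split=> [[S [SF _]]|d0]; last by eexists; exact: reduction_inv d0.
apply/eqP => d0; have /eqP/det0P[v v0 vM] : \det (redmx Gi)^T = 0 by rewrite det_tr.
pose c := v^T; have Mc : redmx Gi *m c = 0 by rewrite /c -[redmx Gi]trmxK -trmx_mul vM trmx0.
pose u := \sum_(k < p) c k ord0 *: Gi (x k).
have uE (i : 'I_p) : inner u (e i) = c i ord0 :> C.
  have := congr1 (fun w : 'cV[C]_p => w i ord0) Mc; rewrite redmxE [RHS]mxE => /eqP.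
  rewrite subr_eq0 => /eqP ->; rewrite ip_suml; apply: eq_bigr => k _; by rewrite ipZl.
have Fu : F u = 0.
  rewrite FE bopB frankE {1}/u linear_sum -sumrB big1// => k _.
  by rewrite linearZ /= GGi uE subrr.
have u0 : u = 0 by rewrite -[LHS]/((1 : bop H) u) -SF bopM Fu linear0.
case/eqP: v0; apply/rowP => i; rewrite mxE; have := uE i; rewrite u0 ip0l /c mxE => ->.
by [].
Qed.

End Reduction.

Section Multiplicity.
Context {R : realType} {H : hilbertType R}.
Notation C := R[i].
Notation Co := (R[i]^o).

Lemma trace_family_sum (I : Type) (r : seq I) (O : set C) (x : I -> C -> H) (e : I -> H)
    (S : I -> C -> bop H) : (forall i, holo O (x i)) -> (forall i, holo O (S i)) ->
  trace_family O (fun z => \sum_(i <- r) rk (x i z) (e i) * S i z)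
    (fun z => \sum_(i <- r) inner (S i z (x i z)) (e i)).
Proof.
move=> hx hS; elim: r => [|i r IH].
  have -> : (fun z => \sum_(i <- [::]) rk (x i z) (e i) * S i z) = fun=> 0.
    by apply/funext => z; rewrite big_nil.
  have -> : (fun z : C => \sum_(i <- [::]) inner (S i z (x i z)) (e i) : Co) = fun=> 0.
    by apply/funext => z; rewrite big_nil.
  exact: trace_family0.
have -> : (fun z => \sum_(j <- i :: r) rk (x j z) (e j) * S j z) =
    fun z => rk (x i z) (e i) * S i z + \sum_(j <- r) rk (x j z) (e j) * S j z.
  by apply/funext => z; rewrite big_cons.
have -> : (fun z : C => \sum_(j <- i :: r) inner (S j z (x j z)) (e j) : Co) =
    fun z => inner (S i z (x i z)) (e i) + \sum_(j <- r) inner (S j z (x j z)) (e j).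
  by apply/funext => z; rewrite big_cons.
exact: trace_familyS.
Qed.

Lemma bopZl (a : C) (X Y : bop H) : (a *: X) * Y = a *: (X * Y).
Proof. exact: bopP. Qed.

Lemma bopZr (a : C) (X Y : bop H) : X * (a *: Y) = a *: (X * Y).
Proof. by apply: bopP => u; rewrite bopM bopZ linearZ. Qed.

Lemma mul_rk (X : bop H) (y u : H) : X * rk y u = rk (X y) u.
Proof. by apply: bopP => v; rewrite bopM !rkE linearZ. Qed.

Section Local.
Variables (O : set C) (w : C) (p m : nat) (x e : nat -> H) (G Gi G' : C -> bop H) (h : C -> Co).
Let f z : Co := \det (redmx p x e (Gi z)).
Hypotheses (Oo : copen O) (Ow : O w).
Hypothesis GI : forall z, O z -> is_inv (Gi z) (G z).
Hypothesis dG : forall z, O z -> cder G z (G' z).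
Hypothesis hh : holo O h.
Hypothesis h0 : forall z, O z -> h z != 0.
Hypothesis fE : forall z, O z -> f z = (z - w) ^+ m.+1 * h z.

Let M z := redmx p x e (Gi z).

Let dGi z : O z -> cder Gi z (- (Gi z * G' z * Gi z)).
Proof. by move=> Oz; apply: (cder_inv O G) => //; exact: dG. Qed.

Let M' z : 'M[C]_p := \matrix_(i, j) inner (Gi z (G' z (Gi z (x j)))) (e i).

Let dM z i j : O z -> cder (fun z => M z i j : Co) z (M' z i j : Co).
Proof.
move=> Oz; have d1 := cder_ip _ (e i) _ _ (cder_app _ _ _ _ _ (dGi z Oz) (cder_cst (x j) z)).
apply: cder_ext (cderB _ _ _ _ _ (cder_cst ((1%:M : 'M[C]_p) i j : Co) z) d1).
  by move=> y; rewrite /M /redmx !mxE.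
by rewrite mxE linear0 addr0 sub0r bopN ipNl opprK.
Qed.

Let df z : O z -> cder f z (\sum_i \sum_j M' z i j * cofactor (M z) i j : C).
Proof. by move=> Oz; apply: jacobi => i j; exact: dM. Qed.

Let hG' : holo O G'. Proof. exact: (holo_derivative bop_complete O G G' Oo dG). Qed.
Let hGi : holo O Gi. Proof. by move=> z Oz; eexists; exact: dGi. Qed.

Let y (k : 'I_p * 'I_p) z : H := (cofactor (M z) k.2 k.1 / h z) *: G' z (Gi z (x k.1)).

Let hy k : holo O (y k).
Proof.
move=> z Oz; have [lh dh] := hh z Oz; have [l1 d1] := hG' z Oz.
have hcof : holo O (fun z => cofactor (M z) k.2 k.1 : Co).
  rewrite /cofactor => z' Oz'.
  have [|l dl] := holo_det O _ (fun z => row' k.2 (col' k.1 (M z))) _ z' Oz'.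
    move=> i j z2 Oz2; have d := dM z2 (lift k.2 i) (lift k.1 j) Oz2.
    by eexists; apply: cder_ext d => // q; rewrite !mxE.
  by eexists; exact: (cderM _ _ _ _ _ (cder_cst ((-1) ^+ (k.2 + k.1) : Co) z') dl).
have [l2 d2] := hcof z Oz.
eexists; apply: cderZ; first exact: (cderM _ _ _ _ _ d2 (cderV _ _ _ dh (h0 z Oz))).
exact: cder_app d1 (cder_app _ _ _ _ _ (dGi z Oz) (cder_cst (x k.1) z)).
Qed.

Let N z : bop H := \sum_(k <- index_enum ('I_p * 'I_p)%type) rk (y k z) (e k.2) * Gi z.

(** Writing the inverse matrix with cofactors, the singular part of G' F^-1 is (z - w)^-(m+1) N(z)
    with N holomorphic of finite rank. By Jacobi's formula the trace of N is f'/h, that is (m+1)(z -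
    w)^m + (z - w)^(m+1) h'/h, so the residue, the coefficient of index m, has trace m + 1. *)
Lemma local_laurent : exists (Ck : nat -> bop H) (N1 : C -> bop H), [/\ holo O N1,
  has_trace (Ck m) m.+1%:R & forall z, O z -> z != w ->
   is_inv (Gi z + \sum_(k : 'I_p * 'I_p) invmx (M z) k.1 k.2 *: (rk (Gi z (x k.1)) (e k.2) * Gi z))
     (G z - frank p x e) /\
   G' z * (Gi z + \sum_(k : 'I_p * 'I_p) invmx (M z) k.1 k.2 *: (rk (Gi z (x k.1)) (e k.2) * Gi z)) =
   G' z * Gi z + \sum_(k < m.+1) (z - w)^-1 ^+ (m.+1 - k) *: Ck k + N1 z].
Proof.
have [h' dh] := holo_choose O h hh.
have tN := trace_family_sum _ (index_enum ('I_p * 'I_p)%type) O y (fun k => e k.2) (fun _ => Gi)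
  hy (fun _ => hGi).
have qc : ccont (logd h h') w by apply: (holo_cont O) => //; exact: logd_holo.
have [|Ck [N1 [hN1 tC NE]]] := laurent O w m m.+1%:R Oo Ow _ _ _ tN qc.
  move=> z Oz; have hz := h0 z Oz.
  have d1 := df z Oz.
  have d2 : cder f z _ := cder_near O _ _ _ _ Oo Oz (fun y Oy => esym (fE y Oy))
    (cderM _ _ _ _ _ (cderX _ _ _ m.+1 (cder_subc w z)) (dh z Oz)).
  have /= fd := cder_uniq _ _ _ _ d1 d2.
  transitivity ((\sum_i \sum_j M' z i j * cofactor (M z) i j) / h z).
    rewrite exchange_big pair_big /= mulr_suml; apply: eq_bigr => k _.
    by rewrite /y linearZ ipZl [M' z _ _]mxE; move: (inner _ _) (cofactor _ _ _) => a b; ring.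
  rewrite fd mulr1 /logd; move: (h z) (h' z) hz => a b a0.
  by rewrite mulrDl mulfK// mulrA.
exists Ck, N1; split => // z Oz zw; have zw0 : z - w != 0 by rewrite subr_eq0.
have fz : f z != 0 by rewrite (fE z Oz) mulf_neq0 ?expf_neq0 ?h0.
have Mu : M z \in unitmx by rewrite unitmxE unitfE.
split; first by apply: reduction_inv => //; exact: GI.
rewrite mulrDr -addrA; congr (_ + _).
have -> : G' z * (\sum_(k : 'I_p * 'I_p) invmx (M z) k.1 k.2 *: (rk (Gi z (x k.1)) (e k.2) * Gi z)) =
    ((z - w) ^+ m.+1)^-1 *: N z.
  rewrite mulr_sumr /N scaler_sumr; apply: eq_bigr => k _.
  rewrite bopZr mulrA mul_rk /invmx Mu mxE mxE -/(M z).
  apply: bopP => u; rewrite !bopZ !bopM !rkE /y !scalerA; congr (_ *: _).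
  have := fE z Oz; rewrite /f -/(M z) => ->; have := h0 z Oz.
  have : (z - w) ^+ m.+1 != 0 by rewrite expf_neq0.
  by move: (inner _ _) (cofactor _ _ _) (h z) (_ ^+ _) => a b c d d0 c0; field; rewrite c0 d0.
rewrite [N z]NE scalerDr scalerA mulVf ?scale1r ?expf_neq0//; congr (_ + _).
rewrite scaler_sumr; apply: eq_bigr => k _; rewrite scalerA; congr (_ *: _).
rewrite exprVn; apply: (mulfI (expf_neq0 (m.+1) zw0)).
rewrite mulrA divff ?mul1r ?expf_neq0//.
by rewrite -{2}(subnK (ltnW (ltn_ord k))) exprD mulrC mulrA mulVf ?mul1r ?expf_neq0.
Qed.

End Local.
End Multiplicity.

Section CharvalMult.
Context {R : realType} {H : hilbertType R}.
Notation C := R[i].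
Notation Co := (R[i]^o).
Variables (D : set Co) (A A' : C -> bop H).
Hypothesis Hsep : separable H.
Hypothesis Do : copen (D : set C).
Hypothesis dA : forall z, D z -> cder A z (A' z).

(** Removing the factor 1/z from [charop] changes the logarithmic derivative by the scalar operator
    -1/z, which is regular at a nonzero [w]. *)
Definition Fz (z : C) : bop H := z *: (1 : bop H) - A z.

Lemma charopE (z : C) : z != 0 -> charop A z = z^-1 *: Fz z.
Proof. by move=> z0; rewrite /charop /Fz scalerBr scalerA mulVf// scale1r. Qed.

Lemma charop_inv (z : C) S : z != 0 -> is_inv S (Fz z) -> is_inv (z *: S) (charop A z).
Proof.
move=> z0 [h1 h2]; rewrite (charopE z z0); split; rewrite bopZl bopZr scalerA ?mulfV ?mulVf// scale1r//.
Qed.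

Lemma charop_invertible (z : C) : z != 0 -> op_invertible (charop A z) <-> op_invertible (Fz z).
Proof.
move=> z0; split=> -[S SI]; last by exists (z *: S); exact: charop_inv.
exists (z^-1 *: S); move: SI; rewrite (charopE z z0) bopZl bopZr => -[h1 h2].
by split; rewrite ?bopZl ?bopZr.
Qed.

Lemma dFz (z : C) : D z -> cder Fz z (1 - A' z).
Proof.
move=> Dz; have := cderB _ _ _ _ _ (cderZ _ _ _ _ _ (cder_id z) (cder_cst (1 : bop H) z)) (dA z Dz).
by apply: cder_ext => //; rewrite scaler0 addr0 scale1r.
Qed.

Let D0 : set C := [set z | D z /\ z != 0].

Let D0o : copen D0.
Proof.
move=> z [Dz z0]; have [d d0 Hd] := Do z Dz.
exists (Num.min d (nr z)); first by rewrite lt_min d0 nr_gt0.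
move=> y; rewrite lt_min => /andP[/Hd Dy yz]; split => //.
by apply: contraTneq yz => ->; rewrite sub0r nrN ltxx.
Qed.

Let dcharop (z : C) : D0 z ->
  cder (charop A : C -> bop H) z (- ((- 1 / z ^+ 2) *: A z + z^-1 *: A' z)).
Proof.
move=> [Dz z0].
have := cderB _ _ _ _ _ (cder_cst (1 : bop H) z) (cderZ _ _ _ _ _ (cderV _ _ _ (cder_id z) z0) (dA z Dz)).
by apply: cder_ext => //; rewrite sub0r.
Qed.

Let dchar1 (z : C) : D0 z -> derive1 (charop A) z = - ((- 1 / z ^+ 2) *: A z + z^-1 *: A' z).
Proof. by move=> D0z; have [] := cder_derive1 _ (charop A) z _ (dcharop z D0z). Qed.

Variables (O : set C) (w : C) (p m : nat) (x e : nat -> H) (G Gi G' : C -> bop H) (h : C -> Co).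
Hypotheses (Oo : copen O) (Ow : O w) (OD : forall z, O z -> D z) (O0 : forall z, O z -> z != 0).
Hypothesis GI : forall z, O z -> is_inv (Gi z) (G z).
Hypothesis dG : forall z, O z -> cder G z (G' z).
Hypothesis FzE : forall z, O z -> Fz z = G z - frank p x e.
Hypothesis hh : holo O h.
Hypothesis h0 : forall z, O z -> h z != 0.
Hypothesis fE : forall z, O z -> \det (redmx p x e (Gi z)) = (z - w) ^+ m.+1 * h z.

Let Om1 : set C := [set z | [/\ D z, z != 0, z != w & op_invertible (Fz z)]].
Let Om : set C := [set z | z = w \/ Om1 z].
Let T (z : C) : bop H := derive1 (charop A) z * op_inv (charop A z).

Let Om1o : copen Om1.
Proof.
move=> z [Dz z0 zw [S SI]]; have [d1 d10 H1] := D0o z (conj Dz z0).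
have [d2 d20 H2] := inv_open Fz z S (cder_cont _ _ _ (dFz z Dz)) SI.
have zw0 : 0 < nr (z - w) by rewrite nr_gt0 subr_eq0.
exists (Num.min d1 (Num.min d2 (nr (z - w)))); first by rewrite !lt_min d10 d20.
move=> y; rewrite !lt_min => /and3P[/H1[Dy y0] /H2[S' [S'I _]] yw]; split => //; last by exists S'.
by apply: contraTneq yw => ->; rewrite nrC ltxx.
Qed.

Let Tholo : holo Om1 T.
Proof.
move=> z Oz; have [Dz z0 zw Fi] := Oz.
have dc y : D0 y -> cder (charop A : C -> bop H) y (derive1 (charop A) y).
  by move=> D0y; rewrite dchar1//; exact: dcharop.
have [l dl] := holo_derivative bop_complete D0 _ _ D0o dc z (conj Dz z0).
eexists; apply: cder_comp_op; first exact: dl.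
apply: (cder_inv Om1 (charop A)) => //; last exact: dc.
by move=> y [Dy y0 _ Fy]; apply: op_invP; apply/charop_invertible.
Qed.

Let Om1O z : O z -> z != w -> Om1 z.
Proof.
move=> Oz zw; split => //; [exact: OD|exact: O0|].
apply/(reduction_invertible p x e (G z) (Gi z) (Fz z) (GI z Oz) (FzE z Oz)).
by rewrite fE// mulf_neq0 ?h0// expf_neq0// subr_eq0.
Qed.

Let Omo : copen Om.
Proof.
move=> z [->|Oz].
  have [d d0 Hd] := Oo w Ow; exists d => // y /Hd Oy.
  by have [->|yw] := eqVneq y w; [left|right; exact: Om1O].
by have [d d0 Hd] := Om1o z Oz; exists d => // y /Hd; right.
Qed.

Let A'E z : O z -> A' z = 1 - G' z.
Proof.
move=> Oz; have d1 := dFz z (OD z Oz).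
have d2 : cder Fz z _ := cder_near O _ _ _ _ Oo Oz (fun y Oy => esym (FzE y Oy))
  (cderB _ _ _ _ _ (dG z Oz) (cder_cst (frank p x e) z)).
by have := cder_uniq _ _ _ _ d1 d2; rewrite subr0 => <-; rewrite subKr.
Qed.

Let TE z Fi : O z -> is_inv Fi (G z - frank p x e) -> T z = G' z * Fi - z^-1 *: (1 : bop H).
Proof.
move=> Oz FI; have z0 := O0 z Oz; rewrite -FzE// in FI.
rewrite /T (op_inv_eq _ _ (charop_inv z Fi z0 FI)) dchar1; last by split => //; exact: OD.
have AE : A z = z *: (1 : bop H) - Fz z by rewrite subKr.
have [_ FF] := FI; rewrite (A'E z Oz) AE bopZr.
have -> : - ((- 1 / z ^+ 2) *: (z *: (1 : bop H) - Fz z) + z^-1 *: (1 - G' z)) =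
    z^-1 *: G' z - (z^-1 ^+ 2) *: Fz z.
  move: (Fz z) (G' z) => F1 G1; rewrite !scalerBr scalerA (_ : - 1 / z ^+ 2 * z = - z^-1); last by field.
  rewrite (_ : - 1 / z ^+ 2 = - z^-1 ^+ 2); last by field.
  by move: (z^-1) (z^-1 ^+ 2) (1 : bop H) => a b u; vec.
rewrite mulrBl !bopZl FF scalerBr !scalerA mulfV// scale1r; congr (_ - _ *: _).
by field.
Qed.

(** [charval_mult] picks some integer produced by some admissible radius, and the disc of that
    radius may leave [O]. The integral is therefore computed on every admissible circle: [T] minus
    its principal part at [w] is holomorphic on [Om], which contains the closed disc, and has a
    primitive along segments from [w]. Uniqueness of the integral and of the trace then determines
    the integer. *)
Lemma charval_multE : charval_mult D A w = m.+1.
Proof.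
have [Ck [N1 [hN1 tC LE]]] := local_laurent O w p m x e G Gi G' h Oo Ow GI dG hh h0 fE.
pose S z : bop H := \sum_(k < m.+1) (z - w)^-1 ^+ (m.+1 - k) *: Ck k.
have TO z : O z -> z != w -> T z = (G' z * Gi z - z^-1 *: (1 : bop H) + N1 z) + S z.
  move=> Oz zw; have [FI GE] := LE z Oz zw; rewrite (TE z _ Oz FI) GE -/(S z).
  by move: (G' z * Gi z) (S z) (N1 z) (z^-1 *: _) => a b c d; vec.
(* On [O] the local formula extends T - S to [w]; elsewhere the difference itself is taken. *)
pose Psi z : bop H := if `[< O z >] then G' z * Gi z - z^-1 *: (1 : bop H) + N1 z else T z - S z.
have PsiE z : Om1 z -> Psi z = T z - S z.
  move=> Oz; rewrite /Psi; case: asboolP => // Oz'; have [_ _ zw _] := Oz.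
  by rewrite (TO z Oz' zw) addrK.
have dpow n z : z != w -> cder (fun z => (z - w)^-1 ^+ n : Co) z (- (n%:R * (z - w)^-1 ^+ n.+1)).
  move=> zw; have zw0 : z - w != 0 by rewrite subr_eq0.
  apply: cder_ext (cderX _ _ _ n (cderV _ _ _ (cder_subc w z) zw0)) => //.
  case: n => [|n]; first by rewrite !mul0r oppr0.
  by rewrite /= !exprVn !exprS; field; rewrite zw0 expf_neq0.
have hS z : z != w -> exists l, cder S z l.
  move=> zw; eexists; apply: (cder_sum _ (index_enum 'I_m.+1) (fun k z => (z - w)^-1 ^+ (m.+1 - k) *: Ck k)
    (fun k => _)) => k.
  exact: cderZ (dpow (m.+1 - k)%N z zw) (cder_cst (Ck k) z).
have hPsi : holo Om Psi.
  move=> z [->|Oz].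
    have [l1 d1] := holo_derivative bop_complete O G G' Oo dG w Ow.
    have d2 := cder_inv O G Gi w _ Oo Ow GI (dG w Ow).
    have [l3 d3] := hN1 w Ow.
    have d4 := cderZ _ _ _ _ _ (cderV _ _ _ (cder_id w) (O0 w Ow)) (cder_cst (1 : bop H) w).
    eexists; apply: (cder_near O _ _ _ _ Oo Ow _ (cderD _ _ _ _ _ (cderB _ _ _ _ _ (cder_comp_op _ _ _ _ _ d1 d2) d4) d3)).
    by move=> y Oy; rewrite /Psi asboolT.
  have [l1 d1] := Tholo z Oz; have [_ _ zw _] := Oz; have [l2 d2] := hS z zw.
  eexists; apply: (cder_near Om1 _ _ _ _ Om1o Oz _ (cderB _ _ _ _ _ d1 d2)).
  by move=> y Oy; rewrite PsiE.
(* A primitive of the poles of order at least 2; the simple pole, with coefficient [Ck m], is left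
   to [circle_integral]. *)
pose Prim z : bop H := \sum_(k < m) (- ((m - k)%:R^-1 * (z - w)^-1 ^+ (m - k))) *: Ck k.
pose Th z := L Psi w z + Prim z.
have dTh z : z != w -> segment_in Om w z -> Om1 z -> cder Th z (T z - (z - w)^-1 *: Ck m).
  move=> zw sg Oz; have d1 := primitive bop_complete Om Psi w z Omo hPsi sg.
  have d2 : cder Prim z (\sum_(k < m) (z - w)^-1 ^+ (m.+1 - k) *: Ck k).
    apply: (cder_sum _ (index_enum 'I_m) (fun k z => (- ((m - k)%:R^-1 * (z - w)^-1 ^+ (m - k))) *: Ck k)
      (fun k => (z - w)^-1 ^+ (m.+1 - k) *: Ck k)) => k.
    have mk : ((m - k)%:R : C) != 0 by rewrite pnatr_eq0 -lt0n subn_gt0.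
    have := cderZ _ _ _ _ _ (cderN _ _ _ (cderM _ _ _ _ _ (cder_cst ((m - k)%:R^-1 : Co) z)
      (dpow (m - k)%N z zw))) (cder_cst (Ck k) z).
    apply: cder_ext => //; rewrite scaler0 addr0; congr (_ *: _).
    by rewrite mul0r add0r mulrN opprK mulKf// subSn// ltnW.
  have := cderD _ _ _ _ _ d1 d2; apply: cder_ext => //.
  rewrite (PsiE z Oz) /S big_ord_recr /= subSnn expr1.
  by move: (\sum_(k < m) _) (_ *: _) (T z) => a b c; vec.
have circ (rho : R) : 0 < rho -> (forall z : Co, `|z - w| <= rho%:C -> [/\ D z, z != 0 & charval D A z -> z = w]) ->
    is_circle_integral T w rho ((2 * 'i * pi%:C) *: Ck m).
  move=> r0 Hr; have inOm z : nr (z - w) <= rho -> Om z.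
    rewrite nr_le => /Hr[Dz z0 cz]; have [->|zw] := eqVneq z w; first by left.
    right; split => //; apply/(charop_invertible z z0); apply: contrapT => ni.
    by move/eqP: zw; apply; apply: cz.
  have on z : nr (z - w) = rho -> z != w /\ Om1 z.
    move=> zr; have zw : z != w.
      by apply: contra_eq_neq zr => ->; rewrite subrr nr0 lt_eqF.
    by split => //; case: (inOm z) => //; [rewrite zr|move=> E; rewrite E eqxx in zw].
  apply: (circle_integral T Th) => // z zr; have [zw Oz] := on z zr; last exact: Tholo.
  apply: dTh => // t /andP[t0 t1]; apply: inOm.
  by rewrite -{2}(seg0 w z) seg_shift subr0 nrM nrR ger0_norm// zr ler_piMl// ltW.
have pi0 : 0 < 2 * pi :> R by rewrite mulr_gt0// pi_gt0.
have piC : (2 * 'i * pi%:C : C) != 0.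
  rewrite !mulf_neq0 ?pnatr_eq0//; first by rewrite -nr_gt0 nrI.
  by apply/eqP => -[] E; have := pi_gt0 R; rewrite E ltxx.
have trI := traceZ _ (2 * 'i * pi%:C) _ tC.
have mem : [set k : nat | exists rho : R, exists I : bop H, exists tau : C,
    [/\ 0 < rho, forall z : Co, `|z - w| <= rho%:C -> [/\ D z, z != 0 & charval D A z -> z = w],
        is_circle_integral (fun z => derive1 (charop A) z * op_inv (charop A z)) w rho I,
        has_trace I tau & k%:R = (2 * 'i * pi%:C)^-1 * tau]] m.+1.
  have [d d0 Hd] := Oo w Ow; exists (d / 2), ((2 * 'i * pi%:C) *: Ck m), (2 * 'i * pi%:C * m.+1%:R).
  have Hr (z : Co) : `|z - w| <= (d / 2)%:C -> [/\ D z, z != 0 & charval D A z -> z = w].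
    rewrite -nr_le => zr; have Oz : O z by apply: Hd; apply: le_lt_trans zr _; lra.
    split; [exact: OD|exact: O0|move=> [_ z0 ni]]; apply: contrapT => /eqP zw; apply: ni.
    by apply/(charop_invertible z z0); have [] := Om1O z Oz zw.
  split => //; first by rewrite divr_gt0.
    by apply: circ => //; rewrite divr_gt0.
  by rewrite mulrA mulVf// mul1r.
rewrite /charval_mult; case: xgetP => [k _ [rho [I [tau [r0 Hr HI HT kE]]]]|/(_ m.+1)//].
have IE := riemann_uniq _ _ _ _ _ pi0 HI (circ rho r0 Hr).
have tE := trace_uniq _ _ _ Hsep HT; rewrite IE in tE.
move: kE; rewrite (tE _ trI) mulrA mulVf// mul1r => /eqP; rewrite eqr_nat => /eqP ->.
by [].
Qed.

End CharvalMult.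

(** * The resolvent of the truncated operator near zero *)

Section ResolventNearZero.
Context {R : realType} {H : hilbertType R}.
Notation C := R[i].
Notation Co := (R[i]^o).
Variables (K A1 Pi0 : bop H).
Hypotheses (Ksa : op_selfadjoint K) (A1s : ortho_small A1).
Hypothesis Pi0P : orthogonal_projection (op_ker K) Pi0.

Lemma ker_proj_perp u v : K v = 0 -> inner (u - Pi0 u) v = 0.
Proof. by move=> Kv; have [_] := Pi0P u; apply. Qed.

Lemma ker_proj u : K (Pi0 u) = 0. Proof. by have [] := Pi0P u. Qed.

(* A1 is small on vectors that are orthogonal to the kernel of K and on which K is small. *)
Lemma small_on_small (eps : R) : 0 < eps -> exists2 tau : R, 0 < tau &
  forall (v : H) (a : R), (forall k, K k = 0 -> inner v k = 0) -> nr v <= a -> nr (K v) <= tau * a ->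
  nr (A1 v) <= eps * a.
Proof.
move=> eps0; have [|n [f [fo foff]]] := small_off A1 (eps / 2) A1s; first by lra.
pose M := nr A1 + 1; have M0 : 0 < M by rewrite ltr_wpDl ?nr_ge0.
pose n1 : R := n%:R + 1; have n10 : 0 < n1 by rewrite ltr_wpDl.
pose e1 := eps / (4 * M * n1); have e10 : 0 < e1 by rewrite divr_gt0// !mulr_gt0.
(* As v is orthogonal to ker K, its product with f_j sees only the part of f_j orthogonal to ker K,
   which is close to K g_j; hence it is close to the product of K v with g_j, and small when K v
   is. *)
have /choice[g Hg] : forall j : nat, exists g, nr ((f j - Pi0 (f j)) - K g) <= e1.
  by move=> j; apply: range_dense => // v; exact: ker_proj_perp.
pose B := 1 + \sum_(j < n) nr (g j).
have B0 : 0 < B by rewrite ltr_pwDl// sumr_ge0// => j _; exact: nr_ge0.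
have gB (j : 'I_n) : nr (g j) <= B.
  rewrite /B (bigD1 j)//= addrCA lerDl addr_ge0// sumr_ge0// => i _; exact: nr_ge0.
exists (e1 / B); first by rewrite divr_gt0.
move=> v a vk va Kv; have a0 : 0 <= a := le_trans (nr_ge0 v) va.
have vf (j : 'I_n) : nr (inner v (f j)) <= 2 * e1 * a.
  have -> : inner v (f j) = inner v (f j - Pi0 (f j) - K (g j)) + inner (K v) (g j).
    by rewrite Ksa -ipDr subrK ipBr (vk (Pi0 (f j))) ?subr0//; exact: ker_proj.
  apply: le_trans (nrD _ _) _; have -> : 2 * e1 * a = a * e1 + e1 / B * a * B.
    by rewrite [X in _ + X]mulrAC divfK ?gt_eqF//; ring.
  apply: lerD; apply: le_trans (cauchy_schwarz _ _) _; apply: ler_pM; rewrite ?nr_ge0//.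
have pv : nr (oproj n f v) <= 2 * e1 * a * n%:R.
  rewrite projE; apply: le_trans (nr_sum _ _ _ _) _.
  apply: (@le_trans _ _ (\sum_(j < n) (2 * e1 * a))); last by rewrite sumr_const card_ord mulr_natr.
  by apply: ler_sum => j _; rewrite nrZ (ortho_nr n)// mulr1.
have -> : A1 v = A1 (v - oproj n f v) + A1 (oproj n f v) by rewrite -linearD subrK.
apply: le_trans (nrD _ _) _; have -> : eps * a = eps / 2 * a + eps / 2 * a by rewrite -mulrDl -splitr.
apply: lerD.
  apply: le_trans (foff _ _) _; first by move=> i i_n; exact: ip_proj_off.
  by rewrite ler_pM2l; [exact: le_trans (proj_off_le _ _ _ fo) va|lra].
apply: le_trans (nr_app _ _) _; apply: (@le_trans _ _ (M * (2 * e1 * a * n1))).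
  apply: ler_pM; rewrite ?nr_ge0 ?lerDl//; apply: le_trans pv _.
  apply: ler_wpM2l; last by rewrite /n1 lerDl.
  by apply: mulr_ge0 => //; apply: mulr_ge0 => //; exact: ltW.
by rewrite le_eqVlt; apply/orP; left; apply/eqP; rewrite /e1; field; rewrite !gt_eqF.
Qed.

Variables (N : nat) (e : nat -> H) (lam : nat -> R) (eta : R) (Q : pred nat).
Hypothesis Ke : eigenfamily K N e lam.
Hypotheses (eta0 : 0 < eta) (big : forall i, (i < N)%N -> eta < `|lam i|).
Hypothesis off : forall u, (forall i, (i < N)%N -> inner u (e i) = 0) -> nr (K u) <= eta * nr u.

Let eo : orthon N e. Proof. exact: (proj1 Ke). Qed.
Let E := oproj N e.
(** The eigenvalues of K (1 - P): those selected by [Q] are replaced by 0. *)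
Let mu i : R := if Q i then 0 else lam i.
Definition spec_proj : bop H := \sum_(i < N) (if Q i then 1 else 0 : C) *: rk (e i) (e i).
Let P := spec_proj.

Let diag_ip (c : nat -> C) u j : (j < N)%N ->
  inner ((\sum_(i < N) c i *: rk (e i) (e i)) u) (e j) = c j * inner u (e j).
Proof.
move=> jN; rewrite bop_sum ip_suml (bigD1 (Ordinal jN))//= big1 ?addr0 => [|i ij].
  by rewrite !ipZl eo// eqxx mulr1.
by rewrite !ipZl eo// (_ : (i == j :> nat) = false) ?mulr0//; apply/negbTE.
Qed.

Let diag_e (c : nat -> C) j : (j < N)%N ->
  (\sum_(i < N) c i *: rk (e i) (e i)) (e j) = c j *: e j.
Proof.
move=> jN; rewrite bop_sum (bigD1 (Ordinal jN))//= big1 ?addr0 => [|i ij].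
  by rewrite -[LHS]/(c j *: (inner (e j) (e j) *: e j)) eo// eqxx scale1r.
rewrite -[LHS]/(c i *: (inner (e j) (e i) *: e i)) eo// eq_sym (_ : (i == j :> nat) = false).
  by rewrite scale0r scaler0.
by apply/negbTE.
Qed.

Let diag_nr (c : nat -> C) (b : R) u : 0 <= b -> (forall i, (i < N)%N -> nr (c i) <= b) ->
  nr ((\sum_(i < N) c i *: rk (e i) (e i)) u) <= b * nr u.
Proof.
move=> b0 cb; rewrite -(ler_pXn2r (n := 2)) ?nnegrE ?nr_ge0 ?mulr_ge0 ?nr_ge0//.
have -> : (\sum_(i < N) c i *: rk (e i) (e i)) u = \sum_(i < N) (c i * inner u (e i)) *: e i.
  by rewrite bop_sum; apply: eq_bigr => i _; rewrite bopZ rkE scalerA.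
rewrite (ortho_sum N e (fun i => c i * inner u (e i)) eo) exprMn.
apply: (@le_trans _ _ (b ^+ 2 * \sum_(i < N) nr (inner u (e i)) ^+ 2)); last first.
  by rewrite ler_wpM2l ?exprn_ge0// bessel.
rewrite mulr_sumr; apply: ler_sum => i _; rewrite nrM exprMn ler_wpM2r ?exprn_ge0 ?nr_ge0//.
by rewrite lerXn2r ?nnegrE ?nr_ge0// cb.
Qed.

Let eker i : (i < N)%N -> forall k, K k = 0 -> inner (e i) k = 0.
Proof.
move=> iN k Kk; have := Ksa (e i) k; rewrite Kk ip0r (proj2 Ke)// ipZl => /eqP.
rewrite mulf_eq0 => /orP[/eqP[] l0|/eqP//].
by have := big i iN; rewrite l0 normr0 ltNge ltW.
Qed.

Lemma spec_proj_e i : (i < N)%N -> spec_proj (e i) = (if Q i then 1 else 0 : C) *: e i.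
Proof. exact: (diag_e (fun i => if Q i then 1 else 0 : C)). Qed.

Section Point.
Variable (z : C) (c : R).
Hypotheses (z0 : z != 0) (zeta : 2 * eta <= nr z) (c0 : 0 <= c).
Hypothesis zmu : forall i, (i < N)%N -> z != (mu i)%:C.
Hypothesis yc : forall i, (i < N)%N -> nr (z / (z - (mu i)%:C)) <= c.

Let y i : C := z / (z - (mu i)%:C).
(** K cut off from all listed eigenvectors. Its norm is at most eta, so 1 - K0 / z is inverted by a
    Neumann series as soon as 2 eta <= |z|. *)
Let K0 : bop H := K * (1 - E).
Let Zz : bop H := z *: (1 : bop H) - K * (1 - P).

Let K0n u : nr (K0 u) <= eta * nr u.
Proof.
rewrite /K0 bopM bopB bop1; apply: le_trans (off _ _) _.
  by move=> i iN; exact: ip_proj_off.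
by rewrite ler_pM2l// proj_off_le.
Qed.

Let nz : 0 < nr z. Proof. by rewrite nr_gt0. Qed.

Let neu : exists N0 : bop H, [/\ N0 * (1 - z^-1 *: K0) = 1, (1 - z^-1 *: K0) * N0 = 1 & nr N0 <= 2].
Proof.
apply: neumann; apply: nr_bop_le => [|u]; first by lra.
rewrite bopZ nrZ nrV; apply: le_trans (_ : (nr z)^-1 * (eta * nr u) <= _).
  by rewrite ler_wpM2l ?invr_ge0 ?nr_ge0// K0n.
rewrite mulrA; apply: ler_wpM2r; first exact: nr_ge0.
by rewrite mulrC ler_pdivrMr//; move: zeta; lra.
Qed.

(** Y = z (z - K(1-P))^-1 acts by z / (z - mu_i) on the listed eigenvectors and by the Neumann
    series on their complement, whence the bound c + 2; on the selected eigenvectors it is the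
    identity. In the splitting, [w] collects the eigenvalues of modulus above tau, where the factor
    is small, and [v] all the rest outside ker K, where K is at most tau. So [small_on_small]
    applies to [v]. *)
Lemma resolvent_split : exists Y : bop H,
  [/\ Zz * Y = z *: (1 : bop H), Y * Zz = z *: (1 : bop H), nr Y <= c + 2,
     forall i u, (i < N)%N -> Q i -> inner (Y u) (e i) = inner u (e i) &
     forall (tau d : R) (u : H), eta <= tau ->
       (forall i, (i < N)%N -> tau < `|lam i| -> nr (y i) <= d /\ ~~ Q i) -> 0 <= d ->
       exists v w, [/\ Y u = Pi0 u + v + w, forall k, K k = 0 -> inner v k = 0, nr v <= (c + 2) * nr u,
         nr (K v) <= tau * ((c + 2) * nr u) & nr w <= d * nr u]].
Proof.
have [N0 [NK KN N2]] := neu.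
pose Y1 : bop H := \sum_(i < N) y i *: rk (e i) (e i).
pose Y := Y1 + N0 * (1 - E).
have NE u : N0 u = u + z^-1 *: K0 (N0 u).
  have e1 : N0 u - z^-1 *: K0 (N0 u) = u := congr1 (fun X : bop H => X u) KN.
  by apply/eqP; rewrite -subr_eq e1.
have K0e u i : (i < N)%N -> inner (K0 u) (e i) = 0.
  by move=> iN; rewrite /K0 bopM bopB bop1 (eigen_ip _ _ _ _ _ _ Ksa Ke)// ip_proj_off ?mulr0.
have N0e u i : (i < N)%N -> inner (N0 (u - E u)) (e i) = 0.
  by move=> iN; rewrite NE ipDl ipZl K0e// ip_proj_off// mulr0 addr0.
have YE u : Y u = Y1 u + N0 (u - E u) by [].
have KPe i : (i < N)%N -> K (e i - P (e i)) = (mu i)%:C *: e i.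
  move=> iN; rewrite /P spec_proj_e// /mu; case: ifP => _; first by rewrite scale1r subrr linear0 scale0r.
  by rewrite scale0r subr0 (proj2 Ke).
have ZY u : Zz (Y u) = z *: u.
  have Z1 : Zz (Y1 u) = z *: E u.
    rewrite /Y1 bop_sum linear_sum /E projE scaler_sumr; apply: eq_bigr => i _.
    have Ze : Zz (e i) = (z - (mu i)%:C) *: e i.
      by rewrite -[LHS]/(z *: e i - K (e i - P (e i))) KPe// scalerBl.
    have lin (X : bop H) (a : C) (v : H) : X (a *: v) = a *: X v by rewrite linearZ.
    have Zl (a b : C) (v : H) : Zz (a *: (b *: v)) = a *: (b *: Zz v) by rewrite 2!lin.
    rewrite -[LHS]/(Zz (y i *: (inner u (e i) *: e i))) Zl Ze !scalerA; congr (_ *: _); rewrite /y.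
    have : z - (mu i)%:C != 0 by rewrite subr_eq0 zmu.
    by move: (z - _) => q q0; field.
  have Z2 : Zz (N0 (u - E u)) = z *: (u - E u).
    rewrite bopB bopZ bop1 bopM bopB bop1.
    have -> : P (N0 (u - E u)) = 0.
      rewrite /P /spec_proj bop_sum big1// => i _; by rewrite bopZ rkE N0e// scale0r scaler0.
    have K0N : K0 (N0 (u - E u)) = K (N0 (u - E u)).
      by rewrite /K0 bopM bopB bop1 (proj_perp N e (N0 (u - E u))) ?subr0// => i; exact: N0e.
    rewrite subr0 {1}NE K0N scalerDr scalerA mulfV// scale1r addrK.
    by [].
  have lin (X : bop H) (a b : H) : X (a + b) = X a + X b by rewrite linearD.
  by rewrite YE lin Z1 Z2 -scalerDr addrC subrK.
have Zinj u : Zz u = 0 -> u = 0.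
  rewrite bopB bopZ bop1 bopM bopB bop1 => /eqP; rewrite subr_eq0 => /eqP zu.
  have ue i : (i < N)%N -> inner u (e i) = 0.
    move=> iN; have := congr1 (fun v => inner v (e i)) zu; rewrite ipZl (eigen_ip _ _ _ _ _ _ Ksa Ke)//.
    rewrite ipBl /P (diag_ip (fun i => if Q i then 1 else 0 : C))// => h.
    have : (z - (mu i)%:C) * inner u (e i) = 0.
      rewrite mulrBl h /mu; case: ifP => _; first by rewrite mul1r subrr mulr0 mul0r subrr.
      by rewrite mul0r subr0 subrr.
    by move/eqP; rewrite mulf_eq0 subr_eq0 (negbTE (zmu i iN)) /= => /eqP.
  have Pu : P u = 0 by rewrite /P /spec_proj bop_sum big1// => i _; rewrite bopZ rkE ue// scale0r scaler0.
  move: zu; rewrite Pu subr0 => zu; apply: nr0_eq0; apply/eqP; rewrite eq_le nr_ge0 andbT.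
  have := off u ue; rewrite -zu nrZ => h.
  have : nr z / 2 * nr u <= 0.
    have : eta * nr u <= nr z / 2 * nr u by apply: ler_wpM2r; [exact: nr_ge0|move: zeta; lra].
    by move: h; lra.
  by rewrite pmulr_rle0// divr_gt0.
have Y1n u : nr (Y1 u) <= c * nr u by exact: diag_nr.
have Nn u : nr (N0 (u - E u)) <= 2 * nr u.
  apply: le_trans (nr_app_le _ _ _ N2) _; rewrite ler_pM2l// proj_off_le//.
exists Y; split.
- by apply: bopP => u; rewrite bopM ZY bopZ.
- apply: bopP => u; rewrite bopM bopZ bop1; apply/eqP; rewrite -subr_eq0; apply/eqP; apply: Zinj.
  have lin (X : bop H) (a : C) (b d : H) : X (b - a *: d) = X b - a *: X d.
    by rewrite linearB linearZ.
  by rewrite lin ZY subrr.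
- apply: nr_bop_le => [|u]; first by rewrite addr_ge0.
  by rewrite YE mulrDl (le_trans (nrD _ _))// lerD.
- move=> i u iN Qi; rewrite YE ipDl N0e// addr0 diag_ip// /y /mu Qi subr0 divff// mul1r.
  by [].
move=> tau d u et Hd d0.
pose sm i : bool := `|lam i| <= tau.
pose v1 := (\sum_(i < N) (if sm i then y i else 0 : C) *: rk (e i) (e i)) u.
pose w := (\sum_(i < N) (if sm i then 0 else y i : C) *: rk (e i) (e i)) u.
pose v2 := N0 (u - E u) - Pi0 u.
have Y1E : Y1 u = v1 + w.
  rewrite /v1 /w -bopD -big_split /=; congr (bop_fun _ u); apply: eq_bigr => i _.
  by case: (sm i); rewrite scale0r ?addr0 ?add0r.
have N0k k : K k = 0 -> N0 k = k.
  move=> Kk; have e1 : N0 (k - z^-1 *: K0 k) = k := congr1 (fun X : bop H => X k) NK.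
  rewrite -{2}e1; have -> : K0 k = 0 by rewrite /K0 bopM bopB bop1 /E proj_perp ?subr0// => i iN; exact: ip_eq0C _ _ (eker i iN k Kk).
  by rewrite scaler0 subr0.
have EPi : E (Pi0 u) = 0.
  by rewrite /E proj_perp// => i iN; apply: ip_eq0C; apply: eker => //; exact: ker_proj.
pose u' := u - E u - Pi0 u.
have linB (X : bop H) (a b : H) : X (a - b) = X a - X b by rewrite linearB.
have v2E : v2 = N0 u' by rewrite /u' (linB N0 (u - E u)) (N0k (Pi0 u))//; exact: ker_proj.
have u'k k : K k = 0 -> inner u' k = 0.
  move=> Kk; rewrite /u' addrAC ipBl ker_proj_perp// sub0r /E projE ip_suml big1 ?oppr0// => i _.
  by rewrite ipZl eker// mulr0.
have u'e i : (i < N)%N -> inner u' (e i) = 0.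
  move=> iN; rewrite /u' ipBl ip_proj_off// (ip_eq0C _ _ (eker i iN _ (ker_proj u))) subrr.
  by [].
have Eu' : E u' = 0 by rewrite /E proj_perp.
have v2k k : K k = 0 -> inner v2 k = 0.
  move=> Kk; rewrite v2E NE ipDl u'k// ipZl /K0 bopM Ksa Kk ip0r mulr0 addr0.
  by [].
have v2e i : (i < N)%N -> inner v2 (e i) = 0.
  by move=> iN; rewrite v2E -[u']subr0 -Eu' N0e.
have u'n : nr u' <= nr u.
  have p : inner u' (Pi0 u) = 0 by apply: u'k; exact: ker_proj.
  have := pythagoras _ _ p; rewrite subrK => h.
  rewrite -(ler_pXn2r (n := 2)) ?nnegrE ?nr_ge0//; apply: (@le_trans _ _ (nr (u - E u) ^+ 2)).
    by rewrite h lerDl exprn_ge0// nr_ge0.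
  by rewrite lerXn2r ?nnegrE ?nr_ge0// proj_off_le.
have v2n : nr v2 <= 2 * nr u.
  by rewrite v2E; apply: le_trans (nr_app_le _ _ _ N2) _; rewrite ler_pM2l.
have v1n : nr v1 <= c * nr u.
  by apply: (diag_nr (fun i => if sm i then y i else 0 : C)) => // i iN; case: ifP => // _; rewrite ?nr0//; exact: yc.
have Kv1 : nr (K v1) <= tau * (c * nr u).
  have -> : K v1 = (\sum_(i < N) ((if sm i then lam i else 0)%:C : C) *: rk (e i) (e i)) v1.
    rewrite [in RHS]bop_sum; under [RHS]eq_bigr => i _.
      rewrite bopZ rkE (diag_ip (fun i => if sm i then y i else 0 : C))//; over.
    rewrite /v1 bop_sum linear_sum; apply: eq_bigr => i _.
    have linZ (X : bop H) (q : C) (q' : H) : X (q *: q') = q *: X q' by rewrite linearZ.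
    rewrite -[LHS]/(K ((if sm i then y i else 0) *: (inner u (e i) *: e i))).
    rewrite 2!linZ (proj2 Ke)// !scalerA; congr (_ *: e i).
    by case: (sm i); rewrite ?mul0r ?mulr0//; ring.
  have tau0 : 0 <= tau by apply: le_trans et; exact: ltW.
  apply: le_trans (diag_nr (fun i => (if sm i then lam i else 0)%:C : C) tau v1 tau0 _) _.
    by move=> i iN; rewrite nrR; case: ifP => // _; rewrite normr0.
  by rewrite ler_wpM2l.
exists (v1 + v2), w; split.
- have zm (p q a b : H) : p + q + a = b + (p + (a - b)) + q by vec.
  by rewrite YE Y1E; exact: zm.
- move=> k Kk; rewrite ipDl v2k// addr0 /v1 bop_sum ip_suml big1// => i _.
  by rewrite bopZ rkE !ipZl eker// !mulr0.
- by rewrite mulrDl (le_trans (nrD _ _))// lerD.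
- rewrite linearD (le_trans (nrD _ _))// mulrDl mulrDr lerD//; apply: le_trans (off _ v2e) _.
  by apply: ler_pM; rewrite ?nr_ge0// ltW.
apply: (diag_nr (fun i => if sm i then 0 else y i : C)) => // i iN; rewrite /sm.
by case: ifPn => [_|]; [rewrite nr0|rewrite -ltNge => h; case: (Hd i iN h)].
Qed.

End Point.
End ResolventNearZero.

Section NearZero.
Context {R : realType} {H : hilbertType R}.
Notation C := R[i].
Notation Co := (R[i]^o).
Variables (K A1 Pi0 T0 : bop H) (G1 : C -> bop H).
Hypotheses (Ksa : op_selfadjoint K) (A1s : ortho_small A1).
Hypothesis Pi0P : orthogonal_projection (op_ker K) Pi0.
Hypothesis T0I : is_inv T0 (1 - A1 * Pi0).
Hypotheses (G1c : ccont G1 0) (G10 : G1 0 = A1).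

(** The eigenvalues left out on the small side are below r(1 - delta) while Re z > r(1 - delta/2):
    the gap is a fixed fraction of Re z, whatever r is. *)
Lemma ratio_left (z : C) (r l delta : R) : 0 < r -> 0 < delta -> delta <= 1 ->
  r * (1 - delta / 2) < complex.Re z -> l < r * (1 - delta) ->
  z != l%:C /\ nr (z / (z - l%:C)) <= 4 / delta.
Proof.
move=> r0 d0 d1 zr lr.
have h1 : complex.Re z * (delta / 2) <= complex.Re z - l.
  have : 0 <= (complex.Re z - r * (1 - delta / 2)) * (1 - delta / 2).
    by apply: mulr_ge0; lra.
  have : 0 <= r * delta ^+ 2 by rewrite mulr_ge0 ?exprn_ge0// ltW.
  by move: lr; rewrite expr2; lra.
have z0 : 0 < complex.Re z.
  by apply: lt_trans zr; rewrite mulr_gt0//; lra.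
have h2 : 0 < complex.Re z - l by apply: lt_le_trans h1; rewrite mulr_gt0//; lra.
have zl : z != l%:C by apply: contraTneq h2 => ->; rewrite subrr ltxx.
split => //; have n0 : 0 < nr (z - l%:C) by rewrite nr_gt0 subr_eq0.
have hR := Re_le_nr (z - l%:C); have hI := Im_le_nr (z - l%:C); have hz := ReIm_ge_nr z.
rewrite cReD cReN /= in hR; rewrite cImD cImN /= subr0 in hI.
rewrite nrM nrV ler_pdivrMr// mulrAC ler_pdivlMr//.
have h3 : complex.Re z - l <= nr (z - l%:C) by apply: le_trans hR; exact: ler_norm.
have h4 : nr z <= complex.Re z + nr (z - l%:C).
  by apply: le_trans hz _; rewrite lerD// ger0_norm// ltW.
have h5 : nr z * delta <= (complex.Re z + nr (z - l%:C)) * delta by rewrite ler_pM2r.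
have h6 : nr (z - l%:C) * delta <= nr (z - l%:C) by rewrite ler_piMr// nr_ge0.
lra.
Qed.

(** Uses the factorization (1 - G1 Y)(z - K(1-P)) of the truncated operator: S' inverts 1 - G1 Y,
    close to 1 - A1 Pi0, and Gi = Y S' / z. On the selected eigenvectors Y drops out, which leaves
    the entries of S'. The numbers tau and rho are fixed before r and the eigenfamily. *)
Lemma near_zero (delta kappa : R) : 0 < delta -> delta <= 1 / 2 -> 0 < kappa ->
  exists tau rho : R, [/\ 0 < tau, 0 < rho, 8 * rho <= tau &
  forall (N : nat) (e : nat -> H) (lam : nat -> R) (r : R) (eta : R),
    eigenfamily K N e lam -> 0 < r -> 0 < eta -> eta <= r / 4 ->
    (forall i, (i < N)%N -> eta < `|lam i|) ->
    (forall u, (forall i, (i < N)%N -> inner u (e i) = 0) -> nr (K u) <= eta * nr u) ->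
    let Q i := r * (1 - delta) <= lam i <= tau in
    forall z : C, r * (1 - delta / 2) < complex.Re z -> nr z < rho ->
    exists Gi S' : bop H, [/\ is_inv Gi (z *: (1 : bop H) - (K + z *: G1 z) + K * spec_proj N e Q),
      nr (S' - T0) <= kappa &
      forall i u, (i < N)%N -> Q i -> z * inner (Gi u) (e i) = inner (S' u) (e i)]].
Proof.
move=> d0 d1 k0; have d1' : delta <= 1 by lra.
pose t := nr T0; have t0 : 0 <= t := nr_ge0 T0.
(* The tolerance for G1 Y - A1 Pi0: the first bound makes [inv_perturb] applicable, the second makes
   the change of the inverse at most kappa. *)
pose sg := Num.min (1 / (2 * (t + 1))) (kappa / (2 * t ^+ 2 + 1)).
have t2 : 0 < 2 * t ^+ 2 + 1 by rewrite ltr_wpDl// mulr_ge0// exprn_ge0.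
have t1 : 0 < 2 * (t + 1) by lra.
have sg0 : 0 < sg by rewrite lt_min !divr_gt0.
pose c := 4 / delta; have c8 : 8 <= c by rewrite ler_pdivlMr//; lra.
(* Three errors share [sg] equally: A1 on [v], A1 on [w], and G1 z - A1; the first and third are
   multiplied by c + 2. *)
pose eps := sg / (3 * (c + 2)); have eps0 : 0 < eps by rewrite divr_gt0// mulr_gt0//; lra.
have [tau tau0 Htau] := small_on_small K A1 Pi0 Ksa A1s Pi0P eps eps0.
have [rho1 rho10 Hrho1] := G1c eps eps0.
pose a1 := nr A1 + 1; have a10 : 0 < a1 by rewrite ltr_wpDl ?nr_ge0.
(* In turn: G1 z is close to A1, |z| is far below the eigenvalues above tau, and the factor 2 rho /
   tau on these eigenvalues is small enough after applying A1. *)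
pose rho := Num.min rho1 (Num.min (tau / 8) (tau * sg / (6 * a1))).
have rho0 : 0 < rho by rewrite !lt_min rho10 !divr_gt0// mulr_gt0.
have rhot : rho <= tau / 8 by rewrite !ge_min lexx orbT.
exists tau, rho; split => //; first by lra.
move=> N e lam r eta Ke r0 eta0 etar big off Q z zr znr.
have zn : complex.Re z <= nr z by rewrite (le_trans (ler_norm _))// Re_le_nr.
have zr2 : r / 2 <= complex.Re z.
  by apply: le_trans (ltW zr); rewrite ler_pM2l//; lra.
have z0 : z != 0 by rewrite -nr_gt0; lra.
have etat : eta <= tau by lra.
have away i : tau < `|lam i| -> [/\ z != (lam i)%:C, nr (z / (z - (lam i)%:C)) <= 2 * rho / tau & 1 <= c].
  move=> tl; have h1 : tau / 2 <= nr (z - (lam i)%:C).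
    have := nr_geB ((lam i)%:C : C) z; rewrite nrC nrR; lra.
  have n0 : 0 < nr (z - (lam i)%:C) by lra.
  split; [by rewrite -subr_eq0 -nr_gt0| |lra].
  rewrite nrM nrV ler_pdivrMr// mulrAC ler_pdivlMr//.
  have : rho * (tau / 2) <= rho * nr (z - (lam i)%:C) by rewrite ler_pM2l.
  have : nr z * tau <= rho * tau by rewrite ler_pM2r// ltW.
  lra.
have mu_ok i : (i < N)%N -> z != (if Q i then 0 else lam i)%:C /\
    nr (z / (z - (if Q i then 0 else lam i)%:C)) <= c.
  move=> iN; case: ifP => [_|/negbT]; first by rewrite subr0 divff// nr1; split => //; lra.
  rewrite /Q negb_and -!ltNge => /orP[h|h]; first exact: (ratio_left z r (lam i) delta r0 d0 d1' zr h).
  have [|h1 h2 h3] := away i; first by apply: lt_le_trans h (ler_norm _).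
  split => //; apply: le_trans h2 (le_trans _ h3); rewrite ler_pdivrMr//; lra.
have [||||Y [ZY YZ Yn YQ Ysp]] := resolvent_split K Pi0 Ksa Pi0P N e lam eta Q Ke eta0 big off z c z0.
- by lra.
- by lra.
- by move=> i /mu_ok[].
- by move=> i /mu_ok[].
set P := spec_proj N e Q in ZY YZ *; set Zz := z *: (1 : bop H) - K * (1 - P) in ZY YZ.
have c20 : 0 < c + 2 by lra.
have A1Y u : nr (A1 (Y u - Pi0 u)) <= (2 / 3) * sg * nr u.
  have [||v [w [YE vk vn Kv wn]]] := Ysp tau (2 * rho / tau) u etat.
  + move=> i iN /[dup] /away[_ h _] tl.
    have nQ : ~~ Q i.
      rewrite /Q negb_and -!ltNge.
      have [l0|l0] := leP 0 (lam i); first by rewrite (ger0_norm l0) in tl; rewrite tl orbT.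
      by apply/orP; left; apply: lt_trans l0 _; rewrite mulr_gt0//; move: d1'; lra.
    by split => //; rewrite (negbTE nQ).
  + by rewrite divr_ge0 ?mulr_ge0// ltW.
  have -> : A1 (Y u - Pi0 u) = A1 v + A1 w.
    have zm (a b d : H) : a + b + d - a = b + d by vec.
    by rewrite YE zm linearD.
  apply: le_trans (nrD _ _) _; have -> : 2 / 3 * sg * nr u = sg / 3 * nr u + sg / 3 * nr u by lra.
  apply: lerD.
    apply: le_trans (Htau v _ vk vn Kv) _; rewrite mulrA ler_wpM2r ?nr_ge0// /eps.
    by rewrite le_eqVlt; apply/orP; left; apply/eqP; field; rewrite gt_eqF.
  apply: le_trans (nr_app _ _) _; apply: (@le_trans _ _ (a1 * (2 * rho / tau * nr u))).
    by apply: ler_pM; rewrite ?nr_ge0// lerDl.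
  rewrite mulrA ler_wpM2r ?nr_ge0//.
  have h : rho <= tau * sg / (6 * a1) by rewrite !ge_min lexx !orbT.
  rewrite ler_pdivlMr ?mulr_gt0// in h.
  rewrite mulrA ler_pdivrMr//; lra.
pose E := A1 * Pi0 - G1 z * Y.
have En : nr E <= sg.
  apply: nr_bop_le => [|u]; first exact: ltW.
  have -> : E u = - (A1 (Y u - Pi0 u)) - (G1 z - A1) (Y u).
    have eA : A1 (Y u - Pi0 u) = A1 (Y u) - A1 (Pi0 u) by rewrite linearB.
    have eG : (G1 z - A1) (Y u) = G1 z (Y u) - A1 (Y u) by [].
    rewrite -[LHS]/(A1 (Pi0 u) - G1 z (Y u)) eA eG.
    by move: (A1 (Pi0 u)) (G1 z (Y u)) (A1 (Y u)) => p q s; vec.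
  apply: le_trans (nrB _ _) _; rewrite nrN.
  have -> : sg * nr u = 2 / 3 * sg * nr u + sg / 3 * nr u by lra.
  apply: lerD => //; apply: le_trans (nr_app _ _) _.
  have g1 : nr (G1 z - A1) <= eps.
    by rewrite -G10; apply: Hrho1; rewrite subr0; apply: lt_le_trans znr _; rewrite ge_min lexx.
  apply: (@le_trans _ _ (eps * ((c + 2) * nr u))).
    by apply: ler_pM; rewrite ?nr_ge0//; exact: nr_app_le.
  rewrite mulrA ler_wpM2r ?nr_ge0// /eps.
  by rewrite le_eqVlt; apply/orP; left; apply/eqP; field; rewrite gt_eqF.
have [|S' [S'I _ S'n]] := inv_perturb (1 - A1 * Pi0) T0 E T0I.
  apply: (@le_trans _ _ (t * (1 / (2 * (t + 1))))).
    by apply: ler_pM; rewrite ?nr_ge0//; apply: le_trans En _; rewrite ge_min lexx.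
  by rewrite mulrA ler_pdivrMr//; lra.
rewrite /E subrKA in S'I.
exists (z^-1 *: (Y * S')), S'; split.
- have -> : z *: (1 : bop H) - (K + z *: G1 z) + K * P = (1 - G1 z * Y) * Zz.
    rewrite mulrBl mul1r -mulrA YZ bopZr mulr1 /Zz mulrBr mulr1.
    by move: (z *: (1 : bop H)) (z *: G1 z) (K * P) => p q s; vec.
  have [S1 S2] := S'I; split.
    rewrite bopZl -mulrA [S' * _]mulrA S1 mul1r YZ scalerA mulVf// scale1r//.
  by rewrite bopZr -mulrA [Zz * _]mulrA ZY bopZl mul1r bopZr S2 scalerA mulVf// scale1r.
- apply: le_trans S'n _; apply: (@le_trans _ _ (2 * t ^+ 2 * (kappa / (2 * t ^+ 2 + 1)))).
    by apply: ler_wpM2l; [rewrite mulr_ge0// exprn_ge0|apply: le_trans En _; rewrite ge_min lexx orbT].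
  by rewrite mulrA ler_pdivrMr// mulrDr mulr1 mulrC lerDl ltW.
- move=> i u iN Qi; rewrite bopZ ipZl mulrA mulfV// mul1r bopM.
  exact: YQ.
Qed.

End NearZero.

(** * Characteristic values between the abscissas r and s *)

Section CountNear.
Context {R : realType} {H : hilbertType R}.
Notation C := R[i].
Notation Co := (R[i]^o).

Lemma prod_pull (ws : seq C) (w z : C) :
  \prod_(v <- ws) (z - v) = (z - w) ^+ count_mem w ws * \prod_(v <- ws | v != w) (z - v).
Proof.
rewrite (bigID (pred1 w)) /=; congr (_ * _).
rewrite (eq_bigr (fun=> z - w)) => [|v /eqP ->//].
by rewrite big_const_seq iter_mulr_1.
Qed.

Lemma cder_prod_cond (ws : seq C) (P : pred C) z :
  exists l, cder (fun z => \prod_(v <- ws | P v) (z - v) : Co) z l.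
Proof.
have [l dl] := cder_prod [seq v <- ws | P v] z; exists l.
by apply: cder_ext dl => // x; rewrite big_filter.
Qed.

Lemma ccont_neq0_open (O : set C) (h : C -> Co) : copen O -> holo O h ->
  copen [set z | O z /\ h z != 0].
Proof.
move=> Oo hh z [Oz hz]; have [d d0 Hd] := Oo z Oz; have [l dl] := hh z Oz.
have n0 : 0 < nr (h z) by rewrite nr_gt0.
have [|d' d'0 Hd'] := cder_cont _ _ _ dl (nr (h z) / 2); first by rewrite divr_gt0.
exists (Num.min d d'); first by rewrite lt_min d0.
move=> y; rewrite lt_min => /andP[/Hd Oy /Hd' hy]; split => //.
by rewrite -nr_gt0; have := nr_geB (h z) (h y); rewrite nrC; lra.
Qed.

Lemma count_nth (idx : seq nat) (P : pred nat) :
  count (fun i : 'I_(size idx) => P (nth 0%N idx i)) (enum 'I_(size idx)) = count P idx.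
Proof.
rewrite -[in RHS](mkseq_nth 0%N idx) /mkseq count_map.
by rewrite -[in RHS]val_enum_ord count_map.
Qed.

Lemma eigen_perp_ker (K : bop H) N e lam i k : op_selfadjoint K -> eigenfamily K N e lam ->
  (i < N)%N -> lam i != 0 -> K k = 0 -> inner (e i) k = 0.
Proof.
move=> Ksa Ke iN l0 Kk; have := Ksa (e i) k; rewrite Kk ip0r (proj2 Ke)// ipZl => /eqP.
by rewrite mulf_eq0 => /orP[/eqP[] E|/eqP//]; move: l0; rewrite E eqxx.
Qed.

Lemma near_scale (delta x : R) : 200 * (delta / 400 * x) <= delta / 2 * x.
Proof. lra. Qed.

Lemma range_incl (r delta l s tau : R) : 0 < r * delta -> r <= l -> l < s -> s <= tau ->
  r * (1 - delta) <= l <= tau.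
Proof. by move=> *; apply/andP; split; lra. Qed.

Lemma kappa_coef (eps delta : R) : 0 < eps -> 0 < delta ->
  44 * (2 * (2 * (eps * delta / 400) / eps)) <= delta.
Proof.
move=> e0 d0; rewrite (_ : 44 * _ = 176 / 400 * delta); first by lra.
by field; rewrite gt_eqF.
Qed.

Lemma window_box (r delta x a b rho theta s : R) : 0 < x -> x <= s -> 0 < theta * s ->
  s * (4 * (1 + theta)) <= rho -> delta * x <= x / 2 -> 0 < delta * x ->
  r * (1 - delta / 2) <= x * (1 - delta / 2) ->
  - (54 * (delta * x / 400)) < a - x -> a - x < 54 * (delta * x / 400) ->
  - (54 * (delta * x / 400)) < b - delta * x / 400 -> b - delta * x / 400 < 54 * (delta * x / 400) ->
  [/\ r * (1 - delta / 2) < a, - rho < a < rho & - rho < b < rho].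
Proof. by move=> *; split; [|apply/andP; split|apply/andP; split]; lra. Qed.

Lemma sector_box (r delta a b rho theta s : R) : 0 < r -> r <= a -> a < s -> 0 < r * delta ->
  0 < theta * s -> s * (4 * (1 + theta)) <= rho -> theta * a <= theta * s -> `|b| <= theta * a ->
  [/\ r * (1 - delta / 2) < a, `|a| < rho & `|b| < rho].
Proof. by move=> *; split; [|rewrite ger0_norm|]; lra. Qed.

Variables (D : set Co) (A A' : C -> bop H) (Pi0 T0 : bop H) (theta : R).
Let K := A 0.
Hypotheses (Hsep : separable H) (Do : copen (D : set C)) (D0 : D 0).
Hypothesis dA : forall z, D z -> cder A z (A' z).
Hypotheses (Ksa : op_selfadjoint K) (A1s : ortho_small (A' 0)).
Hypothesis Pi0P : orthogonal_projection (op_ker K) Pi0.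
Hypothesis T0I : is_inv T0 (1 - A' 0 * Pi0).
Hypothesis theta0 : 0 < theta.

(** [s] and [tau] are chosen before [r], so everything to the right of [s] can later go into a
    constant that depends on delta only. The eigenvalues kept in P start at r(1 - delta), those
    actually counted at r; the domain in between gives room for the window at r. *)
Lemma count_near (delta K0 : R) : 0 < delta -> delta <= 1 / 2 -> 620 <= K0 ->
  exists s tau : R, [/\ 0 < s, s < 1, s <= tau &
  forall (r : R) (N : nat) (e : nat -> H) (lam : nat -> R) (eta : R),
    0 < r -> r < s -> eigenfamily K N e lam -> 0 < eta -> eta <= r / 4 ->
    (forall i, (i < N)%N -> eta < `|lam i|) ->
    (forall u, (forall i, (i < N)%N -> inner u (e i) = 0) -> nr (K u) <= eta * nr u) ->
  exists ws : seq C,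
  [/\ forall z, r <= complex.Re z < s -> `|complex.Im z| <= theta * complex.Re z ->
        D z /\ (~ op_invertible (Fz A z) <-> z \in ws),
      forall w, w \in ws -> r <= complex.Re w < s ->
        `|complex.Im w| <= theta * complex.Re w /\ charval_mult D A w = count_mem w ws &
      `|(count (fun w => r <= complex.Re w < s) ws)%:R -
        (count (fun i => r <= lam i < s) (iota 0 N))%:R| <=
      delta * (count (fun i => r * (1 - delta) <= lam i <= tau) (iota 0 N))%:R +
      (7 * ln K0 + 3) * (count (fun i => `|lam i - r| <= delta / 2 * r) (iota 0 N) +
         count (fun i => `|lam i - s| <= delta / 2 * s) (iota 0 N))%:R + 14]].
Proof.
move=> d0 d1 K620.
have [G1 hG1 G1E] := divided_difference bop_complete D A 0 Do D0 (fun z Dz => ex_intro _ _ (dA z Dz)).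
have {}G1E z : A z = K + z *: G1 z by rewrite G1E subr0.
have G10 : G1 0 = A' 0.
  have [l dl] := hG1 0 D0.
  have d2 := cderD _ _ _ _ _ (cder_cst K 0) (cderZ _ _ _ _ _ (cder_id 0) dl).
  have d3 := cder_ext _ _ _ _ _ (fun x => esym (G1E x)) erefl d2.
  by have := cder_uniq _ _ _ _ d3 (dA 0 D0); rewrite add0r scale1r scale0r addr0.
have G1c : ccont G1 0 by apply: (holo_cont D).
(* A window at x concerns the eigenvalues within 200 k x = delta x / 2 of x. *)
pose k := delta / 400; have k0 : 0 < k by rewrite /k; lra.
have k1 : k <= 1 by rewrite /k; lra.
(* With eps <= theta every zero found in the narrow cone lies in the sector. *)
pose eps := Num.min (k / 2) theta.
have eps0 : 0 < eps by rewrite lt_min theta0 divr_gt0.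
have epsk : eps < k.
  by apply: (@le_lt_trans _ _ (k / 2)); [rewrite ge_min lexx|move: k0; lra].
have epst : eps <= theta by rewrite ge_min lexx orbT.
(* The error term of the matrix count is 44 * 2 * (2 kappa / eps) n, which this choice keeps below
   delta n. *)
pose kappa := eps * delta / 400.
have kappa0 : 0 < kappa by have := mulr_gt0 eps0 d0; rewrite /kappa; lra.
have kappa1 : 16 * kappa <= eps.
  have : eps * delta <= eps * (1 / 2) by rewrite ler_pM2l.
  by rewrite /kappa; lra.
have [tau [rho [tau0 rho0 rhot NZ]]] := near_zero K (A' 0) Pi0 T0 G1 Ksa A1s Pi0P T0I G1c G10 delta kappa d0 d1 kappa0.
have [dD dD0 HD] := Do 0 D0.
pose rho2 := Num.min rho dD / 2.
have m0 : 0 < Num.min rho dD by rewrite lt_min rho0.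
have rho20 : 0 < rho2 by rewrite divr_gt0.
have rho2r : 2 * rho2 <= rho by rewrite /rho2 mulrC divfK// ge_min lexx.
have rho2d : 2 * rho2 <= dD by rewrite /rho2 mulrC divfK// ge_min lexx orbT.
have t10 : 0 < 1 + theta by lra.
(* Small enough for the sector and the windows of half side 54 k x, for all x up to [s], to fit into
   the square of half side rho2. *)
pose s := Num.min (rho2 / (4 * (1 + theta))) (1 / 2).
have t40 : 0 < 4 * (1 + theta) by lra.
have s0 : 0 < s by rewrite lt_min !divr_gt0.
have s1 : s < 1 by apply: (@le_lt_trans _ _ (1 / 2)); [rewrite ge_min lexx orbT|lra].
have sr : s * (4 * (1 + theta)) <= rho2.
  by rewrite -ler_pdivlMr// ge_min lexx.
have ts : 0 < theta * s by rewrite mulr_gt0.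
have stau : s <= tau by lra.
exists s, tau; split => //.
move=> r N e lam eta r0 rs Ke eta0 etar big off.
pose Q i := r * (1 - delta) <= lam i <= tau.
pose P := spec_proj N e Q.
pose O : set C := [set z | r * (1 - delta / 2) < complex.Re z /\ sn z < rho2].
have O1 z : O z -> [/\ D z, z != 0, nr z < rho & 0 < complex.Re z].
  move=> [zr zs]; have zn : nr z < 2 * rho2 by apply: le_lt_trans (nr_le_sn z) _; rewrite ltr_pM2l.
  have z0 : 0 < complex.Re z by apply: lt_trans zr; rewrite mulr_gt0//; lra.
  split => //; [by apply: HD; rewrite subr0; apply: lt_le_trans zn _| |exact: lt_le_trans zn _].
  by apply: contraTneq z0 => ->; rewrite ltxx.
have Oo : copen O.
  move=> z [zr zs]; have [d d0' Hd] := sn_open 0 rho2 z ltac:(by rewrite /= subr0).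
  exists (Num.min d (complex.Re z - r * (1 - delta / 2))); first by rewrite lt_min d0' subr_gt0.
  move=> y; rewrite lt_min => /andP[/Hd]; rewrite /= subr0 => ys yz; split => //.
  have := Re_le_nr (y - z); rewrite cReD cReN ler_norml => /andP[h _]; lra.
have OC : cconvex O.
  move=> p q [pr ps] [qr qs] t t01; split.
    rewrite seg_ReIm /= -ltrN2; have -> : - (complex.Re p + t * (complex.Re q - complex.Re p)) =
      - complex.Re p + t * (- complex.Re q - - complex.Re p) by ring.
    by apply: conv_lt; rewrite ?ltrN2.
  by have := sn_convex 0 rho2 p q; rewrite /cconvex /segment_in /= !subr0 => /(_ ps qs t t01); rewrite subr0.
have OV x z : r <= x <= s -> sn (z - ray k 1 x) < 54 * (k * x) -> O z.
  move=> /andP[rx xs]; rewrite sn_lt cReD cReN cImD cImN /ray /= mul1r !ltr_norml.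
  move=> /andP[/andP[a1 a2] /andP[b1 b2]]; have x0 : 0 < x by lra.
  have kx : k * x = delta * x / 400 by rewrite /k; lra.
  have dx : delta * x <= x / 2 by have := ler_wpM2r (ltW x0) d1; lra.
  have rxd : r * (1 - delta / 2) <= x * (1 - delta / 2) by rewrite ler_pM2r//; lra.
  have dx0 : 0 < delta * x by rewrite mulr_gt0.
  rewrite kx in a1 a2 b1 b2.
  have [h1 h2 h3] := window_box _ _ _ _ _ _ _ _ x0 xs ts sr dx dx0 rxd a1 a2 b1 b2.
  by split=> //; rewrite sn_lt !ltr_norml h2.
have /choice[GS HGS] : forall z, exists GS : bop H * bop H, O z ->
    [/\ is_inv GS.1 (z *: (1 : bop H) - (K + z *: G1 z) + K * P), nr (GS.2 - T0) <= kappa &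
      forall i u, (i < N)%N -> Q i -> z * inner (GS.1 u) (e i) = inner (GS.2 u) (e i)].
  move=> z; have [Oz|nO] := pselect (O z); last by exists (0, 0).
  have [_ _ zr _] := O1 z Oz.
  by have [Gi [S' h]] := NZ N e lam r eta Ke r0 eta0 etar big off z (proj1 Oz) zr; exists (Gi, S').
pose Gi z := (GS z).1; pose Gz z := z *: (1 : bop H) - (K + z *: G1 z) + K * P.
have GI z : O z -> is_inv (Gi z) (Gz z) by move=> /HGS[].
have hGz : holo O Gz.
  move=> z /O1[Dz _ _ _]; have [l dl] := hG1 z Dz.
  eexists; apply: cderD (cder_cst (K * P) z); apply: cderB.
    exact: cderZ (cder_id z) (cder_cst (1 : bop H) z).
  exact: cderD (cder_cst K z) (cderZ _ _ _ _ _ (cder_id z) dl).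
have [Gz' dGz] := holo_choose O Gz hGz.
pose idx := [seq i <- iota 0 N | Q i]; pose n := size idx.
pose e' j := e (nth 0%N idx j); pose lam' j := lam (nth 0%N idx j).
have idxP j : (j < n)%N -> (nth 0%N idx j < N)%N /\ Q (nth 0%N idx j).
  by move=> jn; have := mem_nth 0%N jn; rewrite mem_filter mem_iota add0n => /andP[-> /andP[_ ->]].
have eo' : orthon n e'.
  move=> i j iN jN; have [i1 _] := idxP i iN; have [j1 _] := idxP j jN.
  by rewrite /e' (proj1 Ke)// nth_uniq// filter_uniq// iota_uniq.
have lam'0 j : (j < n)%N -> 0 < lam' j.
  by move=> /idxP[_ /andP[h _]]; apply: lt_le_trans h; rewrite mulr_gt0//; lra.
have Ke' j : (j < n)%N -> K (e' j) = (lam' j)%:C *: e' j by move=> /idxP[h _]; exact: (proj2 Ke).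
(* The eigenvalue is put into the functional, so that it multiplies the rows of [redmx], as in
   [char_mx]. *)
pose x' j := (lam' j)%:C *: e' j.
have KPE : K * P = frank n e' x'.
  rewrite /P /spec_proj /frank mulr_sumr.
  transitivity (\sum_(i <- idx) K * rk (e i) (e i)).
    rewrite /idx big_filter -(big_mkord xpredT (fun i => K * ((if Q i then 1 else 0 : C) *: rk (e i) (e i)))).
    rewrite /index_iota subn0 [RHS]big_mkcond; apply: eq_bigr => i _.
    by case: (Q i); rewrite ?scale1r// scale0r mulr0.
  rewrite (big_nth 0%N) big_mkord; apply: eq_bigr => j _; rewrite mul_rk.
  rewrite -/(e' j) Ke'; last exact: ltn_ord.
  by apply: bopP => u; rewrite !rkE /x' ipZr conjc_real scalerA mulrC.
have FE z : Fz A z = Gz z - frank n e' x'.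
  by rewrite /Fz /Gz G1E KPE addrK.
pose Y z : 'M[C]_n := \matrix_(i, j) (z * inner (Gi z (e' j)) (e' i) - (i == j)%:R).
pose L0 (i : 'I_n) := lam' i.
have charE z : char_mx n L0 Y z = z *: redmx n e' x' (Gi z).
  apply/matrixP => i j; rewrite /char_mx mul_diag_mx !mxE /x' ipZr conjc_real.
  by case: (i == j); rewrite ?mulr1n ?mulr0n /L0; ring.
have hGi z : O z -> exists l, cder Gi z l.
  by move=> Oz; eexists; apply: (cder_inv O Gz) => //; exact: dGz.
have hY i j : holo O (fun z => Y z i j : Co).
  move=> z Oz; have [l dl] := hGi z Oz.
  eexists; apply: cder_ext (cderB _ _ _ _ _ (cderM _ _ _ _ _ (cder_id z)
    (cder_ip _ (e' i) _ _ (cder_app _ _ _ _ _ dl (cder_cst (e' j) z)))) (cder_cst ((i == j)%:R : Co) z)) => //.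
  by move=> y; rewrite mxE.
(* The selected eigenvectors are orthogonal to ker K, so Pi0 kills them and T0 fixes them. Comparing
   S' with T0 is thus comparing with the identity, and [Y] has norm at most kappa. *)
have T0e j : (j < n)%N -> T0 (e' j) = e' j.
  move=> /[dup] jn /idxP[jN _]; have pk v : K v = 0 -> inner (e' j) v = 0.
    by apply: (eigen_perp_ker K N e lam) => //; rewrite gt_eqF// lam'0.
  have Pe : Pi0 (e' j) = 0.
    have [Kp Pp] := Pi0P (e' j); apply: nr0_eq0; apply/eqP.
    have := Pp _ Kp; rewrite ipBl pk// sub0r ip_nr => /eqP; rewrite oppr_eq0 => /eqP[] /eqP.
    by rewrite sqrf_eq0.
  have := congr1 (fun X : bop H => X (e' j)) (proj1 T0I).
  rewrite -[X in X = _]/(T0 (e' j - A' 0 (Pi0 (e' j)))) Pe linear0 subr0 => ->.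
  by [].
have bY z : O z -> mx_bound (Y z) kappa.
  move=> Oz v; have [_ Sk SE] := HGS z Oz.
  pose c j : C := if insub j is Some i then v i ord0 else 0.
  have cE (i : 'I_n) : c i = v i ord0 by rewrite /c valK.
  pose u := \sum_(j < n) c j *: e' j.
  have un : nr u ^+ 2 = sqn v by rewrite (ortho_sum n e' c eo') /sqn; apply: eq_bigr => i _; rewrite cE.
  have YE (i : 'I_n) : (Y z *m v) i ord0 = inner (((GS z).2 - T0) u) (e' i).
    rewrite mxE /u linear_sum ip_suml; apply: eq_bigr => j _; rewrite mxE cE mulrC.
    have [iN Qi] := idxP i (ltn_ord i).
    have lin (X : bop H) (a : C) (b : H) : X (a *: b) = a *: X b by rewrite linearZ.
    rewrite -[RHS]/(inner (((GS z).2 - T0) (v j ord0 *: e' j)) (e' i)) lin ipZl; congr (_ * _).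
    by rewrite bopB ipBl T0e// eo'// /Gi SE// eq_sym.
  rewrite -un -exprMn; apply: (@le_trans _ _ (nr (((GS z).2 - T0) u) ^+ 2)).
    rewrite {1}/sqn; under eq_bigr => i _ do rewrite YE.
    exact: bessel.
  have h1 := nr_app_le _ u _ Sk; have h2 : 0 <= kappa * nr u := le_trans (nr_ge0 _) h1.
  by rewrite (ler_pXn2r (n := 2)) ?nnegrE ?nr_ge0.
have Opos z : O z -> 0 < complex.Re z by case/O1.
have [ws [h [hh fE wsP h0 bound]]] := matrix_zeros_near_reals n r s k eps kappa K0 O L0 Y
  r0 rs eps0 epsk k1 kappa0 kappa1 K620 Oo OC Opos OV (fun i => lam'0 i (ltn_ord i)) hY bY.
have detE z : \det (char_mx n L0 Y z) = z ^+ n * \det (redmx n e' x' (Gi z)).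
  by rewrite charE detZ.
have inv_iff z : O z -> r <= complex.Re z < s -> (~ op_invertible (Fz A z) <-> z \in ws).
  move=> Oz /andP[zr zs]; have [Dz z0 _ Rz] := O1 z Oz.
  have hz : h z != 0.
    apply: h0 => //; apply/andP; split.
      by apply: le_trans zr; rewrite gerBl mulr_ge0// ltW.
    by rewrite (le_trans (ltW zs))// lerDl mulr_ge0// ltW.
  have := reduction_invertible n e' x' (Gz z) (Gi z) (Fz A z) (GI z Oz) (FE z) => iff.
  have dz : (\det (redmx n e' x' (Gi z)) == 0) = (z \in ws).
    have := fE z; rewrite detE => e1.
    have : (z ^+ n * \det (redmx n e' x' (Gi z)) == 0) = (\det (redmx n e' x' (Gi z)) == 0).
      by rewrite mulf_eq0 expf_eq0 (negbTE z0) andbF.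
    rewrite e1 => <-; rewrite mulf_eq0 (negbTE hz) orbF prodf_seq_eq0.
    apply/hasP/idP => [[w ww /=]|zw]; last by exists z; rewrite //= subrr.
    by rewrite subr_eq0 => /eqP ->.
  rewrite -dz; split=> [ni|/eqP d00 /iff]; last by rewrite d00 eqxx.
  by apply: contrapT => /negP d00; apply: ni; apply/iff.
exists ws; split.
- move=> z zs zt; have Oz : O z.
    move: zs => /andP[zr zs]; have rd : 0 < r * delta by rewrite mulr_gt0.
    have tz : theta * complex.Re z <= theta * s by rewrite ler_pM2l// ltW.
    have [h1 h2 h3] := sector_box _ _ _ _ _ _ _ r0 zr zs rd ts sr tz zt.
    by split=> //; rewrite sn_lt h2.
  by split; [case: (O1 z Oz)|exact: inv_iff].
- move=> w ww wr; have [Ow [_ wc]] := wsP w ww; have [Dw w0 _ Rw] := O1 w Ow.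
  split; first by apply: le_trans wc _; rewrite ler_pM2r.
  have [m cm] : exists m, count_mem w ws = m.+1.
    by exists (count_mem w ws).-1; rewrite prednK// -has_count has_pred1.
  (* Since det (char_mx) = z^n det (redmx), the nonvanishing cofactor at [w] consists of the other
     zeros and [h], divided by z^n. *)
  pose hl z : Co := \prod_(v <- ws | v != w) (z - v) * h z / z ^+ n.
  have hhl : holo O hl.
    move=> z Oz; have [_ z0 _ _] := O1 z Oz.
    have [l1 d1'] := cder_prod_cond ws (fun v => v != w) z; have [l2 d2'] := hh z Oz.
    eexists; apply: cderM (cderM _ _ _ _ _ d1' d2') (cderV _ _ _ (cderX _ _ _ n (cder_id z)) _).
    by rewrite expf_neq0.
  pose Ol : set C := [set z | O z /\ hl z != 0].
  have hw : hl w != 0.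
    rewrite /hl !mulf_neq0 ?invr_eq0 ?expf_neq0//.
      by rewrite prodf_seq_neq0; apply/allP => v _; apply/implyP => vw; rewrite subr_eq0 eq_sym.
    move: wr => /andP[w1 w2]; apply: h0 => //; apply/andP; split.
      by apply: le_trans w1; rewrite gerBl mulr_ge0// ltW.
    by rewrite (le_trans (ltW w2))// lerDl mulr_ge0// ltW.
  rewrite cm; apply: (charval_multE D A A' Hsep Do dA Ol w n m e' x' Gz Gi Gz' hl) => //.
  + exact: ccont_neq0_open.
  + by move=> z [/O1[]].
  + by move=> z [/O1[]].
  + by move=> z [Oz _]; exact: GI.
  + by move=> z [Oz _]; exact: dGz.
  + by move=> z [Oz _]; exact: hhl.
  + by move=> z [].
  + move=> z [Oz _]; have [_ z0 _ _] := O1 z Oz; have zn : z ^+ n != 0 by rewrite expf_neq0.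
    apply: (mulfI zn); rewrite -detE fE (prod_pull ws w) cm /hl.
    by move: (_ ^+ m.+1) (\prod_(_ <- _ | _) _) (h z) (z ^+ n) zn => a b c q q0; field.
have cE (p : pred R) : count (fun w => p (complex.Re w)) [seq (L0 i)%:C | i <- enum 'I_n] =
    count (fun i => Q i && p (lam i)) (iota 0 N).
  rewrite count_map (count_nth idx (fun i => p (lam i))) /idx count_filter.
  by apply: eq_count => i /=; rewrite andbC.
have nearE x : 0 < x -> (near_count k [seq (L0 i)%:C | i <- enum 'I_n] x <=
    count (fun i => (`|lam i - x| <= delta / 2 * x)%R) (iota 0 N))%N.
  move=> x0; rewrite /near_count /away (cE (fun l => ~~ (200 * (k * x) < `|l - x|))).
  apply: sub_count => i /= /andP[_]; rewrite -leNgt => /le_trans; apply.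
  exact: near_scale.
move: bound; rewrite (cE (fun l => r <= l < s)) => bound.
have -> : count (fun i => r <= lam i < s) (iota 0 N) = count (fun i => Q i && (r <= lam i < s)) (iota 0 N).
  apply: eq_count => i /=; apply/idP/andP => [/andP[l1 l2]|[]//]; split; last by rewrite l1.
  exact: range_incl (mulr_gt0 r0 d0) l1 l2 stau.
apply: le_trans bound _; apply: lerD => //; apply: lerD.
  have -> : n = count (fun i => r * (1 - delta) <= lam i <= tau) (iota 0 N) by rewrite /n /idx size_filter.
  by rewrite ler_wpM2r// kappa_coef.
rewrite ler_wpM2l//; last by rewrite ler_nat leq_add// nearE// (lt_trans r0 rs).
by rewrite addr_ge0// mulr_ge0// ln_ge0// (le_trans _ K620)// ler1n.
Qed.

End CountNear.

(** * Counting eigenvalues by finite sums *)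

Section FiniteSums.
Context {R : realType}.

Lemma esum_seq (T : choiceType) (I : set T) (r : seq T) (a : T -> \bar R) : uniq r ->
  (forall x, x \in r -> I x) -> (forall x, (0 <= a x)%E) -> (forall x, I x -> x \notin r -> a x = 0%E) ->
  (\esum_(x in I) a x = \sum_(x <- r) a x)%E.
Proof.
move=> ur rI a0 aI.
transitivity (\esum_(x in [set` r]) a x)%E; last first.
  by rewrite (esum_fset (finite_seq r) (fun i _ => a0 i)) (fsbig_seq _ a ur).
have <- : I `&` [set` r] = [set` r] by apply: setIidr => x; exact: rI.
rewrite esum_mkcondr; apply: eq_esum => x Ix; case: ifPn => // xr.
by apply: aI => //; apply: contra xr => xr; exact: mem_set.
Qed.

Lemma sum_count_mem (T : eqType) (s : seq T) (P : pred T) :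
  (\sum_(x <- undup s | P x) count_mem x s)%N = count P s.
Proof.
rewrite -sum1_count -[RHS](big_undup_iterop_count addn); apply: eq_bigr => x _.
by rewrite Monoid.iteropE iter_addn mul1n addn0.
Qed.

Lemma sum_natE (T : Type) (s : seq T) (P : pred T) (m : T -> nat) :
  (\sum_(x <- s | P x) ((m x)%:R : R)%:E = ((\sum_(x <- s | P x) m x)%N%:R)%:E)%E.
Proof. by rewrite sumEFin natr_sum. Qed.

End FiniteSums.

Section EigenCount.
Context {R : realType} {H : hilbertType R}.
Notation C := R[i].
Variables (K : bop H) (N : nat) (e : nat -> H) (lam : nat -> R) (eta : R).
Hypotheses (Ksa : op_selfadjoint K) (Ke : eigenfamily K N e lam).
Hypothesis off : forall u, (forall i, (i < N)%N -> inner u (e i) = 0) -> nr (K u) <= eta * nr u.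

Lemma subfamily (P : pred nat) (idx := [seq i <- iota 0 N | P i]) :
  [/\ size idx = count P (iota 0 N), orthon (size idx) (fun j => e (nth 0%N idx j)) &
    forall j, (j < size idx)%N -> (nth 0%N idx j < N)%N /\ P (nth 0%N idx j)].
Proof.
have idxP j : (j < size idx)%N -> (nth 0%N idx j < N)%N /\ P (nth 0%N idx j).
  by move=> jn; have := mem_nth 0%N jn; rewrite mem_filter mem_iota add0n => /andP[-> /andP[_ ->]].
split => //; first by rewrite /idx size_filter.
move=> i j iN jN; have [i1 _] := idxP i iN; have [j1 _] := idxP j jN.
by rewrite (proj1 Ke)// nth_uniq// filter_uniq// iota_uniq.
Qed.

(** The part of an eigenvector orthogonal to the family is again an eigenvector for [l]; as K is
    bounded by eta there and eta < |l|, it vanishes. *)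
Lemma eigenvector_expansion (l : R) (v : H) : eta < `|l| -> K v = l%:C *: v ->
  v = \sum_(i < N | lam i == l) inner v (e i) *: e i.
Proof.
move=> le Kv; pose w := v - oproj N e v.
have Kw : K w = l%:C *: w.
  have h := eigen_proj K N e lam v Ksa Ke.
  have e1 : K w = K v - K (oproj N e v) by exact: raddfB.
  have e2 : oproj N e (l%:C *: v) = l%:C *: oproj N e v by exact: linearZ.
  by rewrite e1 h Kv e2 scalerBr.
have w0 : w = 0.
  apply: nr0_eq0; apply/eqP; rewrite eq_le nr_ge0 andbT leNgt; apply/negP => w0.
  have := off w (fun i iN => ip_proj_off N e v i (proj1 Ke) iN).
  by rewrite Kw nrZ nrR ler_pM2r// leNgt le.
have -> : \sum_(i < N | lam i == l) inner v (e i) *: e i = oproj N e v.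
  rewrite projE big_mkcond; apply: eq_bigr => i _; case: eqP => // /eqP li.
  have := eigen_ip _ _ _ _ v i Ksa Ke (ltn_ord i); rewrite Kv ipZl => /eqP.
  rewrite -subr_eq0 -mulrBl mulf_eq0 => /orP[|/eqP ->]; last by rewrite scale0r.
  by rewrite subr_eq0 => /eqP[] E; move: li; rewrite E eqxx.
by apply/eqP; rewrite -subr_eq0; apply/eqP.
Qed.

(** More than n independent eigenvectors would have a coordinate matrix with a nonzero left kernel,
    that is a linear relation. *)
Lemma dimension_eigenspace (l : R) : eta < `|l| ->
  dimension (op_eigenspace K l%:C) = (count (fun i => lam i == l) (iota 0 N))%:R%:E.
Proof.
move=> le; have [sz eo idxP] := subfamily (fun i => lam i == l).
move: sz eo idxP; set idx := [seq _ <- _ | _] => sz eo idxP; rewrite -sz; set n := size idx.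
pose e' j := e (nth 0%N idx j).
apply/eqP; rewrite eq_le; apply/andP; split; last first.
  apply: ereal_sup_ubound; exists n => //; exists (fun i : 'I_n => e' i); split.
    move=> i; have [iN /eqP li] := idxP i (ltn_ord i).
    by rewrite /op_eigenspace /= /e' (proj2 Ke)// li.
  move=> c c0 i; have := congr1 (fun u => inner u (e' i)) c0.
  rewrite ip0l ip_suml (bigD1 i)//= ipZl eo// eqxx mulr1 big1 ?addr0// => j ji.
  by rewrite ipZl eo// (_ : (j == i :> nat) = false) ?mulr0//; apply/negbTE.
apply: ge_ereal_sup => _ [k [v [vE vfree]] <-]; rewrite lee_fin ler_nat leqNgt; apply/negP => nk.
pose M : 'M[C]_(k, n) := \matrix_(i, j) inner (v i) (e' j).
have vM i : v i = \sum_(j < n) M i j *: e' j.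
  rewrite {1}(eigenvector_expansion l (v i) le (vE i)).
  rewrite -(big_mkord (fun j => lam j == l) (fun j => inner (v i) (e j) *: e j)).
  rewrite /index_iota subn0 -big_filter -/idx (big_nth 0%N) big_mkord.
  by apply: eq_bigr => j _; rewrite mxE.
have kM : kermx M != 0.
  by rewrite -mxrank_eq0 mxrank_ker subn_eq0 -ltnNge (leq_ltn_trans (rank_leq_col _) nk).
have [u /sub_kermxP uM u0] := rowV0Pn kM; case/negP: u0; apply/eqP/rowP => i; rewrite [RHS]mxE.
apply: (vfree (fun i => u ord0 i)).
under eq_bigr => j _ do rewrite vM scaler_sumr.
rewrite exchange_big big1// => j _.
have := congr1 (fun w : 'rV[C]_n => w ord0 j) uM; rewrite !mxE => uj.
by under eq_bigr => a _ do rewrite scalerA; rewrite -scaler_suml uj scale0r.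
Qed.

Lemma eigen_countE (L : set R) (P : pred R) : (forall l, L l <-> P l) ->
  (forall l, P l -> eta < `|l|) ->
  eigen_count K L = (count (fun i => P (lam i)) (iota 0 N))%:R%:E.
Proof.
move=> LP Pe; pose ls := [seq lam i | i <- iota 0 N].
have dimE l : P l -> dimension (op_eigenspace K l%:C) = (count_mem l ls)%:R%:E.
  by move=> /Pe le; rewrite dimension_eigenspace// /ls count_map.
have dim0 (E : set H) : (0 <= dimension E)%E.
  by apply: ereal_sup_ubound; exists 0%N => //; exists (fun=> 0); split=> [[]|c _ []].
rewrite /eigen_count (esum_seq _ L [seq l <- undup ls | P l]).
- rewrite big_filter; under eq_bigr => l Pl do rewrite dimE//.
  by rewrite sum_natE sum_count_mem /ls count_map.
- by rewrite filter_uniq// undup_uniq.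
- by move=> l; rewrite mem_filter => /andP[/LP].
- by move=> l; exact: dim0.
- move=> l /LP Pl; rewrite mem_filter Pl mem_undup /= => nl.
  by rewrite dimE// (count_memPn nl).
Qed.

End EigenCount.

Section LargeEigenvalues.
Context {R : realType} {H : hilbertType R}.

(** The bound holds for all eigenfamilies at once, hence does not depend on r. *)
Lemma large_eigenvalues (K : bop H) (c : R) : compact_op K -> 0 < c ->
  exists B : nat, forall N e lam, eigenfamily K N e lam ->
    (count (fun i => (c <= lam i)%R) (iota 0 N) <= B)%N.
Proof.
move=> Kc c0; have [|B HB] := compact_ortho_small K Kc (c / 2); first by rewrite divr_gt0.
exists B => N e lam Ke; have [sz eo idxP] := subfamily K N e lam Ke (fun i => c <= lam i).
rewrite -sz; apply: HB eo _ => j /idxP[jN cj].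
rewrite (proj2 Ke)// nrZ nrR (ortho_nr N)//; last exact: (proj1 Ke).
by rewrite mulr1 ger0_norm; lra.
Qed.

End LargeEigenvalues.

(** * Analytic Fredholm theory along the sector *)

Section Discreteness.
Context {R : realType} {H : hilbertType R}.
Notation C := R[i].
Notation Co := (R[i]^o).

Lemma notin_ball (z : C) (d : R) (cs : seq C) : 0 < d -> exists2 w, nr (w - z) < d & w \notin cs.
Proof.
move=> d0; pose f k := z + (d / 2 / k.+1%:R)%:C.
have [/allP sub|/allPn[w wf wcs]] := boolP (all [in cs] [seq f k | k <- iota 0 (size cs).+1]).
  have u : uniq [seq f k | k <- iota 0 (size cs).+1].
    rewrite map_inj_uniq ?iota_uniq// => a b /addrI[] /mulfI.
    rewrite gt_eqF ?divr_gt0// => /(_ isT) /invr_inj /eqP.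
    by rewrite eqr_nat eqSS => /eqP.
  by have := uniq_leq_size u sub; rewrite size_map size_iota ltnn.
exists w => //; case/mapP: wf => k _ ->; rewrite /f addrC addKr nrR ger0_norm ?divr_ge0 ?(ltW d0)//.
apply: (@le_lt_trans _ _ (d / 2)); last by lra.
by rewrite ler_pdivrMr// ler_peMr ?ler1n// divr_ge0// ltW.
Qed.

Variables (D : set Co) (A A' : C -> bop H).
Hypotheses (Do : copen (D : set C)) (Ac : forall z, D z -> compact_op (A z)).
Hypothesis dA : forall z, D z -> cder A z (A' z).

(** Near z0, A z is a finite-rank operator plus a perturbation of norm below |z|, so invertibility
    is decided by a holomorphic determinant: it vanishes on the whole small ball, or it has a
    nonzero value there and finitely many zeros. *)
Lemma local_dichotomy (z0 : C) : D z0 -> z0 != 0 -> exists2 d : R, 0 < d &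
  (forall z, nr (z - z0) < d -> ~ op_invertible (Fz A z)) \/
  (exists cs : seq C, forall z, nr (z - z0) < d -> ~ op_invertible (Fz A z) -> z \in cs).
Proof.
move=> Dz0 z00; have n0 : 0 < nr z0 by rewrite nr_gt0.
have [|n [e [eo off]]] := small_off (A z0) (nr z0 / 2) (compact_ortho_small _ (Ac _ Dz0)).
  by rewrite divr_gt0.
pose x j := A z0 (e j); pose Lf := frank n x e; pose X := A z0 - Lf.
have LE : Lf = A z0 * oproj n e.
  by rewrite /Lf /frank /oproj mulr_sumr; apply: eq_bigr => i _; rewrite mul_rk.
have Xn : nr X <= nr z0 / 2.
  apply: nr_bop_le; first by rewrite divr_ge0// ltW.
  move=> u; rewrite /X LE bopB bopM -linearB.
  apply: le_trans (off _ (fun i iN => ip_proj_off n e u i eo iN)) _.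
  by rewrite ler_wpM2l ?proj_off_le// divr_ge0// ltW.
have [|S [S1 S2 _]] := neumann (z0^-1 *: X).
  by rewrite nrZ nrV ler_pdivrMl// (le_trans Xn)//; lra.
pose G z := z *: (1 : bop H) - A z + Lf.
have G0 : is_inv (z0^-1 *: S) (G z0).
  have -> : G z0 = z0 *: (1 - z0^-1 *: X).
    by rewrite /G /X scalerBr scalerA mulfV// scale1r opprB addrCA addrC.
  by split; rewrite bopZl bopZr scalerA ?mulVf ?mulfV// scale1r.
have hG z : D z -> exists l, cder G z l.
  move=> Dz; eexists; apply: cderD (cderB _ _ _ _ _ (cderZ _ _ _ _ _ (cder_id z)
    (cder_cst (1 : bop H) z)) (dA z Dz)) (cder_cst Lf z).
have [l0 dl0] := hG z0 Dz0.
have [d1 d10 Hd1] := inv_open G z0 _ (cder_cont _ _ _ dl0) G0.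
have [d2 d20 Hd2] := Do z0 Dz0; pose d := Num.min d1 d2.
have d0 : 0 < d by rewrite lt_min d10.
pose O : set C := [set z | nr (z - z0) < d].
have Oo : copen O.
  move=> z Oz; exists (d - nr (z - z0)); first by rewrite subr_gt0.
  by move=> w wz; rewrite /O /=; have := nr_tri z w z0; lra.
have OD z : O z -> D z by move=> Oz; apply: Hd2; apply: lt_le_trans Oz _; rewrite ge_min lexx orbT.
have /choice[Gi GI] : forall z, exists S', O z -> is_inv S' (G z).
  move=> z; have [Oz|nO] := pselect (O z); last by exists 0.
  have [|S' [h _]] := Hd1 z; last by exists S'.
  by apply: lt_le_trans Oz _; rewrite ge_min lexx.
have [G' dG] := holo_choose O G (fun z Oz => hG z (OD z Oz)).
pose f z : Co := \det (redmx n x e (Gi z)).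
have hf : holo O f.
  apply: holo_det => i j z Oz.
  have dl := cder_inv O G Gi z _ Oo Oz GI (dG z Oz).
  eexists; apply: cder_ext (cderB _ _ _ _ _ (cder_cst ((i == j)%:R : Co) z)
    (cder_ip _ (e i) _ _ (cder_app _ _ _ _ _ dl (cder_cst (x j) z)))) => //.
  by move=> y; rewrite !mxE.
have FE z : Fz A z = G z - frank n x e by rewrite /Fz /G addrK.
have bad z : O z -> (~ op_invertible (Fz A z) <-> f z = 0).
  move=> Oz; have := reduction_invertible n x e (G z) (Gi z) (Fz A z) (GI z Oz) (FE z) => iff.
  split=> [ni|f0 /iff]; last by rewrite -/(f z) f0 eqxx.
  by apply: contrapT => /eqP f0; apply: ni; apply/iff.
(* The factorization at [c] uses half sides 2u and 11u > 5 * 2u with u = d/23. The larger square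
   lies in the disc of radius 22u around [c], hence within 23u = d of [z0]. *)
have dl : 0 < d / 23 by rewrite divr_gt0.
have OB z : nr (z - z0) < d / 23 -> O z by rewrite /O /= => h; lra.
exists (d / 23) => //.
have [[c cB fc]|nf] := pselect (exists2 c, nr (c - z0) < d / 23 & f c != 0); last first.
  left=> z zB; apply/bad; first exact: OB.
  by apply: contrapT => /eqP fz; apply: nf; exists z.
right; have [|||ws [h [_ fE _ h0]]] := factorization O f c (2 * (d / 23)) (11 * (d / 23)) Oo _ _ _ hf fc.
- by lra.
- by lra.
- by move=> z zc; rewrite /O /=; have := nr_tri c z z0; have := nr_le_sn (z - c); lra.
exists ws => z zB /(bad z (OB z zB)); rewrite fE => /eqP; rewrite mulf_eq0 => /orP[|hz].
  by rewrite prodf_seq_eq0 => /hasP[w ww /=]; rewrite subr_eq0 => /eqP ->.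
have : h z != 0.
  apply: h0; apply: le_trans (sn_le_nr _) _.
  by have := nr_tri z0 z c; rewrite (nrC z0 c); lra.
by rewrite hz.
Qed.

Definition locally_finite_bad (z0 : C) := exists2 d : R, 0 < d & exists cs : seq C,
  forall z, nr (z - z0) < d -> ~ op_invertible (Fz A z) -> z \in cs.

(** In a ball where every point is bad no point is locally finite, as a ball exceeds any finite
    list; in the other case every point is. So the property is constant near each point of the
    segment and Cousin's lemma propagates it. *)
Lemma locally_finite_bad_seg p q : segment_in [set z | D z /\ z != 0] p q ->
  locally_finite_bad p -> locally_finite_bad q.
Proof.
move=> sD pf.
suff : locally_finite_bad (seg p q 0) <-> locally_finite_bad (seg p q 1).
  by rewrite seg0 seg1 => -[h _]; exact: h.
pose P x y := locally_finite_bad (seg p q x) <-> locally_finite_bad (seg p q y).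
apply: (cousin 0 1 P ler01) => [x y z _ _ _ _ [a b] [a' b']|t t01]; first by split; eauto.
have [Dt t0] := sD t t01; have [d d0 dich] := local_dichotomy _ Dt t0.
have n0 : 0 < nr (q - p) + 1 by rewrite ltr_wpDl ?nr_ge0.
have near u : `|u - t| < d / (nr (q - p) + 1) -> nr (seg p q u - seg p q t) < d.
  move=> ut; rewrite seg_shift nrM nrR; apply: (@le_lt_trans _ _ (`|u - t| * (nr (q - p) + 1))).
    by rewrite ler_wpM2l// lerDl.
  by rewrite -ltr_pdivlMr.
exists (d / (nr (q - p) + 1)); first by rewrite divr_gt0.
move=> x y x0 xt ty y1 tx yt.
have nx : nr (seg p q x - seg p q t) < d by apply: near; rewrite ltr_norml; apply/andP; split; lra.
have ny : nr (seg p q y - seg p q t) < d by apply: near; rewrite ltr_norml; apply/andP; split; lra.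
case: dich => [allbad|[cs Hcs]]; last first.
  have fin u : nr (seg p q u - seg p q t) < d -> locally_finite_bad (seg p q u).
    move=> nu; exists (d - nr (seg p q u - seg p q t)); first by rewrite subr_gt0.
    by exists cs => z zu; apply: Hcs; have := nr_tri (seg p q u) z (seg p q t); lra.
  by split=> _; exact: fin.
have inf u : nr (seg p q u - seg p q t) < d -> ~ locally_finite_bad (seg p q u).
  move=> nu [d' d'0 [cs Hcs]].
  have m0 : 0 < Num.min d' (d - nr (seg p q u - seg p q t)) by rewrite lt_min d'0 subr_gt0.
  have [w wd wcs] := notin_ball (seg p q u) _ cs m0.
  move: wd; rewrite lt_min => /andP[wd1 wd2]; move/negP: wcs; apply; apply: Hcs => //.
  by apply: allbad; have := nr_tri (seg p q u) w (seg p q t); lra.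
by split=> h; [case: (inf x nx h)|case: (inf y ny h)].
Qed.

Lemma sector_convex (theta a b : R) : 0 < a -> cconvex (sector theta a b : set C).
Proof.
move=> a0 p q [/andP[pa pb] pt] [/andP[qa qb] qt] t /andP[t0 t1].
have t1' : 0 <= 1 - t by rewrite subr_ge0.
move: pt qt; rewrite (ger0_norm (_ : 0 <= complex.Re p)); last by lra.
rewrite (ger0_norm (_ : 0 <= complex.Re q)); last by lra.
rewrite !ler_norml => /andP[p1 p2] /andP[q1 q2].
rewrite /sector seg_ReIm /=; set x := complex.Re p in pa pb p1 p2 *; set x' := complex.Re q in qa qb q1 q2 *.
set y := complex.Im p in p1 p2 *; set y' := complex.Im q in q1 q2 *.
have mono (f g : R) : 0 <= f -> 0 <= g -> 0 <= (1 - t) * f + t * g.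
  by move=> f0 g0; rewrite addr_ge0 ?mulr_ge0.
have h1 : 0 <= (1 - t) * (x - a) + t * (x' - a) by apply: mono; rewrite subr_ge0.
have h2 : 0 <= (1 - t) * (b - x) + t * (b - x') by apply: mono; rewrite subr_ge0.
have h3 : 0 <= (1 - t) * (theta * x - y) + t * (theta * x' - y') by apply: mono; rewrite subr_ge0.
have h4 : 0 <= (1 - t) * (theta * x + y) + t * (theta * x' + y') by apply: mono; lra.
clear mono; split; first by apply/andP; split; lra.
rewrite (ger0_norm (_ : 0 <= x + t * (x' - x))); last by lra.
by rewrite ler_norml; apply/andP; split; lra.
Qed.

(** The count between abscissas a/2 and a gives local finiteness at one point. It spreads along
    segments of the convex sector, which avoids 0, and compactness of the sector makes the list
    finite. *)
Lemma sector_finite_bad (theta a : R) (cs0 : seq C) : 0 < a -> a < 1 -> 0 < theta ->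
  (forall z, sector theta (a / 2) 1 z -> D z) ->
  (forall z, a / 2 <= complex.Re z < a -> `|complex.Im z| <= theta * complex.Re z ->
     ~ op_invertible (Fz A z) -> z \in cs0) ->
  exists cs : seq C, forall z, sector theta a 1 z -> ~ op_invertible (Fz A z) -> z \in cs.
Proof.
move=> a0 a1 th0 SD near; have a20 : 0 < a / 2 by rewrite divr_gt0.
(* The middle of the strip between a/2 and a: a ball of radius a/8 around it stays in the strip. *)
pose p : C := (3 / 4 * a)%:C.
have ta : 0 < theta * a by rewrite mulr_gt0.
have pf : locally_finite_bad p.
  exists (Num.min (a / 8) (theta * a / 2)); first by rewrite lt_min !divr_gt0.
  exists cs0 => z; rewrite lt_min => /andP[z1 z2].
  have := Re_le_nr (z - p); have := Im_le_nr (z - p).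
  rewrite cReD cImD cReN cImN /= subr0 => i1; rewrite ler_norml => /andP[r1 r2].
  have zr : a / 2 <= complex.Re z by lra.
  apply: near; first by apply/andP; split; lra.
  have : theta * (a / 2) <= theta * complex.Re z by rewrite ler_pM2l.
  by lra.
have qf q : sector theta (a / 2) 1 q -> locally_finite_bad q.
  move=> Sq; apply: (locally_finite_bad_seg p) => // t t01.
  have Sp : sector theta (a / 2) 1 p.
    by split; rewrite /= ?normr0 ?mulr_ge0 ?(ltW th0)//; apply/andP; split; lra.
  have St := sector_convex theta (a / 2) 1 a20 p q Sp Sq t t01.
  split; first exact: SD.
  by apply: contraTneq (proj1 St) => ->; rewrite negb_and -ltNge a20.
(* Parametrizes the sector by a rectangle, so that its compactness follows from two applications of
   Cousin's lemma, first in y and then in x. *)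
pose phi (x y : R) : C := x +i* (theta * x * y).
have Sphi x y : a <= x <= 1 -> -1 <= y <= 1 -> sector theta (a / 2) 1 (phi x y).
  move=> /andP[ax x1] y1; rewrite -ler_norml in y1; have x0 : 0 < x by lra.
  split; rewrite /= ?x1 ?andbT; first by lra.
  by rewrite !normrM (gtr0_norm th0) (gtr0_norm x0) ler_piMr// mulr_ge0// ltW.
have phid x y x' y' : a <= x <= 1 -> a <= x' <= 1 -> -1 <= y <= 1 ->
    nr (phi x' y' - phi x y) <= (1 + theta) * `|x' - x| + theta * `|y' - y|.
  move=> /andP[ax x1] /andP[ax' x1'] y1; rewrite -ler_norml in y1.
  apply: le_trans (ReIm_ge_nr _) _; rewrite /phi /=.
  have -> : theta * x' * y' - theta * x * y = theta * (x' * (y' - y)) + theta * ((x' - x) * y) by ring.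
  have n1 : `|x' * (y' - y)| <= `|y' - y| by rewrite normrM ler_piMl// ger0_norm; lra.
  have n2 : `|(x' - x) * y| <= `|x' - x| by rewrite normrM ler_piMr.
  have m1 : theta * `|x' * (y' - y)| <= theta * `|y' - y| by rewrite ler_pM2l.
  have m2 : theta * `|(x' - x) * y| <= theta * `|x' - x| by rewrite ler_pM2l.
  have := ler_normD (theta * (x' * (y' - y))) (theta * ((x' - x) * y)).
  rewrite !(normrM theta) (gtr0_norm th0) => t1.
  by move: m1 m2 t1 n1 n2; lra.
pose Fin x1 x2 y1 y2 := exists cs : seq C, forall x y, a <= x <= 1 -> x1 < x < x2 -> y1 <= y <= y2 ->
  ~ op_invertible (Fz A (phi x y)) -> phi x y \in cs.
have strip x0 : a <= x0 <= 1 -> exists2 d : R, 0 < d & Fin (x0 - d) (x0 + d) (-1) 1.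
  move=> xa; pose P y1 y2 := exists2 d : R, 0 < d & Fin (x0 - d) (x0 + d) y1 y2.
  apply: (cousin (-1) 1 P); first by lra.
    move=> y1 y2 y3 _ y12 y23 _ [d d0 [cs Hcs]] [d' d'0 [cs' Hcs']].
    exists (Num.min d d'); first by rewrite lt_min d0.
    exists (cs ++ cs') => x y xa' /andP[xd1 xd2] /andP[ya yb] bad; rewrite mem_cat.
    have md : Num.min d d' <= d by rewrite ge_min lexx.
    have md' : Num.min d d' <= d' by rewrite ge_min lexx orbT.
    have [yl|yg] := lerP y y2.
      by rewrite Hcs//; apply/andP; split => //; lra.
    by rewrite Hcs' ?orbT//; apply/andP; split => //; lra.
  move=> y0 y01; have [d d0 [cs Hcs]] := qf _ (Sphi x0 y0 xa y01).
  have m0 : 0 < 1 + 2 * theta by lra.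
  exists (d / (1 + 2 * theta)); first by rewrite divr_gt0.
  move=> y1 y2 _ y1y yy2 _ yd1 yd2; exists (d / (1 + 2 * theta)); first by rewrite divr_gt0.
  exists cs => x y xa' /andP[xd1 xd2] /andP[ya yb]; apply: Hcs.
  apply: le_lt_trans (phid _ _ _ _ xa xa' y01) _.
  have dx : `|x - x0| < d / (1 + 2 * theta) by rewrite ltr_norml; apply/andP; split; lra.
  have dy : `|y - y0| < d / (1 + 2 * theta) by rewrite ltr_norml; apply/andP; split; lra.
  have e1 : (1 + theta) * `|x - x0| < (1 + theta) * (d / (1 + 2 * theta)) by rewrite ltr_pM2l//; lra.
  have e2 : theta * `|y - y0| < theta * (d / (1 + 2 * theta)) by rewrite ltr_pM2l.
  have e3 : (1 + theta) * (d / (1 + 2 * theta)) + theta * (d / (1 + 2 * theta)) = d.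
    by field; rewrite gt_eqF.
  by rewrite -[ltRHS]e3 ltrD.
pose P x1 x2 := exists cs : seq C, forall x y, a <= x <= 1 -> x1 <= x <= x2 -> -1 <= y <= 1 ->
  ~ op_invertible (Fz A (phi x y)) -> phi x y \in cs.
have [cs Hcs] : P a 1.
  apply: (cousin a 1 P); first exact: ltW.
    move=> x1 x2 x3 _ x12 x23 _ [cs Hcs] [cs' Hcs']; exists (cs ++ cs') => x y xa /andP[xa' xb] yy bad.
    rewrite mem_cat; have [xl|xg] := lerP x x2; first by rewrite Hcs// xa'.
    by rewrite Hcs' ?orbT// xb (ltW xg).
  move=> x0 xa; have [d d0 [cs Hcs]] := strip x0 xa; exists d => //.
  move=> x1 x2 _ _ _ _ l1 l2; exists cs => x y xa' /andP[xb xc]; apply: Hcs => //.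
  by apply/andP; split; lra.
exists cs => z [/andP[z1 z2] zt] bad; have z0 : 0 < complex.Re z by lra.
move: zt; rewrite (gtr0_norm z0) => zt.
have tz : 0 < theta * complex.Re z by rewrite mulr_gt0.
have zE : z = phi (complex.Re z) (complex.Im z / (theta * complex.Re z)).
  by apply: complexP => //=; rewrite mulrC divfK// gt_eqF.
rewrite zE; apply: Hcs; rewrite -?zE//; apply/andP; split => //.
  by rewrite ler_pdivlMr// mulN1r; move: zt; rewrite ler_norml => /andP[].
by rewrite ler_pdivrMr// mul1r; move: zt; rewrite ler_norml => /andP[].
Qed.

End Discreteness.

(** * Assembly of the two counts *)

Section Assembly.
Context {R : realType} {H : hilbertType R}.
Notation C := R[i].
Notation Co := (R[i]^o).

Lemma open_copen (D : set Co) : open D -> copen (D : set C).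
Proof.
move=> Do z Dz; have /nbhs_ballP[e /= e0 He] : nbhs (z : Co) D by exact: open_nbhs_nbhs.
have er : e = (complex.Re e)%:C by rewrite RRe_real// gtr0_real.
exists (complex.Re e); first by move: e0; rewrite {1}er ltcR.
move=> w wz; apply: He; rewrite -ball_normE /= er -nr_lt.
by rewrite nrC.
Qed.

(** Difference quotients are combinations of compact operators and converge in norm to the
    derivative; [ortho_small] passes to the limit. *)
Lemma derivative_ortho_small (D : set C) (A : C -> bop H) (z : C) (l : bop H) : copen D ->
  (forall z, D z -> compact_op (A z)) -> D z -> cder A z l -> ortho_small l.
Proof.
move=> Do Ac Dz dl; apply: ortho_small_lim => eta eta0.
have [d d0 Hd] := dl eta eta0; have [d' d'0 Hd'] := Do z Dz.
have m0 : 0 < Num.min d d' by rewrite lt_min d0.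
pose h : C := (Num.min d d' / 2)%:C.
have hn : nr h < Num.min d d' by rewrite nrR ger0_norm; lra.
have h0 : 0 < nr h by rewrite nrR gtr0_norm ?divr_gt0.
have hz : h != 0 by rewrite -nr_gt0.
exists (h^-1 *: (A (z + h) + (-1) *: A z)).
  apply: ortho_smallZ; apply: ortho_smallD; first apply: compact_ortho_small; last first.
    by apply: ortho_smallZ; apply: compact_ortho_small; exact: Ac.
  by apply: Ac; apply: Hd'; rewrite addrC addKr; apply: lt_le_trans hn _; rewrite ge_min lexx orbT.
have -> : l - h^-1 *: (A (z + h) + (-1) *: A z) = - (h^-1 *: (A (z + h) - A z - h *: l)).
  by rewrite scaleN1r [in RHS]scalerBr scalerA mulVf// scale1r opprB.
rewrite nrN nrZ nrV ler_pdivrMl// mulrC; apply: Hd.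
by apply: lt_le_trans hn _; rewrite ge_min lexx.
Qed.

(** The sector is cut at abscissa [s]. On the left multiplicities in [ws] count; on the right the
    finite list [cs] gives a total that does not depend on r. *)
Lemma charval_countE (D : set Co) (A : Co -> bop H) (theta r s : R) (ws cs : seq Co) :
  0 < r -> r < s -> s < 1 ->
  (forall z : Co, r <= complex.Re z < s -> `|complex.Im z| <= theta * complex.Re z ->
     D z /\ (~ op_invertible (Fz A z) <-> z \in ws)) ->
  (forall w : Co, w \in ws -> r <= complex.Re w < s ->
     `|complex.Im w| <= theta * complex.Re w /\ charval_mult D A w = count_mem w ws) ->
  (forall z : Co, sector theta s 1 z -> ~ op_invertible (Fz A z) -> z \in cs) ->
  charval_count D A (sector theta r 1) =
    ((count (fun w : Co => (r <= complex.Re w < s)%R) ws +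
      \sum_(w <- [seq w <- undup cs | `[< sector theta s 1%R w /\ charval D A w >]])
        charval_mult D A w)%N%:R)%:E.
Proof.
move=> r0 rs s1 wsP wsM csP; set fs := [seq w <- undup cs | _].
pose ns : seq Co := [seq w <- undup ws | r <= complex.Re w < s].
have fsP w : w \in fs -> sector theta s 1 w /\ charval D A w.
  by rewrite mem_filter => /andP[/asboolP].
have nsP w : w \in ns -> w \in ws /\ r <= complex.Re w < s.
  by rewrite mem_filter mem_undup => /andP[].
rewrite /charval_count (esum_seq _ _ (ns ++ fs)).
- rewrite sum_natE big_cat /=; congr ((_ + _)%N%:R%:E).
  rewrite -sum_count_mem -[in RHS]big_filter; apply: eq_big_seq => w /nsP[ww wr].
  by have [_ ->] := wsM w ww wr.
- rewrite cat_uniq !filter_uniq ?undup_uniq//= andbT; apply/hasPn => w /fsP[[/andP[sw _] _] _].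
  by apply/negP => /nsP[_ /andP[_]]; rewrite ltNge sw.
- move=> w; rewrite mem_cat => /orP[/nsP[ww wr]|/fsP[[/andP[sw w1] wt] cw]]; last first.
    by split => //; split => //; rewrite w1 andbT; apply: le_trans sw; exact: ltW.
  have [wt _] := wsM w ww wr; have [Dw iff] := wsP w wr wt; move: wr => /andP[rw wlt].
  have w0 : 0 < complex.Re w by lra.
  have wn0 : w != 0 by apply: contraTneq w0 => ->; rewrite ltxx.
  split; first by split; rewrite ?rw ?(gtr0_norm w0)//= (le_trans (ltW wlt)) ?(ltW s1).
  by split => // /(charop_invertible A w wn0); exact: (proj2 iff).
- by move=> w; rewrite lee_fin ler0n.
- move=> w [[/andP[rw w1] wt] cw]; rewrite mem_cat negb_or => /andP[wns wfs]; exfalso.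
  have [_ wn0 ninv] := cw; have w0 : 0 < complex.Re w by lra.
  have bad : ~ op_invertible (Fz A w) by move=> h; apply: ninv; apply/(charop_invertible A w wn0).
  have [ws_|sw] := ltP (complex.Re w) s.
    have wr : r <= complex.Re w < s by rewrite rw.
    move: wns; rewrite mem_filter wr mem_undup /= => /negP; apply.
    by apply/(proj2 (wsP w wr _)) => //; move: wt; rewrite (gtr0_norm w0).
  have Sw : sector theta s 1 w by split; rewrite ?sw.
  move: wfs; rewrite mem_filter mem_undup csP// andbT => /negP; apply.
  exact/asboolP.
Qed.

Lemma count_le_add (T : Type) (p q1 q2 : pred T) (s : seq T) :
  (forall x, p x -> q1 x || q2 x) -> (count p s <= count q1 s + count q2 s)%N.
Proof.
move=> h; rewrite -count_predUI (leq_trans _ (leq_addr _ _))//.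
by apply: sub_count => x /h.
Qed.

(** Here n1 and n2 are the two eigenvalue counts of the theorem, a and m those in [r, s) and
    [r(1 - delta), tau], p and q the numbers close to r and to s, B the bound for eigenvalues above
    s/2, F the characteristic values to the right of s, and L = |ln delta|^2. *)
Lemma count_comparison (X F a n1 n2 B m p q delta E L : R) :
  `|X - a| <= delta * m + E * (p + q) + 14 -> a <= n1 -> n1 <= a + B -> m <= n1 + n2 + B ->
  p <= n2 -> q <= B -> 1 <= L -> 0 <= E -> 0 < delta -> delta <= 1 -> 0 <= n1 -> 0 <= n2 ->
  0 <= F -> 0 <= B ->
  `|X + F - n1| <= (E + 1) * delta * L * n1 + (E + 1) * L * n2 +
     (delta * B + E * B + 14 + F + B + 1).
Proof.
move=> h an nB mB pn qB L1 E0 d0 d1 n10 n20 F0 B0.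
have h1 : delta * m <= delta * (n1 + n2 + B) by rewrite ler_pM2l.
have h2 : E * (p + q) <= E * (n2 + B) by rewrite ler_wpM2l// lerD.
have EL : 1 <= (E + 1) * L by rewrite mulr_ege1//; lra.
have h3 : delta * n1 <= (E + 1) * delta * L * n1.
  have -> : (E + 1) * delta * L * n1 = (E + 1) * L * (delta * n1) by ring.
  by rewrite ler_peMl// mulr_ge0// ltW.
have h4 : (delta + E) * n2 <= (E + 1) * L * n2.
  rewrite ler_wpM2r//; apply: (@le_trans _ _ (E + 1)); first by lra.
  by rewrite ler_peMr//; lra.
have h5 : `|X + F - n1| <= `|X - a| + (F + B).
  have -> : X + F - n1 = (X - a) + (F - (n1 - a)) by ring.
  apply: le_trans (ler_normD _ _) _; rewrite lerD2l ler_norml.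
  by apply/andP; split; lra.
move: h3 h4 h5; move: ((E + 1) * delta * L * n1) ((E + 1) * L * n2) => P Q h3 h4 h5.
move: h2 h4 h1; rewrite mulrDr (mulrDr E n2) mulrDl !(mulrDr delta) => h2 h4 h1.
by clear - h h1 h2 h3 h4 h5; lra.
Qed.

End Assembly.

Theorem theorem3p7 (R : realType) (H : hilbertType R) (Hsep : separable H)
    (D : set R[i]^o) (Dopen : open D) (Dconn : connected D) (D0 : D 0)
    (A : R[i]^o -> bop H)
    (Acompact : forall z, D z -> compact_op (A z))
    (Ahol : forall z, D z -> derivable A z 1)
    (A0sa : op_selfadjoint (A 0))
    (Pi0 : bop H) (Pi0P : orthogonal_projection (op_ker (A 0)) Pi0)
    (A0inv : op_invertible (1 - derive1 A 0 * Pi0))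
    (theta : R) (theta_gt0 : 0 < theta)
    (sectorD : forall r : R, 0 < r < 1 -> sector theta r 1 `<=` D) :
  exists C delta1 : R, [/\ 0 < C, 0 < delta1 &
    forall delta : R, 0 < delta < delta1 ->
    exists rdelta Cdelta : R, [/\ 0 < rdelta, 0 < Cdelta &
      forall r : R, 0 < r < rdelta ->
      (`|charval_count D A (sector theta r 1) - eigen_count (A 0%R) `[r, 1%R]|
       <= (C * delta * `|ln delta| ^+ 2)%:E * eigen_count (A 0%R) `[r, 1%R]
          + (C * `|ln delta| ^+ 2)%:E *
            eigen_count (A 0%R) `[(r * (1 - delta))%R, (r * (1 + delta))%R]
          + Cdelta%:E)%E]].
Proof.
have Do := open_copen D Dopen; pose A' (z : R[i]) : bop H := derive1 A z.
have dA z : D z -> cder A z (A' z) by move=> Dz; apply: derivable_cder; exact: Ahol.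
have A1s : ortho_small (A' 0) := derivative_ortho_small D A 0 _ Do Acompact D0 (dA 0 D0).
have [T0 T0I] := A0inv; have Kc : compact_op (A 0) := Acompact 0 D0.
(* Hidden behind an existential so that [ln K0] stays an opaque constant in the arithmetic below. *)
have [K0 K620] : exists K0 : R, 620 <= K0 by exists 620.
pose E := 7 * ln K0 + 3.
have E0 : 0 <= E by rewrite addr_ge0// mulr_ge0// ln_ge0// (le_trans _ K620)// ler1n.
have E10 : 0 < E + 1 by lra.
exists (E + 1), (Num.min (1 / 2) (expR (-1))); split; [exact: E10| |].
  by rewrite lt_min expR_gt0 andbT; lra.
move=> delta /andP[d0]; rewrite lt_min => /andP[d1 de].
(* For delta below 1/e the logarithmic factors are at least 1, so they only weaken the estimate
   obtained. *)
have L1 : 1 <= `|ln delta| ^+ 2.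
  have : ln delta < -1 by rewrite -[ltRHS](@expRK R) ltr_ln// posrE// expR_gt0.
  move=> l1; have l2 : 1 <= `|ln delta| by rewrite ltr0_norm; lra.
  by rewrite expr_ge1// (le_trans _ l2).
have [s [tau [s0 s1 st CN]]] := count_near D A A' Pi0 T0 theta Hsep Do D0 dA A0sa A1s Pi0P T0I
  theta_gt0 delta K0 d0 (ltW d1) K620.
have s20 : 0 < s / 2 by lra.
have [B HB] := large_eigenvalues (A 0) (s / 2) Kc s20.
(* The count itself, taken once with r = s/2, starts the Fredholm argument to the right of [s]. *)
have [cs Hcs] : exists cs : seq R[i], forall z, sector theta s 1 z -> ~ op_invertible (Fz A z) -> z \in cs.
  have e0 : 0 < s / 2 / 4 by lra.
  have [n [e [lam [Ke big off]]]] := spectral (A 0) (s / 2 / 4) A0sa Kc e0.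
  have s2s : s / 2 < s by lra.
  have [ws [near _ _]] := CN (s / 2) n e lam (s / 2 / 4) s20 s2s Ke e0 (lexx _) big off.
  apply: (sector_finite_bad D A A' Do Acompact dA theta s ws) => //.
    by apply: sectorD; apply/andP; split; lra.
  by move=> z zr zt; exact: (proj1 (proj2 (near z zr zt))).
pose F := (\sum_(w <- [seq w <- undup (cs : seq R[i]^o) | `[< sector theta s 1%R w /\ charval D A w >]])
  charval_mult D A w)%N.
have B0 : 0 <= B%:R :> R := ler0n _ _.
have F0 : 0 <= F%:R :> R := ler0n _ _.
exists s, (delta * B%:R + E * B%:R + 14 + F%:R + B%:R + 1); split => //.
  have h1 : 0 <= delta * B%:R by rewrite mulr_ge0// ltW.
  have h2 : 0 <= E * B%:R by rewrite mulr_ge0.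
  by rewrite ltr_wpDl// !addr_ge0.
move=> r /andP[r0 rs]; have e0 : 0 < r / 4 by lra.
(* With threshold r/4 the family contains all eigenvectors that matter, as the eigenvalues counted
   are at least r(1 - delta) > r/2. *)
have [N [e [lam [Ke big off]]]] := spectral (A 0) (r / 4) A0sa Kc e0.
have [ws [wsP wsM bound]] := CN r N e lam (r / 4) r0 rs Ke e0 (lexx _) big off.
have rd0 : 0 < r * delta by rewrite mulr_gt0.
have rd1 : r * delta < r * (1 / 2) by rewrite ltr_pM2l.
rewrite (charval_countE D A theta r s ws cs r0 rs s1 wsP wsM Hcs).
rewrite (eigen_countE (A 0) N e lam (r / 4) A0sa Ke off _ (fun l => r <= l <= 1)); last 2 first.
- by move=> l; rewrite /= in_itv.
- by move=> l /andP[rl _]; rewrite gtr0_norm; lra.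
rewrite (eigen_countE (A 0) N e lam (r / 4) A0sa Ke off _
  (fun l => r * (1 - delta) <= l <= r * (1 + delta))); last 2 first.
- by move=> l; rewrite /= in_itv.
- by move=> l /andP[rl _]; rewrite gtr0_norm; lra.
rewrite -EFinB -!EFinM -!EFinD lee_fin natrD.
have HBN := HB N e lam Ke.
rewrite (natrD _ (count _ (iota 0 N)) (count _ (iota 0 N))) in bound.
apply: (count_comparison _ _ _ _ _ B%:R _ _ _ _ _ _ bound) => //.
- rewrite ler_nat; apply: sub_count => i /= /andP[-> ls] /=; lra.
- rewrite -natrD ler_nat; apply: leq_trans (leq_add (leqnn _) HBN).
  apply: count_le_add => i /andP[rl l1]; rewrite rl /=; have [ls|sl] := ltP (lam i) s => //=; lra.
- rewrite -!natrD ler_nat; apply: leq_trans (leq_add (leqnn _) HBN).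
  rewrite -addnA; apply: leq_trans (count_le_add nat _ (fun i => r <= lam i <= 1)
    (fun i => (r * (1 - delta) <= lam i <= r * (1 + delta)) || (s / 2 <= lam i)) _ _) _.
    move=> i /andP[l1 l2]; rewrite l1 /=; have [rl|lr] := lerP r (lam i) => /=; last first.
      by apply/orP; left; lra.
    have [l3|l3] := lerP (lam i) 1 => //=; apply/orP; right; lra.
  by rewrite leq_add2l; exact: count_le_add.
- rewrite ler_nat; apply: sub_count => i /=; rewrite ler_norml => /andP[l1 l2].
  by apply/andP; split; lra.
- rewrite ler_nat; apply: leq_trans HBN; apply: sub_count => i /=; rewrite ler_norml => /andP[l1 l2].
  have : delta * s < 1 / 2 * s by rewrite ltr_pM2r.
  lra.
- by lra.
Qed.
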